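(* Let $y,t_0\in\mathbb{R}$, let $V=V_1+V_2$ with $V_1\in\mathcal{K}_1$, $V_2\in\mathcal{K}_2$, and for $x\in\mathbb{R}$, $t>t_0$ let $I=I(x,t|y,t_0)\in(\mathcal{S})^{-1}$ be the associated Feynman integrand. For $\theta\in\mathcal{S}_{\mathbb{C}}$ in a neighborhood of zero on which $TI(\theta)$ is given by its series representation (see context), put $$K^{(\theta)}(x,t|y,t_0):=\Theta(t-t_0)\,TI(\theta)\exp\Big(\frac i2\int_{[t_0,t]^c}\theta^2(\tau)\,d\tau+iy\theta(t_0)-ix\theta(t)\Big),$$ where $\Theta$ is the Heaviside function and $[t_0,t]^c=\mathbb{R}\setminus[t_0,t]$. Then $K^{(\theta)}(x,t|y,t_0)$ is a Green function for the Schr\''odinger equation, i.e. $$\Big(i\partial_t+\frac12\partial_x^2-\dot\theta(t)x-V(x)\Big)K^{(\theta)}(x,t|y,t_0)=i\,\delta(t-t_0)\,\delta(x-y)$$ in the sense of distributions in $(x,t)$. In particular, $K(x,t|y,t_0):=TI(0)$ is a Feynman integral solving $$i\partial_tK(x,t|y,t_0)=\Big(-\frac12\partial_x^2+V(x)\Big)K(x,t|y,t_0)\qquad\text{for }t>t_0 .$$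
   Context: Spaces. $\mathcal{S}=S(\mathbb{R})$ is the real Schwartz space, $\mathcal{S}_{\mathbb{C}}$ its complexification, $\mu$ the white noise measure on $\mathcal{S}'$ ($\int e^{i\langle\omega,\xi\rangle}d\mu(\omega)=e^{-|\xi|^2/2}$, $|\cdot|$ the $L^2(\mathbb{R})$ norm), $(\mathcal{S})^{-1}$ the space of Kondratiev distributions (generalized white noise functionals) over $L^2(\mu)$, and $T\Phi(\theta)=\langle\!\langle\Phi,\exp(i\langle\cdot,\theta\rangle)\rangle\!\rangle$ the $T$-transform of $\Phi\in(\mathcal{S})^{-1}$, a holomorphic function on a neighborhood of $0$ in $\mathcal{S}_{\mathbb{C}}$ which determines $\Phi$. Potentials. $\mathcal{K}_1$: functions $V_1(x)=\int_{\mathbb{R}}e^{\alpha x}dm_1(\alpha)$, $m_1$ a complex Borel measure with $\int e^{C|\alpha|}d|m_1|(\alpha)<\infty$ for all $C>0$. $\mathcal{K}_2$: generalized functions $V_2(x)=\int_{\mathbb{R}}\delta(x-y)dm_2(y)$, $m_2$ a finite signed Borel measure of bounded support. Feynman integrand. $I=I(x,t|y,t_0)$ is the element of $(\mathcal{S})^{-1}$ giving meaning to $I_0\exp(-i\int_{t_0}^tV(x(\tau))d\tau)$ (where $I_0$ is the free Feynman integrand and $x(\tau)=x-\langle\omega,1_{(\tau,t]}\rangle$); it is determined by its $T$-transform, which for $\theta$ in a neighborhood of $0$ in $\mathcal{S}_{\mathbb{C}}$ is the series $$TI(\theta)=\sum_{n=0}^\infty \frac{(-i)^n}{n!}\sum_{k=0}^n\binom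 nk k!\int_{\Delta_k}d^k\tau \int_{[t_0,t]^{n-k}}d^{n-k}s\int_{\mathbb{R}^k}\int_{\mathbb{R}^{n-k}}T\Phi_{n,k}(\theta)\prod_{l=1}^{n-k}dm_1(\alpha_l)\prod_{j=1}^kdm_2(x_j),$$ where $\Delta_k=\{t_0<\tau_1<\dots<\tau_k<t\}$ (integrals over $\Delta_k,\mathbb{R}^k$ absent if $k=0$; integrals over $[t_0,t]^{n-k},\mathbb{R}^{n-k}$ absent if $k=n$) and, with $\tau_0:=t_0$, $x_0:=y$, $\tau_{k+1}:=t$, $x_{k+1}:=x$, $\eta:=\theta+i\sum_{l=1}^{n-k}\alpha_l1_{(s_l,t]}$, $$T\Phi_{n,k}(\theta)=\exp\Big(x\sum_{l=1}^{n-k}\alpha_l\Big)\exp\Big(-\tfrac i2\int_{\mathbb{R}}\eta(s)^2ds\Big)\prod_{j=1}^{k+1}\frac{1}{\sqrt{2\pi i(\tau_j-\tau_{j-1})}}\exp\Big(\frac{i}{2(\tau_j-\tau_{j-1})}\Big(\int_{\tau_{j-1}}^{\tau_j}\eta(s)ds+x_j-x_{j-1}\Big)^2\Big)$$ (principal branch of the square root; squares without complex conjugation). Meaning of the equations. $K^{(\theta)}(\cdot,\cdot|y,t_0)$ is taken to be $0$ for $t<t_0$. For an interval $[T_0,T]$ containing the times considered, the equation is understood as an identity of distributions on $\mathcal{D}(\mathbb{R}\times[T_0,T])$ (smooth compactly supported test functions $\varphi(x,t)$), where $K^{(\theta)}$ acts by $\varphi\mapsto\int_{\mathbb{R}}dx\int_{T_0}^Tdt\,K^{(\theta)}(x,t|y,t_0)\varphi(x,t)$,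 the product $V_1K^{(\theta)}$ is the pointwise product, and the product $V_2K^{(\theta)}$ is the distribution $$\langle V_2K^{(\theta)},\varphi\rangle=\int_{\mathbb{R}}dm_2(x)\int_{T_0}^Tdt\,K^{(\theta)}(x,t|y,t_0)\varphi(x,t),$$ and $VK^{(\theta)}=V_1K^{(\theta)}+V_2K^{(\theta)}$. Derivatives are distributional. *)

(* Defs.v *)
(* Limits, derivatives and integrals of R[i]-valued functions are taken on real
   and imaginary parts. *)
From HB Require Import structures.
From mathcomp Require Import all_boot all_order all_algebra.
From mathcomp Require Import all_classical all_reals all_analysis.
From mathcomp Require Import complex.
Set Implicit Arguments.
Unset Strict Implicit.
Unset Printing Implicit Defensive.
Import Order.TTheory GRing.Theory Num.Theory.
Import numFieldNormedType.Exports.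
Local Open Scope classical_set_scope.
Local Open Scope ring_scope.

Section ComplexCalculus.
Context {R : realType}.
Implicit Types (f : R -> R[i]) (u : nat -> R[i]).

Definition iC : R[i] := Complex 0 1.

Definition cexp (z : R[i]) : R[i] :=
  (expR (complex.Re z))%:C%C
    * Complex (cos (complex.Im z)) (sin (complex.Im z)).

Definition cpart_cvg u (z : R[i]) : Prop :=
  ((fun n => complex.Re (u n)) @ \oo --> complex.Re z) /\
  ((fun n => complex.Im (u n)) @ \oo --> complex.Im z).

Definition clim u : R[i] :=
  Complex (limn (fun n => complex.Re (u n))) (limn (fun n => complex.Im (u n))).

Definition cderivable f (x : R) : Prop :=
  derivable (fun s => complex.Re (f s)) x 1 /\
  derivable (fun s => complex.Im (f s)) x 1.

Definition cderive f (x : R) : R[i] :=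
  Complex (derive1 (fun s => complex.Re (f s)) x)
          (derive1 (fun s => complex.Im (f s)) x).

Definition cintegral (mu : {measure set (measurableTypeR R) -> \bar R})
    (D : set R) f : R[i] :=
  Complex (Rintegral mu D (fun x => complex.Re (f x)))
          (Rintegral mu D (fun x => complex.Im (f x))).

Definition lintegral (D : set R) f : R[i] := cintegral lebesgue_measure D f.

(* The n-fold iterate of a one-variable integral J, i.e. the integral against
   the n-fold product of the measure behind J. *)
Fixpoint iter_integral (J : (R -> R[i]) -> R[i]) (n : nat) :
    (n.-tuple R -> R[i]) -> R[i] :=
  match n return (n.-tuple R -> R[i]) -> R[i] with
  | 0 => fun F => F [tuple]
  | n'.+1 => fun F =>
      J (fun a : R => iter_integral J (fun us : n'.-tuple R => F [tuple of a :: us]))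
  end.

(* Lebesgue integral over the simplex {a < tau_1 < ... < tau_n < b}. *)
Fixpoint simplex_integral (n : nat) (a b : R) :
    (n.-tuple R -> R[i]) -> R[i] :=
  match n return (n.-tuple R -> R[i]) -> R[i] with
  | 0 => fun F => F [tuple]
  | n'.+1 => fun F =>
      lintegral `]a, b[ (fun tau =>
        simplex_integral tau b
          (fun taus : n'.-tuple R => F [tuple of tau :: taus]))
  end.

End ComplexCalculus.

Section Measures.
Context {R : realType}.

(* A finite signed Borel measure on the line is a charge (charges are
   finite-valued). *)
Definition signed_measure := {charge set (measurableTypeR R) -> \bar R}.

Definition hahn_sets (m : signed_measure) :
    {PN : set R * set R | hahn_decomposition m PN.1 PN.2} :=
  cid (let: ex_intro P (ex_intro N h) := Hahn_decomposition m in
       ex_intro (fun PN : set R * set R => hahn_decomposition m PN.1 PN.2)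
                (P, N) h).

(* Integral against the Jordan decomposition; it does not depend on the chosen
   Hahn sets. *)
Definition charge_integral (m : signed_measure) (f : R -> R[i]) : R[i] :=
  cintegral (jordan_pos (svalP (hahn_sets m))) setT f
  - cintegral (jordan_neg (svalP (hahn_sets m))) setT f.

Definition bounded_support (m : signed_measure) : Prop :=
  exists M : R, forall A : set (measurableTypeR R), measurable A ->
    (forall x : R, A x -> M < `|x|) -> m A = 0%E.

Record complex_measure := ComplexMeasure {
  re_measure : signed_measure ;
  im_measure : signed_measure }.

Definition cmeasure_val (m : complex_measure) (A : set (measurableTypeR R)) :
    R[i] :=
  Complex (fine (re_measure m A)) (fine (im_measure m A)).

Definition cmeasure_integral (m : complex_measure) (f : R -> R[i]) : R[i] :=
  charge_integral (re_measure m) f + iC * charge_integral (im_measure m) f.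

(* |m|(A) is the supremum of the sums of |m(F_i)| over countable measurable
   partitions (F_i) of A. *)
Definition cmeasure_variation (m : complex_measure)
    (A : set (measurableTypeR R)) : \bar R :=
  ereal_sup [set (\sum_(0 <= i <oo) (Normc.normc (cmeasure_val m (F i)))%:E)%E
            | F in [set F : nat -> set (measurableTypeR R) |
                     [/\ forall i, measurable (F i), trivIset setT F
                       & \bigcup_i F i = A]]].

Definition all_exp_moments (m : complex_measure) : Prop :=
  forall C : R, 0 < C ->
    (integral (cmeasure_variation m) setT (fun a : R => (expR (C * `|a|))%:E)
       < +oo)%E.

Definition potential1 (m1 : complex_measure) (x : R) : R[i] :=
  cmeasure_integral m1 (fun a => (expR (a * x))%:C%C).

End Measures.
Arguments signed_measure R : clear implicits.
Arguments complex_measure R : clear implicits.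

Section SchwartzSpace.
Context {R : realType}.

Definition schwartz (f : R -> R) : Prop :=
  (forall n x, derivable (derive1n n f) x 1) /\
  (forall k n, exists M : R, forall x, `|x ^+ k * derive1n n f x| <= M).

Definition schwartzC (theta : R -> R[i]) : Prop :=
  schwartz (fun s => complex.Re (theta s)) /\
  schwartz (fun s => complex.Im (theta s)).

(* Neighborhoods of 0 for the topology generated by the seminorms
   sup_x |x^k theta^(n)(x)|. *)
Definition schwartzC_nbhs0 (U : set (R -> R[i])) : Prop :=
  U `<=` schwartzC /\
  exists (N : nat) (e : R), 0 < e /\
    forall theta, schwartzC theta ->
      (forall k n x, (k <= N)%N -> (n <= N)%N ->
        `|x ^+ k * derive1n n (fun s => complex.Re (theta s)) x| < e /\
        `|x ^+ k * derive1n n (fun s => complex.Im (theta s)) x| < e) ->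
      U theta.

End SchwartzSpace.

Section WhiteNoise.
Context {R : realType}.

(* Physicists' Hermite polynomials. *)
Fixpoint hermite_poly (j : nat) : {poly R} :=
  if j is j'.+1 then
    2%:R *: ('X * hermite_poly j') - deriv (hermite_poly j')
  else 1.

(* L^2-normalized eigenfunction of H = - d^2/dx^2 + x^2 + 1, with eigenvalue
   2j + 2. *)
Definition hermite_fun (j : nat) (x : R) : R :=
  (Num.sqrt (Num.sqrt pi * 2 ^+ j * (j`!)%:R))^-1
    * (hermite_poly j).[x] * expR (- (x ^+ 2) / 2).

Definition hermite_coef (theta : R -> R[i]) (j : nat) : R[i] :=
  lintegral setT (fun x => theta x * (hermite_fun j x)%:C%C).

(* Kondratiev distributions through their chaos expansion
   Phi = sum_n <:omega^n:, Phi^(n)>.  The symmetric kernel Phi^(n) is given by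
   its coefficients on the tensor products h_(j_1) x ... x h_(j_n) of Hermite
   functions, and the condition reads
     exists p q, sum_n 2^(-nq) |Phi^(n)|_(-p)^2 < oo,
   where |f|_(-p) = |H^(-p) f| for H as above.  The sums of nonnegative terms
   are exhausted by n < N, j_l < N. *)
Record kondratiev := Kondratiev {
  chaos : forall n, n.-tuple nat -> R[i] ;
  chaos_sym : forall n (j j' : n.-tuple nat),
    perm_eq j j' -> chaos j = chaos j' ;
  chaos_bound : exists (p q : nat) (M : R), forall N : nat,
    \sum_(n < N) (2 ^+ (n * q))^-1 *
      \sum_(j : n.-tuple 'I_N)
        (\prod_(l < n) ((2 * tnth j l + 2)%:R ^+ (2 * p))^-1)
        * Normc.normc (chaos [tuple nat_of_ord (tnth j l) | l < n]) ^+ 2 <= M }.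

(* <<Phi, phi>> = sum_n n! <Phi^(n), phi^(n)> for a test functional phi with
   chaos coefficients phi^(n); the pairing is bilinear. *)
Definition pairing (Phi : kondratiev) (phi : forall n, n.-tuple nat -> R[i]) :
    R[i] :=
  clim (fun N => \sum_(n < N) (n`!)%:R *
    \sum_(j : n.-tuple 'I_N)
      chaos Phi [tuple nat_of_ord (tnth j l) | l < n]
      * phi n [tuple nat_of_ord (tnth j l) | l < n]).

(* exp(i<omega,theta>) = exp(-(1/2) int theta^2) :exp(<omega,i theta>): and
   :exp(<omega,i theta>): = sum_n (i^n/n!) <:omega^n:, theta^(x n)>. *)
Definition exp_chaos (theta : R -> R[i]) (n : nat) (j : n.-tuple nat) : R[i] :=
  cexp (- (2%:R^-1) * lintegral setT (fun s => theta s ^+ 2))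
    * (iC ^+ n / (n`!)%:R) * \prod_(l < n) hermite_coef theta (tnth j l).

Definition Ttransform (Phi : kondratiev) (theta : R -> R[i]) : R[i] :=
  pairing Phi (exp_chaos theta).

End WhiteNoise.
Arguments kondratiev R : clear implicits.

Section FeynmanIntegrand.
Context {R : realType}.
Variables (m1 : complex_measure R) (m2 : signed_measure R).
Variables (y t0 x t : R).
Implicit Types theta : R -> R[i].

Definition shifted theta (n : nat) (alphas ss : n.-tuple R) (s : R) : R[i] :=
  theta s + iC * (\sum_(l < n) tnth alphas l * \1_(`]tnth ss l, t]) s)%:C%C.

(* T Phi_(n,k)(theta) with k point interactions (taus, xs) and n' = n - k
   exponential factors (ss, alphas).  sqrtc is the principal square root. *)
Definition TPhi theta (k n' : nat) (taus : k.-tuple R) (ss : n'.-tuple R)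
    (xs : k.-tuple R) (alphas : n'.-tuple R) : R[i] :=
  let eta := shifted theta alphas ss in
  let tau j := nth 0 (t0 :: rcons taus t) j in
  let X j := nth 0 (y :: rcons xs x) j in
  cexp (x * \sum_(l < n') tnth alphas l)%:C%C
  * cexp (- (iC / 2%:R) * lintegral setT (fun s => eta s ^+ 2))
  * \prod_(1 <= j < k.+2)
      ((sqrtc (iC * (2 * pi * (tau j - tau j.-1))%:C%C))^-1
       * cexp (iC / (2 * (tau j - tau j.-1))%:C%C
               * (lintegral `[tau j.-1, tau j] eta
                  + (X j - X j.-1)%:C%C) ^+ 2)).

Definition feynman_term theta (n : nat) : R[i] :=
  (- iC) ^+ n / (n`!)%:R *
  \sum_(k < n.+1) ('C(n, k) * k`!)%:R *
    simplex_integral t0 t (fun taus : k.-tuple R =>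
      iter_integral (lintegral `[t0, t]) (fun ss : (n - k).-tuple R =>
        iter_integral (charge_integral m2) (fun xs : k.-tuple R =>
          iter_integral (cmeasure_integral m1) (fun alphas : (n - k).-tuple R =>
            TPhi theta taus ss xs alphas)))).

Definition feynman_series_to theta (z : R[i]) : Prop :=
  cpart_cvg (fun N => \sum_(n < N) feynman_term theta n) z.

End FeynmanIntegrand.

(* For x real and t > t0, I x t is the Feynman integrand I(x,t|y,t0), and U is
   a neighborhood of 0 on which its T-transform is given by the series. *)
Definition feynman_integrand {R : realType} (m1 : complex_measure R)
    (m2 : signed_measure R) (y t0 : R) (I : R -> R -> kondratiev R)
    (U : set (R -> R[i])) : Prop :=
  schwartzC_nbhs0 U /\
  forall theta, U theta -> forall x t, t0 < t ->
    feynman_series_to m1 m2 y t0 x t theta (Ttransform (I x t) theta).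

Section Distributions.
Context {R : realType}.
Implicit Types (phi : R -> R -> R[i]).

(* Functions of (x, t), in this order. *)
Definition partial_x phi : R -> R -> R[i] :=
  fun x t => cderive (fun x' => phi x' t) x.

Definition partial_t phi : R -> R -> R[i] :=
  fun x t => cderive (phi x) t.

Definition iter_partial (w : seq bool) phi : R -> R -> R[i] :=
  foldr (fun b g => if b then partial_x g else partial_t g) phi w.

Definition smooth2 phi : Prop :=
  forall w : seq bool, let g := iter_partial w phi in
    [/\ continuous (fun p : R * R => complex.Re (g p.1 p.2)),
        continuous (fun p : R * R => complex.Im (g p.1 p.2)),
        forall x t, cderivable (fun x' => g x' t) x
      & forall x t, cderivable (g x) t].

(* D(R x [T0,T]): smooth functions on the plane whose support is a compact
   subset of R x [T0,T]. *)
Definition test_function (T0 T : R) phi : Prop :=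
  smooth2 phi /\
  exists M : R, forall x t, phi x t != 0 -> `|x| <= M /\ T0 <= t <= T.

Definition functional := (R -> R -> R[i]) -> R[i].

Definition dist_of_fun (T0 T : R) (K : R -> R -> R[i]) : functional :=
  fun phi => lintegral setT (fun x => lintegral `[T0, T] (fun t =>
    K x t * phi x t)).

Definition dist_dx (u : functional) : functional := fun phi => - u (partial_x phi).

Definition dist_dt (u : functional) : functional := fun phi => - u (partial_t phi).

Definition dist_delta (t0 y : R) : functional := fun phi => phi y t0.

Definition dist_V2 (m2 : signed_measure R) (T0 T : R) (K : R -> R -> R[i]) :
    functional :=
  fun phi => charge_integral m2 (fun x => lintegral `[T0, T] (fun t =>
    K x t * phi x t)).

Definition dist_V (m1 : complex_measure R) (m2 : signed_measure R) (T0 T : R)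
    (K : R -> R -> R[i]) : functional :=
  fun phi => dist_of_fun T0 T (fun x t => potential1 m1 x * K x t) phi
             + dist_V2 m2 T0 T K phi.

(* The value at 0 is immaterial: it only affects a null set of times. *)
Definition heaviside (s : R) : R := if 0 < s then 1 else 0.

Definition green_kernel (y t0 : R) (I : R -> R -> kondratiev R)
    (theta : R -> R[i]) (x t : R) : R[i] :=
  (heaviside (t - t0))%:C%C * Ttransform (I x t) theta
  * cexp (iC / 2%:R * lintegral (~` `[t0, t]) (fun s => theta s ^+ 2)
          + iC * y%:C%C * theta t0 - iC * x%:C%C * theta t).

End Distributions.

(* Main.v *)
(* Fix theta and write theta' for its derivative.  Up to the gauge factor in K,
   the (n,k) term of the series is an iterated integral of a product of
   Gaussian kernels along a path with k point interactions (tau_j, x_j) and n-k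
   exponential kicks (s_l, alpha_l).  Between two successive events this product
   solves i d_t + (1/2) d_x^2 - theta'(t) x = 0 in the end point (x,t), so
   integration by parts against a test function only leaves a boundary term at
   the last event.  If that event is a kick, the path without it times
   exp(alpha x) remains, which is the V_1 term of the preceding order; if it is
   a point interaction, the Fresnel kernel tends to a delta function and gives
   the V_2 term; with no event one gets the delta function at (y,t_0).  Summing
   over the orders, the identity telescopes.  The sum may be taken under the
   integral since, by a weighted Dirichlet estimate for the product of the
   (tau_j - tau_(j-1))^(-1/2), the term with k point interactions and m kicks is
   at most a constant times 4^(-k-m) (t-t_0)^(-1/2). *)

Require Import Defs.
From HB Require Import structures.
From mathcomp Require Import all_boot all_order all_algebra.
From mathcomp Require Import all_classical all_reals all_analysis.
From mathcomp Require Import complex measurable_realfun.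
From mathcomp Require Import ring lra.
Set Implicit Arguments.
Unset Strict Implicit.
Unset Printing Implicit Defensive.
Import Order.TTheory GRing.Theory Num.Theory.
Import numFieldNormedType.Exports.
Local Open Scope classical_set_scope.
Local Open Scope ring_scope.

Local Notation Re := complex.Re.
Local Notation Im := complex.Im.
Local Notation normc := Normc.normc.

(** * Complex-valued integrals *)

Section ComplexBasics.
Context {R : realType}.
Implicit Types (z w : R[i]) (a b : R).

Lemma complex_ext z w : Re z = Re w -> Im z = Im w -> z = w.
Proof. by case: z => a b; case: w => c d /= -> ->. Qed.

Lemma ReD z w : Re (z + w) = Re z + Re w. Proof. by case: z; case: w. Qed.

Lemma ImD z w : Im (z + w) = Im z + Im w. Proof. by case: z; case: w. Qed.

Lemma ReN z : Re (- z) = - Re z. Proof. by case: z. Qed.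

Lemma ImN z : Im (- z) = - Im z. Proof. by case: z. Qed.

Lemma ReM z w : Re (z * w) = Re z * Re w - Im z * Im w.
Proof. by case: z; case: w. Qed.

Lemma ImM z w : Im (z * w) = Re z * Im w + Im z * Re w.
Proof. by case: z => a b; case: w => c d /=; rewrite (mulrC b). Qed.

Definition ReImE := (ReD, ImD, ReN, ImN, ReM, ImM).

Lemma normcE2 z : normc z = Num.sqrt (Re z ^+ 2 + Im z ^+ 2).
Proof. by case: z. Qed.

Lemma normc_ge0 z : 0 <= normc z. Proof. by case: z => a b; exact: sqrtr_ge0. Qed.

Lemma Re_le_normc z : `|Re z| <= normc z.
Proof. by rewrite normcE2 -sqrtr_sqr ler_wsqrtr// lerDl sqr_ge0. Qed.

Lemma Im_le_normc z : `|Im z| <= normc z.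
Proof. by rewrite normcE2 -sqrtr_sqr ler_wsqrtr// lerDr sqr_ge0. Qed.

Lemma normc_le z : normc z <= `|Re z| + `|Im z|.
Proof.
rewrite normcE2 -ler_sqr ?nnegrE ?addr_ge0 ?sqrtr_ge0//.
rewrite sqr_sqrtr ?addr_ge0 ?sqr_ge0// sqrrD !real_normK ?num_real//.
by rewrite -addrA lerD2l lerDr mulrn_wge0// mulr_ge0.
Qed.

Lemma normc_real a : normc a%:C%C = `|a|.
Proof. by rewrite normcE2/= expr0n addr0 sqrtr_sqr. Qed.

Lemma normcX z n : normc (z ^+ n) = normc z ^+ n.
Proof.
elim: n => [|n IH]; first by rewrite !expr0 Normc.normc1.
by rewrite !exprS Normc.normcM IH.
Qed.

Lemma normc_prod I (s : seq I) (F : I -> R[i]) :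
  normc (\prod_(i <- s) F i) = \prod_(i <- s) normc (F i).
Proof.
elim: s => [|i s IH]; first by rewrite !big_nil Normc.normc1.
by rewrite !big_cons Normc.normcM IH.
Qed.

Lemma normc_sum I (s : seq I) (F : I -> R[i]) :
  normc (\sum_(i <- s) F i) <= \sum_(i <- s) normc (F i).
Proof.
elim: s => [|i s IH]; first by rewrite !big_nil Normc.normc0.
by rewrite !big_cons (le_trans (le_normcD _ _))// lerD2l.
Qed.

Lemma normciC : normc (iC : R[i]) = 1.
Proof. by rewrite normcE2/= expr0n add0r expr1n sqrtr1. Qed.

Lemma iC2 : (iC : R[i]) * iC = -1.
Proof. by apply: complex_ext; rewrite ReImE/= ?mul0r ?mulr0 ?mulr1 ?add0r ?oppr0//; lra. Qed.

Lemma cexpD z w : cexp (z + w) = cexp z * cexp w.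
Proof.
by apply: complex_ext; rewrite /cexp !ReImE/= expRD cosD sinD !mul0r ?(subr0,addr0); ring.
Qed.

Lemma cexp0 : cexp (0 : R[i]) = 1.
Proof. by apply: complex_ext; rewrite /cexp !ReImE/= expR0 cos0 sin0; ring. Qed.

Lemma normc_cexp z : normc (cexp z) = expR (Re z).
Proof.
rewrite /cexp Normc.normcM normc_real normcE2/= cos2Dsin2 sqrtr1 mulr1.
by rewrite ger0_norm// expR_ge0.
Qed.

Lemma Re_cexp z : Re (cexp z) = expR (Re z) * cos (Im z).
Proof. by rewrite /cexp ReM/= mul0r subr0. Qed.

Lemma Im_cexp z : Im (cexp z) = expR (Re z) * sin (Im z).
Proof. by rewrite /cexp ImM/= mul0r addr0. Qed.

Lemma cexp_real a : cexp a%:C%C = (expR a)%:C%C.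
Proof. by apply: complex_ext; rewrite ?Re_cexp ?Im_cexp/= ?cos0 ?sin0 ?mulr1 ?mulr0. Qed.

End ComplexBasics.

Section ComplexMeasurable.
Context {R : realType} d {T : measurableType d}.
Implicit Types (f g : T -> R[i]).

Definition cmeas f := measurable_fun setT (fun x => Re (f x)) /\
  measurable_fun setT (fun x => Im (f x)).

Lemma cmeas_cst z : cmeas (cst z).
Proof. by split; exact: measurable_cst. Qed.

Lemma cmeasD f g : cmeas f -> cmeas g -> cmeas (fun x => f x + g x).
Proof.
move=> [a b] [c e]; split.
  by under eq_fun do rewrite ReD; exact: measurable_funD.
by under eq_fun do rewrite ImD; exact: measurable_funD.
Qed.

Lemma cmeasN f : cmeas f -> cmeas (fun x => - f x).
Proof.
move=> [a b]; split.
  by under eq_fun do rewrite ReN; exact: measurableT_comp.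
by under eq_fun do rewrite ImN; exact: measurableT_comp.
Qed.

Lemma cmeasB f g : cmeas f -> cmeas g -> cmeas (fun x => f x - g x).
Proof. by move=> a b; apply: cmeasD => //; exact: cmeasN. Qed.

Lemma cmeasM f g : cmeas f -> cmeas g -> cmeas (fun x => f x * g x).
Proof.
move=> [a b] [c e]; split.
  by under eq_fun do rewrite ReM; apply: measurable_funB; exact: measurable_funM.
by under eq_fun do rewrite ImM; apply: measurable_funD; exact: measurable_funM.
Qed.

Lemma cmeasX f n : cmeas f -> cmeas (fun x => f x ^+ n).
Proof.
move=> mf; elim: n => [|n IH].
  by under eq_fun do rewrite expr0; exact: cmeas_cst.
by under eq_fun do rewrite exprS; exact: cmeasM.
Qed.

Lemma cmeas_sum I (s : seq I) (F : I -> T -> R[i]) :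
  (forall i, cmeas (F i)) -> cmeas (fun x => \sum_(i <- s) F i x).
Proof.
move=> mF; elim: s => [|i s IH].
  by under eq_fun do rewrite big_nil; exact: cmeas_cst.
by under eq_fun do rewrite big_cons; exact: cmeasD.
Qed.

Lemma cmeas_prod I (s : seq I) (F : I -> T -> R[i]) :
  (forall i, cmeas (F i)) -> cmeas (fun x => \prod_(i <- s) F i x).
Proof.
move=> mF; elim: s => [|i s IH].
  by under eq_fun do rewrite big_nil; exact: cmeas_cst.
by under eq_fun do rewrite big_cons; exact: cmeasM.
Qed.

Lemma cmeas_real (f : T -> R) :
  measurable_fun setT f -> cmeas (fun x => (f x)%:C%C).
Proof. by move=> mf; split => //=; exact: measurable_cst. Qed.

Lemma cmeas_cexp f : cmeas f -> cmeas (fun x => cexp (f x)).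
Proof.
move=> [a b]; split.
  under eq_fun do rewrite Re_cexp.
  apply: measurable_funM; first exact: measurableT_comp.
  apply: (measurableT_comp (f := cos)) => //.
  by apply: continuous_measurable_fun; exact: continuous_cos.
under eq_fun do rewrite Im_cexp.
apply: measurable_funM; first exact: measurableT_comp.
apply: (measurableT_comp (f := sin)) => //.
by apply: continuous_measurable_fun; exact: continuous_sin.
Qed.

Lemma cmeas_if (b : T -> bool) f g : measurable_fun setT b ->
  cmeas f -> cmeas g -> cmeas (fun x => if b x then f x else g x).
Proof.
move=> mb [a1 a2] [b1 b2]; split.
  by rewrite (_ : (fun x => _) = fun x => if b x then Re (f x) else Re (g x));
    [exact: measurable_fun_ifT|apply/funext => x; case: (b x)].
by rewrite (_ : (fun x => _) = fun x => if b x then Im (f x) else Im (g x));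
  [exact: measurable_fun_ifT|apply/funext => x; case: (b x)].
Qed.

Lemma measurable_normc f : cmeas f -> measurable_fun setT (fun x => normc (f x)).
Proof.
move=> [a b]; under eq_fun do rewrite normcE2.
apply: (measurableT_comp (f := @Num.sqrt R)) => //=.
  by apply: continuous_measurable_fun; exact: sqrt_continuous.
by apply: measurable_funD; exact: measurable_funX.
Qed.
End ComplexMeasurable.

(* Syntactic dispatch: unification on complex-valued functions would unfold the
   field operations. *)
Ltac hyp := match goal with H : ?P |- ?P => exact H end.

Ltac cmeas_step := lazymatch goal with
  | |- cmeas (fun _ => ?z) => exact: cmeas_cst
  | |- cmeas (cst ?z) => exact: cmeas_cst
  | |- cmeas (fun x => @?f x + @?g x) => refine (@cmeasD _ _ _ f g _ _); cmeas_step
  | |- cmeas (fun x => - @?f x) => refine (@cmeasN _ _ _ f _); cmeas_step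
  | |- cmeas (fun x => @?f x * @?g x) => refine (@cmeasM _ _ _ f g _ _); cmeas_step
  | |- cmeas (fun x => @?f x ^+ ?n) => refine (@cmeasX _ _ _ f n _); cmeas_step
  | |- cmeas (fun x => cexp (@?f x)) => refine (@cmeas_cexp _ _ _ f _); cmeas_step
  | |- _ => try hyp
  end.

Lemma cmeas_comp {R : realType} d d' {T : measurableType d} {T' : measurableType d'}
  (f : T -> R[i]) (g : T' -> T) :
  cmeas f -> measurable_fun setT g -> cmeas (fun x => f (g x)).
Proof. by move=> [a b] mg; split; [exact: (measurableT_comp a mg)|exact: (measurableT_comp b mg)]. Qed.

Section ComplexIntegral.
Context {R : realType} d {T : measurableType d}.
Variable mu : {measure set T -> \bar R}.
Implicit Types (f g : T -> R[i]) (D : set T).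

Definition cint D f : R[i] :=
  Complex (Rintegral mu D (fun x => Re (f x))) (Rintegral mu D (fun x => Im (f x))).

Definition cintg D f := mu.-integrable D (EFin \o (fun x => Re (f x))) /\
  mu.-integrable D (EFin \o (fun x => Im (f x))).

Lemma cintg_meas f : cintg setT f -> cmeas f.
Proof. by move=> [/measurable_int/measurable_EFinP a /measurable_int/measurable_EFinP b]. Qed.

Lemma eq_cint D f g : (forall x, D x -> f x = g x) -> cint D f = cint D g.
Proof.
move=> fg; congr Complex; apply: eq_Rintegral => x; rewrite inE => /fg ->//.
Qed.

Lemma cint_mkcond D f : cint D f = cint setT (fun x => if x \in D then f x else 0).
Proof.
by congr Complex; rewrite Rintegral_mkcond; apply: eq_Rintegral => x _;
  rewrite patchE; case: ifP.
Qed.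

Lemma cintg_mkcond D f : measurable D ->
  cintg D f <-> cintg setT (fun x => if x \in D then f x else 0).
Proof.
move=> mD; rewrite /cintg; split => -[a b]; split.
- move/(integrable_mkcond _ mD) : a; apply: eq_integrable => // x _ /=.
  by rewrite patchE; case: ifP.
- move/(integrable_mkcond _ mD) : b; apply: eq_integrable => // x _ /=.
  by rewrite patchE; case: ifP.
- apply/(integrable_mkcond _ mD); apply: eq_integrable a => // x _ /=.
  by rewrite patchE; case: ifP.
- apply/(integrable_mkcond _ mD); apply: eq_integrable b => // x _ /=.
  by rewrite patchE; case: ifP.
Qed.

Lemma cintg_le f (g : T -> R) : cmeas f -> (forall x, normc (f x) <= g x) ->
  mu.-integrable setT (EFin \o g) -> cintg setT f.
Proof.
move=> [a b] fg ig; split.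
  apply: le_integrable ig => //; first exact/measurable_EFinP.
  move=> x _ /=; rewrite lee_fin (le_trans (Re_le_normc _))//.
  by rewrite (le_trans (fg x))// ler_norm.
apply: le_integrable ig => //; first exact/measurable_EFinP.
move=> x _ /=; rewrite lee_fin (le_trans (Im_le_normc _))//.
by rewrite (le_trans (fg x))// ler_norm.
Qed.

Lemma cintg_normc f : cintg setT f ->
  mu.-integrable setT (EFin \o (fun x => normc (f x))).
Proof.
move=> [a b]; have := integrableD measurableT (integrable_norm a) (integrable_norm b).
apply: le_integrable => //.
  apply/measurable_EFinP; exact: measurable_normc (cintg_meas (conj a b)).
move=> x _ /=; rewrite lee_fin ger0_norm ?normc_ge0// (le_trans (normc_le _))//.
by rewrite ler_norm.
Qed.

Variable D : set T.
Hypothesis mD : measurable D.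

Lemma cintgD f g : cintg D f -> cintg D g -> cintg D (fun x => f x + g x).
Proof.
move=> [a b] [c e]; split.
  by move: (integrableD mD a c); apply: eq_integrable => // x _; rewrite /= ReD.
by move: (integrableD mD b e); apply: eq_integrable => // x _; rewrite /= ImD.
Qed.

Let intZ (k : R) (h : T -> R) : mu.-integrable D (EFin \o h) ->
  mu.-integrable D (EFin \o (fun x => k * h x)).
Proof. by move=> /(integrableZl mD k); apply: eq_integrable. Qed.

Lemma cintgZ z f : cintg D f -> cintg D (fun x => z * f x).
Proof.
move=> [a b]; split.
  move: (integrableD mD (integrableZl mD (Re z) a) (integrableZl mD (- Im z) b)).
  by apply: eq_integrable => // x _; rewrite /= ReM -!EFinM -EFinD mulNr.
move: (integrableD mD (integrableZl mD (Re z) b) (integrableZl mD (Im z) a)).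
by apply: eq_integrable => // x _; rewrite /= ImM -!EFinM -EFinD.
Qed.

Lemma cintD f g : cintg D f -> cintg D g ->
  cint D (fun x => f x + g x) = cint D f + cint D g.
Proof.
move=> [a b] [c e]; apply: complex_ext; rewrite ?ReD ?ImD/= -RintegralD//;
by apply: eq_Rintegral => x _; rewrite ReImE.
Qed.

Lemma cintZ z f : cintg D f -> cint D (fun x => z * f x) = z * cint D f.
Proof.
move=> [a b]; apply: complex_ext; rewrite ?ReM ?ImM/= -!RintegralZl//.
  rewrite -RintegralB//; try exact: intZ.
  by apply: eq_Rintegral => x _; rewrite ReM.
rewrite -RintegralD//; try exact: intZ.
by apply: eq_Rintegral => x _; rewrite ImM.
Qed.

Lemma cint0 : cint D (fun=> 0) = 0.
Proof. by apply: complex_ext; rewrite /= Rintegral_cst// mul0r. Qed.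

Lemma cintg0 : cintg D (fun=> 0).
Proof. by split; exact: integrable0. Qed.

Lemma cintgN f : cintg D f -> cintg D (fun x => - f x).
Proof. by move=> /(cintgZ (-1)); under eq_fun do rewrite mulN1r. Qed.

Lemma cintN f : cintg D f -> cint D (fun x => - f x) = - cint D f.
Proof.
move=> fi; rewrite -mulN1r -cintZ//.
by under eq_fun do rewrite -mulN1r.
Qed.

Lemma cintB f g : cintg D f -> cintg D g ->
  cint D (fun x => f x - g x) = cint D f - cint D g.
Proof. by move=> a b; rewrite cintD ?cintN//; exact: cintgN. Qed.

Lemma cintg_sum I (s : seq I) (F : I -> T -> R[i]) :
  (forall i, cintg D (F i)) -> cintg D (fun x => \sum_(i <- s) F i x).
Proof.
move=> h; elim: s => [|i s IH].
  by under eq_fun do rewrite big_nil; exact: cintg0.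
by under eq_fun do rewrite big_cons; exact: cintgD.
Qed.

Lemma cint_sum I (s : seq I) (F : I -> T -> R[i]) :
  (forall i, cintg D (F i)) ->
  cint D (fun x => \sum_(i <- s) F i x) = \sum_(i <- s) cint D (F i).
Proof.
move=> h; elim: s => [|i s IH].
  by under eq_fun do rewrite big_nil; rewrite big_nil cint0.
rewrite big_cons -IH -cintD//; last exact: cintg_sum.
by under eq_fun do rewrite big_cons.
Qed.

Lemma normc_cint f : cintg D f ->
  mu.-integrable D (EFin \o (fun x => normc (f x))) ->
  normc (cint D f) <= 2 * Rintegral mu D (fun x => normc (f x)).
Proof.
move=> [a b] c; rewrite (le_trans (normc_le _))//= mulr2n mulrDl !mul1r lerD//.
  rewrite (le_trans (le_normr_Rintegral mD a))// le_Rintegral//.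
    exact: integrable_norm.
  by move=> x _; exact: Re_le_normc.
rewrite (le_trans (le_normr_Rintegral mD b))// le_Rintegral//.
  exact: integrable_norm.
by move=> x _; exact: Im_le_normc.
Qed.

End ComplexIntegral.

Section ComplexAE.
Context {R : realType} d {T : measurableType d}.
Variable mu : {measure set T -> \bar R}.

Lemma ae_eq_Rintegral (f g : T -> R) :
  measurable_fun setT f -> measurable_fun setT g ->
  {ae mu, forall x, f x = g x} ->
  Rintegral mu setT f = Rintegral mu setT g.
Proof.
move=> mf mg fg; rewrite /Rintegral; congr fine; apply: ae_eq_integral => //.
- exact/measurable_EFinP.
- exact/measurable_EFinP.
- by apply: filterS fg => x /= -> _.
Qed.

Lemma ae_eq_integrable (f g : T -> \bar R) :
  measurable_fun setT g -> {ae mu, forall x, f x = g x} ->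
  mu.-integrable setT f -> mu.-integrable setT g.
Proof.
move=> mg fg /integrableP[mf fi]; apply/integrableP; split => //.
rewrite (_ : (\int[mu]_x `|g x|)%E = (\int[mu]_x `|f x|)%E)//.
apply: ge0_ae_eq_integral => //; [exact: measurableT_comp|exact: measurableT_comp|].
by apply: filterS fg => x /= ->.
Qed.

Lemma ae_eq_cint (f g : T -> R[i]) : cmeas f -> cmeas g ->
  {ae mu, forall x, f x = g x} -> cint mu setT f = cint mu setT g.
Proof.
move=> [a b] [c e] fg; congr Complex; apply: ae_eq_Rintegral => //;
by apply: filterS fg => x /= ->.
Qed.

Lemma cint_dominated (f_ : nat -> T -> R[i]) (f : T -> R[i]) (g : T -> R) :
  (forall n, cmeas (f_ n)) -> cmeas f ->
  (forall x, cpart_cvg (f_ ^~ x) (f x)) ->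
  mu.-integrable setT (EFin \o g) -> (forall n x, normc (f_ n x) <= g x) ->
  cpart_cvg (fun n => cint mu setT (f_ n)) (cint mu setT f).
Proof.
move=> mf_ mf fcvg ig fg.
have key (h_ : nat -> T -> R) (h : T -> R) : (forall n, measurable_fun setT (h_ n)) ->
    measurable_fun setT h -> (forall x, h_ ^~ x @ \oo --> h x) ->
    (forall n x, `|h_ n x| <= g x) ->
    (fun n => Rintegral mu setT (h_ n)) @ \oo --> Rintegral mu setT h.
  move=> mh_ mh hc hg.
  have [|||ih _ cvg] := @dominated_convergence _ T R mu setT measurableT
    (fun n => EFin \o h_ n) (EFin \o h) (EFin \o g)
    (fun n => proj2 (measurable_EFinP _ _) (mh_ n))
    (proj2 (measurable_EFinP _ _) mh).
  - apply: aeW => x _; apply: cvg_EFin; first exact: nearW.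
    exact: hc.
  - exact: ig.
  - by apply: aeW => x n' _ /=; rewrite lee_fin.
  rewrite /Rintegral; apply: fine_cvg.
  by rewrite fineK//; apply: integrable_fin_num => //; exact: ih.
split.
  apply: key => //; [by move=> n; case: (mf_ n)|by case: mf|by move=> x; case: (fcvg x)|].
  by move=> n x; exact: le_trans (Re_le_normc _) _.
apply: key => //; [by move=> n; case: (mf_ n)|by case: mf|by move=> x; case: (fcvg x)|].
by move=> n x; exact: le_trans (Im_le_normc _) _.
Qed.

End ComplexAE.

Section ComplexFubini.
Context {R : realType} d1 d2 {T1 : measurableType d1} {T2 : measurableType d2}.
Variables (m1 : {sigma_finite_measure set T1 -> \bar R}).
Variables (m2 : {sigma_finite_measure set T2 -> \bar R}).

Let Rfubini1 (f : T1 * T2 -> R) :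
  (m1 \x m2)%E.-integrable setT (EFin \o f) ->
  [/\ measurable_fun setT (fun x => Rintegral m2 setT (fun y => f (x, y))),
   m1.-integrable setT (EFin \o (fun x => Rintegral m2 setT (fun y => f (x, y)))) &
  Rintegral m1 setT (fun x => Rintegral m2 setT (fun y => f (x, y))) =
  Rintegral (m1 \x m2)%E setT f].
Proof.
move=> fi.
have mF := measurable_fubini_F fi.
have mFf : measurable_fun setT (fun x => Rintegral m2 setT (fun y => f (x, y))).
  by apply: measurableT_comp => //; exact: mF.
have aeE : {ae m1, forall x, setT x -> (EFin \o (fun x => Rintegral m2 setT (fun y => f (x, y)))) x
    = fubini_F m2 (EFin \o f) x}.
  have := ae_integrable1 fi; apply: filterS => x ix _ /=.
  by rewrite /Rintegral fineK//; exact: integrable_fin_num ix.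
split => //.
  have := integrable_fubini_F fi; apply: ae_eq_integrable => //.
  - exact/measurable_EFinP.
  - by apply: filterS aeE => x /= h; rewrite h.
rewrite /Rintegral -integral12_prod_meas1//; congr fine.
apply: ae_eq_integral => //; exact/measurable_EFinP.
Qed.

Let Rfubini2 (f : T1 * T2 -> R) :
  (m1 \x m2)%E.-integrable setT (EFin \o f) ->
  [/\ measurable_fun setT (fun y => Rintegral m1 setT (fun x => f (x, y))),
   m2.-integrable setT (EFin \o (fun y => Rintegral m1 setT (fun x => f (x, y)))) &
  Rintegral m2 setT (fun y => Rintegral m1 setT (fun x => f (x, y))) =
  Rintegral (m1 \x m2)%E setT f].
Proof.
move=> fi.
have mF := measurable_fubini_G fi.
have mFf : measurable_fun setT (fun y => Rintegral m1 setT (fun x => f (x, y))).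
  by apply: measurableT_comp => //; exact: mF.
have aeE : {ae m2, forall y, setT y -> (EFin \o (fun y => Rintegral m1 setT (fun x => f (x, y)))) y
    = fubini_G m1 (EFin \o f) y}.
  have := ae_integrable2 fi; apply: filterS => x ix _ /=.
  by rewrite /Rintegral fineK//; exact: integrable_fin_num ix.
split => //.
  have iG : m2.-integrable setT (fubini_G m1 (EFin \o f)).
    have mf := measurable_int _ fi.
    apply/integrableP; split => //.
    apply: le_lt_trans ((integrable21ltyP m1 m2 mf).1 fi).
    apply: ge0_le_integral => //; first exact: measurableT_comp.
      apply: (measurable_fun_fubini_tonelli_G (abse \o (EFin \o f))) => //=.
      exact: measurableT_comp.
    move=> y _; apply: le_abse_integral => //.
    exact: measurable_fun_pair1.
  move: iG; apply: ae_eq_integrable => //.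
  - exact/measurable_EFinP.
  - by apply: filterS aeE => x /= h; rewrite h.
rewrite /Rintegral -integral21_prod_meas1//; congr fine.
apply: ae_eq_integral => //; exact/measurable_EFinP.
Qed.

Variable f : T1 * T2 -> R[i].
Hypothesis fi : cintg (m1 \x m2)%E setT f.

Lemma cintg_fubini1 : cintg m1 setT (fun x => cint m2 setT (fun y => f (x, y))).
Proof. by have [a b] := fi; split; [have [] := Rfubini1 a|have [] := Rfubini1 b]. Qed.

Lemma cintg_fubini2 : cintg m2 setT (fun y => cint m1 setT (fun x => f (x, y))).
Proof. by have [a b] := fi; split; [have [] := Rfubini2 a|have [] := Rfubini2 b]. Qed.

Lemma cint_fubini1 :
  cint m1 setT (fun x => cint m2 setT (fun y => f (x, y))) = cint (m1 \x m2)%E setT f.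
Proof. by have [a b] := fi; congr Complex; [have [] := Rfubini1 a|have [] := Rfubini1 b]. Qed.

Lemma cint_fubini2 :
  cint m2 setT (fun y => cint m1 setT (fun x => f (x, y))) = cint (m1 \x m2)%E setT f.
Proof. by have [a b] := fi; congr Complex; [have [] := Rfubini2 a|have [] := Rfubini2 b]. Qed.

Lemma cint_swap :
  cint m1 setT (fun x => cint m2 setT (fun y => f (x, y))) =
  cint m2 setT (fun y => cint m1 setT (fun x => f (x, y))).
Proof. by rewrite cint_fubini1 cint_fubini2. Qed.

End ComplexFubini.

(** * Product measures on tuples *)

Definition tcons {T : Type} {n} (wv : T * n.-tuple T) : n.+1.-tuple T :=
  [tuple of wv.1 :: wv.2].

Lemma measurable_tcons d {T : measurableType d} n :
  measurable_fun setT (@tcons T n).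
Proof. exact: measurable_cons. Qed.

Section TupleMeasure.
Context {R : realType} d {T : measurableType d}.
Variable mu : {finite_measure set T -> \bar R}.

Section Step.
Variables (n : nat) (nu : {finite_measure set n.-tuple T -> \bar R}).

Definition tpush := pushforward (mu \x nu)%E (@tcons T n).

HB.instance Definition _ := Measure.copy tpush
  (measure_function_pushforward__canonical__measure_function_Measure
    (mu \x nu)%E (measurable_tcons (n:=n))).

Let tpush_fin : fin_num_fun tpush.
Proof.
move=> A mA; rewrite ge0_fin_numE//.
have : (tpush A <= (mu \x nu)%E setT)%E.
  apply: (le_measure (mu \x nu)%E (x := tcons @^-1` A)); rewrite ?inE//.
  by rewrite -[X in measurable X]setTI; exact: measurable_tcons.
move=> /le_lt_trans; apply.
rewrite -setXTT product_measure1E//.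
by rewrite -ge0_fin_numE ?mule_ge0// fin_numM// fin_num_measure.
Qed.

HB.instance Definition _ := Measure_isFinite.Build _ _ _ tpush tpush_fin.

End Step.

Fixpoint tmeas n : {finite_measure set n.-tuple T -> \bar R} :=
  match n with
  | 0 => \d_([tuple] : 0.-tuple T)
  | n'.+1 => tpush (tmeas n')
  end.

Lemma ge0_integral_tmeas0 (f : 0.-tuple T -> \bar R) :
  measurable_fun setT f -> (forall x, 0 <= f x)%E ->
  (\int[tmeas 0]_x f x = f [tuple])%E.
Proof. by move=> mf f0; rewrite /= integral_dirac// diracT mul1e. Qed.

Lemma ge0_integral_tmeasS n (f : n.+1.-tuple T -> \bar R) :
  measurable_fun setT f -> (forall x, 0 <= f x)%E ->
  (\int[tmeas n.+1]_x f x = \int[mu]_w \int[tmeas n]_v f (tcons (w, v)))%E.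
Proof.
move=> mf f0; rewrite /= ge0_integral_pushforward//; last exact: measurable_tcons.
have mfc : measurable_fun setT (f \o tcons (n:=n)).
  by apply: measurableT_comp => //; exact: measurable_tcons.
rewrite preimage_setT; apply: fubini_tonelli1 => // x.
exact: f0.
Qed.

Lemma cmeas_tcons n (f : n.+1.-tuple T -> R[i]) :
  cmeas f -> cmeas (fun wv => f (tcons wv)).
Proof. by move=> mf; apply: cmeas_comp mf _; exact: measurable_tcons. Qed.

Lemma integrable_tmeasS n (f : n.+1.-tuple T -> \bar R) :
  measurable_fun setT f ->
  (tmeas n.+1).-integrable setT f <->
  (mu \x tmeas n)%E.-integrable setT (f \o tcons).
Proof.
move=> mf.
have mfc : measurable_fun setT (f \o tcons (n:=n)).
  by apply: measurableT_comp => //; exact: measurable_tcons.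
split => /integrableP[_ h]; apply/integrableP; split => //.
  move: h; rewrite /= ge0_integral_pushforward//; first exact: measurable_tcons.
  exact: measurableT_comp.
rewrite /= ge0_integral_pushforward//; first exact: measurable_tcons.
exact: measurableT_comp.
Qed.

Lemma cintg_tmeasS n (f : n.+1.-tuple T -> R[i]) : cmeas f ->
  cintg (tmeas n.+1) setT f <->
  cintg (mu \x tmeas n)%E setT (fun wv => f (tcons wv)).
Proof.
move=> [a b]; split => -[h1 h2]; split.
- by move/integrable_tmeasS : h1; apply; exact/measurable_EFinP.
- by move/integrable_tmeasS : h2; apply; exact/measurable_EFinP.
- by apply/integrable_tmeasS => //; exact/measurable_EFinP.
- by apply/integrable_tmeasS => //; exact/measurable_EFinP.
Qed.

Let Rint_tmeasS n (f : n.+1.-tuple T -> R) : measurable_fun setT f ->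
  (tmeas n.+1).-integrable setT (EFin \o f) ->
  Rintegral (tmeas n.+1) setT f = Rintegral (mu \x tmeas n)%E setT (f \o tcons).
Proof.
move=> mf fi; rewrite /Rintegral; congr fine => /=.
have mf' : measurable_fun setT (EFin \o f) by exact/measurable_EFinP.
have := integral_pushforward (measurable_tcons (T:=T) (n:=n)) (mu := (mu \x tmeas n)%E)
  (D := setT) mf'.
rewrite preimage_setT => -> //.
exact/integrable_tmeasS.
Qed.

Lemma cint_tmeas0 (f : 0.-tuple T -> R[i]) : cmeas f ->
  cint (tmeas 0) setT f = f [tuple].
Proof.
move=> [a b]; apply: complex_ext; rewrite /= /Rintegral integral_dirac// ?diracT ?mul1e//=.
  exact/measurable_EFinP.
exact/measurable_EFinP.
Qed.

Lemma cint_tmeasS n (f : n.+1.-tuple T -> R[i]) : cintg (tmeas n.+1) setT f ->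
  cint (tmeas n.+1) setT f =
  cint mu setT (fun w => cint (tmeas n) setT (fun v => f (tcons (w, v)))).
Proof.
move=> fi; have mf := cintg_meas fi.
have fi' := (cintg_tmeasS mf).1 fi.
rewrite (cint_fubini1 fi').
by case: fi mf => i1 i2 [a b]; congr Complex; exact: Rint_tmeasS.
Qed.

End TupleMeasure.

(** * Peeling off one variable of a tuple *)

Section Transfer.
Context {R : realType} d d' {X : measurableType d} {Y : measurableType d'}.
Variables (m : {measure set X -> \bar R}) (m' : {measure set Y -> \bar R}).
Variables (g : Y -> X) (mg : measurable_fun setT g).
Hypothesis tr : forall f : X -> \bar R, measurable_fun setT f ->
  (forall x, 0 <= f x)%E -> (\int[m]_x f x = \int[m']_y f (g y))%E.

Lemma integrable_transfer (f : X -> \bar R) : measurable_fun setT f ->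
  m.-integrable setT f <-> m'.-integrable setT (f \o g).
Proof.
move=> mf; have mA : measurable_fun setT (abse \o f) by exact: measurableT_comp.
have E := tr mA (fun x => abse_ge0 _).
split => /integrableP[_ h]; apply/integrableP; split => //.
- exact: measurableT_comp.
- by move: h; rewrite /= in E *; rewrite E.
- by rewrite /= in E *; rewrite E.
Qed.

Let Rint_transfer (f : X -> R) : measurable_fun setT f ->
  Rintegral m setT f = Rintegral m' setT (f \o g).
Proof.
move=> /measurable_EFinP mf; rewrite /Rintegral; congr fine.
rewrite integralE [RHS]integralE; congr (_ - _)%E.
  rewrite tr//; last exact: measurable_funepos.
  by under [RHS]eq_integral do rewrite (funepos_comp (EFin \o f)).
rewrite tr//; last exact: measurable_funeneg.
by under [RHS]eq_integral do rewrite (funeneg_comp (EFin \o f)).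
Qed.

Lemma cintg_transfer (f : X -> R[i]) : cmeas f ->
  cintg m setT f <-> cintg m' setT (fun y => f (g y)).
Proof.
move=> [a b]; split => -[h1 h2]; split.
- by move/integrable_transfer : h1; apply; exact/measurable_EFinP.
- by move/integrable_transfer : h2; apply; exact/measurable_EFinP.
- by apply/integrable_transfer => //; exact/measurable_EFinP.
- by apply/integrable_transfer => //; exact/measurable_EFinP.
Qed.

Lemma cint_transfer (f : X -> R[i]) : cmeas f ->
  cint m setT f = cint m' setT (fun y => f (g y)).
Proof. by move=> [a b]; congr Complex; exact: Rint_transfer. Qed.

End Transfer.

Section FiniteProduct.
Context {R : realType} d1 d2 {T1 : measurableType d1} {T2 : measurableType d2}.
Variables (m1 : {finite_measure set T1 -> \bar R}).
Variables (m2 : {finite_measure set T2 -> \bar R}).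

Definition fprodm := (m1 \x m2)%E.

HB.instance Definition _ := Measure.on fprodm.

Let fprodm_fin : fin_num_fun fprodm.
Proof.
move=> A mA; rewrite ge0_fin_numE//.
have : (fprodm A <= (m1 \x m2)%E setT)%E by apply: le_measure; rewrite ?inE.
move=> /le_lt_trans; apply.
rewrite -setXTT product_measure1E//.
by rewrite -ge0_fin_numE ?mule_ge0// fin_numM// fin_num_measure.
Qed.

HB.instance Definition _ := Measure_isFinite.Build _ _ _ fprodm fprodm_fin.

End FiniteProduct.

Section TuplePeel.
Context {R : realType} d {T : measurableType d}.
Variable mu : {finite_measure set T -> \bar R}.
Local Open Scope ereal_scope.

Definition trcons {n} (uw : n.-tuple T * T) : n.+1.-tuple T :=
  [tuple of rcons uw.1 uw.2].

Lemma measurable_trcons n : measurable_fun setT (@trcons n).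
Proof.
apply/measurable_fun_tnthP => i.
have [ilt|ige] := ltnP i n.
  rewrite (_ : _ \o _ = fun uw => tnth uw.1 (Ordinal ilt)); last first.
    apply/funext => -[u w] /=.
    by rewrite !(tnth_nth w) /= nth_rcons size_tuple ilt.
  apply: (measurableT_comp (f := fun u : n.-tuple T => tnth u (Ordinal ilt))) => //.
  exact: measurable_tnth.
rewrite (_ : _ \o _ = snd)//.
apply/funext => -[u w] /=; rewrite (tnth_nth w) /= nth_rcons size_tuple ltnNge ige/=.
by rewrite (_ : i == n :> nat)// eqn_leq ige -ltnS ltn_ord.
Qed.

Lemma ge0_integral_tmeas_rcons n (f : n.+1.-tuple T -> \bar R) :
  measurable_fun setT f -> (forall x, 0 <= f x) ->
  \int[tmeas mu n.+1]_x f x = \int[(tmeas mu n \x mu)]_uw f (trcons uw).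
Proof.
have mr n' (f' : n'.+1.-tuple T -> \bar R) : measurable_fun setT f' ->
    measurable_fun setT (fun uw => f' (trcons (n:=n') uw)).
  by move=> mf'; apply: measurableT_comp mf' _; exact: measurable_trcons.
have mc n' (f' : n'.+1.-tuple T -> \bar R) : measurable_fun setT f' ->
    measurable_fun setT (fun uw => f' (tcons (n:=n') uw)).
  by move=> mf'; apply: measurableT_comp mf' _; exact: measurable_tcons.
elim: n f => [|n IH] f mf f0.
  rewrite ge0_integral_tmeasS// fubini_tonelli1//=; last exact: mr.
  rewrite /fubini_F integral_dirac//; last first.
    apply: (measurable_fun_fubini_tonelli_F (fun uw => f (trcons (n:=0) uw))) => //.
    exact: mr.
  rewrite diracT mul1e; apply: eq_integral => w _.
  rewrite integral_dirac ?diracT ?mul1e//.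
    by congr f; apply: val_inj.
  exact: measurable_fun_pair2 (mc _ _ mf).
rewrite ge0_integral_tmeasS//.
transitivity (\int[mu]_w0 \int[tmeas mu n]_u \int[mu]_w f (tcons (w0, trcons (u, w)))).
  apply: eq_integral => w0 _.
  have mfw : measurable_fun setT (fun v => f (tcons (w0, v))).
    exact: measurable_fun_pair2 (mc _ _ mf).
  rewrite IH//; apply: (fubini_tonelli1 (fun uw => f (tcons (w0, trcons uw)))) => //.
  exact: (mr _ _ mfw).
rewrite fubini_tonelli1//; last exact: mr.
pose H (u : n.+1.-tuple T) := \int[mu]_w f (trcons (u, w)).
have mH : measurable_fun setT H.
  apply: (measurable_fun_fubini_tonelli_F (fun uw => f (trcons (n:=n.+1) uw))) => //.
  exact: mr.
have H0 u : 0 <= H u by exact: integral_ge0.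
rewrite [RHS](_ : _ = \int[tmeas mu n.+1]_u H u)// (ge0_integral_tmeasS mu mH H0).
apply: eq_integral => w0 _; apply: eq_integral => u _; apply: eq_integral => w _.
by congr f; apply: val_inj.
Qed.

Variable s : T -> R.
Hypothesis ms : measurable_fun setT s.
Hypothesis s_null : forall c, mu [set w | s w = c] = 0.

Definition tsym n (Z : Type) (f : n.-tuple T -> Z) :=
  forall u v : n.-tuple T, perm_eq u v -> f u = f v.

Lemma tsym_cons n (Z : Type) (f : n.+1.-tuple T -> Z) w :
  tsym f -> tsym (fun v => f (tcons (w, v))).
Proof. by move=> fs u v uv; apply: fs; rewrite /= perm_cons. Qed.

Definition tmaxb n (w : T) (v : n.-tuple T) := all (fun w' => (s w' <= s w)%R) v.

Lemma measurable_tmaxb n : measurable_fun setT (fun wv : T * n.-tuple T => tmaxb wv.1 wv.2).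
Proof.
elim: n => [|n IH].
  by rewrite (_ : (fun _ => _) = cst true)//; apply/funext => -[w v]; rewrite /tmaxb (tuple0 v).
rewrite (_ : (fun _ => _) = fun wv : T * n.+1.-tuple T => (s (thead wv.2) <= s wv.1)%R &&
    tmaxb wv.1 [tuple of behead wv.2]); last first.
  by apply/funext => -[w v]; rewrite /tmaxb [v in LHS]tuple_eta.
apply: measurable_and.
  apply: measurable_fun_ler; last exact: measurableT_comp.
  apply: measurableT_comp => //.
  apply: (measurableT_comp (f := fun u : n.+1.-tuple T => thead u)) => //.
  exact: measurable_tnth.
have mg : measurable_fun setT (fun wv : T * n.+1.-tuple T =>
    (wv.1, [tuple of behead wv.2]) : T * n.-tuple T); last first.
  exact: (measurableT_comp IH mg).
apply: measurable_fun_pair => //.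
by apply: (measurableT_comp (f := fun u : n.+1.-tuple T => [tuple of behead u])) => //; exact: measurable_behead.
Qed.

Lemma ge0_integral_tmax n (f : n.+1.-tuple T -> \bar R) :
  measurable_fun setT f -> (forall x, 0 <= f x) -> tsym f ->
  \int[tmeas mu n.+1]_x f x = n.+1%:R%:E *
    \int[mu]_w \int[tmeas mu n]_v (if tmaxb w v then f (tcons (w, v)) else 0).
Proof.
have mc n' (f' : n'.+1.-tuple T -> \bar R) : measurable_fun setT f' ->
    measurable_fun setT (fun uw => f' (tcons (n:=n') uw)).
  by move=> mf'; apply: measurableT_comp mf' _; exact: measurable_tcons.
have mi n' (f' : n'.+1.-tuple T -> \bar R) : measurable_fun setT f' ->
    measurable_fun setT (fun uw => if tmaxb uw.1 uw.2 then f' (tcons (n:=n') uw) else 0).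
  move=> mf'; apply: measurable_fun_ifT => //; first exact: measurable_tmaxb.
  exact: mc.
have i0 n' (f' : n'.+1.-tuple T -> \bar R) : (forall x, 0 <= f' x) ->
    forall w v, 0 <= (if tmaxb w v then f' (tcons (n:=n') (w, v)) else 0).
  by move=> f'0 w v; case: ifP.
elim: n f => [|n IH] f mf f0 fs.
  rewrite ge0_integral_tmeasS// mul1e; apply: eq_integral => w _.
  by apply: eq_integral => v _; rewrite /tmaxb (tuple0 v).
rewrite ge0_integral_tmeasS//.
pose G (w0 w : T) (v : n.-tuple T) := f (tcons (w0, tcons (w, v))).
have mG : measurable_fun setT (fun x : (T * T) * n.-tuple T => G x.1.1 x.1.2 x.2).
  apply: (measurableT_comp (mc _ _ mf) (g := fun x : (T * T) * n.-tuple T =>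
    (x.1.1, tcons (x.1.2, x.2)))).
  apply: measurable_fun_pair; first exact: measurableT_comp.
  apply: (measurableT_comp (f := @tcons T n)) => //; first exact: measurable_tcons.
  by apply: measurable_fun_pair => //; exact: measurableT_comp.
have mtm : measurable_fun setT (fun x : (T * T) * n.-tuple T => tmaxb x.1.2 x.2).
  apply: (measurableT_comp (@measurable_tmaxb n) (g := fun x : (T * T) * n.-tuple T => (x.1.2, x.2))).
  by apply: measurable_fun_pair => //; exact: measurableT_comp.
have msT (k : T * T -> T) : measurable_fun setT k ->
    measurable_fun setT (fun x : (T * T) * n.-tuple T => s (k x.1)).
  move=> mk; apply: measurableT_comp => //.
  by apply: (measurableT_comp (f := k)).
pose A w0 w v := if (s w0 <= s w)%R && tmaxb w v then G w0 w v else 0.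
pose B w0 w v := if (s w < s w0)%R && tmaxb w v then G w0 w v else 0.
pose B' w0 w v := if (s w <= s w0)%R && tmaxb w v then G w0 w v else 0.
have mA : measurable_fun setT (fun x : (T * T) * n.-tuple T => A x.1.1 x.1.2 x.2).
  apply: measurable_fun_ifT => //; apply: measurable_and => //.
  by apply: measurable_fun_ler; exact: msT.
have mB : measurable_fun setT (fun x : (T * T) * n.-tuple T => B x.1.1 x.1.2 x.2).
  apply: measurable_fun_ifT => //; apply: measurable_and => //.
  by apply: measurable_fun_ltr; exact: msT.
have mB' : measurable_fun setT (fun x : (T * T) * n.-tuple T => B' x.1.1 x.1.2 x.2).
  apply: measurable_fun_ifT => //; apply: measurable_and => //.
  by apply: measurable_fun_ler; exact: msT.
have A0 w0 w v : 0 <= A w0 w v by rewrite /A; case: ifP => // _; exact: f0.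
have B0 w0 w v : 0 <= B w0 w v by rewrite /B; case: ifP => // _; exact: f0.
have B'0 w0 w v : 0 <= B' w0 w v by rewrite /B'; case: ifP => // _; exact: f0.
have mF H : measurable_fun setT (fun x : (T * T) * n.-tuple T => H x.1.1 x.1.2 x.2) ->
    (forall w0 w v, 0 <= H w0 w v) ->
    measurable_fun setT (fun x : T * T => \int[tmeas mu n]_v H x.1 x.2 v).
  move=> mH H0; exact: (measurable_fun_fubini_tonelli_F
    (fun x : (T * T) * n.-tuple T => H x.1.1 x.1.2 x.2)).
have mF1 H : measurable_fun setT (fun x : (T * T) * n.-tuple T => H x.1.1 x.1.2 x.2) ->
    (forall w0 w v, 0 <= H w0 w v) ->
    measurable_fun setT (fun w0 : T => \int[mu]_w \int[tmeas mu n]_v H w0 w v).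
  move=> mH H0; apply: (measurable_fun_fubini_tonelli_F
    (fun x : T * T => \int[tmeas mu n]_v H x.1 x.2 v)).
    exact: mF.
  by move=> x; exact: integral_ge0.
have mv H w0 w : measurable_fun setT (fun x : (T * T) * n.-tuple T => H x.1.1 x.1.2 x.2 : \bar R) ->
    measurable_fun setT (fun v : n.-tuple T => H w0 w v).
  by move=> mH; exact: (measurable_fun_pair2 (w0, w) mH).
have mw H w0 : measurable_fun setT (fun x : (T * T) * n.-tuple T => H x.1.1 x.1.2 x.2) ->
    (forall w0 w v, 0 <= H w0 w v) ->
    measurable_fun setT (fun w => \int[tmeas mu n]_v H w0 w v).
  by move=> mH H0; exact: (measurable_fun_pair2 w0 (mF _ mH H0)).
transitivity (\int[mu]_w0 (n.+1%:R%:E * (\int[mu]_w \int[tmeas mu n]_v A w0 w v) +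
    n.+1%:R%:E * (\int[mu]_w \int[tmeas mu n]_v B' w0 w v))).
  apply: eq_integral => w0 _.
  rewrite (IH (fun v => f (tcons (w0, v)))); [|exact: measurable_fun_pair2 (mc _ _ mf)|by []|exact: tsym_cons].
  rewrite -ge0_muleDr; [|by apply: integral_ge0 => *; exact: integral_ge0..].
  congr (_ * _).
  transitivity (\int[mu]_w ((\int[tmeas mu n]_v A w0 w v) + (\int[tmeas mu n]_v B w0 w v))).
    apply: eq_integral => w _; rewrite -(ge0_integralD _ measurableT
      (fun v _ => A0 w0 w v) (mv A w0 w mA) (fun v _ => B0 w0 w v) (mv B w0 w mB)).
    apply: eq_integral => v _; rewrite /A /B /G.
    by case: leP => /= h; case: tmaxb; rewrite ?adde0 ?add0e.
  rewrite (ge0_integralD _ measurableT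
    (fun w _ => integral_ge0 _ (fun v _ => A0 w0 w v)) (mw A w0 mA A0)
    (fun w _ => integral_ge0 _ (fun v _ => B0 w0 w v)) (mw B w0 mB B0)).
  congr (_ + _); apply: ge0_ae_eq_integral => //; try exact: mw;
    try by move=> *; exact: integral_ge0.
  exists [set w | s w = s w0]; split => //.
  - rewrite -[X in measurable X]setTI (_ : [set w | _] = s @^-1` [set s w0])//.
    exact: ms.
  - exact: s_null.
  - move=> w /=; apply: contra_notP => /eqP sw _.
    apply: eq_integral => v _; rewrite /B /B' le_eqVlt.
    by case: eqP sw.
rewrite ge0_integralD//; first last.
- by apply: emeasurable_funM => //; exact: mF1.
- by move=> *; rewrite mule_ge0// integral_ge0// => *; exact: integral_ge0.
- by apply: emeasurable_funM => //; exact: mF1.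
- by move=> *; rewrite mule_ge0// integral_ge0// => *; exact: integral_ge0.
rewrite ge0_integralZl//; [|exact: mF1|by move=> *; apply: integral_ge0 => *; exact: integral_ge0].
pose X := \int[mu]_w \int[tmeas mu n.+1]_v (if tmaxb w v then f (tcons (w, v)) else 0).
have -> : \int[mu]_w0 \int[mu]_w \int[tmeas mu n]_v A w0 w v = X.
  have mFA := mF _ mA A0.
  rewrite (fubini_tonelli (fun x : T * T => \int[tmeas mu n]_v A x.1 x.2 v))//=; last first.
    by move=> x; exact: integral_ge0.
  apply: eq_integral => w _; rewrite ge0_integral_tmeasS; [|exact: measurable_fun_pair2 (mi _ _ mf)|by move=> v; exact: i0].
  apply: eq_integral => w0 _; apply: eq_integral => v _.
  rewrite /A /G /tmaxb/=; case: ifP => // _; apply: fs => /=.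
  by rewrite (perm_catCA [:: w0] [:: w]).
have -> : \int[mu]_w0 (n.+1%:R%:E * \int[mu]_w \int[tmeas mu n]_v B' w0 w v) = X.
  apply: eq_integral => w0 _.
  rewrite [RHS](IH (fun v => if tmaxb w0 v then f (tcons (w0, v)) else 0)).
  - congr (_ * _); apply: eq_integral => w _; apply: eq_integral => v _.
    rewrite /B' /G [tmaxb w0 _]/tmaxb /=.
    case: (boolP (tmaxb w v)) => [h|]; last by rewrite andbF.
    rewrite andbT; case: (boolP (s w <= s w0)%R) => //= h0.
    case: (boolP (all _ v)) => // /negP[]; apply: sub_all h => w' /le_trans; exact.
  - exact: measurable_fun_pair2 (mi _ _ mf).
  - by move=> v; exact: i0.
  - by move=> u v uv; rewrite /tmaxb (perm_all _ uv); case: ifP => // _; exact: (tsym_cons w0 fs).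
by rewrite -/X -[Y in _ + Y]mul1e -ge0_muleDl ?lee_fin// -EFinD natr1.
Qed.

End TuplePeel.

Section ComplexPeel.
Context {R : realType} d {T : measurableType d}.
Variable mu : {finite_measure set T -> \bar R}.

Lemma cintg_tmeas_rcons n (f : n.+1.-tuple T -> R[i]) : cmeas f ->
  cintg (tmeas mu n.+1) setT f <->
  cintg (tmeas mu n \x mu)%E setT (fun uw => f (trcons uw)).
Proof.
exact: (cintg_transfer (@measurable_trcons _ T n) (@ge0_integral_tmeas_rcons _ _ _ mu n)).
Qed.

Lemma cint_tmeas_rcons n (f : n.+1.-tuple T -> R[i]) : cmeas f ->
  cint (tmeas mu n.+1) setT f =
  cint (tmeas mu n \x mu)%E setT (fun uw => f (trcons uw)).
Proof.
exact: (cint_transfer (@ge0_integral_tmeas_rcons _ _ _ mu n)).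
Qed.

Variable s : T -> R.
Hypothesis ms : measurable_fun setT s.
Hypothesis s_null : forall c, mu [set w | s w = c] = 0%E.

Lemma cintg_tmax n (f : n.+1.-tuple T -> R[i]) : cintg (tmeas mu n.+1) setT f ->
  cintg (mu \x tmeas mu n)%E setT
    (fun wv => if tmaxb s wv.1 wv.2 then f (tcons wv) else 0).
Proof.
move=> fi; have mf := cintg_meas fi.
have := (cintg_tmeasS mu mf).1 fi => /cintg_normc; apply: cintg_le.
  by apply: cmeas_if; [exact: measurable_tmaxb|exact: cmeas_tcons|exact: cmeas_cst].
by move=> x; case: ifP => // _; rewrite Normc.normc0 normc_ge0.
Qed.

Let Rint_tmax n (f : n.+1.-tuple T -> R) : measurable_fun setT f -> tsym f ->
  (mu \x tmeas mu n)%E.-integrable setT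
    (EFin \o (fun wv => if tmaxb s wv.1 wv.2 then f (tcons wv) else 0)) ->
  Rintegral (tmeas mu n.+1) setT f = n.+1%:R *
  Rintegral (mu \x tmeas mu n)%E setT
    (fun wv => if tmaxb s wv.1 wv.2 then f (tcons wv) else 0).
Proof.
set g := fun wv => _; move=> /measurable_EFinP mf fs gi.
have tmaxE (h : n.+1.-tuple T -> \bar R) : measurable_fun setT h ->
    (forall x, 0 <= h x)%E -> tsym h ->
    (\int[tmeas mu n.+1]_x h x = n.+1%:R%:E *
    \int[(mu \x tmeas mu n)]_wv (if tmaxb s wv.1 wv.2 then h (tcons wv) else 0))%E.
  move=> mh h0 hs; rewrite (ge0_integral_tmax ms s_null)//; congr (_ * _)%E.
  rewrite (fubini_tonelli1 (fun wv => if tmaxb s wv.1 wv.2 then h (tcons wv) else 0)%E)//.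
    apply: measurable_fun_ifT => //; first exact: measurable_tmaxb.
    by apply: measurableT_comp mh _; exact: measurable_tcons.
  by move=> x; case: ifP.
rewrite /Rintegral integralE.
rewrite tmaxE//; [|exact: measurable_funepos|by move=> u v uv; rewrite !funeposE /= (fs _ _ uv)].
rewrite tmaxE//; [|exact: measurable_funeneg|by move=> u v uv; rewrite !funenegE /= (fs _ _ uv)].
have -> : (\int[(mu \x tmeas mu n)]_wv (if tmaxb s wv.1 wv.2 then (EFin \o f)^\+ (tcons wv) else 0) =
    \int[(mu \x tmeas mu n)]_wv (EFin \o g)^\+ wv)%E.
  apply: eq_integral => wv _; rewrite !funeposE /g /=; case: ifP => // _.
  by rewrite maxxx.
have -> : (\int[(mu \x tmeas mu n)]_wv (if tmaxb s wv.1 wv.2 then (EFin \o f)^\- (tcons wv) else 0) =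
    \int[(mu \x tmeas mu n)]_wv (EFin \o g)^\- wv)%E.
  apply: eq_integral => wv _; rewrite !funenegE /g /=; case: ifP => // _.
  by rewrite oppr0 maxxx.
have a1 := integrable_pos_fin_num measurableT gi.
have a2 := integrable_neg_fin_num measurableT gi.
by rewrite -muleBr ?fin_num_adde_defl// ?fin_numN// [in RHS]integralE fineM// fin_numB a1.
Qed.

Lemma cint_tmax n (f : n.+1.-tuple T -> R[i]) :
  cintg (tmeas mu n.+1) setT f -> tsym f ->
  cint (tmeas mu n.+1) setT f = n.+1%:R * cint (mu \x tmeas mu n)%E setT
    (fun wv => if tmaxb s wv.1 wv.2 then f (tcons wv) else 0).
Proof.
move=> fi fs; have [a b] := cintg_meas fi.
have [i1 i2] := cintg_tmax fi.
have nE : (n.+1%:R : R[i]) = n.+1%:R%:C%C by rewrite rmorph_nat.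
apply: complex_ext; rewrite nE ReImE /= mul0r ?subr0 ?addr0.
  rewrite Rint_tmax//.
  - by congr (_ * _); apply: eq_Rintegral => x _; case: ifP.
  - by move=> u v uv; rewrite (fs _ _ uv).
  - by apply: eq_integrable i1 => // x _ /=; case: ifP.
rewrite Rint_tmax//.
- by congr (_ * _); apply: eq_Rintegral => x _; case: ifP.
- by move=> u v uv; rewrite (fs _ _ uv).
- by apply: eq_integrable i2 => // x _ /=; case: ifP.
Qed.

End ComplexPeel.

Section Unzip.
Context {R : realType} d1 d2 {T1 : measurableType d1} {T2 : measurableType d2}.
Variables (m1 : {finite_measure set T1 -> \bar R}).
Variables (m2 : {finite_measure set T2 -> \bar R}).

Definition tunzip n (u : n.-tuple (T1 * T2)) : n.-tuple T1 * n.-tuple T2 :=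
  ([tuple of map fst u], [tuple of map snd u]).

Lemma measurable_tunzip n : measurable_fun setT (@tunzip n).
Proof.
apply: measurable_fun_pair; apply/measurable_fun_tnthP => i.
  rewrite (_ : _ \o _ = fun u => (tnth u i).1); last by apply/funext => u /=; rewrite tnth_map.
  by apply: measurableT_comp => //; exact: measurable_tnth.
rewrite (_ : _ \o _ = fun u => (tnth u i).2); last by apply/funext => u /=; rewrite tnth_map.
by apply: measurableT_comp => //; exact: measurable_tnth.
Qed.

Local Open Scope ereal_scope.

Lemma ge0_integral_tunzip n (f : n.-tuple T1 * n.-tuple T2 -> \bar R) :
  measurable_fun setT f -> (forall x, 0 <= f x) ->
  \int[(tmeas m1 n \x tmeas m2 n)]_x f x = \int[tmeas (fprodm m1 m2) n]_u f (tunzip u).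
Proof.
elim: n f => [|n IH] f mf f0.
  have mF := measurable_fun_fubini_tonelli_F (m2 := tmeas m2 0) f mf f0.
  have mfu : measurable_fun setT (fun u => f (tunzip (n:=0) u)).
    by apply: measurableT_comp mf _; exact: measurable_tunzip.
  have F0 x : 0 <= fubini_F (tmeas m2 0) f x by apply: integral_ge0.
  rewrite fubini_tonelli1// (ge0_integral_tmeas0 m1 mF F0).
  rewrite (ge0_integral_tmeas0 _ mfu)// /fubini_F.
  rewrite (ge0_integral_tmeas0 m2 (measurable_fun_pair2 _ mf))//.
  by congr f; congr pair; apply: val_inj.
pose G (a0 : T1) (b0 : T2) (a : n.-tuple T1) (b : n.-tuple T2) :=
  f (tcons (a0, a), tcons (b0, b)).
have mG : measurable_fun setT (fun z : (T1 * n.-tuple T1) * (T2 * n.-tuple T2) =>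
    f (tcons z.1, tcons z.2)).
  apply: (measurableT_comp mf); apply: measurable_fun_pair.
    by apply: measurableT_comp => //; exact: measurable_tcons.
  by apply: measurableT_comp => //; exact: measurable_tcons.
have mG1 a0 b0 : measurable_fun setT (fun ab : n.-tuple T1 * n.-tuple T2 => G a0 b0 ab.1 ab.2).
  apply: (measurableT_comp mG (g := fun ab : n.-tuple T1 * n.-tuple T2 => ((a0, ab.1), (b0, ab.2)))).
  by apply: measurable_fun_pair; apply: measurable_fun_pair.
have mG2 a0 : measurable_fun setT (fun z : (n.-tuple T1 * T2) * n.-tuple T2 => G a0 z.1.2 z.1.1 z.2).
  apply: (measurableT_comp mG (g := fun z : (n.-tuple T1 * T2) * n.-tuple T2 => ((a0, z.1.1), (z.1.2, z.2)))).
  by apply: measurable_fun_pair; apply: measurable_fun_pair => //; exact: measurableT_comp.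
transitivity (\int[m1]_a0 \int[m2]_b0 \int[tmeas m1 n]_a \int[tmeas m2 n]_b G a0 b0 a b).
  have mF := measurable_fun_fubini_tonelli_F (m2 := tmeas m2 n.+1) f mf f0.
  have F0 x : 0 <= fubini_F (tmeas m2 n.+1) f x by apply: integral_ge0.
  rewrite fubini_tonelli1// (ge0_integral_tmeasS m1 mF F0) /fubini_F.
  apply: eq_integral => a0 _.
  have mG3 := measurable_fun_fubini_tonelli_F (m2 := tmeas m2 n) _ (mG2 a0).
  rewrite (fubini_tonelli (m1 := m2) (m2 := tmeas m1 n) (fun ba : T2 * n.-tuple T1 =>
    \int[tmeas m2 n]_b G a0 ba.1 ba.2 b)); last 2 first.
  - have := measurableT_comp (mG3 (fun=> f0 _)) (g := fun ba : T2 * n.-tuple T1 => (ba.2, ba.1)).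
    by apply; apply: measurable_fun_pair.
  - by move=> x; apply: integral_ge0 => *; exact: f0.
  apply: eq_integral => a _; rewrite ge0_integral_tmeasS//.
  exact: measurable_fun_pair2.
rewrite [RHS]ge0_integral_tmeasS//; last first.
  by apply: measurableT_comp => //; exact: measurable_tunzip.
pose H (ab : T1 * T2) := \int[tmeas m1 n]_a \int[tmeas m2 n]_b G ab.1 ab.2 a b.
have mH : measurable_fun setT H.
  have mH0 : measurable_fun setT (fun z : ((T1 * T2) * n.-tuple T1) * n.-tuple T2 =>
      G z.1.1.1 z.1.1.2 z.1.2 z.2).
    apply: (measurableT_comp mG (g := fun z : ((T1 * T2) * n.-tuple T1) * n.-tuple T2 =>
      ((z.1.1.1, z.1.2), (z.1.1.2, z.2)))).
    apply: measurable_fun_pair; apply: measurable_fun_pair => //;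
    by do ?apply: measurableT_comp.
  apply: (measurable_fun_fubini_tonelli_F (fun z : (T1 * T2) * n.-tuple T1 =>
    \int[tmeas m2 n]_b G z.1.1 z.1.2 z.2 b)).
    exact: (measurable_fun_fubini_tonelli_F (fun z : ((T1 * T2) * n.-tuple T1) * n.-tuple T2 =>
      G z.1.1.1 z.1.1.2 z.1.2 z.2) mH0 (fun=> f0 _)).
  by move=> x; apply: integral_ge0 => *; exact: f0.
transitivity (\int[fprodm m1 m2]_ab H ab).
  by rewrite [RHS]fubini_tonelli1// => x; apply: integral_ge0 => *; apply: integral_ge0 => *; exact: f0.
apply: eq_integral => -[a0 b0] _ /=.
transitivity (\int[(tmeas m1 n \x tmeas m2 n)]_ab G a0 b0 ab.1 ab.2).
  by rewrite [RHS]fubini_tonelli1// => -[a b]; exact: f0.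
rewrite (IH _ (mG1 a0 b0) (fun=> f0 _)); apply: eq_integral => u _; rewrite /G; congr f; congr pair; exact: val_inj.
Qed.

End Unzip.

(** * Complex derivatives *)

Section ComplexDerivative.
Context {R : realType}.
Implicit Types (f g : R -> R[i]) (t : R) (a b z : R[i]).

Definition is_cd f t a : Prop :=
  is_derive t 1 (fun x => Re (f x)) (Re a) /\ is_derive t 1 (fun x => Im (f x)) (Im a).

Lemma is_cd_cst z t : is_cd (cst z) t 0.
Proof. by split; exact: is_derive_cst. Qed.

Lemma is_cdD f g t a b : is_cd f t a -> is_cd g t b ->
  is_cd (fun x => f x + g x) t (a + b).
Proof.
move=> [f1 f2] [g1 g2]; split.
  by under eq_fun do rewrite ReD; rewrite ReD; exact: is_deriveD.
by under eq_fun do rewrite ImD; rewrite ImD; exact: is_deriveD.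
Qed.

Lemma is_cdN f t a : is_cd f t a -> is_cd (fun x => - f x) t (- a).
Proof.
move=> [f1 f2]; split.
  by under eq_fun do rewrite ReN; rewrite ReN; exact: is_deriveN.
by under eq_fun do rewrite ImN; rewrite ImN; exact: is_deriveN.
Qed.

Lemma is_cdB f g t a b : is_cd f t a -> is_cd g t b ->
  is_cd (fun x => f x - g x) t (a - b).
Proof. by move=> fa gb; apply: is_cdD => //; exact: is_cdN. Qed.

Lemma is_cdM f g t a b : is_cd f t a -> is_cd g t b ->
  is_cd (fun x => f x * g x) t (a * g t + f t * b).
Proof.
move=> [f1 f2] [g1 g2]; split.
  under eq_fun do rewrite ReM.
  apply: (@is_derive_eq _ _ _ _ _ _ _ _ (is_deriveB (is_deriveM f1 g1) (is_deriveM f2 g2))).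
  by rewrite !ReImE /GRing.scale/=; ring.
under eq_fun do rewrite ImM.
apply: (@is_derive_eq _ _ _ _ _ _ _ _ (is_deriveD (is_deriveM f1 g2) (is_deriveM f2 g1))).
by rewrite !ReImE /GRing.scale/=; ring.
Qed.

Lemma is_cdZ z f t a : is_cd f t a -> is_cd (fun x => z * f x) t (z * a).
Proof. by move=> /(is_cdM (is_cd_cst z t)); rewrite mul0r add0r. Qed.

Lemma is_cd_sqr f t a : is_cd f t a -> is_cd (fun x => f x ^+ 2) t (a * f t + f t * a).
Proof. by move=> fa; exact: is_cdM. Qed.

Lemma is_cd_real (f : R -> R) t (d : R) : is_derive t 1 f d ->
  is_cd (fun x => (f x)%:C%C) t d%:C%C.
Proof. by move=> fd; split => //=; exact: is_derive_cst. Qed.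

Lemma is_cd_id t : is_cd (fun x => x%:C%C) t 1.
Proof. by apply: is_cd_real; exact: is_derive_id. Qed.

Lemma is_cd_cexp f t a : is_cd f t a -> is_cd (fun x => cexp (f x)) t (cexp (f t) * a).
Proof.
move=> [f1 f2].
have e := @is_derive1_comp _ expR (fun x => Re (f x)) t _ _ (is_derive_expR _) f1.
have c := @is_derive1_comp _ cos (fun x => Im (f x)) t _ _ (is_derive_cos _) f2.
have s := @is_derive1_comp _ sin (fun x => Im (f x)) t _ _ (is_derive_sin _) f2.
split.
  under eq_fun do rewrite Re_cexp.
  apply: (@is_derive_eq _ _ _ _ _ _ _ _ (is_deriveM e c)).
  by rewrite !ReImE ?Re_cexp ?Im_cexp /GRing.scale/=; ring.
under eq_fun do rewrite Im_cexp.
apply: (@is_derive_eq _ _ _ _ _ _ _ _ (is_deriveM e s)).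
by rewrite !ReImE ?Re_cexp ?Im_cexp /GRing.scale/=; ring.
Qed.

Lemma cderivable_is_cd f t : cderivable f t -> is_cd f t (cderive f t).
Proof.
by move=> [f1 f2]; split; split => //=; rewrite derive1E.
Qed.

Definition ccont {X : topologicalType} (f : X -> R[i]) (p : X) : Prop :=
  {for p, continuous (fun x => Re (f x))} /\ {for p, continuous (fun x => Im (f x))}.

Lemma is_cd_ccont f t a : is_cd f t a -> ccont f t.
Proof.
move=> [[f1 _] [f2 _]]; split; apply: differentiable_continuous;
exact/derivable1_diffP.
Qed.

Lemma cFTC (a b : R) f F : a <= b ->
  (forall t, a <= t <= b -> is_cd F t (f t)) ->
  (forall t, a <= t <= b -> ccont f t) ->
  cint lebesgue_measure `[a, b] f = F b - F a.
Proof.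
rewrite le_eqVlt => /predU1P[<- _ _|ab dF cf].
  rewrite set_itv1; apply: complex_ext; rewrite /= !ReImE subrr;
  exact: Rintegral_set1.
have key (h H : R -> R) : (forall t, a <= t <= b -> is_derive t 1 H (h t)) ->
    (forall t, a <= t <= b -> {for t, continuous h}) ->
    Rintegral lebesgue_measure `[a, b] h = H b - H a.
  move=> dH ch; rewrite /Rintegral (@continuous_FTC2 _ h H)//.
  - apply: continuous_in_subspaceT => t; rewrite inE/= in_itv/=; exact: ch.
  - have cH t : a <= t <= b -> {for t, continuous H}.
      by move=> /dH[+ _]; move=> /derivable1_diffP/differentiable_continuous.
    split.
    + by move=> t; rewrite in_itv/= => /andP[at_ tb]; have [] := dH t; rewrite ?ltW.
    + by apply: cvg_at_right_filter; apply: cH; rewrite lexx ltW.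
    + by apply: cvg_at_left_filter; apply: cH; rewrite lexx ltW.
  - move=> t; rewrite in_itv/= => /andP[at_ tb]; rewrite derive1E.
    by have [] := dH t ltac:(by rewrite !ltW).
apply: complex_ext; rewrite /= !ReImE.
  apply: (key (fun t => Re (f t)) (fun t => Re (F t))) => t tab.
    by case: (dF t tab).
  by case: (cf t tab).
apply: (key (fun t => Im (f t)) (fun t => Im (F t))) => t tab.
  by case: (dF t tab).
by case: (cf t tab).
Qed.

End ComplexDerivative.

Section CBounded.
Context {R : realType} {X : Type}.
Variable S : set X.
Implicit Types (f g : X -> R[i]).

Definition cbnd f := exists C : R, forall x, S x -> normc (f x) <= C.

Lemma cbnd_cst z : cbnd (cst z).
Proof. by exists (normc z). Qed.

Lemma cbndD f g : cbnd f -> cbnd g -> cbnd (fun x => f x + g x).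
Proof.
move=> [C fC] [D gD]; exists (C + D) => x Sx.
by rewrite (le_trans (le_normcD _ _))// lerD// ?fC ?gD.
Qed.

Lemma cbndN f : cbnd f -> cbnd (fun x => - f x).
Proof. by move=> [C fC]; exists C => x Sx; rewrite normcN fC. Qed.

Lemma cbndM f g : cbnd f -> cbnd g -> cbnd (fun x => f x * g x).
Proof.
move=> [C fC] [D gD]; exists (C * D) => x Sx.
by rewrite Normc.normcM ler_pM ?normc_ge0 ?fC ?gD.
Qed.

Lemma cbndX f n : cbnd f -> cbnd (fun x => f x ^+ n).
Proof.
move=> bf; elim: n => [|n IH]; first by under eq_fun do rewrite expr0; exact: cbnd_cst.
by under eq_fun do rewrite exprS; exact: cbndM.
Qed.

Lemma cbnd_real (f : X -> R) (C : R) : (forall x, S x -> `|f x| <= C) ->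
  cbnd (fun x => (f x)%:C%C).
Proof. by move=> fC; exists C => x Sx; rewrite normc_real fC. Qed.

Lemma cbnd_cexp f : cbnd f -> cbnd (fun x => cexp (f x)).
Proof.
move=> [C fC]; exists (expR C) => x Sx; rewrite normc_cexp ler_expR.
by rewrite (le_trans _ (fC x Sx))// (le_trans (ler_norm _) (Re_le_normc _)).
Qed.
End CBounded.

Ltac cbnd_step := lazymatch goal with
  | |- cbnd _ (fun _ => ?z) => exact: cbnd_cst
  | |- cbnd _ (cst ?z) => exact: cbnd_cst
  | |- cbnd ?S (fun x => @?f x + @?g x) => refine (@cbndD _ _ S f g _ _); cbnd_step
  | |- cbnd ?S (fun x => - @?f x) => refine (@cbndN _ _ S f _); cbnd_step
  | |- cbnd ?S (fun x => @?f x * @?g x) => refine (@cbndM _ _ S f g _ _); cbnd_step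
  | |- cbnd ?S (fun x => @?f x ^+ ?n) => refine (@cbndX _ _ S f n _); cbnd_step
  | |- cbnd ?S (fun x => cexp (@?f x)) => refine (@cbnd_cexp _ _ S f _); cbnd_step
  | |- _ => try hyp
  end.

Lemma itv_cbnd {R : realType} (f : R -> R[i]) (a b : R) :
  (forall t, a <= t <= b -> ccont f t) -> cbnd [set t | a <= t <= b] f.
Proof.
move=> cf.
have key (h : R -> R) : (forall t, a <= t <= b -> {for t, continuous h}) ->
    exists C, forall t, a <= t <= b -> `|h t| <= C.
  move=> ch.
  have : compact (h @` `[a, b]).
    apply: continuous_compact; last exact: segment_compact.
    by apply: continuous_in_subspaceT => t; rewrite inE/= in_itv/=; exact: ch.
  move=> /compact_bounded[M [_ bM]]; exists (M + 1) => t tab.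
  by apply: (bM (M + 1)); [rewrite ltrDl|exists t => //=; rewrite in_itv].
have [C1 h1] := key (fun t => Re (f t)) (fun t h => (cf t h).1).
have [C2 h2] := key (fun t => Im (f t)) (fun t h => (cf t h).2).
by exists (C1 + C2) => t tab; rewrite (le_trans (normc_le _))// lerD ?h1 ?h2.
Qed.

Lemma ccont_measurable {R : realType} (f : R -> R[i]) :
  (forall t, ccont f t) -> cmeas f.
Proof.
by move=> cf; split; apply: continuous_measurable_fun => t; case: (cf t).
Qed.

Lemma measurable_inv {R : realType} d {T : measurableType d} (f : T -> R) :
  measurable_fun setT f -> measurable_fun setT (fun x => (f x)^-1).
Proof.
move=> mf.
rewrite (_ : (fun x => _) = fun x => if 0 < f x then expR (- ln (f x))
  else if f x < 0 then - expR (- ln (- f x)) else 0); last first.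
  apply/funext => x; case: (ltgtP (f x) 0) => h.
  - by rewrite expRN lnK ?posrE ?oppr_gt0// invrN opprK.
  - by rewrite expRN lnK.
  - by rewrite h invr0.
have ml (g : T -> R) : measurable_fun setT g -> measurable_fun setT (fun x => expR (- ln (g x))).
  move=> mg; apply: (measurableT_comp (f := expR)) => //.
  apply: measurableT_comp => //; exact: (measurableT_comp (f := @ln R)).
apply: measurable_fun_ifT; [exact: measurable_fun_ltr|exact: ml|].
apply: measurable_fun_ifT => //; first exact: measurable_fun_ltr.
by apply: measurableT_comp => //; apply: ml; exact: measurableT_comp.
Qed.

Section PlaneContinuity.
Context {R : realType}.

(* Rectangles with rational corners form a countable base of the plane. *)
Lemma continuous2_measurable (f : R * R -> R) : continuous f -> measurable_fun setT f.
Proof.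
move=> cf; apply: (measurability _ (RGenOInfty.measurableE R)) => //.
move=> _ [_ [a ->] <-]; rewrite setTI.
set O := f @^-1` _.
have oO : open O by apply: open_comp => // x _; exact: cf.
pose Q (q : rat * rat * (rat * rat)) : set (R * R) :=
  `]ratr q.1.1, ratr q.1.2[ `*` `]ratr q.2.1, ratr q.2.2[.
have -> : O = \bigcup_(q in [set q | Q q `<=` O]) Q q.
  apply/seteqP; split; last by move=> x [q /= + Qx]; apply.
  move=> [x y] Oxy.
  have /nbhs_ballP[e /= e0 he] : nbhs (x, y) O by exact: open_nbhs_nbhs.
  have rt z : exists q : rat * rat, (z - e < ratr q.1 < z) /\ (z < ratr q.2 < z + e).
    have [q1 h1] := @rat_in_itvoo R (z - e) z ltac:(by rewrite ltrBlDr ltrDl).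
    have [q2 h2] := @rat_in_itvoo R z (z + e) ltac:(by rewrite ltrDl).
    by exists (q1, q2); move: h1 h2; rewrite !in_itv.
  have [q1 [/andP[a1 a2] /andP[a3 a4]]] := rt x.
  have [q2 [/andP[b1 b2] /andP[b3 b4]]] := rt y.
  exists (q1, q2); last by split; rewrite /= in_itv/= ?a2 ?a3 ?b2 ?b3.
  move=> [u v] [/=]; rewrite !in_itv/= => /andP[c1 c2] /andP[c3 c4].
  apply: he; split; rewrite /ball/= ltr_norml; apply/andP; split; lra.
rewrite bigcup_mkcond; apply: countable_bigcupT_measurable => // q.
by case: ifP => // _; exact: measurableX.
Qed.

Lemma rect_bounded (f : R * R -> R) (a b c d : R) : continuous f ->
  exists C, forall x t, a <= x <= b -> c <= t <= d -> `|f (x, t)| <= C.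
Proof.
move=> cf.
have : compact (f @` (`[a, b] `*` `[c, d])).
  apply: continuous_compact; first exact: continuous_subspaceT.
  by apply: compact_setX; exact: segment_compact.
move=> /compact_bounded[M [_ bM]]; exists (M + 1) => x t xab tcd.
apply: (bM (M + 1)); first by rewrite ltrDl.
by exists (x, t) => //; split; rewrite /= in_itv.
Qed.

End PlaneContinuity.

(** * The free kernel *)

Section RestrictedLebesgue.
Context {R : realType}.
Implicit Types (a b c d : R).

Lemma lebesgue_itv_lty a b : (@lebesgue_measure R `[a, b]%classic < +oo)%E.
Proof. by rewrite lebesgue_measure_itv/=; case: ifP => // _; rewrite ltry. Qed.

Definition lebr a b : {finite_measure set (measurableTypeR R) -> \bar R} :=
  @mfrestr _ (measurableTypeR R) R _ lebesgue_measure
    (@measurable_itv R (`[a, b]%R)) (lebesgue_itv_lty a b).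

Lemma lebr_null a b c : lebr a b [set c] = 0%E.
Proof.
apply/eqP; rewrite eq_le measure_ge0 andbT /lebr/= /mfrestr /mrestr.
rewrite (@le_trans _ _ (@lebesgue_measure R [set c]))//; last by rewrite lebesgue_measure_set1.
by apply: measureIl => //; exact: measurable_itv.
Qed.

Lemma ge0_integral_lebr a b (f : R -> \bar R) :
  measurable_fun setT f -> (forall x, 0 <= f x)%E ->
  (\int[lebr a b]_x f x = \int[lebesgue_measure]_(x in `[a, b]) f x)%E.
Proof.
move=> mf f0; rewrite -(setUv `[a, b]) ge0_integral_setU//=; first last.
- by rewrite disj_set2E setICr.
- by rewrite setUv.
- exact: measurableC.
rewrite [X in (_ + X)%E](_ : _ = 0%E) ?adde0.
  apply: eq_measure_integral => A mA AD.
  by rewrite /lebr /= /mfrestr /mrestr setIidl.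
apply: null_set_integral => //=.
- exact: measurableC.
- exact: measurable_funTS.
- by rewrite /lebr /= /mfrestr /mrestr setICl measure0.
Qed.

Lemma cint_lebr a b (f : R -> R[i]) : cmeas f ->
  cint (lebr a b) setT f = cint lebesgue_measure `[a, b] f.
Proof.
have key (h : R -> R) : measurable_fun setT h ->
    Rintegral (lebr a b) setT h = Rintegral lebesgue_measure `[a, b] h.
  move=> /measurable_EFinP mh; rewrite /Rintegral integralE [in RHS]integralE.
  by rewrite !ge0_integral_lebr//; [exact: measurable_funeneg|exact: measurable_funepos].
by move=> [m1 m2]; congr Complex; exact: key.
Qed.

Lemma lintegral_lebr a b (f : R -> R[i]) : cmeas f ->
  lintegral `[a, b] f = cint (lebr a b) setT f.
Proof. by move=> mf; rewrite cint_lebr. Qed.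

Lemma cintg_bnd disp (T : measurableType disp) (mu : {finite_measure set T -> \bar R})
  (f : T -> R[i]) C : cmeas f -> (forall x, normc (f x) <= C) -> cintg mu setT f.
Proof.
move=> mf fC; apply: (@cintg_le _ _ _ _ _ (cst C)) => //.
exact: finite_measure_integrable_cst.
Qed.

Definition rect a b c d : set (R * R) := [set p | a <= p.1 <= b /\ c <= p.2 <= d].

Variables (a b c d : R) (f : R * R -> R[i]).
Hypotheses (mf : cmeas f) (bf : cbnd (rect a b c d) f).

Let fr (p : R * R) := if (a <= p.1 <= b) && (c <= p.2 <= d) then f p else 0.

Let mfr : cmeas fr.
Proof.
apply: cmeas_if; [|exact: mf|exact: cmeas_cst].
by apply: measurable_and; apply: measurable_and; exact: measurable_fun_ler.
Qed.

Let ifr : cintg (lebr a b \x lebr c d)%E setT fr.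
Proof.
have [C hC] := bf.
apply: (@cintg_bnd _ _ (fprodm (lebr a b) (lebr c d)) _ (Num.max C 0)) => // p.
rewrite /fr le_max; case: ifPn => [/andP[h1 h2]|_]; first by rewrite hC.
by rewrite Normc.normc0 lexx orbT.
Qed.

Lemma rect_swap :
  lintegral `[a, b] (fun x => lintegral `[c, d] (fun t => f (x, t))) =
  lintegral `[c, d] (fun t => lintegral `[a, b] (fun x => f (x, t))).
Proof.
have sw := cint_swap ifr.
have m1 x : cmeas (fun t => fr (x, t)) by apply: cmeas_comp mfr _; exact: measurable_fun_pair.
have m2 t : cmeas (fun x => fr (x, t)) by apply: cmeas_comp mfr _; exact: measurable_fun_pair.
transitivity (lintegral `[a, b] (fun x => cint (lebr c d) setT (fun t => fr (x, t)))).
  apply: eq_cint => x; rewrite /= in_itv/= => xab.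
  rewrite -lintegral_lebr//; apply: eq_cint => t; rewrite /= in_itv/= => tcd.
  by rewrite /fr /= xab tcd.
rewrite lintegral_lebr; last exact: cintg_meas (cintg_fubini1 ifr).
rewrite sw -lintegral_lebr; last exact: cintg_meas (cintg_fubini2 ifr).
apply: eq_cint => t; rewrite /= in_itv/= => tcd.
rewrite -lintegral_lebr//; apply: eq_cint => x; rewrite /= in_itv/= => xab.
by rewrite /fr /= xab tcd.
Qed.

End RestrictedLebesgue.

Section KernelAlgebra.
Context {F : numFieldType}.
Implicit Types i u A H x Hd g h : F.

Let kernel_alg1 i u A H x Hd g : i ^+ 2 = -1 -> i * (g *
  (- (2%:R^-1 * u) - i / 2%:R * u ^+ 2 * A ^+ 2 + i * u * A * H - i / 2%:R * H ^+ 2 - i * x * Hd))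
  + 2%:R^-1 * (g * ((i * u * A - i * H) ^+ 2 + i * u)) = Hd * x * g.
Proof.
move=> i2; transitivity (Hd * x * g + (i ^+ 2 + 1) * (g * (- 2^-1 * u ^+ 2 * A ^+ 2 + u * A * H
   - 2^-1 * H ^+ 2 - x * Hd + 2^-1 * (u * A - H) ^+ 2))).
  by field.
by rewrite i2 addNr mul0r addr0.
Qed.

Let kernel_alg2 i u A H x : 0 + i / 2%:R * u * ((0 + 1 - 0) * A + A * (0 + 1 - 0))
  + (0 - ((0 * x + i * 1) * H + i * x * 0) + 0) = i * u * A - i * H.
Proof. by field. Qed.

Let kernel_alg3 i u A H x Hd h :
  h + (i / 2%:R * (- u ^+ 2) * A ^+ 2 + i / 2%:R * u * ((H + 0 - 0) * A + A * (H + 0 - 0)))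
  + (- (i / 2%:R) * H ^+ 2 - i * x * Hd + 0) =
  h - i / 2%:R * u ^+ 2 * A ^+ 2 + i * u * A * H - i / 2%:R * H ^+ 2 - i * x * Hd.
Proof. by field. Qed.

Definition kernel_alg := (kernel_alg1, kernel_alg2, kernel_alg3).

End KernelAlgebra.

Section GaussianKernel.
Context {R : realType}.
Implicit Types (x t : R).

Definition k0 : R[i] := (sqrtc (iC * (2 * pi)%:C%C))^-1.

(* (2 pi i D)^(-1/2) exp (i A^2 / (2 D)), with the real powers of D written
   through the logarithm. *)
Definition gk (D : R) (A : R[i]) : R[i] :=
  k0 * cexp ((- (2^-1 * ln D))%:C%C + iC / 2%:R * (D^-1)%:C%C * A ^+ 2).

Variables (H Hd T1 T2 : R -> R[i]) (tau : R) (c c' : R[i]).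
Hypotheses (dT1 : forall t, is_cd T1 t (H t)) (dT2 : forall t, is_cd T2 t (H t ^+ 2))
  (dH : forall t, is_cd H t (Hd t)) (cHd : forall t, ccont Hd t).

Definition gker x t : R[i] :=
  gk (t - tau) (T1 t + x%:C%C - c)
  * cexp (- (iC / 2%:R) * T2 t - iC * x%:C%C * H t + c').

Definition gker_x x t : R[i] :=
  gker x t * (iC * ((t - tau)^-1)%:C%C * (T1 t + x%:C%C - c) - iC * H t).

Definition gker_xx x t : R[i] :=
  gker x t * ((iC * ((t - tau)^-1)%:C%C * (T1 t + x%:C%C - c) - iC * H t) ^+ 2
    + iC * ((t - tau)^-1)%:C%C).

Definition gker_t x t : R[i] :=
  gker x t * ((- (2^-1 * (t - tau)^-1))%:C%C
   - iC / 2%:R * ((t - tau)^-1 ^+ 2)%:C%C * (T1 t + x%:C%C - c) ^+ 2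
   + iC * ((t - tau)^-1)%:C%C * (T1 t + x%:C%C - c) * H t
   - iC / 2%:R * H t ^+ 2 - iC * x%:C%C * Hd t).

Lemma gker_eq x t : iC * gker_t x t + 2%:R^-1 * gker_xx x t =
  Hd t * x%:C%C * gker x t.
Proof.
rewrite /gker_t /gker_xx; set g := gker x t; set u := ((t - tau)^-1)%:C%C.
have -> : (- (2^-1 * (t - tau)^-1))%:C%C = - (2^-1 * u).
  by rewrite /u rmorphN rmorphM fmorphV rmorphD rmorph1.
have -> : ((t - tau)^-1 ^+ 2)%:C%C = u ^+ 2 by rewrite /u rmorphXn.
by apply: (kernel_alg.1.1); rewrite expr2 iC2.
Qed.

Let E x t : R[i] := (- (2^-1 * ln (t - tau)))%:C%C
  + iC / 2%:R * ((t - tau)^-1)%:C%C * (T1 t + x%:C%C - c) ^+ 2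
  + (- (iC / 2%:R) * T2 t - iC * x%:C%C * H t + c').

Let gkerE x t : gker x t = k0 * cexp (E x t).
Proof. by rewrite /gker /gk -mulrA -cexpD. Qed.

Lemma is_cd_gker_x x t : is_cd (gker ^~ t) x (gker_x x t).
Proof.
rewrite /gker_x gkerE (_ : gker ^~ t = fun x => k0 * cexp (E x t)); last first.
  by apply/funext => z; rewrite gkerE.
rewrite -mulrA; apply: is_cdZ.
have dA : is_cd (fun x : R => T1 t + x%:C%C - c) x (0 + 1 - 0).
  apply: is_cdB; last exact: is_cd_cst.
  by apply: is_cdD; [exact: is_cd_cst|exact: is_cd_id].
have dE : is_cd (E ^~ t) x
   (0 + iC / 2%:R * ((t - tau)^-1)%:C%C * ((0 + 1 - 0) * (T1 t + x%:C%C - c) + (T1 t + x%:C%C - c) * (0 + 1 - 0))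
   + (0 - ((0 * x%:C%C + iC * 1) * H t + iC * x%:C%C * 0) + 0)).
  apply: is_cdD.
    apply: is_cdD; first exact: is_cd_cst.
    by apply: is_cdZ; exact: is_cd_sqr.
  apply: is_cdD; last exact: is_cd_cst.
  apply: is_cdB; first exact: is_cd_cst.
  apply: is_cdM; last exact: is_cd_cst.
  by apply: is_cdM; [exact: is_cd_cst|exact: is_cd_id].
by have := is_cd_cexp dE; rewrite kernel_alg.1.2.
Qed.

Lemma is_cd_gker_xx x t : is_cd (gker_x ^~ t) x (gker_xx x t).
Proof.
have dA : is_cd (fun x : R => T1 t + x%:C%C - c) x (0 + 1 - 0).
  apply: is_cdB; last exact: is_cd_cst.
  by apply: is_cdD; [exact: is_cd_cst|exact: is_cd_id].
have dB : is_cd (fun x : R => iC * ((t - tau)^-1)%:C%C * (T1 t + x%:C%C - c) - iC * H t) x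
   (iC * ((t - tau)^-1)%:C%C * (0 + 1 - 0) - 0).
  by apply: is_cdB; [exact: is_cdZ|exact: is_cd_cst].
have := is_cdM (is_cd_gker_x x t) dB; congr (is_cd _ _ _).
by rewrite /gker_xx /gker_x; ring.
Qed.

Lemma is_cd_gker_t x t : tau < t -> is_cd (gker x) t (gker_t x t).
Proof.
move=> taut; have D0 : 0 < t - tau by rewrite subr_gt0.
rewrite /gker_t gkerE (_ : gker x = fun t => k0 * cexp (E x t)); last first.
  by apply/funext => z; rewrite gkerE.
rewrite -mulrA; apply: is_cdZ.
have dD : is_derive t 1 (fun t => t - tau) (1 - 0) by exact: is_deriveB.
have dl : is_derive t 1 (fun t => ln (t - tau)) ((t - tau)^-1 * (1 - 0)).
  exact: (@is_derive1_comp _ (@ln R) (fun t => t - tau) t _ _ (is_derive1_ln D0) dD).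
have dl2 : is_derive t 1 (fun t => - (2^-1 * ln (t - tau))) (- (2^-1 * ((t - tau)^-1 * (1 - 0)))).
  apply: is_deriveN; exact: (@is_deriveZ _ _ _ (fun t => ln (t - tau)) 2^-1).
have di : is_derive t 1 (fun t => (t - tau)^-1) (- ((t - tau)^-1 ^+ 2)).
  have [dd dv] := dD; apply: DeriveDef.
    by apply: derivableV => //; exact: lt0r_neq0.
  rewrite deriveV ?dv//; last exact: lt0r_neq0.
  by rewrite /GRing.scale/= subr0 mulr1 exprVn.
have dA : is_cd (fun t : R => T1 t + x%:C%C - c) t (H t + 0 - 0).
  apply: is_cdB; last exact: is_cd_cst.
  by apply: is_cdD => //; exact: is_cd_cst.
have dE : is_cd (E x) t
   ((- (2^-1 * ((t - tau)^-1 * (1 - 0))))%:C%C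
   + ((iC / 2%:R * (- ((t - tau)^-1 ^+ 2))%:C%C) * (T1 t + x%:C%C - c) ^+ 2
     + iC / 2%:R * ((t - tau)^-1)%:C%C * ((H t + 0 - 0) * (T1 t + x%:C%C - c) + (T1 t + x%:C%C - c) * (H t + 0 - 0)))
   + (- (iC / 2%:R) * H t ^+ 2 - iC * x%:C%C * Hd t + 0)).
  apply: is_cdD.
    apply: is_cdD; first exact: is_cd_real.
    apply: is_cdM; first by apply: is_cdZ; exact: is_cd_real.
    exact: is_cd_sqr.
  apply: is_cdD; last exact: is_cd_cst.
  by apply: is_cdB; exact: is_cdZ.
have := is_cd_cexp dE; rewrite subr0 mulr1.
rewrite (_ : (- (t - tau)^-1 ^+ 2)%:C%C = - ((t - tau)^-1)%:C%C ^+ 2); last by rewrite rmorphN rmorphXn.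
by rewrite rmorphXn kernel_alg.2.
Qed.

End GaussianKernel.

(** * Integration by parts against the kernel *)

Section CCont.
Context {R : realType} {X : topologicalType}.
Implicit Types (f g : X -> R[i]) (p : X).

Lemma ccont_cst z p : ccont (cst z : X -> R[i]) p.
Proof. by split; exact: cst_continuous. Qed.

Lemma ccontD f g p : ccont f p -> ccont g p -> ccont (fun x => f x + g x) p.
Proof.
move=> [a b] [c e]; split.
  by rewrite (_ : (fun x => _) = (fun x => Re (f x) + Re (g x))); [exact: cvgD|apply/funext => x; rewrite ReD].
by rewrite (_ : (fun x => _) = (fun x => Im (f x) + Im (g x))); [exact: cvgD|apply/funext => x; rewrite ImD].
Qed.

Lemma ccontM f g p : ccont f p -> ccont g p -> ccont (fun x => f x * g x) p.
Proof.
move=> [a b] [c e]; split.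
  rewrite (_ : (fun x => _) = (fun x => Re (f x) * Re (g x) - Im (f x) * Im (g x))); last by apply/funext => x; rewrite ReM.
  by apply: cvgB; exact: cvgM.
rewrite (_ : (fun x => _) = (fun x => Re (f x) * Im (g x) + Im (f x) * Re (g x))); last by apply/funext => x; rewrite ImM.
by apply: cvgD; exact: cvgM.
Qed.

Lemma ccontN f p : ccont f p -> ccont (fun x => - f x) p.
Proof.
move=> cf; rewrite (_ : (fun x => _) = fun x => (-1) * f x); last by apply/funext => x; rewrite mulN1r.
by apply: ccontM cf; exact: ccont_cst.
Qed.

Lemma ccontX f p n : ccont f p -> ccont (fun x => f x ^+ n) p.
Proof.
move=> cf; elim: n => [|n IH].
  by under eq_fun do rewrite expr0; exact: ccont_cst.
by under eq_fun do rewrite exprS; exact: ccontM.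
Qed.

Lemma ccont_real (f : X -> R) p : {for p, continuous f} -> ccont (fun x => (f x)%:C%C) p.
Proof. by move=> cf; split => //; exact: cst_continuous. Qed.
End CCont.

Ltac ccont_step := lazymatch goal with
  | |- ccont (fun _ => ?z) _ => exact: ccont_cst
  | |- ccont (cst ?z) _ => exact: ccont_cst
  | |- ccont (fun x => @?f x + @?g x) ?p => refine (@ccontD _ _ f g p _ _); ccont_step
  | |- ccont (fun x => - @?f x) ?p => refine (@ccontN _ _ f p _); ccont_step
  | |- ccont (fun x => @?f x * @?g x) ?p => refine (@ccontM _ _ f g p _ _); ccont_step
  | |- ccont (fun x => @?f x ^+ ?n) ?p => refine (@ccontX _ _ f p n _); ccont_step
  | |- ccont (fun x => ?f x) ?p => change (ccont f p); try hyp
  | |- _ => try hyp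
  end.

Lemma cbnd_cintg {R : realType} (f : R -> R[i]) (a b : R) : cmeas f ->
  cbnd [set t | a <= t <= b] f -> cintg lebesgue_measure `[a, b] f.
Proof.
move=> mf [C fC].
apply/(@cintg_mkcond _ _ (measurableTypeR R)) => //.
have : cintg (@lebesgue_measure R) setT (fun x => if x \in `[a, b]%classic then (Num.max C 0)%:C%C else 0).
  apply/(@cintg_mkcond _ _ (measurableTypeR R) lebesgue_measure `[a, b] (cst _)) => //.
  have h k : lebesgue_measure.-integrable `[a, b] (EFin \o (cst k : R -> R)).
    by apply: measurable_bounded_integrable => //; [exact: lebesgue_itv_lty|apply: bounded_cst].
  by split; exact: h.
move=> /cintg_normc; apply: cintg_le.
  apply: cmeas_if; [|exact: mf|exact: cmeas_cst].
  rewrite (_ : (fun x => _) = (fun x => (a <= x) && (x <= b))).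
    by apply: measurable_and; exact: measurable_fun_ler.
  by apply/funext => x; rewrite mem_setE in_itv.
move=> x; case: ifPn => [|_]; last by rewrite Normc.normc0.
move=> /set_mem xI; have xab : a <= x <= b by move: xI; rewrite /= in_itv.
rewrite normc_real ger0_norm ?le_max ?lexx ?orbT//.
by rewrite fC.
Qed.

Section TestFunctions.
Context {R : realType}.

Definition jcont (f : R -> R -> R[i]) : Prop :=
  continuous (fun p : R * R => Re (f p.1 p.2)) /\
  continuous (fun p : R * R => Im (f p.1 p.2)).

Lemma jcont_cmeas f : jcont f -> cmeas (fun p : R * R => f p.1 p.2).
Proof. by move=> [a b]; split; exact: continuous2_measurable. Qed.

Lemma jcont_cbnd f a b c d : jcont f -> cbnd (rect a b c d) (fun p => f p.1 p.2).
Proof.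
move=> [/(@rect_bounded _ _ a b c d)[C1 h1] /(@rect_bounded _ _ a b c d)[C2 h2]].
exists (C1 + C2) => -[x t] [/= xab tcd].
by rewrite (le_trans (normc_le _))// lerD ?h1 ?h2.
Qed.

Lemma jcont1 f t x : jcont f -> ccont (f ^~ t) x.
Proof.
move=> [cf1 cf2].
have cp : (fun x' : R => (x', t)) @ x --> (x, t) by exact: (cvg_pair cvg_id (cvg_cst t)).
split.
  exact: (@continuous_comp _ _ _ (fun x' : R => (x', t)) (fun p : R * R => Re (f p.1 p.2)) x cp (cf1 (x, t))).
exact: (@continuous_comp _ _ _ (fun x' : R => (x', t)) (fun p : R * R => Im (f p.1 p.2)) x cp (cf2 (x, t))).
Qed.

Lemma jcont2 f x t : jcont f -> ccont (f x) t.
Proof.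
move=> [cf1 cf2].
have cp : (fun t' : R => (x, t')) @ t --> (x, t) by exact: (cvg_pair (cvg_cst x) cvg_id).
split.
  exact: (@continuous_comp _ _ _ (fun t' : R => (x, t')) (fun p : R * R => Re (f p.1 p.2)) t cp (cf1 (x, t))).
exact: (@continuous_comp _ _ _ (fun t' : R => (x, t')) (fun p : R * R => Im (f p.1 p.2)) t cp (cf2 (x, t))).
Qed.

Record is_test (phi px pxx pt : R -> R -> R[i]) (M T : R) : Prop := IsTest {
  tst_x : forall x t, is_cd (phi ^~ t) x (px x t) ;
  tst_xx : forall x t, is_cd (px ^~ t) x (pxx x t) ;
  tst_t : forall x t, is_cd (phi x) t (pt x t) ;
  tst_c : jcont phi ; tst_cx : jcont px ; tst_cxx : jcont pxx ; tst_ct : jcont pt ;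
  tst_0 : forall x t, M <= `|x| -> phi x t = 0 ;
  tst_x0 : forall x t, M <= `|x| -> px x t = 0 ;
  tst_xx0 : forall x t, M <= `|x| -> pxx x t = 0 ;
  tst_t0 : forall x t, M <= `|x| -> pt x t = 0 ;
  tst_T : forall x, phi x T = 0 }.

End TestFunctions.

Section KernelIBP.
Context {R : realType}.
Variables (H Hd T1 T2 : R -> R[i]) (tau : R) (c c' : R[i]).
Hypotheses (dT1 : forall t, is_cd T1 t (H t)) (dT2 : forall t, is_cd T2 t (H t ^+ 2))
  (dH : forall t, is_cd H t (Hd t)) (cHd : forall t, ccont Hd t).
Variables (phi px pxx pt : R -> R -> R[i]) (M T : R).
Hypotheses (M0 : 0 <= M) (tst : is_test phi px pxx pt M T).

Definition Lphi (x t : R) : R[i] :=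
  - iC * pt x t + 2%:R^-1 * pxx x t - Hd t * x%:C%C * phi x t.

Local Notation G := (gker H T1 T2 tau c c').
Local Notation Gx := (gker_x H T1 T2 tau c c').
Local Notation Gxx := (gker_xx H T1 T2 tau c c').
Local Notation Gt := (gker_t H Hd T1 T2 tau c c').

Let D1 x t := Gt x t * phi x t + G x t * pt x t.
Let D2 x t := (Gx x t * px x t + G x t * pxx x t) - (Gxx x t * phi x t + Gx x t * px x t).

Lemma gker_LphiE x t : G x t * Lphi x t = - iC * D1 x t + 2%:R^-1 * D2 x t.
Proof.
have e := gker_eq H Hd T1 T2 tau c c' x t.
transitivity (G x t * (- iC * pt x t + 2%:R^-1 * pxx x t) - (iC * Gt x t + 2%:R^-1 * Gxx x t) * phi x t).
  by rewrite e /Lphi; ring.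
by rewrite /D1 /D2; ring.
Qed.

Let mc (f : R -> R[i]) : (forall t, ccont f t) -> cmeas (fun p : R * R => f p.2).
Proof.
by move=> /ccont_measurable mf; apply: (cmeas_comp mf); exact: measurable_snd.
Qed.

Let cH t : ccont H t := is_cd_ccont (dH t).
Let cT1 t : ccont T1 t := is_cd_ccont (dT1 t).
Let cT2 t : ccont T2 t := is_cd_ccont (dT2 t).

Let mH := mc cH.
Let mT1 := mc cT1.
Let mT2 := mc cT2.
Let mHd := mc cHd.
Let mx : cmeas (fun p : R * R => p.1%:C%C) := cmeas_real (@measurable_fst _ _ R R).
Let mDt : measurable_fun setT (fun p : R * R => p.2 - tau).
Proof. exact: measurable_funB. Qed.
Let mDi : cmeas (fun p : R * R => ((p.2 - tau)^-1)%:C%C).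
Proof. by apply: cmeas_real; exact: measurable_inv. Qed.
Let mA : cmeas (fun p : R * R => T1 p.2 + p.1%:C%C - c).
Proof. by apply: cmeasB; [exact: cmeasD|exact: cmeas_cst]. Qed.
Let mln : cmeas (fun p : R * R => (- (2^-1 * ln (p.2 - tau)))%:C%C).
Proof.
apply: cmeas_real; apply: measurableT_comp => //; apply: measurable_funM => //.
exact: (measurableT_comp (f := @ln R)).
Qed.

Lemma gker_cmeas : cmeas (fun p : R * R => G p.1 p.2).
Proof. by rewrite /gker /gk; cmeas_step. Qed.

Let mD1 : cmeas (fun p : R * R => D1 p.1 p.2).
Proof.
have mG := gker_cmeas; have m1 := jcont_cmeas (tst_c tst); have m2 := jcont_cmeas (tst_ct tst).
have m3 : cmeas (fun p : R * R => (- (2^-1 * (p.2 - tau)^-1))%:C%C).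
  apply: cmeas_real; apply: measurableT_comp => //; apply: measurable_funM => //.
  exact: measurable_inv.
have m4 : cmeas (fun p : R * R => ((p.2 - tau)^-1 ^+ 2)%:C%C).
  by apply: cmeas_real; apply: measurable_funX; exact: measurable_inv.
by rewrite /D1 /gker_t; cmeas_step.
Qed.

Let mD2 : cmeas (fun p : R * R => D2 p.1 p.2).
Proof.
have mG := gker_cmeas; have m1 := jcont_cmeas (tst_c tst); have m2 := jcont_cmeas (tst_cx tst).
have m3 := jcont_cmeas (tst_cxx tst).
by rewrite /D2 /gker_x /gker_xx; cmeas_step.
Qed.

Section Bounds.
Variable a : R.
Hypothesis taua : tau < a.
Local Notation S := (rect (- M) M a T).

Let bt (f : R -> R[i]) : (forall t, ccont f t) -> cbnd S (fun p => f p.2).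
Proof.
move=> cf; have [C hC] := itv_cbnd (fun t (_ : a <= t <= T) => cf t).
by exists C => p [_ h]; exact: hC.
Qed.

Let bx : cbnd S (fun p => p.1%:C%C).
Proof. by apply: (cbnd_real (C := M)) => p [h _]; rewrite ler_norml. Qed.

Let Dpos (p : R * R) : S p -> 0 < a - tau <= p.2 - tau.
Proof. by move=> [_ /andP[h _]]; rewrite subr_gt0 taua lerB. Qed.

Let bDi0 p : S p -> `|(p.2 - tau)^-1| <= (a - tau)^-1.
Proof.
move=> /Dpos/andP[h1 h2]; rewrite ger0_norm ?invr_ge0; last by rewrite (le_trans _ h2)// ltW.
by rewrite lef_pV2// posrE// (lt_le_trans h1).
Qed.

Let bDi : cbnd S (fun p => ((p.2 - tau)^-1)%:C%C).
Proof. exact: cbnd_real bDi0. Qed.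

Let bln : cbnd S (fun p => (- (2^-1 * ln (p.2 - tau)))%:C%C).
Proof.
apply: (cbnd_real (C := 2^-1 * (`|ln (a - tau)| + `|ln (T - tau)|))) => p Sp.
have /andP[h1 h2] := Dpos Sp; have h3 : p.2 - tau <= T - tau by case: Sp => _ /andP[_ h]; rewrite lerB.
rewrite normrN normrM ger0_norm// ler_wpM2l// ler_norml.
have l1 : ln (a - tau) <= ln (p.2 - tau) by rewrite ler_ln ?posrE// (lt_le_trans h1).
have l2 : ln (p.2 - tau) <= ln (T - tau) by rewrite ler_ln ?posrE// ?(lt_le_trans h1)// (le_trans h2).
have := ler_norm (ln (T - tau)); have := ler_norm (- ln (a - tau)); rewrite normrN.
have := normr_ge0 (ln (T - tau)); have := normr_ge0 (ln (a - tau)); lra.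
Qed.

Let bH := bt cH.
Let bT1 := bt cT1.
Let bT2 := bt cT2.
Let bHd := bt cHd.

Let bG : cbnd S (fun p => G p.1 p.2).
Proof. by rewrite /gker /gk; cbnd_step. Qed.

Let bD1 : cbnd S (fun p => D1 p.1 p.2).
Proof.
have b1 := jcont_cbnd (- M) M a T (tst_c tst); have b2 := jcont_cbnd (- M) M a T (tst_ct tst).
have b3 : cbnd S (fun p : R * R => (- (2^-1 * (p.2 - tau)^-1))%:C%C).
  apply: (cbnd_real (C := 2^-1 * (a - tau)^-1)) => p Sp.
  by rewrite normrN normrM ger0_norm// ler_wpM2l// bDi0.
have b4 : cbnd S (fun p : R * R => ((p.2 - tau)^-1 ^+ 2)%:C%C).
  apply: (cbnd_real (C := (a - tau)^-1 ^+ 2)) => p Sp.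
  by rewrite normrX lerXn2r ?nnegrE ?bDi0// invr_ge0 subr_ge0 ltW.
by rewrite /D1 /gker_t; cbnd_step.
Qed.

Let bD2 : cbnd S (fun p => D2 p.1 p.2).
Proof.
have b1 := jcont_cbnd (- M) M a T (tst_c tst); have b2 := jcont_cbnd (- M) M a T (tst_cx tst).
have b3 := jcont_cbnd (- M) M a T (tst_cxx tst).
by rewrite /D2 /gker_x /gker_xx; cbnd_step.
Qed.

Let MM : - M <= M. Proof. by rewrite lerNl (le_trans _ M0)// lerNl oppr0. Qed.

Let int_D2 t : lintegral `[- M, M] (D2 ^~ t) = 0.
Proof.
have -> : lintegral `[- M, M] (D2 ^~ t) = (G M t * px M t - Gx M t * phi M t)
    - (G (- M) t * px (- M) t - Gx (- M) t * phi (- M) t).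
  apply: (cFTC MM (F := fun x => G x t * px x t - Gx x t * phi x t)).
    move=> x _; apply: is_cdB; apply: is_cdM.
    - exact: is_cd_gker_x.
    - exact: (tst_xx tst).
    - exact: is_cd_gker_xx.
    - exact: (tst_x tst).
  move=> x _.
  have h1 := is_cd_ccont (is_cd_gker_x H T1 T2 tau c c' x t).
  have h2 := is_cd_ccont (is_cd_id x).
  have h3 := jcont1 t x (tst_cx tst).
  have h4 := jcont1 t x (tst_cxx tst).
  have h5 := jcont1 t x (tst_c tst).
  by rewrite /D2 /gker_xx /gker_x; ccont_step.
rewrite !(tst_0 tst) ?(tst_x0 tst) ?normrN ?ger0_norm//.
by rewrite !mulr0 !subr0.
Qed.

Let int_D1 x : a <= T -> lintegral `[a, T] (D1 x) = - (G x a * phi x a).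
Proof.
move=> aT; have -> : lintegral `[a, T] (D1 x) = G x T * phi x T - G x a * phi x a.
  apply: (cFTC aT (F := fun t => G x t * phi x t)).
    move=> t /andP[at_ _]; apply: is_cdM; last exact: (tst_t tst).
    by apply: is_cd_gker_t; [exact: dT1|exact: dT2|exact: dH|exact: lt_le_trans taua at_].
  move=> t /andP[at_ _]; have taut : tau < t by exact: lt_le_trans taua at_.
  have h1 := is_cd_ccont (is_cd_gker_t c c' dT1 dT2 dH x taut).
  have h2 := cH t; have h5 := cT1 t; have h6 := cHd t.
  have h3 := jcont2 x t (tst_c tst).
  have h4 := jcont2 x t (tst_ct tst).
  have ci : {for t, continuous (fun t : R => (t - tau)^-1)}.
    apply: (@cvgV _ _ _ _ (fun t : R => t - tau)); first by rewrite gt_eqF// subr_gt0.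
    by apply: cvgB; [exact: cvg_id|exact: cvg_cst].
  have cDi := ccont_real ci.
  have c2 : ccont (fun t => (- (2^-1 * (t - tau)^-1))%:C%C) t.
    by apply: ccont_real; apply: continuousN; apply: continuousM; [exact: cst_continuous|exact: ci].
  have c3 : ccont (fun t => ((t - tau)^-1 ^+ 2)%:C%C) t.
    rewrite (_ : (fun x => _) = fun t => ((t - tau)^-1)%:C%C ^+ 2); first exact: ccontX.
    by apply/funext => z; rewrite rmorphXn.
  rewrite /D1 /gker_t; ccont_step.
by rewrite (tst_T tst) mulr0 sub0r.
Qed.

Lemma kernel_ibp : a <= T ->
  lintegral `[a, T] (fun t => lintegral `[- M, M] (fun x => G x t * Lphi x t)) =
  iC * lintegral `[- M, M] (fun x => G x a * phi x a).
Proof.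
move=> aT.
have m1 (f : R -> R -> R[i]) t : cmeas (fun p => f p.1 p.2) -> cmeas (f ^~ t).
  by move=> mf; apply: (cmeas_comp mf (g := fun x => (x, t))); exact: measurable_fun_pair.
have b1 (f : R -> R -> R[i]) t : a <= t <= T -> cbnd S (fun p => f p.1 p.2) ->
    cbnd [set x | - M <= x <= M] (f ^~ t).
  by move=> tT [C hC]; exists C => x xM; apply: (hC (x, t)); split.
have b2 (f : R -> R -> R[i]) x : - M <= x <= M -> cbnd S (fun p => f p.1 p.2) ->
    cbnd [set t | a <= t <= T] (f x).
  by move=> xM [C hC]; exists C => t tT; apply: (hC (x, t)); split.
have m2 (f : R -> R -> R[i]) x : cmeas (fun p => f p.1 p.2) -> cmeas (f x).
  by move=> mf; apply: (cmeas_comp mf (g := fun t => (x, t))); exact: measurable_fun_pair.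
pose D1' x t := - iC * D1 x t.
have mD1' : cmeas (fun p : R * R => D1' p.1 p.2) by rewrite /D1'; cmeas_step.
have bD1' : cbnd S (fun p : R * R => D1' p.1 p.2) by rewrite /D1'; cbnd_step.
transitivity (lintegral `[a, T] (fun t => lintegral `[- M, M] (D1' ^~ t))).
  apply: eq_cint => t; rewrite /= in_itv/= => tT.
  have i1 : cintg lebesgue_measure `[- M, M] (D1' ^~ t).
    by apply: cbnd_cintg; [exact: (m1 D1')|exact: (b1 D1')].
  have i2 : cintg lebesgue_measure `[- M, M] (D2 ^~ t).
    by apply: cbnd_cintg; [exact: (m1 D2)|exact: (b1 D2)].
  transitivity (lintegral `[- M, M] (fun x => D1' x t + 2%:R^-1 * D2 x t)).
    by apply: eq_cint => x _; exact: gker_LphiE.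
  transitivity (lintegral `[- M, M] (D1' ^~ t) + 2%:R^-1 * lintegral `[- M, M] (D2 ^~ t)).
    rewrite /lintegral [LHS](cintD _ i1 (cintgZ _ _ i2))//; congr (_ + _).
    exact: cintZ.
  by rewrite int_D2 mulr0 addr0.
transitivity (lintegral `[- M, M] (fun x => lintegral `[a, T] (D1' x))).
  symmetry; exact: (rect_swap mD1' bD1').
have iG : cintg lebesgue_measure `[- M, M] (fun x => G x a * phi x a).
  have mG := m1 G a gker_cmeas; have mp := m1 phi a (jcont_cmeas (tst_c tst)).
  have aaT : a <= a <= T by rewrite lexx.
  have bG' := b1 G a aaT bG; have bp := b1 phi a aaT (jcont_cbnd _ _ _ _ (tst_c tst)).
  by apply: cbnd_cintg; [cmeas_step|cbnd_step].
transitivity (lintegral `[- M, M] (fun x => iC * (G x a * phi x a))); last first.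
  exact: cintZ.
apply: eq_cint => x; rewrite /= in_itv/= => xM.
have i1 : cintg lebesgue_measure `[a, T] (D1 x).
  by apply: cbnd_cintg; [exact: (m2 D1)|exact: (b2 D1)].
transitivity (- iC * lintegral `[a, T] (D1 x)); first exact: cintZ.
by rewrite int_D1// mulNr mulrN opprK.
Qed.
End Bounds.
End KernelIBP.

(** * The Fresnel integral *)

Section Primitive.
Context {R : realType}.

Lemma continuous_itv_integrable (f : R -> R) (a b : R) : continuous f ->
  lebesgue_measure.-integrable `[a, b] (EFin \o f).
Proof.
move=> cf; apply: continuous_compact_integrable; first exact: segment_compact.
exact: continuous_subspaceT.
Qed.

Lemma primitive_exists (f : R -> R) : continuous f ->
  exists P : R -> R, P 0 = 0 /\ forall t, is_derive t (1 : R) P (f t).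
Proof.
move=> cf.
pose Q (n : nat) x := Rintegral lebesgue_measure `[- n%:R, x] f -
  Rintegral lebesgue_measure `[- n%:R, 0] f.
pose N (x : R) := (Num.trunc `|x|).+2.
have NP (x : R) : `|x| + 1 < (N x)%:R.
  by rewrite /N -natr1 ltrD2r truncnS_gt.
move: N NP => N NP.
have QE n m x : - n%:R <= 0 :> R -> - n%:R <= x -> - m%:R <= - n%:R :> R -> Q m x = Q n x.
  move=> n0 nx mn; rewrite /Q.
  have h b : - n%:R <= b -> Rintegral lebesgue_measure `[- m%:R, b] f =
     Rintegral lebesgue_measure `[- m%:R, - n%:R] f + Rintegral lebesgue_measure `[- n%:R, b] f.
    move=> nb; apply/eqP; rewrite addrC -subr_eq; apply/eqP.
    rewrite Rintegral_itvB ?bnd_simp//; last exact: continuous_itv_integrable.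
    rewrite Rintegral_itv_obnd_cbnd//.
    by apply: integrableS (continuous_itv_integrable (- n%:R) b cf) => //; apply: subset_itvr; rewrite bnd_simp.
  by rewrite (h x)// (h 0)//; ring.
exists (fun x => Q (N x) x); split; first by rewrite /Q subrr.
move=> t; have [n nt] : exists n : nat, `|t| + 1 < n%:R by exists (N t).
have n0 : - n%:R <= 0 :> R by rewrite oppr_le0.
have nt1 : - n%:R < t - 1.
  have := ler_norm (- t); rewrite normrN; move: nt; lra.
apply: (@near_eq_is_derive _ _ _ (Q n)).
  near=> x; have xt : t - 1 < x < t + 1.
    near: x; apply: near_in_itvoo; rewrite in_itv/=; lra.
  have nx : - n%:R <= x by have := nt1; move: xt; lra.
  have [mn|mn] := leP (n%:R : R) (N x)%:R; first by rewrite (@QE n) // lerNr opprK.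
  have Nx : - (N x)%:R <= x by have := NP x; have := ler_norm (- x); rewrite normrN; lra.
  have QN : Q n x = Q (N x) x.
    by apply: QE; [rewrite oppr_le0|exact: Nx|rewrite lerN2 ltW].
  by rewrite QN.
rewrite -[f t]subr0; apply: is_deriveB.
have [] := @continuous_FTC1_closed _ f (- n%:R) t (t + 1).
- by rewrite ltrDl.
- exact: continuous_itv_integrable.
- by rewrite (lt_trans nt1)// ltrBlDr ltrDl.
- exact: cf.
move=> d1 d2; apply: DeriveDef; first exact: d1.
by rewrite -d2 derive1E.
Unshelve. all: by end_near. Qed.

Lemma cprimitive_exists (f : R -> R[i]) : (forall t, ccont f t) ->
  exists P : R -> R[i], P 0 = 0 /\ forall t, is_cd P t (f t).
Proof.
move=> cf.
have [P [P0 dP]] := primitive_exists (fun t => (cf t).1).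
have [Q [Q0 dQ]] := primitive_exists (fun t => (cf t).2).
exists (fun t => Complex (P t) (Q t)); split; first by rewrite P0 Q0.
by move=> t; split; [exact: dP|exact: dQ].
Qed.

Lemma lintegral_FTC (a b : R) (f F : R -> R[i]) : a <= b ->
  (forall t, is_cd F t (f t)) -> (forall t, ccont f t) ->
  lintegral `[a, b] f = F b - F a.
Proof. by move=> ab dF cf; exact: (cFTC ab (fun t _ => dF t) (fun t _ => cf t)). Qed.

Lemma lintegral_real (a b : R) (g : R -> R) :
  lintegral `[a, b] (fun t => (g t)%:C%C) =
  (Rintegral (@lebesgue_measure R) `[a, b] g)%:C%C.
Proof.
apply: complex_ext; first by [].
by rewrite /= Rintegral_cst; [rewrite mul0r|exact: measurable_itv].
Qed.

Lemma normc_lintegral (f : R -> R[i]) (a b C : R) : a <= b -> cmeas f ->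
  (forall x, a <= x <= b -> normc (f x) <= C) -> normc (lintegral `[a, b] f) <= 2 * (C * (b - a)).
Proof.
move=> ab mf fC.
have fi : cintg lebesgue_measure `[a, b] f by apply: cbnd_cintg => //; exists C.
have ci : lebesgue_measure.-integrable `[a, b] (EFin \o (cst C : R -> R)).
  apply: measurable_bounded_integrable => //; first exact: lebesgue_itv_lty.
  exact: bounded_cst.
have ni : lebesgue_measure.-integrable `[a, b] (EFin \o (fun x => normc (f x))).
  apply: le_integrable ci => //.
    by apply/measurable_EFinP; apply: measurable_funTS; exact: measurable_normc.
  move=> x; rewrite /= in_itv/= => xab; rewrite lee_fin ger0_norm ?normc_ge0//.
  by rewrite (le_trans (fC x xab)) ?ler_norm.
have h := @normc_cint _ _ (measurableTypeR R) lebesgue_measure `[a, b] (@measurable_itv R `[a, b]%R) f fi ni.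
apply: (le_trans h); rewrite ler_pM2l//.
have -> : C * (b - a) = Rintegral lebesgue_measure `[a, b] (fun=> C).
  rewrite Rintegral_cst; last exact: measurable_itv.
  have mE : (@lebesgue_measure R `[a, b]%classic) = (b - a)%:E.
    rewrite lebesgue_measure_itv/= lte_fin; case: ltP => // ba.
    by rewrite (_ : a = b) ?subrr//; apply/eqP; rewrite eq_le ab.
  by congr (_ * _); exact: esym (congr1 fine mE).
by apply: le_Rintegral => // x; rewrite /= in_itv/=; exact: fC.
Qed.

Lemma is_cd0_cst (f : R -> R[i]) : (forall t, is_cd f t 0) -> forall t, f t = f 0.
Proof.
move=> df t; apply: complex_ext.
  by apply: (@is_derive_0_is_cst _ (fun t => Re (f t))) => s; case: (df s).
by apply: (@is_derive_0_is_cst _ (fun t => Im (f t))) => s; case: (df s).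
Qed.

Lemma is_derive_sqr (t : R) : is_derive t (1:R) (fun x : R => x ^+ 2) (2 * t).
Proof.
have h := is_deriveM (is_derive_id t (1:R)) (is_derive_id t (1:R)).
by apply: (@is_derive_eq _ _ _ _ _ _ _ _ h); rewrite /GRing.scale/=; ring.
Qed.

Lemma is_derive_scale (k t : R) : is_derive t (1:R) (fun x : R => k * x) k.
Proof.
have h := @is_deriveZ _ _ _ (id : R -> R) k t 1 _ (is_derive_id _ _).
by apply: (@is_derive_eq _ _ _ _ _ _ _ _ h); rewrite /GRing.scale/= mulr1.
Qed.

Lemma is_cd_comp (f : R -> R[i]) (g : R -> R) (t d : R) (e : R[i]) :
  is_cd f (g t) e -> is_derive t (1:R) g d -> is_cd (fun x => f (g x)) t (d%:C%C * e).
Proof.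
move=> [f1 f2] gd; split.
  have h := @is_derive1_comp _ (fun x => Re (f x)) g t _ _ f1 gd.
  by apply: (@is_derive_eq _ _ _ _ _ _ _ _ h); rewrite ReM/= mul0r subr0 mulrC.
have h := @is_derive1_comp _ (fun x => Im (f x)) g t _ _ f2 gd.
by apply: (@is_derive_eq _ _ _ _ _ _ _ _ h); rewrite ImM/= mul0r addr0 mulrC.
Qed.

End Primitive.

Section Fresnel.
Context {R : realType}.

Let e2 (x : R) : R[i] := cexp (iC * (x ^+ 2)%:C%C).

Let is_cd_iX2 (k t : R) : is_cd (fun x => iC * (k * x ^+ 2)%:C%C) t (iC * (2 * k * t)%:C%C).
Proof.
apply: is_cdZ; apply: is_cd_real.
have h := @is_deriveZ _ _ _ (fun x : R => x ^+ 2) k t 1 _ (is_derive_sqr t).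
by apply: (@is_derive_eq _ _ _ _ _ _ _ _ h); rewrite /GRing.scale/=; ring.
Qed.

Let e2E x : e2 x = cexp (iC * (1 * x ^+ 2)%:C%C).
Proof. by rewrite mul1r. Qed.

Let is_cd_e2 t : is_cd e2 t (e2 t * (iC * (2 * t)%:C%C)).
Proof.
rewrite (_ : e2 = fun x => cexp (iC * (1 * x ^+ 2)%:C%C)); last by apply/funext => x; exact: e2E.
have := is_cd_cexp (is_cd_iX2 1 t); rewrite mulr1; exact.
Qed.

Let cont_e2 t : ccont e2 t := is_cd_ccont (is_cd_e2 t).

Let normc_e2 x : normc (e2 x) = 1.
Proof. by rewrite normc_cexp ReM/= mul0r mul1r subrr expR0. Qed.

Variable E : R -> R[i].
Hypotheses (E0 : E 0 = 0) (dE : forall t, is_cd E t (e2 t)).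

Let contE t : ccont E t := is_cd_ccont (dE t).

Lemma fresnel_odd x : E (- x) = - E x.
Proof.
have h : forall t, is_cd (fun t => E t + E (- t)) t 0.
  move=> t; have dN : is_derive t (1:R) (-%R : R -> R) (-1) by apply: is_deriveNid.
  have := is_cdD (dE t) (is_cd_comp (dE (- t)) dN).
  by rewrite (_ : e2 (- t) = e2 t); [rewrite rmorphN rmorph1 mulN1r subrr|rewrite /e2 sqrrN].
have := is_cd0_cst h x; rewrite oppr0 E0 addr0 => /eqP.
by rewrite addrC addr_eq0 => /eqP.
Qed.

Let q (t : R) := (1 + t ^+ 2)^-1.

Let q0 (t : R) : 0 < 1 + t ^+ 2.
Proof. by rewrite ltr_wpDr// sqr_ge0. Qed.

Let q_le1 t : 0 < q t <= 1.
Proof. by rewrite invr_gt0 q0 invf_le1// lerDl sqr_ge0. Qed.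

Let dq t : is_derive t (1:R) q (- (2 * t) * q t ^+ 2).
Proof.
have dd : is_derive t (1:R) (fun t => 1 + t ^+ 2) (0 + (2 * t)).
  exact: is_deriveD (is_derive_cst _ _ _) (is_derive_sqr t).
apply: DeriveDef.
  by apply: derivableV; [exact: lt0r_neq0|case: dd].
rewrite deriveV; [|exact: lt0r_neq0|by case: dd].
by case: dd => _ ->; rewrite /GRing.scale/= add0r /q exprVn mulNr mulNr mulrC.
Qed.

Let cont_q t : ccont (fun t => (q t)%:C%C) t := is_cd_ccont (is_cd_real (dq t)).

Definition fresnel_g (x : R) : R[i] :=
  lintegral `[0, 1] (fun t => cexp (iC * (x ^+ 2 * (1 + t ^+ 2))%:C%C) * (q t)%:C%C).

Let cexpDs x t : cexp (iC * (x ^+ 2 * (1 + t ^+ 2))%:C%C) = e2 x * e2 (x * t).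
Proof.
rewrite /e2 -cexpD -mulrDr -rmorphD; congr (cexp (iC * _%:C%C)); ring.
Qed.

Let int_e2xt x : lintegral `[0, 1] (fun t => x%:C%C * e2 (x * t)) = E x.
Proof.
have dx t := is_derive_scale x t.
rewrite (@lintegral_FTC R 0 1 _ (fun t => E (x * t)) ler01).
- by rewrite mulr1 mulr0 E0 subr0.
- by move=> t; exact: (is_cd_comp (dE (x * t)) (dx t)).
- move=> t; have h := is_cd_ccont (is_cd_comp (is_cd_e2 (x * t)) (dx t)).
  by ccont_step.
Qed.

Lemma fresnel_sqr x : 0 <= x -> E x ^+ 2 = - iC * fresnel_g x + iC * (pi / 4)%:C%C.
Proof.
move=> x0.
have n2 : (2%:R : R[i]) != 0 by rewrite pnatr_eq0.
pose f (y t : R) := 2%:R * e2 y * (y%:C%C * e2 (y * t)).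
have cidy : continuous (fun p : R * R => p.1) by move=> p; exact: cvg_fst.
have cidt : continuous (fun p : R * R => p.2) by move=> p; exact: cvg_snd.
have ce2 (k : R * R -> R) : continuous k -> jcont (fun y t => e2 (k (y, t))).
  move=> ck.
  have h (h : R -> R) : continuous h -> continuous (fun p : R * R => h (k (p.1, p.2))).
    move=> ch; rewrite (_ : (fun p => _) = h \o k); last by apply/funext => -[].
    by move=> p; apply: continuous_comp; [exact: ck|exact: ch].
  split; [apply: (h (fun x => Re (e2 x)))|apply: (h (fun x => Im (e2 x)))] => s;
  by case: (cont_e2 s).
have m1 : cmeas (fun p : R * R => e2 p.1) by exact: (jcont_cmeas (ce2 fst cidy)).
have m2 : cmeas (fun p : R * R => e2 (p.1 * p.2)).
  apply: (jcont_cmeas (f := fun y t => e2 (y * t))); apply: (ce2 (fun p => p.1 * p.2)).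
  by move=> p; apply: cvgM; [exact: cidy|exact: cidt].
have m3 : cmeas (fun p : R * R => (p.1)%:C%C : R[i]) by apply: cmeas_real.
have mf : cmeas (fun p : R * R => f p.1 p.2) by rewrite /f; cmeas_step.
have bf : cbnd (rect 0 x 0 1) (fun p => f p.1 p.2).
  exists (2 * x) => -[y t] Sy; have /andP[y0 yx] : 0 <= y <= x by case: Sy.
  have n2c : normc (2%:R : R[i]) = 2 by rewrite -[2%:R](rmorph_nat (real_complex R)) normc_real normr_nat.
  have yn : normc (y%:C%C : R[i]) = y by rewrite normc_real ger0_norm.
  rewrite -[X in normc X]/(f y t) /f Normc.normcM [normc (2%:R * _)]Normc.normcM n2c normc_e2 mulr1.
  by rewrite [normc (y%:C%C * _)]Normc.normcM normc_e2 mulr1 yn ler_pM2l.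
have sw := rect_swap mf bf.
have cEt t : ccont (fun y => 2%:R * e2 y * E y) t.
  by have h1 := cont_e2 t; have h2 := contE t; ccont_step.
have -> : E x ^+ 2 = lintegral `[0, x] (fun y => 2%:R * e2 y * E y).
  have dE2 t : is_cd (fun y => E y ^+ 2) t (2%:R * e2 t * E t).
    rewrite (_ : 2%:R * e2 t * E t = e2 t * E t + E t * e2 t); first exact: is_cd_sqr.
    by move: (e2 t) (E t) => u v; ring.
  by rewrite (lintegral_FTC x0 dE2 cEt) E0 expr0n subr0.
have -> : lintegral `[0, x] (fun y => 2%:R * e2 y * E y) =
    lintegral `[0, x] (fun y => lintegral `[0, 1] (f y)).
  apply: eq_cint => y _.
  have ie : cintg lebesgue_measure `[0, 1] (fun t => y%:C%C * e2 (y * t)).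
    apply: cbnd_cintg.
      have h : cmeas (fun t : R => e2 (y * t)).
        by apply: (cmeas_comp m2 (g := fun t => (y, t))); exact: measurable_fun_pair.
      by cmeas_step.
    exists `|y| => t _; have nr := normc_real y.
    by rewrite Normc.normcM normc_e2 nr mulr1.
  have Z := @cintZ _ _ (measurableTypeR R) lebesgue_measure `[0, 1] (@measurable_itv R `[0, 1]%R) (2%:R * e2 y) _ ie.
  rewrite -(int_e2xt y); exact: esym Z.
rewrite sw.
have innerE t : lintegral `[0, x] (f ^~ t) =
    - iC * (cexp (iC * (x ^+ 2 * (1 + t ^+ 2))%:C%C) * (q t)%:C%C) + iC * (q t)%:C%C.
  pose s := 1 + t ^+ 2.
  have s0 : s != 0 := lt0r_neq0 (q0 t).
  have dF y : is_cd (fun y => - iC * (q t)%:C%C * cexp (iC * (s * y ^+ 2)%:C%C)) y (f y t).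
    have := is_cdZ (- iC * (q t)%:C%C) (is_cd_cexp (is_cd_iX2 s y)).
    congr (is_cd _ _ _); rewrite /f /e2.
    have -> : cexp (iC * (s * y ^+ 2)%:C%C) = cexp (iC * (y ^+ 2)%:C%C) * cexp (iC * ((y * t) ^+ 2)%:C%C).
      by rewrite -cexpD -mulrDr -rmorphD; congr (cexp (iC * _%:C%C)); rewrite /s; ring.
    have -> : (2 * s * y)%:C%C = 2%:R * s%:C%C * y%:C%C :> R[i] by rewrite !rmorphM rmorph_nat.
    transitivity (- (iC * iC) * ((q t)%:C%C * s%:C%C) * (2%:R * y%:C%C * (cexp (iC * (y ^+ 2)%:C%C) * cexp (iC * ((y * t) ^+ 2)%:C%C)))).
      by ring.
    rewrite iC2 opprK mul1r -rmorphM (mulVf s0) rmorph1 mul1r.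
    move: (cexp (iC * (y ^+ 2)%:C%C)) (cexp _) => u v; ring.
  have cft y : ccont (f ^~ t) y.
    have h1 := cont_e2 y; have h2 := is_cd_ccont (is_cd_id y).
    have dx : is_derive y (1:R) (fun y => y * t) t.
      have h := is_derive_scale t y.
      by rewrite (_ : (fun y => y * t) = fun y => t * y); last by apply/funext => z; rewrite mulrC.
    have h3 := is_cd_ccont (is_cd_comp (g := fun y => y * t) (is_cd_e2 (y * t)) dx).
    by rewrite /f; ccont_step.
  rewrite (lintegral_FTC x0 dF cft) expr0n/= mulr0 mulr0 cexp0 /s (mulrC (1 + t ^+ 2)) mulr1.
  by move: (cexp _) (q t)%:C%C => u v; ring.
have cg (t : R) : ccont (fun t : R => cexp (iC * (x ^+ 2 * (1 + t ^+ 2))%:C%C)) t.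
  rewrite (_ : (fun t => _) = fun t : R => e2 x * e2 (x * t)); last by apply/funext => z; exact: cexpDs.
  have dx := is_derive_scale x t.
  have h3 := is_cd_ccont (is_cd_comp (is_cd_e2 (x * t)) dx).
  by ccont_step.
have c1 (t : R) : ccont (fun t : R => cexp (iC * (x ^+ 2 * (1 + t ^+ 2))%:C%C) * (q t)%:C%C) t.
  by have h1 := cg t; have h2 := cont_q t; ccont_step.
have i1 : cintg lebesgue_measure `[0, 1] (fun t => cexp (iC * (x ^+ 2 * (1 + t ^+ 2))%:C%C) * (q t)%:C%C).
  by apply: cbnd_cintg; [exact: ccont_measurable|apply: itv_cbnd => t _; exact: c1].
have i2 : cintg lebesgue_measure `[0, 1] (fun t => (q t)%:C%C : R[i]).
  by apply: cbnd_cintg; [exact: ccont_measurable|apply: itv_cbnd => t _; exact: cont_q].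
transitivity (lintegral `[0, 1] (fun t => - iC * (cexp (iC * (x ^+ 2 * (1 + t ^+ 2))%:C%C) * (q t)%:C%C) + iC * (q t)%:C%C)).
  by apply: eq_cint => t _; exact: innerE.
have mI := @measurable_itv R `[0, 1]%R.
have ii1 := @cintgZ _ _ (measurableTypeR R) lebesgue_measure _ mI (- iC) _ i1.
have ii2 := @cintgZ _ _ (measurableTypeR R) lebesgue_measure _ mI iC _ i2.
have Z := @cintD _ _ (measurableTypeR R) lebesgue_measure _ mI _ _ ii1 ii2.
have Z1 := @cintZ _ _ (measurableTypeR R) lebesgue_measure _ mI (- iC) _ i1.
have Z2 := @cintZ _ _ (measurableTypeR R) lebesgue_measure _ mI iC _ i2.
apply: (etrans Z); rewrite Z1 Z2; congr (_ + iC * _).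
apply: (etrans (lintegral_real 0 1 q)).
by have -> : (pi / 4 : R) = atan 1; [rewrite atan1|rewrite -(integral0_oneDsqr ler01)].
Qed.

Let normc_q t : normc ((q t)%:C%C : R[i]) <= 1.
Proof. by rewrite normc_real gtr0_norm; have /andP[] := q_le1 t. Qed.

Let normc_cexpi (r : R) : normc (cexp (iC * r%:C%C)) = 1.
Proof. by rewrite normc_cexp ReM/= mul0r mul1r subrr expR0. Qed.

Let cont_e2xt (x t : R) : ccont (fun t : R => e2 (x * t)) t :=
  is_cd_ccont (is_cd_comp (g := fun t : R => x * t) (is_cd_e2 (x * t)) (is_derive_scale x t)).
Let cont_Ext (x t : R) : ccont (fun t : R => E (x * t)) t :=
  is_cd_ccont (is_cd_comp (g := fun t : R => x * t) (dE (x * t)) (is_derive_scale x t)).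

Let e2q x (t : R) : R[i] := e2 (x * t) * (q t)%:C%C.

Let cont_e2q x t : ccont (e2q x) t.
Proof. by have h1 := cont_e2xt x t; have h2 := cont_q t; rewrite /e2q; ccont_step. Qed.

Let fresnel_gE x : fresnel_g x = e2 x * lintegral `[0, 1] (e2q x).
Proof.
have ie : cintg lebesgue_measure `[0, 1] (e2q x).
  apply: cbnd_cintg; first exact: ccont_measurable (cont_e2q x).
  exact: itv_cbnd (fun t _ => cont_e2q x t).
have Z := @cintZ _ _ (measurableTypeR R) lebesgue_measure _ (@measurable_itv R `[0, 1]%R) (e2 x) _ ie.
rewrite -[RHS]Z; apply: eq_cint => t _; rewrite /e2q mulrA; congr (_ * _); exact: cexpDs.
Qed.

Let normc_g x : normc (fresnel_g x) <= 2.
Proof.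
rewrite fresnel_gE Normc.normcM normc_e2 mul1r.
have h t : 0 <= t <= 1 -> normc (e2q x t) <= 1.
  by move=> _; rewrite Normc.normcM normc_e2 mul1r normc_q.
have := normc_lintegral ler01 (ccont_measurable (cont_e2q x)) h.
by rewrite subr0 !mulr1.
Qed.

Let B : R := 3 + pi.
Let B0 : 0 < B. Proof. by have := pi_gt0 R; rewrite /B; lra. Qed.

Lemma fresnel_bounded x : normc (E x) <= B.
Proof.
wlog x0 : x / 0 <= x.
  move=> h; have [|/ltW x0] := leP 0 x; first exact: h.
  by rewrite -[x]opprK fresnel_odd normcN; apply: h; rewrite oppr_ge0.
have h1 : normc (E x) ^+ 2 <= 2 + pi / 4.
  rewrite -normcX (fresnel_sqr x0) (le_trans (le_normcD _ _))// lerD//.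
    by rewrite Normc.normcM normcN normciC mul1r normc_g.
  by rewrite Normc.normcM normciC mul1r normc_real ger0_norm// divr_ge0// pi_ge0.
rewrite -ler_sqr ?nnegrE ?normc_ge0 ?(ltW B0)// (le_trans h1)//.
by have := pi_gt0 R; rewrite /B; nra.
Qed.

Let W x (t : R) : R[i] := (x^-1)%:C%C * (E (x * t) * (- (2 * t) * q t ^+ 2)%:C%C).

Let fresnel_g_decay x : 0 < x -> normc (fresnel_g x) <= 5 * B / x.
Proof.
move=> x0; have xn0 : x != 0 := lt0r_neq0 x0.
rewrite fresnel_gE Normc.normcM normc_e2 mul1r.
have cW t : ccont (W x) t.
  have h1 := cont_Ext x t.
  have h2 : ccont (fun t : R => (- (2 * t) * q t ^+ 2)%:C%C : R[i]) t.
    have a1 := is_cd_ccont (is_cd_real (is_derive_scale 2 t)); have a2 := cont_q t.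
    rewrite (_ : (fun t => _) = fun t : R => - (2 * t)%:C%C * (q t)%:C%C ^+ 2); first by ccont_step.
    by apply/funext => z; rewrite rmorphM rmorphN rmorphXn.
  by rewrite /W; ccont_step.
pose F (t : R) := (x^-1)%:C%C * (E (x * t) * (q t)%:C%C).
have dF t : is_cd F t (e2q x t + W x t).
  have h := is_cdZ (x^-1)%:C%C (is_cdM (is_cd_comp (g := fun t : R => x * t) (dE (x * t)) (is_derive_scale x t)) (is_cd_real (dq t))).
  rewrite (_ : e2q x t + W x t = (x^-1)%:C%C * (x%:C%C * e2 (x * t) * (q t)%:C%C + E (x * t) * (- (2 * t) * q t ^+ 2)%:C%C)); first exact: h.
  rewrite mulrDr -/(W x t); congr (_ + _).
  by rewrite /e2q !mulrA -rmorphM (mulVf xn0) rmorph1 mul1r.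
have mI := @measurable_itv R `[0, 1]%R.
have ig (g : R -> R[i]) : (forall t, ccont g t) -> cintg lebesgue_measure `[0, 1] g.
  by move=> cg; apply: cbnd_cintg; [exact: ccont_measurable|exact: itv_cbnd (fun t _ => cg t)].
have cS t : ccont (fun t : R => e2q x t + W x t) t.
  by have h1 := cont_e2q x t; have h2 := cW t; ccont_step.
have S1 := lintegral_FTC ler01 dF cS.
have S2 : lintegral `[0, 1] (fun t => e2q x t + W x t) = lintegral `[0, 1] (e2q x) + lintegral `[0, 1] (W x) :=
  @cintD _ _ (measurableTypeR R) lebesgue_measure _ mI _ _ (ig _ (cont_e2q x)) (ig _ cW).
have -> : lintegral `[0, 1] (e2q x) = F 1 - F 0 - lintegral `[0, 1] (W x).
  by rewrite -S1 S2 addrK.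
have F0 : F 0 = 0 by rewrite /F mulr0 E0 mul0r mulr0.
have nx : normc ((x^-1)%:C%C : R[i]) = x^-1 by rewrite normc_real gtr0_norm// invr_gt0.
have nF : normc (F 1) <= B / x.
  rewrite /F Normc.normcM nx mulrC ler_pM2r ?invr_gt0// Normc.normcM.
  by rewrite -[leRHS]mulr1 ler_pM ?normc_ge0 ?fresnel_bounded ?normc_q.
have nW t : 0 <= t <= 1 -> normc (W x t) <= 2 * B / x.
  move=> /andP[t0 t1].
  rewrite /W Normc.normcM nx mulrC ler_pM2r ?invr_gt0// Normc.normcM mulrC.
  rewrite ler_pM ?normc_ge0 ?fresnel_bounded// normc_real.
  have /andP[q0t q1t] := q_le1 t.
  rewrite normrM normrN normrM !ger0_norm ?exprn_ge0 ?(ltW q0t)//.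
  rewrite -[leRHS]mulr1 ler_pM ?exprn_ge0 ?(ltW q0t) ?mulr_ge0//.
    by rewrite -[leRHS]mulr1 ler_pM2l.
  by rewrite exprn_ile1// ltW.
have nI := normc_lintegral ler01 (ccont_measurable cW) nW.
rewrite F0 subr0 (le_trans (le_normcD _ _))// normcN.
rewrite (le_trans (lerD nF nI))// subr0 mulr1.
by rewrite [leLHS](_ : _ = 5 * B / x)//; ring.
Qed.

Let cos_ge (v : R) : 0 <= v -> 1 - cos v <= v.
Proof.
rewrite le_eqVlt => /predU1P[<-|v0]; first by rewrite cos0 subrr.
have [|z _ h] := @MVT R (@cos R) (fun x => - sin x) 0 v v0 (fun x _ => is_derive_cos x).
  exact/continuous_subspaceT/continuous_cos.
have : sin z <= 1 by exact: sin_le1.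
move: h; rewrite cos0 subr0 => h s1.
have -> : 1 - cos v = sin z * v by move: h; lra.
by rewrite -[leRHS]mul1r ler_pM2r.
Qed.

Lemma fresnel_Im_ge0 x : 0 <= x -> 0 <= Im (E x).
Proof.
rewrite le_eqVlt => /predU1P[<-|x0]; first by rewrite E0.
have dI t : is_derive t (1:R) (fun t => Im (E t)) (sin (t ^+ 2)).
  rewrite (_ : sin (t ^+ 2) = Im (e2 t)); first by case: (dE t).
  by rewrite /e2 Im_cexp ReM ImM/= !mul0r !mul1r subrr expR0 mul1r add0r.
have cI t : {for t, continuous (fun t => Im (E t))} := (contE t).2.
rewrite leNgt; apply/negP => h.
pose e := Num.min x (- Im (E x) / 4).
have e0 : 0 < e by rewrite lt_min x0/= divr_gt0// oppr_gt0.
have ex : e <= x by rewrite ge_min lexx.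
have eI : e <= - Im (E x) / 4 by rewrite ge_min lexx orbT.
have Ie : - e <= Im (E e).
  have [|z _] := @MVT R _ _ 0 e e0 (fun t _ => dI t).
    by apply: continuous_subspaceT => t; exact: cI.
  rewrite E0 /= !subr0 => ->; rewrite -mulN1r ler_pM2r//.
  by have := sin_geN1 (z ^+ 2).
pose Hf (t : R) := Im (E t) - 2^-1 * (t^-1 * (1 - cos (t ^+ 2))).
have dH (t : R) : 0 < t -> is_derive t (1:R) Hf (2^-1 * (t^-1 ^+ 2 * (1 - cos (t ^+ 2)))).
  move=> t0; have tn0 : t != 0 := lt0r_neq0 t0.
  have di : is_derive t (1:R) (fun t : R => t^-1) (- (t^-1 ^+ 2)).
    apply: DeriveDef; first exact: derivableV tn0 (@derivable_id _ _ _ _).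
    by rewrite (deriveV tn0 (@derivable_id _ _ _ _)) derive_id /GRing.scale/= mulr1 exprVn.
  have dc : is_derive t (1:R) (fun t : R => 1 - cos (t ^+ 2)) (0 - (- sin (t ^+ 2) * (2 * t))).
    apply: is_deriveB.
    exact: (@is_derive1_comp _ (@cos R) (fun t => t ^+ 2) t _ _ (is_derive_cos _) (is_derive_sqr t)).
  have d1 := is_deriveM di dc.
  have d2 := @is_deriveZ _ _ _ _ 2^-1 t 1 _ d1.
  have d3 := is_deriveB (dI t) d2.
  apply: (@is_derive_eq _ _ _ _ _ _ _ _ d3); rewrite /GRing.scale/=.
  rewrite sub0r mulNr opprK.
  have -> : t^-1 * (sin (t ^+ 2) * (2 * t)) = 2 * sin (t ^+ 2).
    by rewrite mulrC -!mulrA (mulfV tn0) mulr1 mulrC.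
  by field.
have Hle : Hf e <= Hf x.
  have := ex; rewrite le_eqVlt => /predU1P[-> //|exlt].
  have [||z zex hz] := @MVT R Hf (fun t => 2^-1 * (t^-1 ^+ 2 * (1 - cos (t ^+ 2)))) e x exlt.
  - by move=> t; rewrite in_itv/= => /andP[et _]; apply: dH; exact: lt_trans et.
  - apply: continuous_in_subspaceT => t; rewrite inE/= in_itv/= => /andP[et _].
    have [d _] := dH t (lt_le_trans e0 et).
    by apply: differentiable_continuous; exact/derivable1_diffP.
  have c1 : 0 <= 1 - cos (z ^+ 2) by rewrite subr_ge0 cos_le1.
  have x1 : 0 <= x - e by rewrite subr_ge0.
  rewrite -subr_ge0 hz; apply: mulr_ge0 x1; apply: mulr_ge0; first by rewrite invr_ge0.
  by apply: mulr_ge0 c1; rewrite exprn_even_ge0.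
have h1 : Hf x <= Im (E x).
  have c1 : 0 <= 1 - cos (x ^+ 2) by rewrite subr_ge0 cos_le1.
  rewrite /Hf gerBl; apply: mulr_ge0; first by rewrite invr_ge0.
  by apply: mulr_ge0 c1; rewrite invr_ge0 ltW.
have h2 : - e - e <= Hf e.
  rewrite /Hf lerD// lerN2.
  rewrite (@le_trans _ _ (2^-1 * (e^-1 * e ^+ 2)))//.
    by rewrite ler_pM2l// ler_pM2l ?invr_gt0// cos_ge// exprn_ge0// ltW.
  have -> : e^-1 * e ^+ 2 = e by rewrite expr2 mulrA (mulVf (lt0r_neq0 e0)) mul1r.
  by move: e0; lra.
by move: h1 h2 Hle eI h; lra.
Qed.

Let sl : R := Num.sqrt (pi / 8).
Let sl0 : 0 < sl. Proof. by rewrite sqrtr_gt0 divr_gt0// pi_gt0. Qed.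

Definition fresnel_lim : R[i] := Complex sl sl.

Lemma fresnel_cvg x : 0 < x -> normc (E x - fresnel_lim) <= 5 * B / sl / x.
Proof.
move=> x0; have c2 : fresnel_lim ^+ 2 = iC * (pi / 4)%:C%C.
  have ss : sl * sl = pi / 8 by rewrite -expr2 sqr_sqrtr// divr_ge0// pi_ge0.
  rewrite expr2; apply: complex_ext.
    by rewrite !ReM/= ss subrr mul0r mul1r subrr.
  by rewrite !ImM/= mul0r add0r mul1r ss; field.
have h : normc (E x - fresnel_lim) * normc (E x + fresnel_lim) <= 5 * B / x.
  rewrite -Normc.normcM -subr_sqr c2 (fresnel_sqr (ltW x0)) addrK Normc.normcM normcN normciC mul1r.
  exact: fresnel_g_decay.
have h2 : sl <= normc (E x + fresnel_lim).
  rewrite (le_trans _ (Im_le_normc _))// ImD/= ger0_norm ?addr_ge0 ?(ltW sl0) ?fresnel_Im_ge0 ?(ltW x0)//.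
  by rewrite lerDr fresnel_Im_ge0// ltW.
rewrite mulrAC ler_pdivlMr// (le_trans _ h)//.
by rewrite ler_wpM2l// normc_ge0.
Qed.

End Fresnel.

(** * The delta limit of the kernel *)

Section ComplexSequences.
Context {R : realType}.
Implicit Types (u v : nat -> R[i]) (a b : R[i]).

Lemma cpart_cvg_cst a : cpart_cvg (fun=> a) a.
Proof. by split; exact: cvg_cst. Qed.

Lemma cpart_cvgD u v a b : cpart_cvg u a -> cpart_cvg v b ->
  cpart_cvg (fun n => u n + v n) (a + b).
Proof.
move=> [u1 u2] [v1 v2]; split.
  by rewrite ReD (_ : (fun n => _) = fun n => Re (u n) + Re (v n)); [exact: cvgD|apply/funext => n; rewrite ReD].
by rewrite ImD (_ : (fun n => _) = fun n => Im (u n) + Im (v n)); [exact: cvgD|apply/funext => n; rewrite ImD].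
Qed.

Lemma cpart_cvgM u v a b : cpart_cvg u a -> cpart_cvg v b ->
  cpart_cvg (fun n => u n * v n) (a * b).
Proof.
move=> [u1 u2] [v1 v2]; split.
  rewrite ReM (_ : (fun n => _) = fun n => Re (u n) * Re (v n) - Im (u n) * Im (v n)); last by apply/funext => n; rewrite ReM.
  by apply: cvgB; exact: cvgM.
rewrite ImM (_ : (fun n => _) = fun n => Re (u n) * Im (v n) + Im (u n) * Re (v n)); last by apply/funext => n; rewrite ImM.
by apply: cvgD; exact: cvgM.
Qed.

Lemma cpart_cvgN u a : cpart_cvg u a -> cpart_cvg (fun n => - u n) (- a).
Proof.
move=> h; rewrite -mulN1r (_ : (fun n => _) = fun n => (-1) * u n); last by apply/funext => n; rewrite mulN1r.
by apply: cpart_cvgM h; exact: cpart_cvg_cst.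
Qed.

Lemma cpart_cvg_cexp u a : cpart_cvg u a -> cpart_cvg (fun n => cexp (u n)) (cexp a).
Proof.
move=> [u1 u2].
have e : (fun n => expR (Re (u n))) @ \oo --> expR (Re a).
  exact: (@cvg_comp _ _ _ (fun n => Re (u n)) (@expR R) _ _ _ u1 (@continuous_expR R (Re a))).
have c : (fun n => cos (Im (u n))) @ \oo --> cos (Im a).
  exact: (@cvg_comp _ _ _ (fun n => Im (u n)) (@cos R) _ _ _ u2 (@continuous_cos R (Im a))).
have s : (fun n => sin (Im (u n))) @ \oo --> sin (Im a).
  exact: (@cvg_comp _ _ _ (fun n => Im (u n)) (@sin R) _ _ _ u2 (@continuous_sin R (Im a))).
split.
  by rewrite Re_cexp (_ : (fun n => _) = fun n => expR (Re (u n)) * cos (Im (u n))); [exact: cvgM|apply/funext => n; rewrite Re_cexp].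
by rewrite Im_cexp (_ : (fun n => _) = fun n => expR (Re (u n)) * sin (Im (u n))); [exact: cvgM|apply/funext => n; rewrite Im_cexp].
Qed.

Lemma cpart_cvg_bounded u a : cpart_cvg u a -> exists C, forall n, normc (u n) <= C.
Proof.
have key (w : nat -> R) (l : R) : w @ \oo --> l -> exists C, forall n, `|w n| <= C.
  move=> /cvgP /cvg_seq_bounded [M [_ hM]]; exists (M + 1) => n.
  by apply: (hM (M + 1)) => //; rewrite ltrDl.
move=> [/key[C1 h1] /key[C2 h2]]; exists (C1 + C2) => n.
by rewrite (le_trans (normc_le _))// lerD.
Qed.

Lemma cpart_cvg_le u a (e : nat -> R) : (forall n, normc (u n - a) <= e n) ->
  e @ \oo --> 0 -> cpart_cvg u a.
Proof.
move=> ue e0.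
have key (w : nat -> R) (l : R) : (forall n, `|w n - l| <= e n) -> w @ \oo --> l.
  move=> we; apply/cvgrPdist_le => d d0.
  move/cvgrPdist_le: (e0) => /(_ d d0); apply: filterS => n.
  rewrite sub0r normrN distrC => h; apply: (le_trans (we n)).
  by apply: le_trans h; exact: ler_norm.
split; apply: key => n; apply: le_trans (ue n).
  by have := Re_le_normc (u n - a); rewrite ReD ReN.
by have := Im_le_normc (u n - a); rewrite ImD ImN.
Qed.

Lemma ccont_cvg (f : R -> R[i]) (t : R) (s : nat -> R) : ccont f t -> s @ \oo --> t ->
  cpart_cvg (fun n => f (s n)) (f t).
Proof.
move=> [c1 c2] st; split.
  exact: (@cvg_comp _ _ _ s (fun x => Re (f x)) _ _ _ st c1).
exact: (@cvg_comp _ _ _ s (fun x => Im (f x)) _ _ _ st c2).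
Qed.

Lemma is_cd_cvg (f : R -> R[i]) (t : R) (a : R[i]) (dl : nat -> R) : is_cd f t a ->
  (forall n, 0 < dl n) -> dl @ \oo --> 0 ->
  cpart_cvg (fun n => ((dl n)^-1)%:C%C * (f (t + dl n) - f t)) a.
Proof.
move=> [d1 d2] dl0 dlc.
have dl' : dl @ \oo --> 0^'.
  move=> A /= hA; have h : \forall n \near \oo, (dl n != 0 -> A (dl n)) := dlc _ hA.
  suff : \forall n \near \oo, A (dl n) by [].
  by near=> n; apply: (near h n) => //; rewrite gt_eqF ?dl0.
have key (g : R -> R) (b : R) : is_derive t (1:R) g b ->
    (fun n => (dl n)^-1 * (g (t + dl n) - g t)) @ \oo --> b.
  move=> [dg <-].
  rewrite (_ : (fun n => _) = (fun h : R => h^-1 *: ((g \o shift t) (h *: 1) - g t)) \o dl).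
    exact: (@cvg_comp _ _ _ dl (fun h : R => h^-1 *: ((g \o shift t) (h *: 1) - g t)) _ _ _ dl' dg).
  by apply/funext => n; rewrite /GRing.scale/= mulr1 [t + _]addrC.
split.
  rewrite (_ : (fun n => _) = fun n => (dl n)^-1 * (Re (f (t + dl n)) - Re (f t))); first exact: key.
  by apply/funext => n; rewrite ReM ReD ReN/= mul0r subr0.
rewrite (_ : (fun n => _) = fun n => (dl n)^-1 * (Im (f (t + dl n)) - Im (f t))); first exact: key.
by apply/funext => n; rewrite ImM ImD ImN/= mul0r addr0.
Unshelve. all: by end_near.
Qed.
End ComplexSequences.

Ltac ccvg_step := lazymatch goal with
  | |- cpart_cvg (fun _ => ?z) _ => exact: cpart_cvg_cst
  | |- cpart_cvg (fun x => @?f x + @?g x) (?a + ?b) => refine (@cpart_cvgD _ f g a b _ _); ccvg_step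
  | |- cpart_cvg (fun x => - @?f x) (- ?a) => refine (@cpart_cvgN _ f a _); ccvg_step
  | |- cpart_cvg (fun x => @?f x * @?g x) (?a * ?b) => refine (@cpart_cvgM _ f g a b _ _); ccvg_step
  | |- cpart_cvg (fun x => cexp (@?f x)) (cexp ?a) => refine (@cpart_cvg_cexp _ f a _); ccvg_step
  | |- _ => try hyp
  end.

Lemma lintegral_dominated {R : realType} (f_ : nat -> R -> R[i]) (f : R -> R[i]) (a b C : R) :
  (forall n, cmeas (f_ n)) -> cmeas f ->
  (forall x, a <= x <= b -> cpart_cvg (f_ ^~ x) (f x)) ->
  (forall n x, a <= x <= b -> normc (f_ n x) <= C) ->
  cpart_cvg (fun n => lintegral `[a, b] (f_ n)) (lintegral `[a, b] f).
Proof.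
move=> mf_ mf fc fC.
pose I (x : R) : bool := (a <= x) && (x <= b).
have mI : measurable_fun setT I by apply: measurable_and; exact: measurable_fun_ler.
have key (g : R -> R[i]) : cmeas g ->
    lintegral `[a, b] g = cint (lebr a b) setT (fun x => if I x then g x else 0).
  move=> mg; have mg' : cmeas (fun x => if I x then g x else 0).
    by apply: cmeas_if; [exact: mI|exact: mg|exact: cmeas_cst].
  rewrite -(lintegral_lebr a b mg'); apply: eq_cint => x; rewrite /= in_itv/= => xab.
  by rewrite /I xab.
rewrite key//; rewrite (_ : (fun n => _) = fun n => cint (lebr a b) setT (fun x => if I x then f_ n x else 0)); last first.
  by apply/funext => n; rewrite key.
apply: (cint_dominated (g := cst (Num.max C 0))).
- by move=> n; apply: cmeas_if; [exact: mI|exact: mf_|exact: cmeas_cst].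
- by apply: cmeas_if; [exact: mI|exact: mf|exact: cmeas_cst].
- move=> x; case Ix : (I x); last exact: cpart_cvg_cst.
  exact: fc.
- exact: finite_measure_integrable_cst.
- move=> n x; rewrite le_max; case Ix : (I x); first by rewrite fC.
  by rewrite Normc.normc0 lexx orbT.
Qed.

Lemma k0_fresnel {R : realType} : 2%:R * (k0 * (Num.sqrt 2)%:C%C * fresnel_lim) = 1 :> R[i].
Proof.
have p0 : 0 < (pi : R) := pi_gt0 R.
have e1 : sqrtc (iC * (2 * pi)%:C%C) = Complex (Num.sqrt pi) (Num.sqrt pi) :> R[i].
  have -> : iC * (2 * pi)%:C%C = Complex 0 (2 * pi) :> R[i].
    by apply: complex_ext; rewrite ReImE/=; ring.
  have p2 : 0 < 2 * pi :> R by rewrite mulr_gt0.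
  rewrite /sqrtc (gt_eqF p2) (gtr0_sg p2) mul1r expr0n/= add0r sqrtr_sqr ger0_norm; last exact: ltW.
  by congr Complex; congr Num.sqrt; field; rewrite //.
have e2 : 2%:R * ((Num.sqrt 2)%:C%C * fresnel_lim) = Complex (Num.sqrt pi) (Num.sqrt pi) :> R[i].
  have h : 2 * (Num.sqrt 2 * Num.sqrt (pi / 8)) = Num.sqrt (pi : R).
    apply/eqP; rewrite -(@eqrXn2 _ 2%N) ?mulr_ge0 ?sqrtr_ge0//.
    apply/eqP; rewrite !exprMn !sqr_sqrtr ?divr_ge0 ?ltW//; field; rewrite //.
  have dbl (w : R[i]) : 2%:R * w = w + w by rewrite mulr_natl mulr2n.
  by rewrite dbl /fresnel_lim; apply: complex_ext; rewrite !ReImE/= -[RHS]h; ring.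
rewrite (_ : _ * _ = k0 * (2%:R * ((Num.sqrt 2)%:C%C * fresnel_lim))); last by ring.
rewrite e2 /k0 e1 mulVf//; apply/eqP => h.
by have : Re (Complex (Num.sqrt pi) (Num.sqrt pi) : R[i]) = 0 :> R by [rewrite h]; move/eqP; rewrite /= sqrtr_eq0 leNgt p0.
Qed.

Section DeltaLimit.
Context {R : realType}.
Variables (H Hd T1 T2 : R -> R[i]) (tau z : R) (c' : R[i]).
Hypotheses (dT1 : forall t, is_cd T1 t (H t)) (dT2 : forall t, is_cd T2 t (H t ^+ 2))
  (dH : forall t, is_cd H t (Hd t)).
Variables (phi px pxx pt : R -> R -> R[i]) (M T : R).
Hypotheses (zM : `|z| <= M) (tst : is_test phi px pxx pt M T).
Variable (dl : nat -> R).
Hypotheses (dl0 : forall n, 0 < dl n <= 1) (dlc : dl @ \oo --> 0).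

Local Notation G := (gker H T1 T2 tau (T1 tau + z%:C%C) c').

Let M0 : 0 <= M. Proof. exact: le_trans (normr_ge0 _) zM. Qed.
Let MM : - M <= M. Proof. by move: M0; lra. Qed.

Let W : R[i] := cexp (- (iC / 2%:R) * T2 tau - iC * z%:C%C * H tau + c').

Let t_ n := tau + dl n.
Let b_ n : R[i] := T1 (t_ n) - T1 tau.
Let bD_ n : R[i] := ((dl n)^-1)%:C%C * b_ n.
Let tc : t_ @ \oo --> tau.
Proof. by rewrite -[X in _ --> X]addr0; apply: cvgD => //; exact: cvg_cst. Qed.
Let bc : cpart_cvg b_ 0.
Proof.
rewrite -(subrr (T1 tau)); apply: cpart_cvgD; last exact: cpart_cvg_cst.
exact: ccont_cvg (is_cd_ccont (dT1 tau)) tc.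
Qed.
Let bDc : cpart_cvg bD_ (H tau).
Proof. by apply: is_cd_cvg => // n; case/andP: (dl0 n). Qed.
Let Hc : cpart_cvg (fun n => H (t_ n)) (H tau) := ccont_cvg (is_cd_ccont (dH tau)) tc.
Let T2c : cpart_cvg (fun n => T2 (t_ n)) (T2 tau) := ccont_cvg (is_cd_ccont (dT2 tau)) tc.
Let phic x : cpart_cvg (fun n => phi x (t_ n)) (phi x tau) := ccont_cvg (jcont2 x tau (tst_c tst)) tc.
Let pxc x : cpart_cvg (fun n => px x (t_ n)) (px x tau) := ccont_cvg (jcont2 x tau (tst_cx tst)) tc.

Let r_ n x : R[i] := cexp (iC * bD_ n * (x - z)%:C%C + iC / 2%:R * (bD_ n * b_ n)
  - iC / 2%:R * T2 (t_ n) - iC * x%:C%C * H (t_ n) + c').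
Let s_ n : R := (Num.sqrt (2 * dl n))^-1.
Let S := [set p : nat * R | - M <= p.2 <= M].

Let G_ n x := r_ n x * phi x (t_ n).
Let G'_ n x := r_ n x * ((iC * bD_ n - iC * H (t_ n)) * phi x (t_ n) + px x (t_ n)).

Let is_cd_r n x : is_cd (r_ n) x (r_ n x * (iC * bD_ n - iC * H (t_ n))).
Proof.
apply: is_cd_cexp.
have h1 : is_cd (fun x : R => x%:C%C) x 1 := is_cd_id x.
have h2 : is_cd (fun x : R => (x - z)%:C%C) x 1.
  rewrite (_ : (fun x => _) = fun x : R => x%:C%C + (- z%:C%C)); last by apply/funext => v; rewrite rmorphB.
  by rewrite -[1]addr0; apply: is_cdD; [exact: is_cd_id|exact: is_cd_cst].
have := is_cdD (is_cdB (is_cdB (is_cdD (is_cdZ (iC * bD_ n) h2)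
   (is_cd_cst (iC / 2%:R * (bD_ n * b_ n)) x)) (is_cd_cst (iC / 2%:R * T2 (t_ n)) x))
   (is_cdM (is_cdM (is_cd_cst iC x) h1) (is_cd_cst (H (t_ n)) x))) (is_cd_cst c' x).
by congr (is_cd _ _ _); rewrite /cst; ring.
Qed.

Let is_cd_G n x : is_cd (G_ n) x (G'_ n x).
Proof.
have := is_cdM (is_cd_r n x) (tst_x tst x (t_ n)); congr (is_cd _ _ _).
by rewrite /G'_; ring.
Qed.

Let cG' n v : ccont (G'_ n) v.
Proof.
have h1 := is_cd_ccont (is_cd_r n v); have h2 := jcont1 (t_ n) v (tst_c tst).
have h3 := jcont1 (t_ n) v (tst_cx tst).
by rewrite /G'_; ccont_step.
Qed.

Let bseq (u : nat -> R[i]) l : cpart_cvg u l -> cbnd S (fun p => u p.1).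
Proof. by move=> /cpart_cvg_bounded[C hC]; exists C => p _; exact: hC. Qed.

Let bx (w : R) : cbnd S (fun p => (p.2 - w)%:C%C).
Proof.
apply: (cbnd_real (C := M + `|w|)) => p Sp.
by rewrite (le_trans (ler_normB _ _))// lerD2r ler_norml.
Qed.
Let bx0 : cbnd S (fun p => p.2%:C%C).
Proof. by have := bx 0; congr (cbnd S _); apply/funext => p; rewrite subr0. Qed.

Let bphi (f : R -> R -> R[i]) : jcont f -> cbnd S (fun p => f p.2 (t_ p.1)).
Proof.
move=> /(jcont_cbnd (- M) M tau (tau + 1))[C hC]; exists C => p Sp.
apply: (hC (p.2, t_ p.1)); split => //=; rewrite /t_.
by have /andP[d0 d1] := dl0 p.1; rewrite lerDl (ltW d0) lerD2l.
Qed.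

Let br : cbnd S (fun p => r_ p.1 p.2).
Proof.
have h1 := bseq bc; have h2 := bseq bDc; have h3 := bseq Hc; have h4 := bseq T2c.
have h5 := bx z; have h6 := bx0.
by rewrite /r_; cbnd_step.
Qed.

Let bG' : cbnd S (fun p => G'_ p.1 p.2).
Proof.
have h1 := br; have h2 := bseq bDc; have h3 := bseq Hc.
have h4 := bphi (tst_c tst); have h5 := bphi (tst_cx tst).
by rewrite /G'_; cbnd_step.
Qed.

Let G'c x : cpart_cvg (fun n => G'_ n x) (W * px x tau).
Proof.
have h1 := bc; have h2 := bDc; have h3 := Hc; have h4 := T2c; have h5 := phic x; have h6 := pxc x.
have : cpart_cvg (fun n => G'_ n x)
   (cexp (iC * H tau * (x - z)%:C%C + iC / 2%:R * (H tau * 0)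
  - iC / 2%:R * T2 tau - iC * x%:C%C * H tau + c')
   * ((iC * H tau - iC * H tau) * phi x tau + px x tau)).
  by rewrite /G'_ /r_; ccvg_step.
congr (cpart_cvg _ _); rewrite subrr mul0r add0r; congr (cexp _ * _).
by rewrite rmorphB/=; ring.
Qed.

Section Limit.
Variable E : R -> R[i].
Hypotheses (E0 : E 0 = 0) (dE : forall t, is_cd E t (cexp (iC * (t ^+ 2)%:C%C))).

Let kk : R[i] := k0 * (Num.sqrt 2)%:C%C.
Let P_ n x := kk * E (s_ n * (x - z)).
Let P'_ n x := kk * ((s_ n)%:C%C * cexp (iC * ((s_ n * (x - z)) ^+ 2)%:C%C)).

Let dxz (k x : R) : is_derive x (1:R) (fun x : R => k * (x - z)) k.
Proof.
have h := @is_deriveZ _ _ _ (fun x : R => x - z) k x 1 _ (is_deriveB (is_derive_id x (1:R)) (is_derive_cst z x 1)).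
by apply: (@is_derive_eq _ _ _ _ _ _ _ _ h); rewrite /GRing.scale/= subr0 mulr1.
Qed.

Let is_cd_P n x : is_cd (P_ n) x (P'_ n x).
Proof. by apply: is_cdZ; apply: (is_cd_comp (dE _)); exact: dxz. Qed.

Let s_gt0 n : 0 < s_ n.
Proof. by rewrite invr_gt0 sqrtr_gt0 mulr_gt0//; case/andP: (dl0 n). Qed.

Let PG n x : P'_ n x * G_ n x = G x (t_ n) * phi x (t_ n).
Proof.
have D0 : 0 < dl n by case/andP: (dl0 n).
have s2 : s_ n ^+ 2 = 2^-1 * (dl n)^-1.
  by rewrite exprVn sqr_sqrtr ?invfM// mulr_ge0// ltW.
have es : Num.sqrt 2 * s_ n = expR (- (2^-1 * ln (dl n))).
  rewrite /s_ sqrtrM// invfM mulrA divff ?mul1r; last by rewrite gt_eqF// sqrtr_gt0.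
  rewrite expRN; congr (_^-1); apply/eqP; rewrite -(@eqrXn2 _ 2%N) ?expR_ge0 ?sqrtr_ge0//.
  by rewrite sqr_sqrtr ?(ltW D0)// -expRM_natl -mulr_natl mulVKf// lnK.
rewrite /G_ mulrA; congr (_ * _).
have -> : kk * ((s_ n)%:C%C * cexp (iC * ((s_ n * (x - z)) ^+ 2)%:C%C)) * r_ n x =
  k0 * ((Num.sqrt 2)%:C%C * (s_ n)%:C%C) * (cexp (iC * ((s_ n * (x - z)) ^+ 2)%:C%C) * r_ n x).
  by rewrite /kk; ring.
rewrite -[(Num.sqrt 2)%:C%C * _]rmorphM/= es -cexp_real /r_ -(mulrA k0) -cexpD -cexpD /gker /gk -(mulrA k0) -cexpD.
have -> : t_ n - tau = dl n by rewrite /t_ addrC addKr.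
congr (_ * cexp _); rewrite exprMn s2 /bD_ /b_.
have -> : (2^-1 * (dl n)^-1 * (x - z) ^+ 2)%:C%C = 2%:R^-1 * ((dl n)^-1)%:C%C * (x - z)%:C%C ^+ 2 :> R[i].
  by rewrite rmorphM rmorphM rmorphXn fmorphV rmorph_nat.
rewrite (_ : T1 (t_ n) + x%:C%C - (T1 tau + z%:C%C) = (T1 (t_ n) - T1 tau) + (x - z)%:C%C); last by rewrite rmorphB/=; ring.
move: (dl n)^-1%:C%C (x - z)%:C%C (T1 (t_ n) - T1 tau) => u v w; field; rewrite //.
Qed.

Let ibp n : lintegral `[- M, M] (fun x => G x (t_ n) * phi x (t_ n)) =
  - lintegral `[- M, M] (fun x => P_ n x * G'_ n x).
Proof.
have cr v : ccont (G_ n) v := is_cd_ccont (is_cd_G n v).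
have cP v : ccont (P_ n) v := is_cd_ccont (is_cd_P n v).
have cP' v : ccont (P'_ n) v.
  have h : ccont (fun x => cexp (iC * ((s_ n * (x - z)) ^+ 2)%:C%C)) v.
    apply: (is_cd_ccont (a := _)); apply: is_cd_cexp; apply: is_cdZ.
    have h' : is_derive v (1:R) (fun x => (s_ n * (x - z)) ^+ 2) _ := (@is_derive1_comp _ (fun x => x ^+ 2) (fun x => s_ n * (x - z)) v _ _ (is_derive_sqr _) (dxz (s_ n) v)); exact: (is_cd_real h').
  by rewrite /P'_; ccont_step.
have c1 v : ccont (fun x => P'_ n x * G_ n x) v by have h1 := cP' v; have h2 := cr v; ccont_step.
have c2 v : ccont (fun x => P_ n x * G'_ n x) v by have h1 := cP v; have h2 := cG' n v; ccont_step.
have ci (f : R -> R[i]) : (forall v, ccont f v) -> cintg lebesgue_measure `[- M, M] f.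
  by move=> cf; apply: cbnd_cintg; [exact: ccont_measurable|exact: itv_cbnd].
have e : lintegral `[- M, M] (fun x => P'_ n x * G_ n x + P_ n x * G'_ n x) = 0.
  transitivity (P_ n M * G_ n M - P_ n (- M) * G_ n (- M)).
    apply: (cFTC MM (F := fun x => P_ n x * G_ n x)) => v _; last exact: ccontD.
    exact: is_cdM (is_cd_P n v) (is_cd_G n v).
  by rewrite /G_ !(tst_0 tst) ?normrN ?ger0_norm// !mulr0 subrr.
have e2 : lintegral `[- M, M] (fun x => P'_ n x * G_ n x + P_ n x * G'_ n x) =
  lintegral `[- M, M] (fun x => P'_ n x * G_ n x) + lintegral `[- M, M] (fun x => P_ n x * G'_ n x).
  exact: (cintD _ (ci _ c1) (ci _ c2)).
transitivity (lintegral `[- M, M] (fun x => P'_ n x * G_ n x)).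
  by apply: eq_cint => x _; rewrite PG.
by apply/eqP; rewrite -addr_eq0 -e2 e.
Qed.

Let Pc x : cpart_cvg (fun n => P_ n x) (kk * fresnel_lim * (Num.sg (x - z))%:C%C).
Proof.
have [->|xz] := eqVneq x z.
  rewrite subrr sgr0 mulr0 (_ : (fun n => _) = cst 0); first exact: cpart_cvg_cst.
  by apply/funext => n; rewrite /P_ subrr mulr0 E0 mulr0.
have nxz : 0 < `|x - z| by rewrite normr_gt0 subr_eq0.
have Es n : E (s_ n * (x - z)) = (Num.sg (x - z))%:C%C * E (s_ n * `|x - z|).
  have [h|h] := ltP 0 (x - z); first by rewrite gtr0_sg// mul1r gtr0_norm.
  have h' : x - z < 0 by rewrite lt_neqAle subr_eq0 xz.
  by rewrite ltr0_sg// ltr0_norm// mulrN (fresnel_odd E0 dE) rmorphN mulN1r opprK.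
rewrite mulrC; rewrite (_ : (fun n => _) = fun n => (Num.sg (x - z))%:C%C * (kk * E (s_ n * `|x - z|))); last first.
  by apply/funext => n; rewrite /P_ Es; ring.
apply: cpart_cvgM; first exact: cpart_cvg_cst.
apply: cpart_cvgM; first exact: cpart_cvg_cst.
pose K : R := 5 * (3 + pi) / Num.sqrt (pi / 8).
apply: (cpart_cvg_le (e := fun n => K / `|x - z| * Num.sqrt (2 * dl n))).
  move=> n; have := fresnel_cvg E0 dE (mulr_gt0 (s_gt0 n) nxz).
  by rewrite invfM invrK mulrA -/K => h; rewrite (le_trans h)// -mulrA [_ * `|_|^-1]mulrC mulrA.
rewrite -(mulr0 (K / `|x - z|)); apply: cvgM; first exact: cvg_cst.
rewrite -(@sqrtr0 R) -(mulr0 2).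
have h : (fun n : nat => 2 * dl n) @ \oo --> (2 * 0 : R) by apply: cvgM => //; exact: cvg_cst.
exact: (cvg_comp (fun n => 2 * dl n) (@Num.sqrt R) h (@sqrt_continuous R (2 * 0))).
Qed.

Let bP : cbnd S (fun p => P_ p.1 p.2).
Proof.
exists (normc kk * (3 + pi)) => p _.
by rewrite Normc.normcM ler_wpM2l ?normc_ge0 ?fresnel_bounded.
Qed.

Let m_sg : cmeas (fun x : R => (Num.sg (x - z))%:C%C * px x tau).
Proof.
have mp : cmeas (px ^~ tau) by apply: ccont_measurable => v; exact: jcont1 (tst_cx tst).
apply: cmeasM => //.
rewrite (_ : (fun x => _) = fun x => if x <= z then (if z <= x then 0 else -1) else 1).
  by apply: cmeas_if; [exact: measurable_fun_ler|apply: cmeas_if; [exact: measurable_fun_ler|exact: cmeas_cst|exact: cmeas_cst]|exact: cmeas_cst].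
apply/funext => v; case: (ltgtP v z) => [h|h|->].
- by rewrite ltr0_sg ?subr_lt0// rmorphN rmorph1.
- by rewrite gtr0_sg// subr_gt0.
- by rewrite subrr sgr0.
Qed.

Let i_sg : @cintg R _ (measurableTypeR R) lebesgue_measure `[- M, M] (fun x : R => (Num.sg (x - z))%:C%C * px x tau).
Proof.
apply: cbnd_cintg; first exact: m_sg.
have [C hC] := itv_cbnd (fun v (_ : - M <= v <= M) => jcont1 tau v (tst_cx tst)).
exists C => v hv; rewrite Normc.normcM normc_real -[C]mul1r ler_pM ?normc_ge0 ?hC//.
by rewrite normr_sg lern1 leq_b1.
Qed.

Let sg_int : lintegral `[- M, M] (fun x : R => (Num.sg (x - z))%:C%C * px x tau) = - (2%:R * phi z tau).
Proof.
have mp : cmeas (px ^~ tau) by apply: ccont_measurable => v; exact: jcont1 (tst_cx tst).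
have ip (a b : R) : cintg lebesgue_measure `[a, b] (px ^~ tau).
  by apply: cbnd_cintg => //; apply: itv_cbnd => v _; exact: jcont1 (tst_cx tst).
have FT (a b : R) : a <= b -> lintegral `[a, b] (px ^~ tau) = phi b tau - phi a tau.
  by move=> ab; apply: (cFTC ab (F := phi ^~ tau)) => v _; [exact: tst_x tst _ _|exact: jcont1 (tst_cx tst)].
have mz : measurable_fun setT (fun x : R => x <= z) by exact: measurable_fun_ler.
have zMM : - M <= z <= M by rewrite -ler_norml.
have [zM1 zM2] : - M <= z /\ z <= M by apply/andP.
pose f x := if x <= z then px x tau else 0.
have mf : cmeas f by apply: cmeas_if; [exact: mz|exact: mp|exact: cmeas_cst].
have if_ : cintg lebesgue_measure `[- M, M] f.
  apply: cbnd_cintg => //; have [C hC] := itv_cbnd (fun v (_ : - M <= v <= M) => jcont1 tau v (tst_cx tst)).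
  exists (Num.max C 0) => v hv; rewrite /f le_max; case: ifP => _; first by rewrite hC.
  by rewrite Normc.normc0 lexx orbT.
have intf : lintegral `[- M, M] f = lintegral `[- M, z] (px ^~ tau).
  rewrite /lintegral [LHS]cint_mkcond [RHS]cint_mkcond; apply: eq_cint => v _.
  rewrite /f !mem_setE !in_itv/=; case: (leP v z) => vz; last by rewrite andbF if_same.
  by rewrite (le_trans vz zM2).
have e : lintegral `[- M, M] (fun x : R => (Num.sg (x - z))%:C%C * px x tau) =
         lintegral `[- M, M] (fun x => px x tau - 2%:R * f x).
  have m1 := m_sg.
  have m2 : cmeas (fun x => px x tau - 2%:R * f x) by cmeas_step.
  rewrite (lintegral_lebr _ _ m1) (lintegral_lebr _ _ m2).
  apply: ae_eq_cint => //; exists [set z]; split => //; first exact: lebr_null.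
  move=> v /=; apply: contra_notP => /eqP vz; rewrite /f; case: (ltgtP v z) => [h|h|h].
  - by rewrite ltr0_sg ?subr_lt0// rmorphN rmorph1; ring.
  - by rewrite gtr0_sg ?subr_gt0// rmorph1; ring.
  - by rewrite h eqxx in vz.
rewrite e.
have -> : lintegral `[- M, M] (fun x => px x tau - 2%:R * f x) =
   lintegral `[- M, M] (px ^~ tau) - 2%:R * lintegral `[- M, M] f.
  transitivity (lintegral `[- M, M] (px ^~ tau) - lintegral `[- M, M] (fun x => 2%:R * f x)).
    exact: (cintB _ (ip _ _) (cintgZ _ _ if_)).
  by congr (_ - _); exact: cintZ.
rewrite intf !FT// !(tst_0 tst tau (x := M)) ?(tst_0 tst tau (x := - M)) ?normrN ?ger0_norm//.
by rewrite !subr0 sub0r.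
Qed.

Lemma delta_limit_E : cpart_cvg (fun n => lintegral `[- M, M] (fun x => G x (t_ n) * phi x (t_ n)))
  (phi z tau * W).
Proof.
rewrite (_ : (fun n => _) = fun n => - lintegral `[- M, M] (fun x => P_ n x * G'_ n x)); last first.
  by apply/funext => n; exact: ibp.
have -> : phi z tau * W = - lintegral `[- M, M] (fun x : R => kk * fresnel_lim * (Num.sg (x - z))%:C%C * (W * px x tau)).
  transitivity (- (kk * fresnel_lim * W * lintegral `[- M, M] (fun x : R => (Num.sg (x - z))%:C%C * px x tau))).
    rewrite sg_int; have := @k0_fresnel R; rewrite -/kk => h.
    transitivity (phi z tau * W * (2%:R * (kk * fresnel_lim))); first by rewrite h mulr1.
    by rewrite mulrN opprK; move: kk => k; ring.
  congr (- _); transitivity (lintegral `[- M, M] (fun x : R => kk * fresnel_lim * W * ((Num.sg (x - z))%:C%C * px x tau))).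
    by symmetry; apply: (cintZ _ _ i_sg).
  by apply: eq_cint => x _; ring.
apply: cpart_cvgN.
have [C hC] := cbndM bP bG'.
apply: (lintegral_dominated (C := C)).
- move=> n; apply: ccont_measurable => v.
  have h1 := is_cd_ccont (is_cd_P n v); have h2 := cG' n v; ccont_step.
- rewrite (_ : (fun x => _) = fun x : R => kk * fresnel_lim * W * ((Num.sg (x - z))%:C%C * px x tau)).
    by apply: cmeasM; [exact: cmeas_cst|exact: m_sg].
  by apply/funext => x; ring.
- by move=> x _; apply: cpart_cvgM.
- by move=> n x xM; apply: (hC (n, x)).
Qed.
End Limit.

Lemma delta_limit :
  cpart_cvg (fun n => lintegral `[- M, M] (fun x => G x (tau + dl n) * phi x (tau + dl n)))
  (phi z tau * cexp (- (iC / 2%:R) * T2 tau - iC * z%:C%C * H tau + c')).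
Proof.
have [|E [E0 dE]] := @cprimitive_exists R (fun t => cexp (iC * (t ^+ 2)%:C%C)).
  move=> t; apply: (is_cd_ccont (a := _)); apply: is_cd_cexp; apply: is_cdZ.
  exact: (is_cd_real (is_derive_sqr t)).
exact: delta_limit_E E0 dE.
Qed.

End DeltaLimit.

(** * Densities of signed and complex measures *)

Section SumMeasure.
Context {R : realType} d {T : measurableType d}.
Variables (m1 m2 : {finite_measure set T -> \bar R}).

Definition madd := measure_add m1 m2.
HB.instance Definition _ := Measure.on madd.

Let madd_fin : fin_num_fun madd.
Proof. by move=> A mA; rewrite /madd measure_addE fin_numD !fin_num_measure. Qed.
HB.instance Definition _ := @Measure_isFinite.Build _ _ _ madd madd_fin.

Lemma le_maddl A : (m1 A <= madd A)%E.
Proof. by rewrite /madd measure_addE leeDl. Qed.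

Lemma le_maddr A : (m2 A <= madd A)%E.
Proof. by rewrite /madd measure_addE leeDr. Qed.
End SumMeasure.

Section Density.
Context {R : realType} d {T : measurableType d}.
Variables (mu nu : {finite_measure set T -> \bar R}).
Hypothesis le_mu_nu : forall A, measurable A -> (mu A <= nu A)%E.

Lemma density_exists : exists g : T -> R,
  [/\ measurable_fun setT g, forall x, 0 <= g x &
      forall h : T -> \bar R, measurable_fun setT h -> (forall x, 0 <= h x)%E ->
        (\int[nu]_x (h x * (g x)%:E) = \int[mu]_x h x)%E].
Proof.
have dom : mu `<< nu.
  apply/null_content_dominatesP => A mA A0.
  by apply/eqP; rewrite eq_le measure_ge0 andbT -A0 le_mu_nu.
pose f := Radon_Nikodym_SigmaFinite.f mu nu.
have f0 x : (0 <= f x)%E by exact: Radon_Nikodym_SigmaFinite.f_ge0.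
have ff x : f x \is a fin_num by exact: Radon_Nikodym_SigmaFinite.f_fin_num.
have mf : measurable_fun setT f.
  by have /integrableP[] := Radon_Nikodym_SigmaFinite.f_integrable dom.
exists (fine \o f); split.
- exact: measurableT_comp.
- by move=> x; exact: fine_ge0.
- move=> h mh h0; rewrite -(Radon_Nikodym_SigmaFinite.change_of_variables dom h0 measurableT mh).
  by apply: eq_integral => x _; rewrite /= fineK.
Qed.

Variable g : T -> R.
Hypotheses (mg : measurable_fun setT g) (g0 : forall x, 0 <= g x)
  (intg : forall h : T -> \bar R, measurable_fun setT h -> (forall x, 0 <= h x)%E ->
        (\int[nu]_x (h x * (g x)%:E) = \int[mu]_x h x)%E).

Let mgE : measurable_fun setT (EFin \o g). Proof. exact/measurable_EFinP. Qed.

Let dens_int (f : T -> R) (F : T -> R) : measurable_fun setT f ->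
  (forall x, `|f x| <= F x) -> nu.-integrable setT (fun x => (F x * g x)%:E) ->
  [/\ mu.-integrable setT (EFin \o f), nu.-integrable setT (EFin \o (fun x => f x * g x)) &
      Rintegral mu setT f = Rintegral nu setT (fun x => f x * g x)].
Proof.
move=> mf fF iF; have mfE : measurable_fun setT (EFin \o f) by exact/measurable_EFinP.
have mfg : measurable_fun setT (fun x => f x * g x) by exact: measurable_funM.
have i2 : nu.-integrable setT (EFin \o (fun x => f x * g x)).
  apply: le_integrable iF => //; first exact/measurable_EFinP.
  move=> x _ /=; rewrite lee_fin !normrM ler_wpM2r//.
  by rewrite (le_trans (fF x))// ler_norm.
have i1 : mu.-integrable setT (EFin \o f).
  apply/integrableP; split => //.
  rewrite -intg//; last exact: measurableT_comp.
  have /integrableP[_] := i2; congr (_ < _)%E; apply: eq_integral => x _ /=.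
  by rewrite normrM EFinM (ger0_norm (g0 x)).
split => //; rewrite /Rintegral; congr fine; rewrite integralE [RHS]integralE; congr (_ - _)%E.
  rewrite -intg//; last exact: measurable_funepos.
  by apply: eq_integral => x _; rewrite !funeposE /= maxe_pMl ?lee_fin// mul0e.
rewrite -intg//; last exact: measurable_funeneg.
apply: eq_integral => x _; rewrite !funenegE /=.
by rewrite maxe_pMl ?lee_fin// mul0e -EFinM mulNr.
Qed.

Lemma cint_density (f : T -> R[i]) : cmeas f ->
  nu.-integrable setT (fun x => (normc (f x) * g x)%:E) ->
  [/\ cintg mu setT f, cintg nu setT (fun x => f x * (g x)%:C%C) &
      cint mu setT f = cint nu setT (fun x => f x * (g x)%:C%C)].
Proof.
move=> [a b] iF.
have [h1 h2 h3] := dens_int a (fun x => Re_le_normc (f x)) iF.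
have [h4 h5 h6] := dens_int b (fun x => Im_le_normc (f x)) iF.
have eR : (fun x => Re (f x * (g x)%:C%C)) = fun x => Re (f x) * g x.
  by apply/funext => x; rewrite ReM/= mulr0 subr0.
have eI : (fun x => Im (f x * (g x)%:C%C)) = fun x => Im (f x) * g x.
  by apply/funext => x; rewrite ImM/= mulr0 add0r.
split; first by [].
  by split; rewrite ?eR ?eI.
by rewrite /cint eR eI h3 h6.
Qed.

End Density.

Section SetFunctionIntegral.
Context {R : realType} d {T : measurableType d}.
Variables (mu : {measure set T -> \bar R}) (v : set T -> \bar R).
Hypotheses (v0 : v set0 = 0%E) (le_mu_v : forall A, measurable A -> (mu A <= v A)%E).
Import HBNNSimple.

Let sintegralv (h : {nnsfun T >-> R}) :
  sintegral v h = (\sum_(x \in range h) x%:E * v (h @^-1` [set x]))%E.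
Proof.
rewrite /sintegral (fsbig_widen (range h) setT)//= => x [_ Nfx] /=.
by rewrite preimage10// v0 mule0.
Qed.

Lemma ge0_integral_le_setfun (f : T -> \bar R) : (forall x, 0 <= f x)%E ->
  (\int[mu]_x f x <= integral v setT f)%E.
Proof.
move=> f0; rewrite ge0_integralTE// /integral.
have -> : (f \_ setT)^\+%E = f.
  by apply/funext => x; rewrite patch_setT funeposE max_l.
have -> : (f \_ setT)^\-%E = cst 0%E.
  by apply/funext => x; rewrite patch_setT funenegE max_r// leeNl oppe0.
rewrite [X in (_ <= _ - X)%E](_ : _ = 0%E) ?sube0.
  apply: ub_ereal_sup => _ [h hf <-].
  apply: (@le_trans _ _ (sintegral v h)); last by apply: ereal_sup_ubound; exists h.
  rewrite sintegralE sintegralv; apply: lee_fsum; first exact: fimfunP.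
  move=> x [t _ <-]; apply: lee_wpmul2l; first by rewrite lee_fin.
  exact: le_mu_v.
apply/eqP; rewrite eq_le; apply/andP; split.
  apply: ub_ereal_sup => _ [h hf <-]; rewrite sintegralv fsbig1// => x [t _ <-].
  by rewrite (_ : h t = 0) ?mul0e//; apply/eqP; rewrite eq_le fun_ge0 andbT -lee_fin.
apply: ereal_sup_ubound; exists (cst_nnsfun T (@NngNum R 0 (lexx 0))) => //.
by rewrite sintegralv fsbig1// => x [t _ <-]; rewrite mul0e.
Qed.

End SetFunctionIntegral.

Section ChargeRepresentation.
Context {R : realType}.
Local Notation mR := (measurableTypeR R).
Implicit Types (m : signed_measure R).

Definition jpos m := jordan_pos (svalP (hahn_sets m)).
Definition jneg m := jordan_neg (svalP (hahn_sets m)).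
HB.instance Definition _ m := FiniteMeasure.on (jpos m).
HB.instance Definition _ m := FiniteMeasure.on (jneg m).

Definition represents (J : (R -> R[i]) -> R[i]) (nu : {finite_measure set mR -> \bar R})
    (rho : R -> R[i]) (r : R -> R) :=
  [/\ @cmeas R _ mR rho, @measurable_fun _ _ mR R setT r, forall x, normc (rho x) <= r x &
      forall f : R -> R[i], @cmeas R _ mR f ->
        nu.-integrable setT (fun x => (normc (f x) * r x)%:E) ->
        J f = cint nu setT (fun x => f x * rho x)].

Lemma charge_representation m (nu : {finite_measure set mR -> \bar R}) :
  (forall A, measurable A -> jpos m A <= nu A)%E ->
  (forall A, measurable A -> jneg m A <= nu A)%E ->
  exists gp gn : R -> R,
   [/\ @measurable_fun _ _ mR R setT gp /\ (forall x, 0 <= gp x), @measurable_fun _ _ mR R setT gn /\ (forall x, 0 <= gn x),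
      represents (charge_integral m) nu (fun x => (gp x - gn x)%:C%C) (fun x => gp x + gn x),
      forall h : mR -> \bar R, measurable_fun setT h -> (forall x, 0 <= h x)%E ->
        (\int[nu]_x (h x * (gp x)%:E) = \int[jpos m]_x h x)%E &
      forall h : mR -> \bar R, measurable_fun setT h -> (forall x, 0 <= h x)%E ->
        (\int[nu]_x (h x * (gn x)%:E) = \int[jneg m]_x h x)%E].
Proof.
move=> lp ln; have [gp [mp p0 ip]] := density_exists lp; have [gn [mn n0 in_]] := density_exists ln.
exists gp, gn; split; [by []|by []| |by []|by []]; split.
- by apply: cmeas_real; exact: measurable_funB.
- exact: measurable_funD.
- by move=> x; rewrite normc_real (le_trans (ler_normB _ _))// !ger0_norm.
- move=> f mf iF.
  have mnf := measurable_normc mf.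
  have sub (g : R -> R) : measurable_fun setT (g : mR -> R) -> (forall x, 0 <= g x <= gp x + gn x) ->
      nu.-integrable setT (fun x => (normc (f x) * g x)%:E).
    move=> mg g0; apply: le_integrable iF => //.
      by apply/measurable_EFinP; exact: measurable_funM.
    move=> x _ /=; rewrite lee_fin !normrM; have /andP[h1 h2] := g0 x.
    by rewrite ler_wpM2l// !ger0_norm// (le_trans h1).
  have [h1 h2 h3] := cint_density mp p0 ip mf (sub _ mp (fun x => introT andP (conj (p0 x) (ler_wpDr (n0 x) (lexx _))))).
  have [h4 h5 h6] := cint_density mn n0 in_ mf (sub _ mn (fun x => introT andP (conj (n0 x) (ler_wpDl (p0 x) (lexx _))))).
  transitivity (cint (jpos m) setT f - cint (jneg m) setT f); first by [].
  rewrite h3 h6 -cintB//; apply: eq_cint => x _; rewrite -mulrBr; congr (_ * _).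
  by rewrite rmorphB.
Qed.

Lemma jposE m A : measurable A -> jpos m A = m (A `&` (sval (hahn_sets m)).1).
Proof.
by move=> mA; rewrite /jpos jordan_posE cjordan_posE /crestr0 mem_set.
Qed.

Lemma jnegE m A : measurable A -> jneg m A = (- m (A `&` (sval (hahn_sets m)).2))%E.
Proof.
by move=> mA; rewrite /jneg jordan_negE cjordan_negE /crestr0 mem_set.
Qed.

Lemma hahn_sets_measurable m :
  measurable (sval (hahn_sets m)).1 /\ measurable (sval (hahn_sets m)).2.
Proof. by have [[a _] [b _] _ _] := svalP (hahn_sets m). Qed.

Section Variation.
Variable m : complex_measure R.

Lemma cmeasure_val0 : cmeasure_val m set0 = 0.
Proof. by rewrite /cmeasure_val !charge0. Qed.

Lemma le_cmeasure_variation (A E : set mR) : measurable A -> measurable E ->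
  ((normc (cmeasure_val m (A `&` E)))%:E <= cmeasure_variation m A)%E.
Proof.
move=> mA mE.
pose F (i : nat) : set mR := if i == 0%N then A `&` E else if i == 1%N then A `\` E else set0.
apply: (@le_trans _ _ (\sum_(0 <= i <oo) (normc (cmeasure_val m (F i)))%:E)%E).
  apply: le_trans (nneseries_lim_ge 1 _); first by rewrite big_nat1.
  by move=> i _ _; rewrite lee_fin normc_ge0.
apply: ereal_sup_ubound; exists F => //; split.
- move=> [|[|i]] //=; rewrite /F/=; [exact: measurableI|exact: measurableD|exact: measurable0].
- apply/trivIsetP => -[|[|i]] [|[|j]] // _ _ _; rewrite /F/= ?set0I ?setI0//.
    by apply/seteqP; split => // x [[_ ?] [_ ?]].
  by apply/seteqP; split => // x [[_ ?] [_ ?]].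
- apply/seteqP; split => [x [[|[|i]] _]|x Ax]; rewrite /F//=.
  + by case.
  + by case.
  + by have [Ex|Ex] := pselect (E x); [exists 0%N|exists 1%N].
Qed.

Lemma cmeasure_variation0 : cmeasure_variation m set0 = 0%E.
Proof.
apply/eqP; rewrite eq_le; apply/andP; split.
  apply: ub_ereal_sup => _ [F [mF tF F0] <-]; rewrite eseries0// => i _ _.
  have -> : F i = set0 by apply/seteqP; split => // x Fx; rewrite -F0; exists i.
  by rewrite cmeasure_val0 Normc.normc0.
have := le_cmeasure_variation measurable0 measurable0.
by rewrite setI0 cmeasure_val0 Normc.normc0.
Qed.

Lemma le_jordan_variation (A : set mR) : measurable A ->
  [/\ (jpos (re_measure m) A <= cmeasure_variation m A)%E,
      (jneg (re_measure m) A <= cmeasure_variation m A)%E,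
      (jpos (im_measure m) A <= cmeasure_variation m A)%E &
      (jneg (im_measure m) A <= cmeasure_variation m A)%E].
Proof.
move=> mA.
have [pr nr] := hahn_sets_measurable (re_measure m).
have [pi_ ni] := hahn_sets_measurable (im_measure m).
have key (mu : signed_measure R) (E : set mR) : measurable E ->
   (`|fine (mu (A `&` E))| <= normc (cmeasure_val m (A `&` E))) ->
   (mu (A `&` E) <= cmeasure_variation m A)%E /\ (- mu (A `&` E) <= cmeasure_variation m A)%E.
  move=> mE h; have mAE : measurable (A `&` E) by exact: measurableI.
  have f : mu (A `&` E) \is a fin_num by exact: fin_num_measure.
  rewrite -(fineK f) -EFinN; split; apply: le_trans (le_cmeasure_variation mA mE); rewrite lee_fin.
    exact: le_trans (ler_norm _) h.
  by apply: le_trans h; rewrite -normrN ler_norm.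
rewrite !jposE// !jnegE//; split.
- exact: (key _ _ pr (Re_le_normc (cmeasure_val m _))).1.
- exact: (key _ _ nr (Re_le_normc (cmeasure_val m _))).2.
- exact: (key _ _ pi_ (Im_le_normc (cmeasure_val m _))).1.
- exact: (key _ _ ni (Im_le_normc (cmeasure_val m _))).2.
Qed.

Lemma cmeasure_representation : all_exp_moments m ->
  exists (nu : {finite_measure set mR -> \bar R}) (rho : R -> R[i]) (r : R -> R),
    represents (cmeasure_integral m) nu rho r /\
    forall c : R, 0 < c -> (\int[nu]_x (expR (c * `|x|) * r x)%:E < +oo)%E.
Proof.
move=> hm.
pose nr := madd (jpos (re_measure m)) (jneg (re_measure m)).
pose ni := madd (jpos (im_measure m)) (jneg (im_measure m)).
pose nu := madd nr ni.
have l1 A : measurable A -> (jpos (re_measure m) A <= nu A)%E.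
  by move=> _; apply: le_trans (le_maddl _ _ _); exact: le_maddl.
have l2 A : measurable A -> (jneg (re_measure m) A <= nu A)%E.
  by move=> _; apply: le_trans (le_maddl _ _ _); exact: le_maddr.
have l3 A : measurable A -> (jpos (im_measure m) A <= nu A)%E.
  by move=> _; apply: le_trans (le_maddr _ _ _); exact: le_maddl.
have l4 A : measurable A -> (jneg (im_measure m) A <= nu A)%E.
  by move=> _; apply: le_trans (le_maddr _ _ _); exact: le_maddr.
have [p [n [[mp p0] [mn n0] [mrho mr rr rep] ip in_]]] := charge_representation l1 l2.
have [p' [n' [[mp' p0'] [mn' n0'] [mrho' mr' rr' rep'] ip' in_']]] := charge_representation l3 l4.
exists nu, (fun x => (p x - n x)%:C%C + iC * (p' x - n' x)%:C%C), (fun x => (p x + n x) + (p' x + n' x)).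
split; first split.
- by cmeas_step.
- exact: measurable_funD.
- move=> x; rewrite (le_trans (le_normcD _ _))// lerD//.
  by rewrite Normc.normcM normciC mul1r.
- move=> f mf iF.
  have mnf := measurable_normc mf.
  have sub (g : R -> R) : measurable_fun setT (g : mR -> R) ->
      (forall x, 0 <= g x <= (p x + n x) + (p' x + n' x)) ->
      nu.-integrable setT (fun x => (normc (f x) * g x)%:E).
    move=> mg g0; apply: le_integrable iF => //.
      by apply/measurable_EFinP; exact: measurable_funM.
    move=> x _ /=; rewrite lee_fin !normrM; have /andP[h1 h2] := g0 x.
    by rewrite ler_wpM2l// !ger0_norm// (le_trans h1).
  have i1 : nu.-integrable setT (fun x => (normc (f x) * (p x + n x))%:E).
    by apply: sub => // x; rewrite addr_ge0//= lerDl addr_ge0.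
  have i2 : nu.-integrable setT (fun x => (normc (f x) * (p' x + n' x))%:E).
    by apply: sub => // x; rewrite addr_ge0//= lerDr addr_ge0.
  have c1 : cintg nu setT (fun x => f x * (p x - n x)%:C%C).
    apply: (cintg_le _ _ i1); first by cmeas_step.
    by move=> x; rewrite Normc.normcM ler_wpM2l ?normc_ge0.
  have c2 : cintg nu setT (fun x => f x * (p' x - n' x)%:C%C).
    apply: (cintg_le _ _ i2); first by cmeas_step.
    by move=> x; rewrite Normc.normcM ler_wpM2l ?normc_ge0.
  rewrite /cmeasure_integral rep// rep'// -cintZ// -cintD//; last exact: cintgZ.
  by apply: eq_cint => x _; ring.
move=> c c0; pose h (x : mR) : \bar R := (expR (c * `|x|))%:E.
have mh : measurable_fun setT h.
  apply/measurable_EFinP.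
  apply: (@measurableT_comp _ _ _ _ _ _ (@expR R) _ (fun x : R => c * `|x|)) => //.
  by apply: measurable_funM => //; exact: (@normr_measurable R).
have h0 x : (0 <= h x)%E by rewrite lee_fin expR_ge0.
have fin (mu : {finite_measure set mR -> \bar R}) : (forall A, measurable A -> (mu A <= cmeasure_variation m A)%E) ->
    (\int[mu]_x h x < +oo)%E.
  move=> le; apply: le_lt_trans (hm c c0).
  exact: (ge0_integral_le_setfun cmeasure_variation0 le).
have mgp (g : mR -> R) : measurable_fun setT g -> measurable_fun setT (fun x => (h x * (g x)%:E)%E).
  by move=> mg; apply: emeasurable_funM => //; exact/measurable_EFinP.
have g0 (g : mR -> R) : (forall x, 0 <= g x) -> forall x, (0 <= h x * (g x)%:E)%E.
  by move=> g0 x; rewrite mule_ge0// lee_fin.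
rewrite (_ : \int[nu]_x _ = \int[nu]_x ((h x * (p x)%:E + h x * (n x)%:E) + (h x * (p' x)%:E + h x * (n' x)%:E)))%E; last first.
  by apply: eq_integral => x _; rewrite -!EFinM -!EFinD !mulrDr.
have e (g1 g2 : mR -> R) : measurable_fun setT g1 -> measurable_fun setT g2 ->
    (forall x, 0 <= g1 x) -> (forall x, 0 <= g2 x) ->
    (\int[nu]_x (h x * (g1 x)%:E + h x * (g2 x)%:E) = \int[nu]_x (h x * (g1 x)%:E) + \int[nu]_x (h x * (g2 x)%:E))%E.
  by move=> m1 m2 z1 z2; apply: ge0_integralD => //; [move=> x _; exact: g0|exact: mgp|move=> x _; exact: g0|exact: mgp].
rewrite ge0_integralD//; last 4 first.
- by move=> x _; rewrite adde_ge0 ?g0.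
- by apply: emeasurable_funD; exact: mgp.
- by move=> x _; rewrite adde_ge0 ?g0.
- by apply: emeasurable_funD; exact: mgp.
rewrite !e// ip// in_// ip'// in_'//.
have f1 : (\int[jpos (re_measure m)]_x h x < +oo)%E by apply: (fin (jpos _)) => A /le_jordan_variation[].
have f2 : (\int[jneg (re_measure m)]_x h x < +oo)%E by apply: (fin (jneg _)) => A /le_jordan_variation[].
have f3 : (\int[jpos (im_measure m)]_x h x < +oo)%E by apply: (fin (jpos _)) => A /le_jordan_variation[].
have f4 : (\int[jneg (im_measure m)]_x h x < +oo)%E by apply: (fin (jneg _)) => A /le_jordan_variation[].
by apply: lte_add_pinfty; apply: lte_add_pinfty.
Qed.
End Variation.

Lemma charge_bounded_representation m : bounded_support m ->
  exists (nu : {finite_measure set mR -> \bar R}) (rho : R -> R[i]) (r : R -> R) (M : R),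
    [/\ represents (charge_integral m) nu rho r, nu.-integrable setT (EFin \o r) &
        forall x, M < `|x| -> r x = 0].
Proof.
move=> [M hM].
pose nu := madd (jpos m) (jneg m).
have l1 A : measurable A -> (jpos m A <= nu A)%E by move=> _; exact: le_maddl.
have l2 A : measurable A -> (jneg m A <= nu A)%E by move=> _; exact: le_maddr.
have [p [n [[mp p0] [mn n0] [mrho mr rr rep] ip in_]]] := charge_representation l1 l2.
pose I (x : R) : bool := `|x| <= M.
have mI : @measurable_fun _ _ mR bool setT I.
  by apply: measurable_fun_ler => //; exact: (@normr_measurable R).
exists nu, (fun x => if I x then (p x - n x)%:C%C else 0), (fun x => if I x then p x + n x else 0), M.
have mrho' : @cmeas R _ mR (fun x => if I x then (p x - n x)%:C%C else 0).
  by apply: cmeas_if; [exact: mI|exact: mrho|exact: cmeas_cst].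
have mr' : @measurable_fun _ _ mR R setT (fun x => if I x then p x + n x else 0).
  exact: measurable_fun_ifT.
have jp0 A : measurable A -> (forall x : R, A x -> M < `|x|) -> jpos m A = 0%E.
  move=> mA hA; rewrite jposE// hM//; last by move=> x [/hA].
  by apply: measurableI => //; case: (hahn_sets_measurable m).
have jn0 A : measurable A -> (forall x : R, A x -> M < `|x|) -> jneg m A = 0%E.
  move=> mA hA; rewrite jnegE// hM ?oppe0//; last by move=> x [/hA].
  by apply: measurableI => //; case: (hahn_sets_measurable m).
have mNI : measurable [set x : mR | ~~ I x].
  rewrite (_ : [set x : mR | ~~ I x] = ~` (I @^-1` [set true])).
    by apply: measurableC; rewrite -[X in measurable X]setTI; exact: mI.
  by apply/seteqP; split => x /=; case: (I x).
have NI x : ~~ I x -> M < `|x| by rewrite /I -ltNge.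
split; last by move=> x; rewrite /I ltNge => /negbTE ->.
- split => //.
    by move=> x; case: ifP => _ //; rewrite Normc.normc0.
  move=> f mf iF.
  have mfI : @cmeas R _ mR (fun x => if I x then f x else 0).
    by apply: cmeas_if; [exact: mI|exact: mf|exact: cmeas_cst].
  have e (mu : {finite_measure set mR -> \bar R}) : mu [set x | ~~ I x] = 0%E ->
      cint mu setT f = cint mu setT (fun x => if I x then f x else 0).
    move=> mu0; apply: ae_eq_cint => //; exists [set x | ~~ I x]; split => // x /=.
    by apply: contra_notN => ->.
  transitivity (charge_integral m (fun x => if I x then f x else 0)).
    congr (_ - _).
      by apply: (e (jpos m)); exact: jp0.
    by apply: (e (jneg m)); exact: jn0.
  rewrite rep//.
    by apply: eq_cint => x _; case: ifP => _ //; rewrite mul0r mulr0.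
  move: iF; apply: eq_integrable => // x _; case: ifP => _ //.
  by rewrite Normc.normc0 mul0r mulr0.
- have ir : nu.-integrable setT (EFin \o (fun x => p x + n x)).
    apply/integrableP; split; first exact/measurable_EFinP.
    have e : (\int[nu]_x `|(p x + n x)%:E| = \int[nu]_x (1 * (p x)%:E) + \int[nu]_x (1 * (n x)%:E))%E.
      rewrite -ge0_integralD//; last 4 first.
      + by move=> x _; rewrite mul1e lee_fin.
      + by under eq_fun do rewrite mul1e; exact/measurable_EFinP.
      + by move=> x _; rewrite mul1e lee_fin.
      + by under eq_fun do rewrite mul1e; exact/measurable_EFinP.
      by apply: eq_integral => x _; rewrite !mul1e /= ger0_norm ?addr_ge0.
    rewrite e (ip (cst 1%E))// (in_ (cst 1%E))// !integral_cst// !mul1e.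
    by rewrite lte_add_pinfty// ltey_eq fin_num_measure.
  apply: le_integrable ir => //; first exact/measurable_EFinP.
  move=> x _ /=; rewrite lee_fin; case: ifP => _ //.
  by rewrite normr0.
Qed.

End ChargeRepresentation.

(** * Paths with point interactions and kicks *)

Section Paths.
Context {R : realType}.
Implicit Types (p q w : R * R) (u v : seq (R * R)).

Fixpoint pre {K : comPzRingType} (g : R * R -> R * R -> K) p u : K :=
  if u is p' :: u' then g p p' * pre g p' u' else 1.

Definition chain {K : comPzRingType} (g : R * R -> R * R -> K) p u q : K :=
  pre g p u * g (last p u) q.

Lemma chain_cons {K : comPzRingType} (g : R * R -> R * R -> K) p p' u q :
  chain g p (p' :: u) q = g p p' * chain g p' u q.
Proof. by rewrite /chain /= mulrA. Qed.

Lemma pre_rcons {K : comPzRingType} (g : R * R -> R * R -> K) p u p' :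
  pre g p (rcons u p') = chain g p u p'.
Proof.
rewrite /chain; elim: u p => [|p1 u IH] p /=; first by rewrite mulr1 mul1r.
by rewrite IH mulrA.
Qed.

Lemma chain_rcons {K : comPzRingType} (g : R * R -> R * R -> K) p u p' q :
  chain g p (rcons u p') q = chain g p u p' * g p' q.
Proof. by rewrite {1}/chain pre_rcons last_rcons. Qed.

Definition forward {K : comPzRingType} (g : R * R -> R * R -> K) :=
  forall p q, q.1 <= p.1 -> g p q = 0.

Lemma chain_forward {K : comPzRingType} (g : R * R -> R * R -> K) p u q :
  forward g -> q.1 <= p.1 -> chain g p u q = 0.
Proof.
move=> fg; elim: u p => [|p' u IH] p qp; first by rewrite /chain /= fg ?mulr0.
rewrite chain_cons; have [pp'|p'p] := ltP p.1 p'.1; last by rewrite fg ?mul0r.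
by rewrite IH ?mulr0// (le_trans qp)// ltW.
Qed.

Lemma eq_chain {K : comPzRingType} (g g' : R * R -> R * R -> K) p u q :
  forward g -> forward g' ->
  (forall a b, p.1 <= a.1 -> a.1 < b.1 -> b.1 <= q.1 -> g a b = g' a b) ->
  chain g p u q = chain g' p u q.
Proof.
move=> fg fg'.
have gen u' p' : p.1 <= p'.1 ->
   (forall a b, p.1 <= a.1 -> a.1 < b.1 -> b.1 <= q.1 -> g a b = g' a b) ->
   chain g p' u' q = chain g' p' u' q; last by move=> h; apply: gen.
elim: u' p' => [|p1 u' IH] p' pp' h.
  rewrite /chain /= !mul1r; have [?|?] := leP q.1 p'.1; first by rewrite fg// fg'.
  by apply: h.
rewrite !chain_cons; have [qp1|p1q] := leP q.1 p1.1; first by rewrite !chain_forward ?mulr0.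
have [p1p|p'p1] := leP p1.1 p'.1; first by rewrite fg// fg'// !mul0r.
by rewrite h ?(ltW p1q)// IH// (le_trans pp')// ltW.
Qed.

(* Points are pairs (time, position).  A path is given by its list u of point
   interactions (tau_j, x_j), its list v of kicks (s_l, alpha_l) and its end
   point q; h is theta, Th1 and Th2 are primitives of theta and theta^2.  Then
   path u v q is T Phi_(n,k) times the gauge factor of K, see TPhi_path, and
   vanishes unless the times in u increase strictly from t0 to q.1. *)
Variables (Th1 Th2 h hd : R -> R[i]) (t0 y : R).

Definition ov (s a b : R) : R := Num.max (b - s) 0 - Num.max (a - s) 0.

Definition segA v p q : R[i] :=
  Th1 q.1 - Th1 p.1 + iC * (\sum_(w <- v) w.2 * ov w.1 p.1 q.1)%:C%C + (q.2 - p.2)%:C%C.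

Definition seg v p q : R[i] :=
  if p.1 < q.1 then gk (q.1 - p.1) (segA v p q) else 0.

Definition phase v q : R[i] :=
  (q.2 * \sum_(w <- v) w.2)%:C%C - iC * q.2%:C%C * h q.1 + iC * y%:C%C * h t0
  - iC / 2%:R * (Th2 q.1 - Th2 t0)
  + \sum_(w <- v) w.2%:C%C * (Th1 q.1 - Th1 w.1)
  + iC / 2%:R * (\sum_(w <- v) \sum_(w' <- v) w.2 * w'.2 * (q.1 - Num.max w.1 w'.1))%:C%C.

Definition path u v q : R[i] := cexp (phase v q) * chain (seg v) (t0, y) u q.

Lemma seg_forward v : forward (seg v).
Proof. by move=> p q qp; rewrite /seg ltNge qp. Qed.

Lemma perm_seg v v' p q : perm_eq v v' -> seg v p q = seg v' p q.
Proof. by move=> vv'; rewrite /seg /segA (perm_big _ vv'). Qed.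

Lemma perm_phase v v' q : perm_eq v v' -> phase v q = phase v' q.
Proof.
move=> vv'; rewrite /phase !(perm_big _ vv')/=; congr (_ + _ * (_)%:C%C).
by apply: eq_bigr => w _; rewrite (perm_big _ vv').
Qed.

Lemma perm_path u v v' q : perm_eq v v' -> path u v q = path u v' q.
Proof.
move=> vv'; rewrite /path (perm_phase _ vv'); congr (_ * _).
apply: eq_chain; try exact: seg_forward.
by move=> a b _ _ _; exact: perm_seg.
Qed.

Lemma path_kick u w v x : path u (w :: v) (w.1, x) =
  if all (fun w' => w'.1 <= w.1) v then (expR (w.2 * x))%:C%C * path u v (w.1, x)
  else path u (w :: v) (w.1, x).
Proof.
case: ifP => // /allP le_w.
rewrite /path mulrA; congr (_ * _).
  rewrite -cexp_real -cexpD; congr cexp.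
  rewrite /phase !big_cons/= subrr mulr0 add0r.
  have -> : \sum_(w' <- v) w.2 * w'.2 * (w.1 - Num.max w.1 w'.1) = 0.
    by apply: big1_seq => w' /andP[_ /le_w ww']; rewrite max_l// subrr mulr0.
  have -> : \sum_(i <- v) \sum_(w' <- w :: v) i.2 * w'.2 * (w.1 - Num.max i.1 w'.1) =
            \sum_(i <- v) \sum_(w' <- v) i.2 * w'.2 * (w.1 - Num.max i.1 w'.1).
    apply: eq_big_seq => i /le_w iw; rewrite big_cons max_r// subrr mulr0 add0r//.
  by rewrite maxxx subrr !mulr0 !add0r mulrDr [(x * _ + _)%:C%C]rmorphD/= [w.2 * x]mulrC; ring.
apply: eq_chain; try exact: seg_forward.
move=> a b _ ab bw; rewrite /seg ab; congr (gk _ _); rewrite /segA big_cons.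
have -> : ov w.1 a.1 b.1 = 0.
  by rewrite /ov /= !max_r ?subrr// subr_le0// (le_trans (ltW ab)).
by rewrite mulr0 add0r.
Qed.

Section AfterLastKick.
Variable v : seq (R * R).
Let a : R := \sum_(w <- v) w.2.

Definition kick_H (t : R) : R[i] := h t + iC * a%:C%C.
Definition kick_T1 (t : R) : R[i] := Th1 t + iC * (a * t)%:C%C.
Definition kick_T2 (t : R) : R[i] := Th2 t + 2%:R * iC * a%:C%C * Th1 t - (a ^+ 2 * t)%:C%C.
Definition kick_c p : R[i] :=
  Th1 p.1 + p.2%:C%C + iC * (\sum_(w <- v) w.2 * Num.max w.1 p.1)%:C%C.
Definition kick_c' : R[i] :=
  iC * y%:C%C * h t0 + iC / 2%:R * Th2 t0 - \sum_(w <- v) w.2%:C%C * Th1 w.1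
  - iC / 2%:R * (\sum_(w <- v) \sum_(w' <- v) w.2 * w'.2 * Num.max w.1 w'.1)%:C%C.

Hypotheses (dTh1 : forall t, is_cd Th1 t (h t)) (dTh2 : forall t, is_cd Th2 t (h t ^+ 2))
  (dh : forall t, is_cd h t (hd t)).

Lemma is_cd_kick_H t : is_cd kick_H t (hd t).
Proof. by rewrite -[hd t]addr0; apply: is_cdD => //; exact: is_cd_cst. Qed.

Lemma is_cd_kick_T1 t : is_cd kick_T1 t (kick_H t).
Proof.
apply: is_cdD => //; apply: is_cdZ.
exact: is_cd_real (is_derive_scale a t).
Qed.

Lemma is_cd_kick_T2 t : is_cd kick_T2 t (kick_H t ^+ 2).
Proof.
have -> : kick_H t ^+ 2 = h t ^+ 2 + 2%:R * iC * a%:C%C * h t - (a ^+ 2)%:C%C.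
  rewrite /kick_H sqrrD rmorphXn/= exprMn [iC ^+ 2]expr2 iC2 mulN1r -mulr_natl; ring.
apply: is_cdB; first by apply: is_cdD => //; exact: is_cdZ.
exact: is_cd_real (is_derive_scale (a ^+ 2) t).
Qed.

Lemma phase_kick q : phase v q =
  - (iC / 2%:R) * kick_T2 q.1 - iC * q.2%:C%C * kick_H q.1 + kick_c'.
Proof.
have e1 : \sum_(w <- v) w.2%:C%C * (Th1 q.1 - Th1 w.1) =
          a%:C%C * Th1 q.1 - \sum_(w <- v) w.2%:C%C * Th1 w.1.
  under eq_bigr do rewrite mulrBr; rewrite sumrB; congr (_ - _).
  by rewrite -mulr_suml /a rmorph_sum.
have e2 : \sum_(w <- v) \sum_(w' <- v) w.2 * w'.2 * (q.1 - Num.max w.1 w'.1) =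
   a ^+ 2 * q.1 - \sum_(w <- v) \sum_(w' <- v) w.2 * w'.2 * Num.max w.1 w'.1.
  under eq_bigr do (under eq_bigr do rewrite mulrBr; rewrite sumrB); rewrite sumrB; congr (_ - _).
  rewrite expr2 /a !mulr_suml; apply: eq_bigr => w _.
  by rewrite mulr_sumr mulr_suml.
have n2 : (2%:R : R[i]) != 0 by rewrite pnatr_eq0.
rewrite /phase -/a e1 e2 /kick_T2 /kick_H /kick_c' rmorphB/= [(q.2 * a)%:C%C]rmorphM/=.
move: (\sum_(w <- v) \sum_(w' <- v) _)%:C%C (a ^+ 2 * q.1)%:C%C => S A.
move: (\sum_(w <- v) _) a%:C%C q.2%:C%C y%:C%C => B a' x' y'.
have i2 := @iC2 R.
transitivity (x' * a' - iC * x' * h q.1 + iC * y' * h t0 - iC / 2%:R * (Th2 q.1 - Th2 t0) +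
  (a' * Th1 q.1 - B) + iC / 2%:R * (A - S) - (iC * iC + 1) * (a' * Th1 q.1 + x' * a')); last by field.
by rewrite i2 addNr mul0r subr0.
Qed.

Lemma seg_kick p q : all (fun w => w.1 <= q.1) v -> p.1 < q.1 ->
  seg v p q = gk (q.1 - p.1) (kick_T1 q.1 + q.2%:C%C - kick_c p).
Proof.
move=> /allP vq pq; rewrite /seg pq; congr gk; rewrite /segA /kick_T1 /kick_c.
have -> : \sum_(w <- v) w.2 * ov w.1 p.1 q.1 = a * q.1 - \sum_(w <- v) w.2 * Num.max w.1 p.1.
  rewrite /a mulr_suml -sumrB; apply: eq_big_seq => w /vq wq; rewrite -mulrBr; congr (_ * _).
  rewrite /ov max_l ?subr_ge0//; have [h1|h1] := leP p.1 w.1.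
    by rewrite max_r ?subr_le0//; ring.
  by rewrite max_l ?subr_ge0 ?(ltW h1)//; ring.
by rewrite !rmorphB/=; ring.
Qed.

Lemma path_gker u q : all (fun w => w.1 <= q.1) v -> (last (t0, y) u).1 < q.1 ->
  path u v q = pre (seg v) (t0, y) u *
    gker kick_H kick_T1 kick_T2 (last (t0, y) u).1 (kick_c (last (t0, y) u)) kick_c' q.2 q.1.
Proof.
move=> vq uq; rewrite /path /chain seg_kick// phase_kick /gker.
by rewrite mulrCA [cexp _ * gk _ _]mulrC.
Qed.

Lemma kick_c_last p : all (fun w => w.1 <= p.1) v -> kick_c p = kick_T1 p.1 + p.2%:C%C.
Proof.
move=> /allP vp; rewrite /kick_c /kick_T1 addrAC; congr (_ + _ * (_)%:C%C + _).
by rewrite /a mulr_suml; apply: eq_big_seq => w /vp wp; rewrite max_r.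
Qed.

End AfterLastKick.
End Paths.

(** * Bounds on paths *)

Section PathBound.
Context {R : realType}.
Implicit Types (p q w : R * R) (u v : seq (R * R)).

Definition dk p q : R := (Num.sqrt (q.1 - p.1))^-1.

Lemma dk_ge0 p q : 0 <= dk p q.
Proof. by rewrite invr_ge0 sqrtr_ge0. Qed.

Lemma dk_forward : forward dk.
Proof. by move=> p q qp; rewrite /dk ler0_sqrtr ?invr0// subr_le0. Qed.

Lemma dkE p q : p.1 < q.1 -> expR (- (2^-1 * ln (q.1 - p.1))) = dk p q.
Proof.
move=> pq; have D0 : 0 < q.1 - p.1 by rewrite subr_gt0.
rewrite expRN; congr (_^-1); apply/eqP; rewrite -(@eqrXn2 _ 2%N) ?expR_ge0 ?sqrtr_ge0//.
by rewrite sqr_sqrtr ?(ltW D0)// -expRM_natl -mulr_natl mulVKf// lnK.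
Qed.

Lemma chain_dk_ge0 p u q : 0 <= chain dk p u q.
Proof.
elim: u p => [|p' u IH] p; first by rewrite /chain/= mul1r dk_ge0.
by rewrite chain_cons mulr_ge0 ?dk_ge0.
Qed.

Lemma half_iC : iC / 2%:R = iC * (2^-1)%:C%C :> R[i].
Proof. by congr (_ * _); rewrite fmorphV rmorph_nat. Qed.

Lemma normc_gk (D : R) (A : R[i]) :
  normc (gk D A) = normc k0 * expR (- (2^-1 * ln D)) * expR (- (Re A * Im A / D)).
Proof.
rewrite /gk Normc.normcM normc_cexp -(mulrA (normc k0)) -expRD; congr (_ * expR _).
rewrite ReD; congr (_ + _).
have -> : iC / 2%:R * (D^-1)%:C%C * A ^+ 2 = iC * ((2^-1 * D^-1)%:C%C * A ^+ 2).
  have e : (2^-1 * D^-1)%:C%C = 2%:R^-1 * (D^-1)%:C%C :> R[i].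
    by rewrite rmorphM fmorphV rmorph_nat.
  by rewrite e; ring.
by case: A => a b; rewrite expr2 !ReImE/=; move: D^-1 => d'; field.
Qed.

Fixpoint inc p u q : bool :=
  if u is p' :: u' then (p.1 < p'.1) && inc p' u' q else p.1 < q.1.

Lemma inc_lt p u q : inc p u q -> p.1 < q.1.
Proof. by elim: u p => [//|p' u IH] p /= /andP[pp' /IH]; exact: lt_trans. Qed.

Lemma chain_inc {K : comPzRingType} (g : R * R -> R * R -> K) p u q :
  forward g -> ~~ inc p u q -> chain g p u q = 0.
Proof.
move=> fg; elim: u p => [|p' u IH] p /=.
  by rewrite -leNgt => qp; rewrite /chain /= fg ?mulr0.
rewrite chain_cons negb_and -leNgt => /orP[p'p|/IH ->]; last by rewrite mulr0.
by rewrite fg ?mul0r.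
Qed.

Definition wt (s : R) p q : R := ov s p.1 q.1 / (q.1 - p.1).

Lemma wt1 s p q : p.1 < q.1 -> s <= p.1 -> wt s p q = 1.
Proof.
move=> pq sp; rewrite /wt /ov !max_l ?subr_ge0 ?(le_trans sp (ltW pq))//.
rewrite (_ : _ - _ - _ = q.1 - p.1); last by ring.
by rewrite divff// subr_eq0 gt_eqF.
Qed.

Lemma wt0 s p q : p.1 < q.1 -> q.1 <= s -> wt s p q = 0.
Proof.
move=> pq qs; rewrite /wt /ov !max_r ?subr_le0 ?(le_trans (ltW pq) qs)//.
by rewrite subrr mul0r.
Qed.

Lemma wt01 s p q : p.1 < q.1 -> 0 <= wt s p q <= 1.
Proof.
move=> pq; have D0 : 0 < q.1 - p.1 by rewrite subr_gt0.
rewrite /wt ler_pdivlMr// ler_pdivrMr// mul0r mul1r /ov.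
have [h1|h1] := leP 0 (q.1 - s); have [h2|h2] := leP 0 (p.1 - s);
  rewrite ?(max_l h1) ?(max_l h2) ?(max_r (ltW h1)) ?(max_r (ltW h2)); apply/andP; split; lra.
Qed.

Variable f : R * R -> R.

Fixpoint kickS (s : R) p u q : R :=
  if u is p' :: u' then (f p' - f p) * wt s p p' + kickS s p' u' q
  else (f q - f p) * wt s p q.

Lemma kickS_after s p u q : inc p u q -> s <= p.1 -> kickS s p u q = f q - f p.
Proof.
elim: u p => [|p' u IH] p /=; first by move=> pq sp; rewrite wt1// mulr1.
move=> /andP[pp' i] sp; rewrite wt1// IH//; first by ring.
by rewrite (le_trans sp)// ltW.
Qed.

Lemma kickS_le (B s : R) p u q : inc p u q -> `|f p| <= B -> `|f q| <= B ->
  all (fun p' => `|f p'| <= B) u -> `|kickS s p u q| <= 2 * B.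
Proof.
elim: u p => [|p' u IH] p /=.
  move=> pq; rewrite !ler_norml => /andP[a1 a2] /andP[b1 b2] _.
  have /andP[w0 w1] := wt01 s pq; apply/andP; split; nra.
move=> /andP[pp' i] bp bq /andP[bp' bu]; have [p's|sp'] := leP p'.1 s.
  by rewrite wt0// mulr0 add0r IH.
rewrite kickS_after ?(ltW sp')//.
move: bp bq bp'; rewrite !ler_norml => /andP[a1 a2] /andP[b1 b2] /andP[c1 c2].
have /andP[w0 w1] := wt01 s pp'; apply/andP; split; nra.
Qed.

End PathBound.

Section PathBound2.
Context {R : realType}.
Implicit Types (p q w : R * R) (u v : seq (R * R)).
Variables (Th1 Th2 h hd : R -> R[i]) (t0 y T M N : R).
Hypotheses (dTh1 : forall t, is_cd Th1 t (h t)) (ch : forall t, ccont h t).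
Hypotheses (t0T : t0 <= T) (yM : `|y| <= M)
  (Nh : forall t, t0 <= t <= T -> normc (h t) <= N)
  (NTh1 : forall t, t0 <= t <= T -> normc (Th1 t) <= N)
  (NTh2 : forall t, t0 <= t <= T -> normc (Th2 t) <= N).

Let f p : R := Re (Th1 p.1) + p.2.
Let B : R := N + M.

Let N0 : 0 <= N.
Proof. by apply: le_trans (Nh (t := t0) _); rewrite ?normc_ge0// lexx. Qed.
Let M0 : 0 <= M. Proof. exact: le_trans (normr_ge0 _) yM. Qed.

Definition okpt p := (t0 <= p.1 <= T) && (`|p.2| <= M).

Let f_le p : okpt p -> `|f p| <= B.
Proof.
move=> /andP[pT pM]; rewrite (le_trans (ler_normD _ _))// lerD//.
by rewrite (le_trans (Re_le_normc _))// NTh1.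
Qed.

Let Th1_lip (a b : R) : t0 <= a -> a <= b -> b <= T ->
  `|Im (Th1 b) - Im (Th1 a)| <= 2 * (N * (b - a)).
Proof.
move=> ta ab bT; have := normc_lintegral ab (ccont_measurable ch) (C := N).
rewrite (lintegral_FTC ab dTh1 ch) => e.
apply: le_trans (e _); first by have := Im_le_normc (Th1 b - Th1 a); rewrite ImD ImN.
by move=> x /andP[ax xb]; apply: Nh; rewrite (le_trans ta ax) (le_trans xb bT).
Qed.

Let K1 : R := normc k0 * expR (2 * B * (2 * N)).

Let seg_le v p q : okpt p -> okpt q ->
  normc (seg Th1 v p q) <= K1 * dk p q * \prod_(w <- v) expR (- (w.2 * ((f q - f p) * wt w.1 p q))).
Proof.
move=> okp okq; rewrite /seg; case: ltP => pq; last first.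
  by rewrite Normc.normc0 !mulr_ge0 ?normc_ge0 ?expR_ge0 ?dk_ge0// prodr_ge0// => w _; exact: expR_ge0.
have D0 : 0 < q.1 - p.1 by rewrite subr_gt0.
rewrite normc_gk dkE// /K1.
rewrite -[leRHS]mulrA [leRHS]mulrACA ler_wpM2l ?mulr_ge0 ?normc_ge0 ?dk_ge0// -expR_sum -expRD ler_expR.
have eR : Re (segA Th1 v p q) = f q - f p by rewrite /segA !ReImE/= /f; ring.
have eI : Im (segA Th1 v p q) = (Im (Th1 q.1) - Im (Th1 p.1)) + \sum_(w <- v) w.2 * ov w.1 p.1 q.1.
  by rewrite /segA !ReImE/=; ring.
rewrite eR eI mulrDr mulrDl opprD lerD//.
  have /andP[/andP[h1 h2] _] := okp; have /andP[/andP[h3 h4] _] := okq.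
  have L := Th1_lip h1 (ltW pq) h4.
  apply: le_trans (ler_norm _) _; rewrite normrN !normrM normfV (gtr0_norm D0).
  have A1 : `|f q - f p| <= 2 * B.
    by rewrite (le_trans (ler_normB _ _))// mulr2n mulrDl mul1r lerD ?f_le.
  rewrite -(mulrA `|f q - f p|) ler_pM//; first by rewrite divr_ge0// ltW.
  by rewrite ler_pdivrMr// -(mulrA 2).
rewrite mulr_sumr mulr_suml -sumrN le_eqVlt; apply/orP; left; apply/eqP.
by apply: eq_bigr => w _; rewrite /wt; move: (f q - f p) (ov _ _ _) (_^-1) w.2 => a1 a2 a3 a4; ring.
Qed.

Let chain_le v p u q : okpt p -> okpt q -> all okpt u ->
  normc (chain (seg Th1 v) p u q) <= K1 ^+ (size u).+1 * chain dk p u q *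
    \prod_(w <- v) expR (- (w.2 * kickS f w.1 p u q)).
Proof.
move=> okp okq; elim: u p okp => [|p' u IH] p okp /=.
  by move=> _; rewrite /chain/= !mul1r expr1; exact: seg_le.
move=> /andP[okp' oku]; rewrite !chain_cons Normc.normcM.
apply: (le_trans (ler_pM (normc_ge0 _) (normc_ge0 _) (seg_le v okp okp') (IH _ okp' oku))).
rewrite le_eqVlt; apply/orP; left; apply/eqP.
have e : \prod_(w <- v) expR (- (w.2 * ((f p' - f p) * wt w.1 p p' + kickS f w.1 p' u q))) =
   (\prod_(w <- v) expR (- (w.2 * ((f p' - f p) * wt w.1 p p')))) *
   \prod_(w <- v) expR (- (w.2 * kickS f w.1 p' u q)).
  by rewrite -big_split/=; apply: eq_bigr => w _; rewrite -expRD mulrDr opprD.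
rewrite e; move: (\prod_(w <- v) _) (\prod_(w <- v) _) (dk p p') (chain dk p' u q) (size u) (K1) => a1 a2 a3 a4 a5 a6.
by rewrite [a6 ^+ a5.+2]exprS; ring.
Qed.

Let P0 : R := M * N + M * N + 2 * N.
Let C : R := M + 2 * N + 2 * B.

Let arith (a b c b2 k d an : R) : 0 <= a -> 0 <= k -> 0 <= d -> 0 <= b -> 0 <= c ->
  a <= an -> c <= b2 -> a * b * (k * d * c) <= k * an * d * (b * b2).
Proof.
move=> a0 k0 d0 b0 c0 aan cb2.
rewrite (_ : a * b * (k * d * c) = a * (k * d * (b * c))); last by ring.
rewrite (_ : k * an * d * (b * b2) = an * (k * d * (b * b2))); last by ring.
apply: ler_pM => //; first by rewrite !mulr_ge0.
by rewrite ler_wpM2l ?mulr_ge0// ler_wpM2l.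
Qed.

Lemma path_bound u v q : okpt q -> all okpt u -> all (fun w => t0 <= w.1 <= T) v ->
  normc (path Th1 Th2 h t0 y u v q) <=
  (K1 * expR P0) ^+ (size u).+1 * chain dk (t0, y) u q * \prod_(w <- v) expR (C * `|w.2|).
Proof.
move=> okq oku okv; have okp : okpt (t0, y) by rewrite /okpt /= lexx t0T.
have [i|/chain_inc i] := boolP (inc (t0, y) u q); last first.
  rewrite /path i; last exact: seg_forward.
  by rewrite mulr0 Normc.normc0 i ?mulr0 ?mul0r//; exact: dk_forward.
have qT : t0 <= q.1 <= T by case/andP: okq.
have qM : `|q.2| <= M by case/andP: okq.
have P00 : 0 <= P0 by rewrite !addr_ge0 ?mulr_ge0.
rewrite /path Normc.normcM normc_cexp.
have ph : expR (Re (phase Th1 Th2 h t0 y v q)) <=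
    expR P0 * \prod_(w <- v) expR ((M + 2 * N) * `|w.2|).
  rewrite -expR_sum -expRD ler_expR /phase.
  have e1 : Re (\sum_(w <- v) w.2%:C%C * (Th1 q.1 - Th1 w.1)) = \sum_(w <- v) w.2 * Re (Th1 q.1 - Th1 w.1).
    rewrite (big_morph _ (@ReD R) (erefl _)); apply: eq_bigr => w _.
    by rewrite ReM/= mul0r subr0.
  have nR (z : R[i]) (m : R) : normc z <= m -> - m <= Re z <= m.
    by move=> zm; rewrite -ler_norml (le_trans (Re_le_normc _)).
  have nI (z : R[i]) (m : R) : normc z <= m -> - m <= Im z <= m.
    by move=> zm; rewrite -ler_norml (le_trans (Im_le_normc _)).
  have t0T' : t0 <= t0 <= T by rewrite lexx.
  have a1 : Re (- (iC * q.2%:C%C * h q.1)) <= M * N.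
    rewrite !ReImE/= (_ : - _ = q.2 * Im (h q.1)); last by ring.
    apply: le_trans (ler_norm _) _; rewrite normrM ler_pM//.
    by rewrite (le_trans (Im_le_normc _))// Nh.
  have a2 : Re (iC * y%:C%C * h t0) <= M * N.
    rewrite !ReImE/= (_ : _ - _ = - (y * Im (h t0))); last by ring.
    apply: le_trans (ler_norm _) _; rewrite normrN normrM ler_pM//.
    by rewrite (le_trans (Im_le_normc _))// Nh.
  have a3 : Re (- (iC / 2%:R * (Th2 q.1 - Th2 t0))) <= 2 * N.
    rewrite half_iC.
    have := nI _ _ (NTh2 qT); have := nI _ _ (NTh2 t0T'); move: N0.
    rewrite !ReImE/=; lra.
  have a4 : Re (iC / 2%:R * (\sum_(w <- v) \sum_(w' <- v) w.2 * w'.2 * (q.1 - Num.max w.1 w'.1))%:C%C) = 0.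
    rewrite half_iC.
    by rewrite !ReImE/=; ring.
  have a5 : q.2 * (\sum_(w <- v) w.2) + \sum_(w <- v) w.2 * Re (Th1 q.1 - Th1 w.1) <=
      \sum_(w <- v) (M + 2 * N) * `|w.2|.
    rewrite mulr_sumr -big_split/= !big_seq; apply: ler_sum => w wv.
    have wT := allP okv _ wv; have := nR _ _ (NTh1 wT); have := nR _ _ (NTh1 qT).
    move=> b1 b2; rewrite [q.2 * _]mulrC -mulrDr; apply: le_trans (ler_norm _) _; rewrite normrM mulrC.
    rewrite ler_wpM2r// (le_trans (ler_normD _ _))// lerD//.
    by rewrite ReD ReN ler_norml; lra.
  move: a1 a2 a3 a5; rewrite /P0 !ReD a4 e1/=; lra.
have ps : \prod_(w <- v) expR (- (w.2 * kickS f w.1 (t0, y) u q)) <= \prod_(w <- v) expR (2 * B * `|w.2|).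
  apply: ler_prod => w _; rewrite expR_ge0/= ler_expR.
  apply: le_trans (ler_norm _) _; rewrite normrN normrM mulrC ler_wpM2r//.
  apply: kickS_le => //; [exact: f_le|exact: f_le|].
  by apply/allP => p' /(allP oku); exact: f_le.
apply: (le_trans (ler_pM (expR_ge0 _) (normc_ge0 _) ph (chain_le v okp okq oku))).
have K10 : 0 <= K1 by rewrite mulr_ge0 ?normc_ge0 ?expR_ge0.
have e : \prod_(w <- v) expR (C * `|w.2|) =
    \prod_(w <- v) expR ((M + 2 * N) * `|w.2|) * \prod_(w <- v) expR (2 * B * `|w.2|).
  by rewrite -big_split/=; apply: eq_bigr => w _; rewrite -expRD -mulrDl.
have g1 : 0 <= \prod_(w <- v) expR ((M + 2 * N) * `|w.2|) by apply: prodr_ge0 => w _; exact: expR_ge0.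
have g2 : 0 <= \prod_(w <- v) expR (2 * B * `|w.2|) by apply: prodr_ge0 => w _; exact: expR_ge0.
have g3 : expR P0 <= expR P0 ^+ (size u).+1.
  by rewrite exprS ler_peMr ?expR_ge0// exprn_ege1// -expR0 ler_expR.
rewrite e [(K1 * expR P0) ^+ _]exprMn; apply: arith => //.
- exact: exprn_ge0.
- exact: chain_dk_ge0.
- by apply: prodr_ge0 => w _; exact: expR_ge0.
Qed.

End PathBound2.

(** * The Dirichlet estimate *)

Section SingularIntegrals.
Context {R : realType}.
Local Notation leb := (@lebesgue_measure R).

Lemma integral_le_primitive (f F : R -> R) (a b K : R) :
  measurable_fun setT f -> (forall s, 0 <= f s) ->
  (forall s, a < s < b -> is_derive s (1:R) F (f s)) ->
  (forall s, a < s < b -> {for s, continuous f}) ->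
  (forall c d, a < c -> c < d -> d < b -> F d - F c <= K) -> 0 <= K ->
  f a = 0 -> f b = 0 ->
  (\int[leb]_(s in `[a, b]) (f s)%:E <= K%:E)%E.
Proof.
move=> mf f0 dF cf FK K0 fa fb.
have [ba|ab] := leP b a.
  rewrite [X in (X <= _)%E](_ : _ = 0%E) ?lee_fin//.
  apply: integral0_eq => s; rewrite /= in_itv/= => /andP[as_ sb].
  by have -> : s = a; [apply/eqP; rewrite eq_le as_ (le_trans sb ba)|rewrite fa].
pose e n : R := (b - a) / n.+3%:R.
have e0 n : 0 < e n by rewrite divr_gt0// ?subr_gt0// ltr0n.
have e3 n : e n <= (b - a) / 3.
  by rewrite ler_pM2l ?subr_gt0// lef_pV2 ?posrE ?ltr0n// ler_nat.
pose D n := [set` `[a + e n, b - e n]].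
have eD : `]a, b[%classic = \bigcup_n D n.
  apply/seteqP; split => [s|s [n _]]; rewrite /D /= !in_itv/=; last first.
    by move=> /andP[h1 h2]; rewrite (lt_le_trans _ h1) ?(le_lt_trans h2)// ?ltrDl ?ltrBlDr ?ltrDl.
  move=> /andP[h1 h2]; pose m := Num.min (s - a) (b - s).
  have m0 : 0 < m by rewrite lt_min !subr_gt0 h1 h2.
  pose n := Num.truncn ((b - a) / m).
  exists n => //; rewrite /D /= in_itv/=.
  have en : e n <= m.
    rewrite /e ler_pdivrMr ?ltr0n// mulrC -ler_pdivrMr//.
    apply: (le_trans (ltW (truncnS_gt _))); rewrite ler_nat -/n; exact: leqW.
  have m1 : m <= s - a by rewrite ge_min lexx.
  have m2 : m <= b - s by rewrite ge_min lexx orbT.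
  by apply/andP; split; lra.
have -> : (\int[leb]_(s in `[a, b]) (f s)%:E = \int[leb]_(s in `]a, b[) (f s)%:E)%E.
  rewrite integral_mkcond [RHS]integral_mkcond; apply: eq_integral => s _.
  rewrite !patchE !mem_setE !in_itv/= !le_eqVlt.
  have [<-|_] := eqVneq a s; first by rewrite ltxx/= fa if_same.
  by have [->|_] := eqVneq s b; rewrite ?ltxx ?andbF/= ?fb ?if_same.
have mfE : measurable_fun setT (EFin \o f) by exact/measurable_EFinP.
have ndD : nondecreasing_seq D.
  apply/nondecreasing_seqP => n; apply/subsetPset => s; rewrite /D /= !in_itv/=.
  have en : e n.+1 <= e n by rewrite ler_pM2l ?subr_gt0// lef_pV2 ?posrE ?ltr0n// ler_nat.
  by move=> /andP[h1 h2]; apply/andP; split; lra.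
have cv : (fun n => (\int[leb]_(s in D n) (f s)%:E)%E) @ \oo --> (\int[leb]_(s in \bigcup_n D n) (f s)%:E)%E.
  apply: ge0_nondecreasing_set_cvg_integral => //.
  - by move=> n; exact: measurable_itv.
  - by move=> n; exact: measurable_funS mfE.
  - by move=> n x _; rewrite lee_fin.
rewrite eD -(cvg_lim _ cv)//; apply: lime_le; first by apply/cvg_ex; eexists; exact: cv.
apply: nearW => n /=.
have ab' : a + e n < b - e n by have := e3 n; move: ab; lra.
have ain s : a + e n <= s <= b - e n -> a < s < b.
  by move=> /andP[h1 h2]; have en0 := e0 n; apply/andP; split; lra.
rewrite (@continuous_FTC2 _ f F)//.
- rewrite -EFinB lee_fin; apply: FK => //; have := e0 n; lra.
- apply: continuous_in_subspaceT => s; rewrite inE/= in_itv/= => /ain; exact: cf.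
- have dc s : a + e n <= s <= b - e n -> {for s, continuous F}.
    move=> /ain sab; have [dF' _] := dF s sab.
    by apply: differentiable_continuous; apply/derivable1_diffP.
  split.
  + by move=> s; rewrite in_itv/= => /andP[h1 h2]; have [] := dF s (ain s _) => //; rewrite !ltW.
  + by apply: cvg_at_right_filter; apply: dc; rewrite lexx ltW.
  + by apply: cvg_at_left_filter; apply: dc; rewrite lexx ltW.
- move=> s; rewrite in_itv/= => /andP[h1 h2]; rewrite derive1E.
  by have [_ ->] := dF s (ain s (introT andP (conj (ltW h1) (ltW h2)))).
Qed.

Lemma measurable_sqrt : measurable_fun setT (@Num.sqrt R).
Proof. exact: (continuous_measurable_fun (@sqrt_continuous R)). Qed.

Lemma measurable_isqrt d (T : measurableType d) (f : T -> R) : measurable_fun setT f ->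
  measurable_fun setT (fun x => (Num.sqrt (f x))^-1).
Proof.
by move=> mf; apply: measurable_inv; apply: (measurableT_comp (f := @Num.sqrt R)) => //; exact: measurable_sqrt.
Qed.

Let is_derive_sub (a s : R) : is_derive s (1:R) (fun s => s - a) 1.
Proof.
by apply: (@is_derive_eq _ _ _ _ _ _ _ _ (is_deriveB (is_derive_id s (1:R)) (is_derive_cst a s 1))); rewrite subr0.
Qed.

Let is_derive_rsub (a s : R) : is_derive s (1:R) (fun s => a - s) (-1).
Proof.
by apply: (@is_derive_eq _ _ _ _ _ _ _ _ (is_deriveB (is_derive_cst a s 1) (is_derive_id s (1:R)))); rewrite sub0r.
Qed.

Let cont_isqrt (g : R -> R) (s : R) : 0 < g s -> {for s, continuous g} ->
  {for s, continuous (fun s => (Num.sqrt (g s))^-1)}.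
Proof.
move=> gs cg; apply: (@cvgV _ _ _ _ (fun s => Num.sqrt (g s))).
  by rewrite gt_eqF// sqrtr_gt0.
exact: (@cvg_comp _ _ _ g (@Num.sqrt R) _ _ _ cg (@sqrt_continuous R (g s))).
Qed.

Lemma integral_isqrt_right (a b : R) : a <= b ->
  (\int[leb]_(s in `[a, b]) (if s < b then (Num.sqrt (s - a))^-1 else 0)%:E <= (2 * Num.sqrt (b - a))%:E)%E.
Proof.
move=> ab; apply: (@integral_le_primitive (fun s => if s < b then (Num.sqrt (s - a))^-1 else 0) (fun s => 2 * Num.sqrt (s - a))).
- apply: measurable_fun_ifT => //; first exact: measurable_fun_ltr.
  by apply: measurable_isqrt; exact: measurable_funB.
- by move=> s; case: ifP => // _; rewrite invr_ge0 sqrtr_ge0.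
- move=> s /andP[as_ sb]; rewrite sb.
  have s0 : 0 < s - a by rewrite subr_gt0.
  have h := @is_derive1_comp _ (@Num.sqrt R) (fun s => s - a) s _ _ (is_derive1_sqrt s0) (is_derive_sub a s).
  have h2 := @is_deriveZ _ _ _ (fun s => Num.sqrt (s - a)) 2 s 1 _ h.
  apply: (@is_derive_eq _ _ _ _ _ _ _ _ h2); rewrite /GRing.scale/= mulr1.
  by rewrite invfM mulrA divff// mul1r.
- move=> s /andP[as_ sb].
  have c : {for s, continuous (fun s => (Num.sqrt (s - a))^-1)}.
    apply: cont_isqrt; first by rewrite subr_gt0.
    by apply: cvgB; [exact: cvg_id|exact: cvg_cst].
  rewrite /prop_for /continuous_at sb; apply: cvg_trans c; apply: near_eq_cvg.
  by near=> z; rewrite ifT//; near: z; exact: lt_nbhsl.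
- move=> c d ac cd db; rewrite lerBlDr -[leLHS]addr0 lerD ?mulr_ge0 ?sqrtr_ge0//.
  by rewrite ler_wpM2l// ler_wsqrtr// lerB// ltW.
- by rewrite mulr_ge0// sqrtr_ge0.
- by rewrite subrr sqrtr0 invr0 if_same.
- by rewrite ltxx.
Unshelve. all: by end_near.
Qed.

Lemma integral_isqrt_left (a b : R) : a <= b ->
  (\int[leb]_(s in `[a, b]) (if a < s then (Num.sqrt (b - s))^-1 else 0)%:E <= (2 * Num.sqrt (b - a))%:E)%E.
Proof.
move=> ab; apply: (@integral_le_primitive (fun s => if a < s then (Num.sqrt (b - s))^-1 else 0) (fun s => - (2 * Num.sqrt (b - s)))).
- apply: measurable_fun_ifT => //; first exact: measurable_fun_ltr.
  by apply: measurable_isqrt; exact: measurable_funB.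
- by move=> s; case: ifP => // _; rewrite invr_ge0 sqrtr_ge0.
- move=> s /andP[as_ sb]; rewrite as_.
  have s0 : 0 < b - s by rewrite subr_gt0.
  have h := @is_derive1_comp _ (@Num.sqrt R) (fun s => b - s) s _ _ (is_derive1_sqrt s0) (is_derive_rsub b s).
  have h2 := is_deriveN (@is_deriveZ _ _ _ (fun s => Num.sqrt (b - s)) 2 s 1 _ h).
  apply: (@is_derive_eq _ _ _ _ _ _ _ _ h2); rewrite /GRing.scale/= mulrN1 mulrN opprK.
  by rewrite invfM mulrA divff// mul1r.
- move=> s /andP[as_ sb].
  have c : {for s, continuous (fun s => (Num.sqrt (b - s))^-1)}.
    apply: cont_isqrt; first by rewrite subr_gt0.
    by apply: cvgB; [exact: cvg_cst|exact: cvg_id].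
  rewrite /prop_for /continuous_at as_; apply: cvg_trans c; apply: near_eq_cvg.
  by near=> z; rewrite ifT//; near: z; exact: lt_nbhsr.
- move=> c d ac cd db; rewrite opprK addrC lerBlDr -[leLHS]addr0 lerD ?mulr_ge0 ?sqrtr_ge0//.
  by rewrite ler_wpM2l// ler_wsqrtr// lerB// ltW.
- by rewrite mulr_ge0// sqrtr_ge0.
- by rewrite ltxx.
- by rewrite subrr sqrtr0 invr0 if_same.
Unshelve. all: by end_near.
Qed.

Lemma integral_expR_left (a b l : R) : 0 < l ->
  (\int[leb]_(s in `[a, b]) (if (a < s) && (s < b) then expR (- (l * (b - s))) else 0)%:E <= (l^-1)%:E)%E.
Proof.
move=> l0; apply: (@integral_le_primitive (fun s => if (a < s) && (s < b) then expR (- (l * (b - s))) else 0) (fun s => l^-1 * expR (- (l * (b - s))))).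
- apply: measurable_fun_ifT => //; first by apply: measurable_and; exact: measurable_fun_ltr.
  apply: (measurableT_comp (f := @expR R)) => //; under eq_fun do rewrite -mulNr.
  by apply: measurable_funM => //; exact: measurable_funB.
- by move=> s; case: ifP => // _; rewrite expR_ge0.
- move=> s /andP[as_ sb]; rewrite as_ sb/=.
  have h0 : is_derive s (1:R) (fun s => - (l * (b - s))) l.
    have h := is_deriveN (@is_deriveZ _ _ _ (fun s => b - s) l s 1 _ (is_derive_rsub b s)).
    by apply: (@is_derive_eq _ _ _ _ _ _ _ _ h); rewrite /GRing.scale/= mulrN1 opprK.
  have h := @is_derive1_comp _ (@expR R) (fun s => - (l * (b - s))) s _ _ (is_derive_expR _) h0.
  have h2 := @is_deriveZ _ _ _ (fun s => expR (- (l * (b - s)))) l^-1 s 1 _ h.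
  apply: (@is_derive_eq _ _ _ _ _ _ _ _ h2); rewrite /GRing.scale/=.
  by rewrite mulrCA mulVf ?mulr1// gt_eqF.
- move=> s /andP[as_ sb].
  have c : {for s, continuous (fun s => expR (- (l * (b - s))))}.
    apply: (@cvg_comp _ _ _ (fun s => - (l * (b - s))) (@expR R) _ _ _ _ (@continuous_expR R _)).
    by apply: cvgN; apply: cvgM; [exact: cvg_cst|apply: cvgB; [exact: cvg_cst|exact: cvg_id]].
  rewrite /prop_for /continuous_at as_ sb/=; apply: cvg_trans c; apply: near_eq_cvg.
  by near=> z; rewrite ifT//; apply/andP; split; near: z; [exact: lt_nbhsr|exact: lt_nbhsl].
- move=> c d ac cd db; rewrite lerBlDr -[leLHS]addr0 lerD ?mulr_ge0 ?expR_ge0 ?invr_ge0 ?(ltW l0)//.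
  by rewrite ler_piMr ?invr_ge0 ?(ltW l0)// -expR0 ler_expR oppr_le0 mulr_ge0 ?subr_ge0 ?ltW.
- by rewrite invr_ge0 ltW.
- by rewrite ltxx.
- by rewrite ltxx andbF.
Unshelve. all: by end_near.
Qed.

End SingularIntegrals.

Section MeasurableChains.
Context {R : realType} d {X : measurableType d}.
Local Notation pt := (R * R)%type.

Lemma chain_cmeas k (g : X -> pt -> pt -> R[i]) :
  (forall p q : X -> pt, measurable_fun setT p -> measurable_fun setT q ->
     cmeas (fun a => g a (p a) (q a))) ->
  forall (u : X -> k.-tuple pt) (p q : X -> pt), measurable_fun setT u ->
  measurable_fun setT p -> measurable_fun setT q ->
  cmeas (fun a => chain (g a) (p a) (u a) (q a)).
Proof.
move=> mg; elim: k => [|k IH] u p q mu mp mq.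
  rewrite (_ : (fun a => _) = fun a => g a (p a) (q a)); first exact: mg.
  by apply/funext => a; rewrite (tuple0 (u a)) /chain/= mul1r.
have mh : measurable_fun setT (fun a => thead (u a)).
  by apply: (measurableT_comp (f := @thead k pt)) => //; exact: measurable_tnth.
have mb : measurable_fun setT (fun a => [tuple of behead (u a)]).
  by apply: (measurableT_comp (f := fun x : k.+1.-tuple pt => [tuple of behead x])) => //; exact: measurable_behead.
rewrite (_ : (fun a => _) = fun a => g a (p a) (thead (u a)) *
    chain (g a) (thead (u a)) [tuple of behead (u a)] (q a)).
  by apply: cmeasM; [exact: mg|exact: IH].
by apply/funext => a; rewrite -chain_cons; congr (chain _ _ _ _); rewrite [u a in LHS]tuple_eta.
Qed.

Lemma chain_rmorph (g : pt -> pt -> R) p u q :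
  (chain g p u q)%:C%C = chain (fun a b => (g a b)%:C%C) p u q :> R[i].
Proof.
elim: u p => [|p' u IH] p; first by rewrite /chain/= !mul1r.
by rewrite !chain_cons rmorphM/= IH.
Qed.

Lemma measurable_chain k (g : pt -> pt -> R) :
  measurable_fun setT (fun pq : pt * pt => g pq.1 pq.2) ->
  forall (u : X -> k.-tuple pt) (p q : X -> pt), measurable_fun setT u ->
  measurable_fun setT p -> measurable_fun setT q ->
  measurable_fun setT (fun a => chain g (p a) (u a) (q a)).
Proof.
move=> mg u p q mu mp mq.
have h : cmeas (fun a => chain (fun b c => (g b c)%:C%C) (p a) (u a) (q a)).
  apply: (chain_cmeas (g := fun a b c => (g b c)%:C%C)) => // p' q' mp' mq'.
  apply: cmeas_real; exact: (measurableT_comp mg (measurable_fun_pair mp' mq')).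
rewrite (_ : (fun a => _) = fun a => Re (chain (fun b c => (g b c)%:C%C) (p a) (u a) (q a))).
  exact: h.1.
by apply/funext => a; rewrite -chain_rmorph.
Qed.

Lemma measurable_dk : measurable_fun setT (fun pq : pt * pt => dk pq.1 pq.2).
Proof.
apply: measurable_isqrt; apply: measurable_funB.
  by apply: (measurableT_comp (f := fst)) => //; exact: measurable_snd.
by apply: (measurableT_comp (f := fst)) => //; exact: measurable_fst.
Qed.

Lemma measurable_prod_tuple k (f : pt -> R) (u : X -> k.-tuple pt) :
  measurable_fun setT f -> measurable_fun setT u ->
  measurable_fun setT (fun a => \prod_(p <- u a) f p).
Proof.
move=> mf mu; under eq_fun do rewrite big_tuple.
apply: measurable_prod => i _ /=.
apply: (measurableT_comp mf); apply: (measurableT_comp (f := fun x : k.-tuple pt => tnth x i)) => //.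
exact: measurable_tnth.
Qed.

Variables (Th1 Th2 h : R -> R[i]) (t0 y : R).
Hypotheses (mTh1 : cmeas Th1) (mTh2 : cmeas Th2) (mh : cmeas h).

Let comp1 (f : R -> R[i]) (p : X -> pt) : cmeas f -> measurable_fun setT p ->
  cmeas (fun a => f (p a).1).
Proof.
move=> mf mp; apply: (cmeas_comp mf (g := fun a => (p a).1)).
by apply: (measurableT_comp (f := fst)).
Qed.

Let m1 (p : X -> pt) : measurable_fun setT p -> measurable_fun setT (fun a => (p a).1).
Proof. by move=> mp; apply: (measurableT_comp (f := fst)). Qed.
Let m2 (p : X -> pt) : measurable_fun setT p -> measurable_fun setT (fun a => (p a).2).
Proof. by move=> mp; apply: (measurableT_comp (f := snd)). Qed.
Let mt m (v : X -> m.-tuple pt) i : measurable_fun setT v -> measurable_fun setT (fun a => tnth (v a) i).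
Proof. by move=> mv; apply: (measurableT_comp (f := fun x : m.-tuple pt => tnth x i)) => //; exact: measurable_tnth. Qed.

Lemma seg_cmeas m (v : X -> m.-tuple pt) (p q : X -> pt) :
  measurable_fun setT v -> measurable_fun setT p -> measurable_fun setT q ->
  cmeas (fun a => seg Th1 (v a) (p a) (q a)).
Proof.
move=> mv mp mq; have mD : measurable_fun setT (fun a => (q a).1 - (p a).1).
  by apply: measurable_funB; exact: m1.
apply: cmeas_if; last exact: cmeas_cst.
  by apply: measurable_fun_ltr; exact: m1.
have a1 : cmeas (fun a => Th1 (q a).1) by exact: comp1.
have a2 : cmeas (fun a => Th1 (p a).1) by exact: comp1.
have a3 : cmeas (fun a => ((q a).2 - (p a).2)%:C%C).
  by apply: cmeas_real; apply: measurable_funB; exact: m2.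
have a4 : cmeas (fun a => (\sum_(w <- v a) w.2 * ov w.1 (p a).1 (q a).1)%:C%C).
  apply: cmeas_real; under eq_fun do rewrite big_tuple.
  apply: measurable_sum => i; apply: measurable_funM; first by apply: m2; exact: mt.
  rewrite /ov; apply: measurable_funB; apply: measurable_maxr => //;
  by apply: measurable_funB; [exact: m1|apply: m1; exact: mt].
have a5 : cmeas (fun a => (((q a).1 - (p a).1)^-1)%:C%C) by apply: cmeas_real; exact: measurable_inv.
have a6 : cmeas (fun a => (- (2^-1 * ln ((q a).1 - (p a).1)))%:C%C).
  apply: cmeas_real; apply: measurableT_comp => //; apply: measurable_funM => //.
  exact: (measurableT_comp (f := @ln R)).
by rewrite /gk /segA; cmeas_step.
Qed.

Lemma phase_cmeas m (v : X -> m.-tuple pt) (q : X -> pt) :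
  measurable_fun setT v -> measurable_fun setT q ->
  cmeas (fun a => phase Th1 Th2 h t0 y (v a) (q a)).
Proof.
move=> mv mq.
have a1 : cmeas (fun a => Th1 (q a).1) by exact: comp1.
have a2 : cmeas (fun a => Th2 (q a).1) by exact: comp1.
have a3 : cmeas (fun a => h (q a).1) by exact: comp1.
have a4 : cmeas (fun a => ((q a).2)%:C%C) by apply: cmeas_real; exact: m2.
have a5 : cmeas (fun a => ((q a).2 * \sum_(w <- v a) w.2)%:C%C).
  apply: cmeas_real; apply: measurable_funM; first exact: m2.
  by under eq_fun do rewrite big_tuple; apply: measurable_sum => i; apply: m2; exact: mt.
have a6 : cmeas (fun a => \sum_(w <- v a) w.2%:C%C * (Th1 (q a).1 - Th1 w.1)).
  under eq_fun do rewrite big_tuple; apply: cmeas_sum => i; apply: cmeasM.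
    by apply: cmeas_real; apply: m2; exact: mt.
  by apply: cmeasB => //; apply: (comp1 (p := fun a => tnth (v a) i)) => //; exact: mt.
have a7 : cmeas (fun a => (\sum_(w <- v a) \sum_(w' <- v a) w.2 * w'.2 * ((q a).1 - Num.max w.1 w'.1))%:C%C).
  apply: cmeas_real; under eq_fun do rewrite big_tuple; apply: measurable_sum => i.
  under eq_fun do rewrite big_tuple; apply: measurable_sum => j.
  apply: measurable_funM; first by apply: measurable_funM; apply: m2; exact: mt.
  apply: measurable_funB; first exact: m1.
  by apply: measurable_maxr; apply: m1; exact: mt.
by rewrite /phase; cmeas_step.
Qed.

Lemma path_cmeas k m (u : X -> k.-tuple pt) (v : X -> m.-tuple pt) (q : X -> pt) :
  measurable_fun setT u -> measurable_fun setT v -> measurable_fun setT q ->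
  cmeas (fun a => path Th1 Th2 h t0 y (u a) (v a) (q a)).
Proof.
move=> mu mv mq; apply: cmeasM.
  by apply: cmeas_cexp; exact: phase_cmeas.
apply: (chain_cmeas (g := fun a => seg Th1 (v a)) _ (p := fun=> (t0, y))) => //.
by move=> p q' mp mq'; exact: seg_cmeas.
Qed.

End MeasurableChains.

Section Dirichlet.
Context {R : realType}.
Local Notation pt := (R * R)%type.
Local Notation leb := (@lebesgue_measure R).
Variables (s0 t0 T e : R).
Hypotheses (e0 : 0 < e).
Local Notation sq x := ((Num.sqrt x)^-1).

Let le_lebr (f : R -> R) (c d K : R) : measurable_fun setT f -> (forall s, 0 <= f s) ->
  (\int[leb]_(s in `[c, d]) (f s)%:E <= K%:E)%E ->
  (\int[lebr s0 T]_s (if (c <= s) && (s <= d) then f s else 0)%:E <= K%:E)%E.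
Proof.
move=> mf f0; apply: le_trans.
have mfi : measurable_fun setT (fun s : R => if (c <= s) && (s <= d) then f s else 0).
  by apply: measurable_fun_ifT => //; apply: measurable_and; exact: measurable_fun_ler.
rewrite ge0_integral_lebr; [|exact/measurable_EFinP|by move=> s; case: ifP => _; rewrite lee_fin].
rewrite integral_mkcond [leRHS]integral_mkcond; apply: ge0_le_integral => //.
- by move=> s _; rewrite patchE; case: ifP => // _; case: ifP => _; rewrite lee_fin.
- apply/(measurable_restrictT _ _).1 => //; apply: measurable_funTS; exact/measurable_EFinP.
- apply/(measurable_restrictT _ _).1 => //; apply: measurable_funTS; exact/measurable_EFinP.
- move=> s _; rewrite !patchE !mem_setE !in_itv/=; case: ifP => _; case: ifP => _; rewrite ?lee_fin//.
Qed.

Let sq0 (x : R) : 0 <= sq x. Proof. by rewrite invr_ge0 sqrtr_ge0. Qed.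

Let sq_le (a b : R) : 0 < a -> a <= b -> sq b <= sq a.
Proof.
move=> a0 ab; rewrite lef_pV2 ?posrE ?sqrtr_gt0// ?(lt_le_trans a0)//.
by rewrite ler_wsqrtr.
Qed.

Lemma isqrt_mul_le (a b : R) : 0 < a -> 0 < b -> sq a * sq b <= sq (a + b) * (sq a + sq b).
Proof.
move=> a0 b0.
have sa : 0 < Num.sqrt a by rewrite sqrtr_gt0.
have sb : 0 < Num.sqrt b by rewrite sqrtr_gt0.
have sab : 0 < Num.sqrt (a + b) by rewrite sqrtr_gt0 addr_gt0.
have h : Num.sqrt (a + b) <= Num.sqrt a + Num.sqrt b.
  rewrite -(@ler_pXn2r _ 2) ?nnegrE ?addr_ge0 ?(ltW sa) ?(ltW sb) ?(ltW sab)//.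
  have ea := sqr_sqrtr (ltW a0); have eb := sqr_sqrtr (ltW b0).
  have eab := sqr_sqrtr (ltW (addr_gt0 a0 b0)).
  have sab2 := mulr_ge0 (ltW sa) (ltW sb).
  rewrite eab sqrrD ea eb mulr2n; lra.
have e1 : sq a + sq b = sq a * sq b * (Num.sqrt a + Num.sqrt b).
  by field; rewrite !gt_eqF.
by rewrite e1 mulrCA ler_peMr ?mulr_ge0// ler_pdivlMl// mulr1.
Qed.

Lemma convolution_bound (t : R) :
  (\int[lebr s0 T]_s (expR (- (e^-1 * (t - s))) * sq (t - s) * sq (s - t0))%:E
     <= (6 * Num.sqrt e * sq (t - t0))%:E)%E.
Proof.
have [tt0|t0t] := leP t t0.
  rewrite [X in (X <= _)%E](_ : _ = 0%E) ?lee_fin ?mulr_ge0 ?sqrtr_ge0//.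
  apply: integral0_eq => s _; have [st|ts] := leP s t0.
    by rewrite [sq (s - t0)](_ : _ = 0) ?mulr0// ler0_sqrtr ?invr0// subr_le0.
  by rewrite [sq (t - s)](_ : _ = 0) ?mulr0 ?mul0r// ler0_sqrtr ?invr0// subr_le0 (le_trans tt0)// ltW.
pose f1 s := if t - e < s then sq (t - s) else 0.
pose f2 s := if s < t0 + e then sq (s - t0) else 0.
pose f3 s := if (t0 < s) && (s < t) then expR (- (e^-1 * (t - s))) else 0.
pose g1 s := if (t - e <= s) && (s <= t) then f1 s else 0.
pose g2 s := if (t0 <= s) && (s <= t0 + e) then f2 s else 0.
pose g3 s := if (t0 <= s) && (s <= t) then f3 s else 0.
have f10 s : 0 <= f1 s by rewrite /f1; case: ifP.
have f20 s : 0 <= f2 s by rewrite /f2; case: ifP.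
have f30 s : 0 <= f3 s by rewrite /f3; case: ifP => // _; exact: expR_ge0.
have mf1 : measurable_fun setT f1.
  apply: measurable_fun_ifT => //; first exact: measurable_fun_ltr.
  by apply: measurable_isqrt; exact: measurable_funB.
have mf2 : measurable_fun setT f2.
  apply: measurable_fun_ifT => //; first exact: measurable_fun_ltr.
  by apply: measurable_isqrt; exact: measurable_funB.
have mE : measurable_fun setT (fun s : R => expR (- (e^-1 * (t - s)))).
  apply: (measurableT_comp (f := @expR R)) => //; under eq_fun do rewrite -mulNr.
  by apply: measurable_funM => //; exact: measurable_funB.
have mf3 : measurable_fun setT f3.
  by apply: measurable_fun_ifT => //; apply: measurable_and; exact: measurable_fun_ltr.
have I1 : (\int[lebr s0 T]_s (g1 s)%:E <= (2 * Num.sqrt e)%:E)%E.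
  apply: le_lebr => //; have := @integral_isqrt_left R (t - e) t.
  by rewrite lerBlDr lerDl ltW// => /(_ erefl); rewrite opprB addrCA subrr addr0.
have I2 : (\int[lebr s0 T]_s (g2 s)%:E <= (2 * Num.sqrt e)%:E)%E.
  apply: le_lebr => //; have := @integral_isqrt_right R t0 (t0 + e).
  by rewrite lerDl ltW// => /(_ erefl); rewrite addrAC subrr add0r.
have I3 : (\int[lebr s0 T]_s (g3 s)%:E <= e%:E)%E.
  by apply: le_lebr => //; rewrite -[X in (_ <= X%:E)%E]invrK; apply: integral_expR_left; rewrite invr_gt0.
have mitv (c d' : R) : measurable_fun setT (fun s : R => (c <= s) && (s <= d')).
  by apply: measurable_and; exact: measurable_fun_ler.
have mg1 : measurable_fun setT g1 by exact: measurable_fun_ifT.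
have mg2 : measurable_fun setT g2 by exact: measurable_fun_ifT.
have mg3 : measurable_fun setT g3 by exact: measurable_fun_ifT.
have g10 s : 0 <= g1 s by rewrite /g1; case: ifP.
have g20 s : 0 <= g2 s by rewrite /g2; case: ifP.
have g30 s : 0 <= g3 s by rewrite /g3; case: ifP.
pose c3 := 2 * sq e.
have key s : expR (- (e^-1 * (t - s))) * sq (t - s) * sq (s - t0) <=
    sq (t - t0) * (g1 s + g2 s + c3 * g3 s).
  have r0 : 0 <= sq (t - t0) * (g1 s + g2 s + c3 * g3 s).
    by rewrite mulr_ge0// !addr_ge0 ?g10 ?g20// mulr_ge0 ?g30 ?mulr_ge0.
  have [st|ts0] := leP s t0.
    by rewrite [sq (s - t0)](_ : _ = 0) ?mulr0// ler0_sqrtr ?invr0// subr_le0.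
  have [tt|st] := leP t s.
    by rewrite [sq (t - s)](_ : _ = 0) ?mulr0 ?mul0r// ler0_sqrtr ?invr0// subr_le0.
  have a0 : 0 < t - s by rewrite subr_gt0.
  have b0 : 0 < s - t0 by rewrite subr_gt0.
  have := isqrt_mul_le a0 b0; rewrite addrA subrK => h.
  set E := expR _; have E0 : 0 <= E := expR_ge0 _.
  have E1 : E <= 1 by rewrite /E -expR0 ler_expR oppr_le0 mulr_ge0 ?invr_ge0 ?ltW.
  have e3 : g3 s = E by rewrite /g3 /f3 (ltW ts0) (ltW st) ts0 st.
  rewrite -mulrA; apply: (le_trans (ler_wpM2l E0 h)); rewrite mulrCA ler_wpM2l//.
  rewrite mulrDr e3 (_ : g1 s + g2 s + c3 * E = (g1 s + sq e * E) + (g2 s + sq e * E)); last by rewrite /c3; ring.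
  apply: lerD.
    have [h1|h1] := ltP (t - e) s.
      rewrite /g1 /f1 h1 (ltW h1) (ltW st) -[leLHS]addr0 lerD ?mulr_ge0//.
      by rewrite ler_piMl.
    rewrite -[leLHS]add0r lerD// mulrC ler_wpM2r// sq_le//; lra.
  have [h1|h1] := ltP s (t0 + e).
    rewrite /g2 /f2 h1 (ltW h1) (ltW ts0) -[leLHS]addr0 lerD ?mulr_ge0//.
    by rewrite ler_piMl.
  rewrite -[leLHS]add0r lerD// mulrC ler_wpM2r// sq_le//; lra.
have mL : measurable_fun setT (fun s : R => expR (- (e^-1 * (t - s))) * sq (t - s) * sq (s - t0)).
  by apply: measurable_funM; [apply: measurable_funM => //|]; apply: measurable_isqrt; exact: measurable_funB.
have mR' : measurable_fun setT (fun s : R => g1 s + g2 s + c3 * g3 s).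
  by apply: measurable_funD; [exact: measurable_funD|exact: measurable_funM].
apply: (@le_trans _ _ (\int[lebr s0 T]_s (sq (t - t0) * (g1 s + g2 s + c3 * g3 s))%:E)%E).
  apply: ge0_le_integral => //.
  - exact/measurable_EFinP.
  - by apply/measurable_EFinP; exact: measurable_funM.
  - by move=> s _; rewrite lee_fin key.
have mE1 : measurable_fun setT (EFin \o g1) by exact/measurable_EFinP.
have mE2 : measurable_fun setT (EFin \o g2) by exact/measurable_EFinP.
have mE3 : measurable_fun setT (EFin \o g3) by exact/measurable_EFinP.
have mE4 : measurable_fun setT (EFin \o (fun s : R => g1 s + g2 s + c3 * g3 s)) by exact/measurable_EFinP.
have c30 : 0 <= c3 by rewrite mulr_ge0.
have z1 s : (0 <= (g1 s)%:E)%E by rewrite lee_fin.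
have z2 s : (0 <= (g2 s)%:E)%E by rewrite lee_fin.
have z3 s : (0 <= (g3 s)%:E)%E by rewrite lee_fin.
have z4 s : (0 <= (g1 s + g2 s + c3 * g3 s)%:E)%E by rewrite lee_fin !addr_ge0// mulr_ge0.
have -> : (\int[lebr s0 T]_s (sq (t - t0) * (g1 s + g2 s + c3 * g3 s))%:E =
   (sq (t - t0))%:E * \int[lebr s0 T]_s (g1 s + g2 s + c3 * g3 s)%:E)%E.
  by under eq_integral do rewrite EFinM; rewrite ge0_integralZl// lee_fin.
rewrite [X in (_ <= X)%E](_ : _ = ((sq (t - t0))%:E * (2 * Num.sqrt e + 2 * Num.sqrt e + c3 * e)%:E)%E); last first.
  rewrite -EFinM; congr (_%:E); rewrite mulrC; congr (_ * _); rewrite /c3 -[in X in _ * _ * X](sqr_sqrtr (ltW e0)).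
  by field; rewrite gt_eqF// sqrtr_gt0.
apply: lee_wpmul2l; first by rewrite lee_fin.
have -> : (\int[lebr s0 T]_s (g1 s + g2 s + c3 * g3 s)%:E =
   \int[lebr s0 T]_s (g1 s)%:E + \int[lebr s0 T]_s (g2 s)%:E + c3%:E * \int[lebr s0 T]_s (g3 s)%:E)%E.
  under eq_integral do rewrite EFinD EFinD EFinM.
  rewrite ge0_integralD//; last first.
  - by apply: emeasurable_funM.
  - by move=> s _; rewrite mule_ge0.
  - by apply: emeasurable_funD.
  - by move=> s _; rewrite adde_ge0.
  by rewrite ge0_integralD// ge0_integralZl.
rewrite !EFinD [(c3 * e)%:E]EFinM; apply: leeD; first exact: leeD.
by apply: lee_wpmul2l => //; rewrite lee_fin.
Qed.

Section SimplexBound.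
Variables (nu2 : {finite_measure set (measurableTypeR R) -> \bar R}) (r2 : R -> R) (y : R).
Hypotheses (mr2 : @measurable_fun _ _ (measurableTypeR R) R setT r2) (r20 : forall x, 0 <= r2 x).
Variable R2 : R.
Hypothesis r2R2 : (\int[nu2]_x (r2 x)%:E <= R2%:E)%E.
Local Notation mu2 := (fprodm (lebr s0 T) nu2).

Let kap := 6 * Num.sqrt e * R2.

Let R20 : 0 <= R2.
Proof. by rewrite -lee_fin (le_trans _ r2R2)// integral_ge0// => x _; rewrite lee_fin. Qed.

Let kap0 : 0 <= kap. Proof. by rewrite !mulr_ge0 ?sqrtr_ge0. Qed.

Lemma dirichlet_bound k (q : pt) :
  (\int[tmeas mu2 k]_u (chain dk (t0, y) u q * \prod_(p <- u) r2 p.2)%:E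
    <= (kap ^+ k * expR (e^-1 * (q.1 - t0)) * sq (q.1 - t0))%:E)%E.
Proof.
have mr : measurable_fun setT (fun p : pt => r2 p.2).
  exact: (measurableT_comp mr2 (@measurable_snd _ _ R R)).
have mF k' (q' : pt) : measurable_fun setT (fun u : k'.-tuple pt => (chain dk (t0, y) u q' * \prod_(p <- u) r2 p.2)%:E).
  apply/measurable_EFinP; apply: measurable_funM.
    by apply: measurable_chain => //; exact: measurable_dk.
  exact: measurable_prod_tuple.
have F0 k' (q' : pt) (u : k'.-tuple pt) : (0 <= (chain dk (t0, y) u q' * \prod_(p <- u) r2 p.2)%:E)%E.
  by rewrite lee_fin mulr_ge0 ?chain_dk_ge0// prodr_ge0.
elim: k q => [|k IH] q.
  rewrite ge0_integral_tmeas0; [|exact: mF|by move=> u; exact: F0].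
  have -> : \prod_(p <- [tuple of [::]]) r2 (p : pt).2 = 1 by exact: big_nil.
  rewrite mulr1 expr0 mul1r lee_fin /chain/= mul1r /dk/=.
  have [qt|qt] := leP q.1 t0; first by rewrite ler0_sqrtr ?subr_le0// invr0 mulr0.
  by rewrite ler_peMl// -expR0 ler_expR mulr_ge0 ?invr_ge0 ?subr_ge0 ?ltW.
pose G (p : pt) : R := dk p q * r2 p.2 * (kap ^+ k * expR (e^-1 * (p.1 - t0)) * sq (p.1 - t0)).
have mdk : measurable_fun setT (fun p : pt => dk p q).
  apply: measurable_isqrt; apply: measurable_funB => //; exact: measurable_fst.
have mH : measurable_fun setT (fun up : k.-tuple pt * pt => (chain dk (t0, y) (trcons up) q * \prod_(p <- trcons up) r2 p.2)%:E).
  by apply: (measurableT_comp (mF k.+1 q)); exact: measurable_trcons.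
rewrite ge0_integral_tmeas_rcons; [|exact: mF|by move=> u; exact: F0].
have F0' (up : k.-tuple pt * pt) : (0 <= (chain dk (t0, y) (trcons up) q * \prod_(p <- trcons up) r2 p.2)%:E)%E.
  exact: F0.
have e2 := @fubini_tonelli2 _ _ _ _ R (tmeas mu2 k) mu2 _ mH F0'.
rewrite e2 {e2}.
have mA : measurable_fun setT (fun s : R => sq (q.1 - s) * (kap ^+ k * expR (e^-1 * (s - t0)) * sq (s - t0))).
  apply: measurable_funM; first by apply: measurable_isqrt; exact: measurable_funB.
  apply: measurable_funM; last by apply: measurable_isqrt; exact: measurable_funB.
  apply: measurable_funM => //; apply: (measurableT_comp (f := @expR R)) => //.
  by apply: measurable_funM => //; exact: measurable_funB.
have A0 s : 0 <= sq (q.1 - s) * (kap ^+ k * expR (e^-1 * (s - t0)) * sq (s - t0)).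
  by rewrite !mulr_ge0 ?expR_ge0// exprn_ge0.
have GE p : G p = (sq (q.1 - p.1) * (kap ^+ k * expR (e^-1 * (p.1 - t0)) * sq (p.1 - t0))) * r2 p.2.
  by rewrite /G /dk mulrAC.
have G0 p : 0 <= G p by rewrite GE mulr_ge0.
have mG : measurable_fun setT (fun p : pt => (G p)%:E).
  apply/measurable_EFinP.
  have -> : G = fun p => (sq (q.1 - p.1) * (kap ^+ k * expR (e^-1 * (p.1 - t0)) * sq (p.1 - t0))) * r2 p.2.
    by apply/funext => p; exact: GE.
  apply: measurable_funM => //; apply: (measurableT_comp mA); exact: measurable_fst.
apply: (@le_trans _ _ (\int[mu2]_p (G p)%:E)%E).
  apply: ge0_le_integral => //.
  - by move=> p _; apply: integral_ge0 => u _; exact: F0.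
  - exact: (@measurable_fun_fubini_tonelli_G _ _ _ _ R (tmeas mu2 k) _ mH F0').
  - move=> p _; rewrite /fubini_G.
    have -> : (\int[tmeas mu2 k]_u (chain dk (t0, y) (trcons (u, p)) q * \prod_(p <- trcons (u, p)) r2 p.2)%:E =
       (dk p q * r2 p.2)%:E * \int[tmeas mu2 k]_u (chain dk (t0, y) u p * \prod_(p <- u) r2 p.2)%:E)%E.
      have c0 : (0 <= (dk p q * r2 p.2)%:E)%E by rewrite lee_fin mulr_ge0// dk_ge0.
      rewrite -(@ge0_integralZl _ _ _ (tmeas mu2 k) _ measurableT _ (mF k p) _ (fun u _ => F0 k p u) c0).
      apply: eq_integral => u _; rewrite -EFinM /= chain_rcons -cats1 big_cat/= big_seq1.
      by congr (_%:E); rewrite [RHS]mulrACA [dk p q * _]mulrC [r2 p.2 * _]mulrC.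
    rewrite [leRHS](_ : _ = (dk p q * r2 p.2)%:E * (kap ^+ k * expR (e^-1 * (p.1 - t0)) * sq (p.1 - t0))%:E)%E; last by rewrite -EFinM.
    apply: lee_wpmul2l; first by rewrite lee_fin mulr_ge0// dk_ge0.
    exact: IH.
have G0' (p : pt) : (0 <= (G p)%:E)%E by rewrite lee_fin.
have e1 := @fubini_tonelli1 _ _ _ _ R (lebr s0 T) nu2 _ mG G0'.
rewrite /fprodm e1 {e1}.
apply: (@le_trans _ _ (\int[lebr s0 T]_s ((R2 * kap ^+ k * expR (e^-1 * (q.1 - t0))) *
    (expR (- (e^-1 * (q.1 - s))) * sq (q.1 - s) * sq (s - t0)))%:E)%E).
  apply: ge0_le_integral => //.
  - by move=> s _; apply: integral_ge0 => x _; rewrite lee_fin.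
  - by apply: (@measurable_fun_fubini_tonelli_F _ _ _ _ R nu2 (fun p => (G p)%:E)) => // p; rewrite lee_fin.
  - apply/measurable_EFinP; apply: measurable_funM => //; apply: measurable_funM.
      apply: measurable_funM; last by apply: measurable_isqrt; exact: measurable_funB.
      apply: (measurableT_comp (f := @expR R)) => //; under eq_fun do rewrite -mulNr.
      by apply: measurable_funM => //; exact: measurable_funB.
    by apply: measurable_isqrt; exact: measurable_funB.
  - move=> s _; rewrite /fubini_F.
    under eq_integral do rewrite GE/= EFinM.
    rewrite ge0_integralZl//; last 3 first.
    + by apply/measurable_EFinP.
    + by move=> x _; rewrite lee_fin.
    + by rewrite lee_fin.
    apply: (@le_trans _ _ ((sq (q.1 - s) * (kap ^+ k * expR (e^-1 * (s - t0)) * sq (s - t0)))%:E * R2%:E)%E).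
      by apply: lee_wpmul2l => //; rewrite lee_fin.
    rewrite -EFinM lee_fin (_ : e^-1 * (s - t0) = e^-1 * (q.1 - t0) + - (e^-1 * (q.1 - s))); last by ring.
    rewrite expRD le_eqVlt; apply/orP; left; apply/eqP.
    move: (kap ^+ k) (expR (e^-1 * _)) (expR (- _)) (sq (q.1 - s)) (sq (s - t0)) => a1 a2 a3 a4 a5; ring.
under eq_integral do rewrite EFinM.
have c0 : 0 <= R2 * kap ^+ k * expR (e^-1 * (q.1 - t0)) by rewrite !mulr_ge0 ?expR_ge0 ?exprn_ge0.
have c0' : (0 <= (R2 * kap ^+ k * expR (e^-1 * (q.1 - t0)))%:E)%E by rewrite lee_fin.
have mL : measurable_fun setT (fun s : R => (expR (- (e^-1 * (q.1 - s))) * sq (q.1 - s) * sq (s - t0))%:E).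
  apply/measurable_EFinP; apply: measurable_funM.
    apply: measurable_funM; last by apply: measurable_isqrt; exact: measurable_funB.
    apply: (measurableT_comp (f := @expR R)) => //; under eq_fun do rewrite -mulNr.
    by apply: measurable_funM => //; exact: measurable_funB.
  by apply: measurable_isqrt; exact: measurable_funB.
have L0 (s : R) : (0 <= (expR (- (e^-1 * (q.1 - s))) * sq (q.1 - s) * sq (s - t0))%:E)%E.
  by rewrite lee_fin !mulr_ge0 ?expR_ge0.
rewrite (@ge0_integralZl _ _ _ (lebr s0 T) _ measurableT _ mL _ (fun s _ => L0 s) c0').
apply: (le_trans (lee_wpmul2l _ (convolution_bound q.1))); first by rewrite lee_fin.
rewrite -EFinM lee_fin exprS /kap le_eqVlt; apply/orP; left; apply/eqP.
move: ((6 * Num.sqrt e * R2) ^+ k) (expR _) (sq _) (Num.sqrt e) => a1 a2 a3 a4; ring.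
Qed.
End SimplexBound.

End Dirichlet.

(** * Pairing a single path with a test function *)

Section ParametricIntegrals.
Context {R : realType} d1 d2 {T1 : measurableType d1} {T2 : measurableType d2}.
Variables (m2 : {sigma_finite_measure set T2 -> \bar R}).

Lemma cmeas_param2 (f : T1 * T2 -> R[i]) : cmeas f -> cmeas (fun x => cint m2 setT (fun y => f (x, y))).
Proof.
have key (g : T1 * T2 -> R) : measurable_fun setT g ->
    measurable_fun setT (fun x => Rintegral m2 setT (fun y => g (x, y))).
  move=> /measurable_EFinP mg; apply: measurableT_comp => //.
  rewrite (_ : (fun x => _) = fun x =>
     (fubini_F m2 ((EFin \o g)^\+%E) x - fubini_F m2 ((EFin \o g)^\-%E) x)%E).
    apply: emeasurable_funB; apply: measurable_fun_fubini_tonelli_F => //.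
    - exact: measurable_funepos.
    - exact: measurable_funeneg.
  apply/funext => x; rewrite integralE /fubini_F; congr (_ - _)%E; apply: eq_integral => y _.
    by rewrite !funeposE.
  by rewrite !funenegE.
by move=> [a b]; split; [exact: (key _ a)|exact: (key _ b)].
Qed.

End ParametricIntegrals.

Section ScaleIntegral.
Context {R : realType} d {T : measurableType d}.
Variable mu : {measure set T -> \bar R}.

Lemma cintZ_scaled (z : R[i]) (D : set T) (f : T -> R[i]) : measurable D ->
  cintg mu D (fun x => z * f x) -> cint mu D (fun x => z * f x) = z * cint mu D f.
Proof.
move=> mD; have [->|z0] := eqVneq z 0.
  move=> _; rewrite mul0r -[RHS](cint0 mu mD); apply: eq_cint => x _; exact: mul0r.
move=> zf; have fi : cintg mu D f.
  rewrite (_ : f = fun x => z^-1 * (z * f x)); first exact: cintgZ.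
  by apply/funext => x; rewrite mulKf.
exact: cintZ.
Qed.
End ScaleIntegral.

Lemma cpart_cvg_unique {R : realType} (u : nat -> R[i]) a b :
  cpart_cvg u a -> cpart_cvg u b -> a = b.
Proof.
move=> [a1 a2] [b1 b2]; apply: complex_ext.
  exact: (cvg_unique _ a1 b1).
exact: (cvg_unique _ a2 b2).
Qed.

Lemma integrable_isqrt_lebr {R : realType} (a b c : R) : c <= b ->
  (lebr a b).-integrable setT (fun t : R => ((Num.sqrt (t - c))^-1)%:E).
Proof.
move=> cb.
have mf : measurable_fun setT (fun t : R => (Num.sqrt (t - c))^-1).
  by apply: measurable_isqrt; exact: measurable_funB.
have f0 (t : R) : 0 <= (Num.sqrt (t - c))^-1 by rewrite invr_ge0 sqrtr_ge0.
apply/integrableP; split; first exact/measurable_EFinP.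
have -> : (\int[lebr a b]_t `|((Num.sqrt (t - c))^-1)%:E| = \int[lebr a b]_t ((Num.sqrt (t - c))^-1)%:E)%E.
  by apply: eq_integral => t _; rewrite gee0_abs// lee_fin.
have cb1 : c <= b + 1 by rewrite (le_trans cb)// lerDl.
apply: le_lt_trans (le_lt_trans (integral_isqrt_right cb1) (ltry _)).
rewrite ge0_integral_lebr; [|exact/measurable_EFinP|by move=> t; rewrite lee_fin].
rewrite integral_mkcond [leRHS]integral_mkcond; apply: ge0_le_integral => //.
- by move=> t _; rewrite patchE; case: ifP => _; rewrite ?lee_fin.
- apply/(measurable_restrictT _ _).1 => //; apply: measurable_funTS; exact/measurable_EFinP.
- apply/(measurable_restrictT _ _).1 => //; apply: measurable_funTS; apply/measurable_EFinP.
  by apply: measurable_fun_ifT => //; exact: measurable_fun_ltr.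
- move=> t _; rewrite !patchE !mem_setE !in_itv/=; case: ifP => [/andP[h1 h2]|_].
    have [ct|tc] := leP c t; last first.
      rewrite /= [X in (X%:E <= _)%E](_ : _ = 0) ?lee_fin//.
      by rewrite ler0_sqrtr ?invr0// subr_le0 ltW.
    have t1 : t < b + 1 by rewrite (le_lt_trans h2)// ltrDl.
    by rewrite (ltW t1) t1.
  by case: ifP => _; rewrite ?lee_fin//; case: ifP.
Qed.

Section PathIBP.
Context {R : realType}.
Implicit Types (p q w : R * R) (u v : seq (R * R)).
Variables (Th1 Th2 h hd : R -> R[i]) (t0 y T M : R).
Hypotheses (dTh1 : forall t, is_cd Th1 t (h t)) (dTh2 : forall t, is_cd Th2 t (h t ^+ 2))
  (dh : forall t, is_cd h t (hd t)) (chd : forall t, ccont hd t).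
Hypotheses (t0T : t0 <= T) (yM : `|y| <= M).
Variables (phi px pxx pt : R -> R -> R[i]).
Hypothesis (tst : is_test phi px pxx pt M T).
Variables (K C : R).

Local Notation path := (path Th1 Th2 h t0 y).
Local Notation Lph := (Lphi hd phi pxx pt).

Definition path_bounded := forall u v q, okpt t0 T M q -> all (okpt t0 T M) u ->
  all (fun w => t0 <= w.1 <= T) v ->
  normc (path u v q) <= K ^+ (size u).+1 * chain dk (t0, y) u q * \prod_(w <- v) expR (C * `|w.2|).

Hypothesis pbound : path_bounded.

Let M0 : 0 <= M. Proof. exact: le_trans (normr_ge0 _) yM. Qed.

Lemma jcont_Lphi : jcont Lph.
Proof.
have := tst_c tst; have := tst_cxx tst; have := tst_ct tst => -[t1 t2] [x1 x2] [p1 p2].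
have jc (f g : R -> R -> R[i]) : (forall p, ccont (fun p : R * R => f p.1 p.2) p) -> jcont f.
  by move=> cf; split => p; case: (cf p).
apply: (jc _ (fun _ _ => 0)) => p.
have c1 : ccont (fun p : R * R => phi p.1 p.2) p by split; [exact: p1|exact: p2].
have c2 : ccont (fun p : R * R => pxx p.1 p.2) p by split; [exact: x1|exact: x2].
have c3 : ccont (fun p : R * R => pt p.1 p.2) p by split; [exact: t1|exact: t2].
have c4 : ccont (fun p : R * R => hd p.2) p.
  have cs : snd @ p --> p.2 by exact: cvg_snd.
  by have [h1 h2] := chd p.2; split; [exact: (cvg_comp _ _ cs h1)|exact: (cvg_comp _ _ cs h2)].
have c5 : ccont (fun p : R * R => (p.1)%:C%C) p by apply: ccont_real; exact: cvg_fst.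
by rewrite /Lphi; ccont_step.
Qed.

Let mTh1 : cmeas Th1 := ccont_measurable (fun t => is_cd_ccont (dTh1 t)).
Let mTh2 : cmeas Th2 := ccont_measurable (fun t => is_cd_ccont (dTh2 t)).
Let mh : cmeas h := ccont_measurable (fun t => is_cd_ccont (dh t)).

Lemma path_Lphi_cmeas u v : cmeas (fun tx : R * R => path u v tx * Lph tx.2 tx.1).
Proof.
apply: cmeasM.
  have := @path_cmeas R _ (R * R)%type Th1 Th2 h t0 y mTh1 mTh2 mh (size u) (size v)
    (fun=> in_tuple u) (fun=> in_tuple v) id.
  by apply.
have := jcont_cmeas jcont_Lphi => m; apply: (cmeas_comp m (g := fun tx : R * R => (tx.2, tx.1))).
by apply: measurable_fun_pair; [exact: measurable_snd|exact: measurable_fst].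
Qed.

Let inner u v (t : R) : R[i] := lintegral `[- M, M] (fun x => path u v (t, x) * Lph x t).

Let inner_lebr u v t : inner u v t = cint (lebr (- M) M) setT (fun x => path u v (t, x) * Lph x t).
Proof.
apply: lintegral_lebr.
by apply: (cmeas_comp (path_Lphi_cmeas u v) (g := fun x => (t, x))); exact: measurable_fun_pair.
Qed.

Lemma inner_cmeas u v : cmeas (inner u v).
Proof.
rewrite (_ : inner u v = fun t => cint (lebr (- M) M) setT (fun x => path u v (t, x) * Lph x t)).
  exact: (@cmeas_param2 R _ _ (measurableTypeR R) (measurableTypeR R) (lebr (- M) M) _ (path_Lphi_cmeas u v)).
by apply/funext => t; exact: inner_lebr.
Qed.

Section FixedPath.
Variables (u v : seq (R * R)).
Hypotheses (oku : all (okpt t0 T M) u) (okv : all (fun w => t0 <= w.1 <= T) v).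
Let p := last (t0, y) u.
Let P := pre (seg Th1 v) (t0, y) u.
Let kH := kick_H h v.
Let kT1 := kick_T1 Th1 v.
Let kT2 := kick_T2 Th1 Th2 v.
Let G := gker kH kT1 kT2 p.1 (kick_c Th1 v p) (kick_c' Th1 Th2 h t0 y v).

Let okp : okpt t0 T M p.
Proof.
rewrite /p; case: (lastP u) oku => [|u' p' oku']; first by rewrite /okpt/= lexx t0T.
by rewrite last_rcons; move: oku'; rewrite all_rcons => /andP[].
Qed.

Let pathE t x : all (fun w => w.1 <= t) v -> p.1 < t -> path u v (t, x) = P * G x t.
Proof. by move=> vt pt'; exact: path_gker. Qed.

Let bK : exists B : R, 0 <= B /\ forall t x, t0 <= t <= T -> `|x| <= M ->
  normc (path u v (t, x) * Lph x t) <= B * dk p (t, 0).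
Proof.
have [CL hCL] := jcont_cbnd (- M) M t0 T jcont_Lphi.
have CL0 : 0 <= CL.
  apply: le_trans (hCL (M, t0) _); first exact: normc_ge0.
  by split; rewrite /= lexx ?andbT ?t0T//; move: M0; lra.
pose B := `|K ^+ (size u).+1| * `|pre dk (t0, y) u| * \prod_(w <- v) expR (C * `|w.2|) * CL.
have E0 : 0 <= \prod_(w <- v) expR (C * `|w.2|) by apply: prodr_ge0 => w _; exact: expR_ge0.
exists B; split; first by rewrite !mulr_ge0.
move=> t x tT xM; rewrite Normc.normcM.
have h1 := @pbound u v (t, x) (introT andP (conj tT xM)) oku okv.
have h2 : normc (Lph x t) <= CL by apply: (hCL (x, t)); split => //=; rewrite -ler_norml.
apply: (le_trans (ler_pM (normc_ge0 _) (normc_ge0 _) h1 h2)).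
rewrite /chain -/p (_ : dk p (t, x) = dk p (t, 0))//.
rewrite (_ : B * dk p (t, 0) = `|K ^+ (size u).+1| * `|pre dk (t0, y) u| * dk p (t, 0) * \prod_(w <- v) expR (C * `|w.2|) * CL); last by rewrite /B; ring.
rewrite ler_wpM2r// ler_wpM2r// mulrA ler_wpM2r ?dk_ge0// -normrM.
exact: ler_norm.
Qed.

Let mG t : cmeas (fun x => path u v (t, x) * Lph x t).
Proof. by apply: (cmeas_comp (path_Lphi_cmeas u v) (g := fun x => (t, x))); exact: measurable_fun_pair. Qed.

Let inner_le : exists B : R, 0 <= B /\ forall t, t0 <= t <= T -> normc (inner u v t) <= B * dk p (t, 0).
Proof.
have [B [B0 hB]] := bK; exists (2 * (B * (M - - M))); split.
  by rewrite !mulr_ge0// opprK addr_ge0.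
move=> t tT; rewrite (_ : _ * dk p (t, 0) = 2 * (B * dk p (t, 0) * (M - - M))); last by ring.
apply: normc_lintegral => //; first by move: M0; lra.
by move=> x xM; apply: hB => //; rewrite ler_norml.
Qed.

Lemma path_ibp a : all (fun w => w.1 <= a) v -> p.1 < a -> a <= T ->
  lintegral `[a, T] (inner u v) = iC * lintegral `[- M, M] (fun x => path u v (a, x) * phi x a).
Proof.
move=> va pa aT; have ta : t0 <= a by case/andP: okp => /andP[h1 _] _; rewrite (le_trans h1)// ltW.
have vt t : a <= t -> all (fun w => w.1 <= t) v.
  by move=> at_; apply/allP => w /(allP va) wa; exact: le_trans wa at_.
have MM : - M <= M by move: M0; lra.
have [B [B0 hB]] := bK; have [B' [B'0 hB']] := inner_le.
have ibp := kernel_ibp (kick_c Th1 v p) (kick_c' Th1 Th2 h t0 y v) (is_cd_kick_T1 v dTh1) (is_cd_kick_T2 v dTh1 dTh2)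
  (is_cd_kick_H v dh) chd M0 tst pa aT.
have e1 t : a <= t <= T -> inner u v t = P * lintegral `[- M, M] (fun x => G x t * Lph x t).
  move=> /andP[at_ tT]; have pt' : p.1 < t by exact: lt_le_trans at_.
  transitivity (lintegral `[- M, M] (fun x => P * (G x t * Lph x t))).
    by apply: eq_cint => x _; rewrite mulrA; congr (_ * _); apply: pathE => //; exact: vt.
  apply: cintZ_scaled => //.
  rewrite (_ : (fun x => _) = fun x => path u v (t, x) * Lph x t); last first.
    by apply/funext => x; rewrite mulrA; congr (_ * _); symmetry; apply: pathE => //; exact: vt.
  apply: cbnd_cintg => //; exists (B * dk p (t, 0)) => x xM.
  by apply: hB; rewrite ?ler_norml// tT (le_trans ta).
transitivity (lintegral `[a, T] (fun t => P * lintegral `[- M, M] (fun x => G x t * Lph x t))).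
  by apply: eq_cint => t; rewrite /= in_itv/=; exact: e1.
transitivity (P * lintegral `[a, T] (fun t => lintegral `[- M, M] (fun x => G x t * Lph x t))).
  apply: cintZ_scaled => //.
  have i1 : cintg lebesgue_measure `[a, T] (inner u v).
    apply: cbnd_cintg; first exact: inner_cmeas.
    exists (B' * dk p (a, 0)) => t /andP[at_ tT]; apply: (le_trans (hB' t _)).
      by rewrite tT (le_trans ta).
    rewrite ler_wpM2l// /dk/= lef_pV2 ?posrE ?sqrtr_gt0 ?subr_gt0// ?(lt_le_trans pa)//.
    by rewrite ler_wsqrtr// lerB.
  move: i1 => /(@cintg_mkcond _ _ (measurableTypeR R) _ _ _ (measurable_itv _)) i1.
  apply/(@cintg_mkcond _ _ (measurableTypeR R) _ _ _ (measurable_itv _)).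
  move: i1; congr (cintg _ _ _); apply/funext => t; rewrite mem_setE in_itv/=.
  by case: ifP => // /e1.
rewrite ibp mulrCA; congr (_ * _).
have iG : cintg lebesgue_measure `[- M, M] (fun x => P * (G x a * phi x a)).
  have [Cp hCp] := jcont_cbnd (- M) M a a (tst_c tst).
  have aa : t0 <= a <= T by rewrite ta aT.
  have e2 : (fun x => P * (G x a * phi x a)) = fun x => path u v (a, x) * phi x a.
    by apply/funext => x; rewrite mulrA; congr (_ * _); symmetry; exact: pathE.
  rewrite e2; apply: cbnd_cintg.
    apply: cmeasM.
      have := @path_cmeas R _ (measurableTypeR R) Th1 Th2 h t0 y mTh1 mTh2 mh (size u) (size v)
        (fun=> in_tuple u) (fun=> in_tuple v) (fun x => (a, x)).
      by apply => //; exact: measurable_fun_pair.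
    by apply: ccont_measurable => x; exact: jcont1 (tst_c tst).
  apply: cbndM; last by exists Cp => x xM; apply: (hCp (x, a)); split => //=; rewrite lexx.
  exists (K ^+ (size u).+1 * chain dk (t0, y) u (a, 0) * \prod_(w <- v) expR (C * `|w.2|)) => x xM.
  have := @pbound u v (a, x) _ oku okv; apply.
  by rewrite /okpt /= aa ler_norml.
transitivity (lintegral `[- M, M] (fun x => P * (G x a * phi x a))).
  by symmetry; apply: cintZ_scaled.
by apply: eq_cint => x _; rewrite mulrA; congr (_ * _); symmetry; exact: pathE.
Qed.

Lemma path_delta : all (fun w => w.1 <= p.1) v ->
  cint (lebr t0 T) setT (fun t => if (p.1 < t) && (t <= T) then inner u v t else 0) =
  iC * (phi p.2 p.1 * (P * cexp (phase Th1 Th2 h t0 y v p))).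
Proof.
move=> vp; have /andP[/andP[tp pT] pM] := okp.
have mI := inner_cmeas u v.
have mS (a : R) : measurable_fun setT (fun t : R => (a < t) && (t <= T)).
  by apply: measurable_and; [exact: measurable_fun_ltr|exact: measurable_fun_ler].
have mS' (a : R) : measurable_fun setT (fun t : R => (a <= t) && (t <= T)).
  by apply: measurable_and; exact: measurable_fun_ler.
have [Tp|pT'] := leP T p.1.
  have pTe : p.1 = T by apply/eqP; rewrite eq_le pT Tp.
  rewrite pTe (tst_T tst) mul0r mulr0 -[RHS](cint0 (lebr t0 T) (measurableT)).
  by apply: eq_cint => t _; case: ltP => //= h1; rewrite leNgt h1.
pose m : R := Num.min 1 (T - p.1).
have m0 : 0 < m by rewrite lt_min ltr01 subr_gt0.
pose dl (n : nat) : R := m / n.+1%:R.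
have dl0 n : 0 < dl n by rewrite divr_gt0// ltr0n.
have dlm n : dl n <= m by rewrite ler_pdivrMr ?ltr0n// ler_peMr ?(ltW m0)// ler1n.
have dl1 n : 0 < dl n <= 1 by rewrite dl0/= (le_trans (dlm n))// /m ge_min lexx.
have dlT n : p.1 + dl n <= T by rewrite -lerBrDl (le_trans (dlm n))// /m ge_min lexx orbT.
have dlc : dl @ \oo --> (0 : R).
  by rewrite -(mulr0 m); apply: cvgM; [exact: cvg_cst|exact: cvg_harmonic].
have [B [B0 hB]] := inner_le.
pose F n t : R[i] := if (p.1 + dl n <= t) && (t <= T) then inner u v t else 0.
pose F' t : R[i] := if (p.1 < t) && (t <= T) then inner u v t else 0.
have mF n : cmeas (F n) by apply: cmeas_if; [exact: mS'|exact: mI|exact: cmeas_cst].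
have mF' : cmeas F' by apply: cmeas_if; [exact: mS|exact: mI|exact: cmeas_cst].
have c1 : cpart_cvg (fun n => cint (lebr t0 T) setT (F n)) (cint (lebr t0 T) setT F').
  apply: (@cint_dominated R _ (measurableTypeR R) (lebr t0 T) F F' (fun t => B * (Num.sqrt (t - p.1))^-1)).
  - exact: mF.
  - exact: mF'.
  - move=> t; have [tp'|pt'] := leP t p.1.
      rewrite (_ : (fun n => _) = cst 0); first by rewrite /F' ltNge tp'; exact: cpart_cvg_cst.
      by apply/funext => n; rewrite /F leNgt (le_lt_trans tp')//= ltrDl.
    rewrite /F' pt'/=.
    have ev : \forall n \near \oo, F n t = if t <= T then inner u v t else 0.
      have : \forall n \near \oo, `|0 - dl n| < t - p.1.
        by apply: (cvgrPdist_lt _ _).1 dlc _ _; rewrite subr_gt0.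
      apply: filterS => n; rewrite sub0r normrN gtr0_norm// => h1.
      by rewrite /F -lerBrDl (ltW h1).
    split; apply: (cvg_trans (near_eq_cvg _) (cvg_cst _)).
      by near=> n; rewrite (near ev n).
    by near=> n; rewrite (near ev n).
  - have := integrable_isqrt_lebr t0 pT => /(integrableZl measurableT B).
    by apply: eq_integrable => // t _; rewrite EFinM.
  - move=> n t; rewrite /F; case: ifP => [/andP[h1 h2]|_]; last first.
      by rewrite Normc.normc0 mulr_ge0// invr_ge0 sqrtr_ge0.
    apply: hB; rewrite h2 andbT (le_trans tp)// (le_trans _ h1)// lerDl ltW//.
have c2 := delta_limit p.1 (kick_c' Th1 Th2 h t0 y v) (is_cd_kick_T1 v dTh1) (is_cd_kick_T2 v dTh1 dTh2)
  (is_cd_kick_H v dh) pM tst dl1 dlc.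
apply: (cpart_cvg_unique c1).
have MM : - M <= M by move: M0; lra.
have e n : cint (lebr t0 T) setT (F n) =
   iC * (P * lintegral `[- M, M] (fun x => gker kH kT1 kT2 p.1 (kT1 p.1 + p.2%:C%C)
      (kick_c' Th1 Th2 h t0 y v) x (p.1 + dl n) * phi x (p.1 + dl n))).
  have va : all (fun w => w.1 <= p.1 + dl n) v.
    by apply/allP => w /(allP vp) wp; rewrite (le_trans wp)// lerDl ltW.
  have pa : p.1 < p.1 + dl n by rewrite ltrDl.
  transitivity (lintegral `[p.1 + dl n, T] (inner u v)).
    rewrite -(lintegral_lebr t0 T (mF n)) /lintegral [LHS]cint_mkcond [RHS]cint_mkcond.
    apply: eq_cint => t _; rewrite !mem_setE !in_itv/= /F.
    have [h1|h1] := leP (p.1 + dl n) t; last by rewrite if_same.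
    by rewrite /= (le_trans tp (le_trans (ltW pa) h1))/=; case: ifP => // ->.
  rewrite path_ibp//; congr (_ * _).
  transitivity (lintegral `[- M, M] (fun x => P * (gker kH kT1 kT2 p.1 (kT1 p.1 + p.2%:C%C)
      (kick_c' Th1 Th2 h t0 y v) x (p.1 + dl n) * phi x (p.1 + dl n)))).
    apply: eq_cint => x _; rewrite mulrA; congr (_ * _).
    by rewrite pathE// /G kick_c_last.
  apply: cintZ_scaled => //; apply: cbnd_cintg.
    apply: cmeasM; first exact: cmeas_cst.
    apply: cmeasM; last by apply: ccont_measurable => x; exact: jcont1 (tst_c tst).
    by apply: ccont_measurable => x; exact: (is_cd_ccont (is_cd_gker_x _ _ _ _ _ _ x _)).
  apply: itv_cbnd => x _.
  have h1 := is_cd_ccont (is_cd_gker_x kH kT1 kT2 p.1 (kT1 p.1 + p.2%:C%C) (kick_c' Th1 Th2 h t0 y v) x (p.1 + dl n)).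
  have h2 := jcont1 (p.1 + dl n) x (tst_c tst).
  by ccont_step.
rewrite (_ : (fun n => _) = fun n => iC * (P * lintegral `[- M, M] (fun x => gker kH kT1 kT2 p.1 (kT1 p.1 + p.2%:C%C)
      (kick_c' Th1 Th2 h t0 y v) x (p.1 + dl n) * phi x (p.1 + dl n)))); last by apply/funext => n; exact: e.
rewrite [phi _ _ * _]mulrCA; apply: cpart_cvgM; first exact: cpart_cvg_cst.
apply: cpart_cvgM; first exact: cpart_cvg_cst.
by rewrite phase_kick.
Unshelve. all: by end_near.
Qed.

End FixedPath.
End PathIBP.

Section Domination.
Context {R : realType} d {T : measurableType d}.

Lemma cintg_dom (mu : {measure set T -> \bar R}) (f : T -> R[i]) (g : T -> R) :
  cmeas f -> measurable_fun setT g -> (forall x, normc (f x) <= g x) ->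
  (\int[mu]_x (g x)%:E < +oo)%E -> cintg mu setT f.
Proof.
move=> mf mg fg ig; apply: (cintg_le mf fg).
apply/integrableP; split; first exact/measurable_EFinP.
apply: le_lt_trans ig; rewrite le_eqVlt; apply/orP; left; apply/eqP.
apply: eq_integral => x _ /=; rewrite ger0_norm//.
by rewrite (le_trans (normc_ge0 _) (fg x)).
Qed.

Lemma normc_cint_dom (mu : {measure set T -> \bar R}) (f : T -> R[i]) (g : T -> R) (B : R) :
  cmeas f -> measurable_fun setT g -> (forall x, normc (f x) <= g x) ->
  (\int[mu]_x (g x)%:E <= B%:E)%E -> normc (cint mu setT f) <= 2 * B.
Proof.
move=> mf mg fg ig.
have fi := cintg_dom mf mg fg (le_lt_trans ig (ltry _)).
have ni := cintg_normc fi.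
have inn : mu.-integrable setT (EFin \o (fun x => normc (f x))).
  have [_ _] := (ni, fg); apply/integrableP; split.
    by apply/measurable_EFinP; exact: measurable_normc.
  apply: le_lt_trans (le_lt_trans ig (ltry _)); apply: ge0_le_integral => //.
  - by apply: measurableT_comp => //; apply/measurable_EFinP; exact: measurable_normc.
  - exact/measurable_EFinP.
  - by move=> x _ /=; rewrite lee_fin ger0_norm ?normc_ge0.
apply: (le_trans (normc_cint measurableT fi inn)); rewrite ler_wpM2l// -lee_fin.
rewrite /Rintegral fineK; last exact: integrable_fin_num.
apply: le_trans ig; apply: ge0_le_integral => //.
- by move=> x _; rewrite lee_fin normc_ge0.
- by apply/measurable_EFinP; exact: measurable_normc.
- exact/measurable_EFinP.
- by move=> x _; rewrite lee_fin.
Qed.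

Lemma ge0_integral_prod_tmeas (mu : {finite_measure set T -> \bar R}) (f : T -> R) (B : R) m :
  measurable_fun setT f -> (forall x, 0 <= f x) -> (\int[mu]_x (f x)%:E <= B%:E)%E ->
  (\int[tmeas mu m]_v (\prod_(w <- v) f w)%:E <= (B ^+ m)%:E)%E.
Proof.
move=> mf f0 fB.
have B0 : 0 <= B by rewrite -lee_fin (le_trans _ fB)// integral_ge0// => x _; rewrite lee_fin.
have mP m' : measurable_fun setT (fun v : m'.-tuple T => (\prod_(w <- v) f w)%:E).
  apply/measurable_EFinP; under eq_fun do rewrite big_tuple.
  by apply: measurable_prod => i _ /=; apply: (measurableT_comp mf); exact: measurable_tnth.
have P0 m' (v : m'.-tuple T) : (0 <= (\prod_(w <- v) f w)%:E)%E by rewrite lee_fin prodr_ge0.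
elim: m => [|m IH].
  rewrite ge0_integral_tmeas0; [|exact: mP|exact: P0].
  by have -> : \prod_(w <- [tuple of [::]]) f (w : T) = 1 by exact: big_nil.
rewrite ge0_integral_tmeasS; [|exact: mP|exact: P0].
apply: (@le_trans _ _ (\int[mu]_w ((B ^+ m)%:E * (f w)%:E))%E).
  apply: ge0_le_integral => //.
  - by move=> w _; apply: integral_ge0 => v _; exact: P0.
  - apply: (@measurable_fun_fubini_tonelli_F _ _ _ _ R (tmeas mu m) (fun wv => (\prod_(w' <- tcons wv) f w')%:E)).
      by apply: (measurableT_comp (mP m.+1)); exact: measurable_tcons.
    by move=> wv; exact: P0.
  - by apply: emeasurable_funM => //; exact/measurable_EFinP.
  - move=> w _.
    have -> : (\int[tmeas mu m]_v (\prod_(w' <- tcons (w, v)) f w')%:E = (f w)%:E * \int[tmeas mu m]_v (\prod_(w' <- v) f w')%:E)%E.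
      have c0 : (0 <= (f w)%:E)%E by rewrite lee_fin.
      rewrite -(@ge0_integralZl _ _ _ (tmeas mu m) _ measurableT _ (mP m) _ (fun v _ => P0 m v) c0).
      by apply: eq_integral => v _; rewrite -EFinM big_cons.
    by rewrite muleC; apply: lee_wpmul2r => //; rewrite lee_fin.
have c0 : (0 <= (B ^+ m)%:E)%E by rewrite lee_fin exprn_ge0.
have mfE : measurable_fun setT (EFin \o f) by exact/measurable_EFinP.
rewrite (@ge0_integralZl _ _ _ mu _ measurableT _ mfE _ _ c0); last by move=> x _; rewrite lee_fin.
by rewrite exprSr EFinM; apply: lee_wpmul2l.
Qed.

End Domination.

Section ProductIntegral.
Context {R : realType} d1 d2 {T1 : measurableType d1} {T2 : measurableType d2}.
Variables (m1 : {sigma_finite_measure set T1 -> \bar R}) (m2 : {sigma_finite_measure set T2 -> \bar R}).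

Lemma ge0_integral_prod_le (a : T1 -> R) (b : T2 -> R) (A B : R) :
  measurable_fun setT a -> measurable_fun setT b -> (forall x, 0 <= a x) -> (forall x, 0 <= b x) ->
  (\int[m1]_x (a x)%:E <= A%:E)%E -> (\int[m2]_x (b x)%:E <= B%:E)%E ->
  (\int[m1 \x m2]_z (a z.1 * b z.2)%:E <= (A * B)%:E)%E.
Proof.
move=> ma mb a0 b0 aA bB.
have B0 : 0 <= B by rewrite -lee_fin (le_trans _ bB)// integral_ge0// => x _; rewrite lee_fin.
have mf : measurable_fun setT (fun z : T1 * T2 => (a z.1 * b z.2)%:E).
  apply/measurable_EFinP; apply: measurable_funM.
    exact: (measurableT_comp ma (@measurable_fst _ _ T1 T2)).
  exact: (measurableT_comp mb (@measurable_snd _ _ T1 T2)).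
have f0 (z : T1 * T2) : (0 <= (a z.1 * b z.2)%:E)%E by rewrite lee_fin mulr_ge0.
rewrite (@fubini_tonelli1 _ _ _ _ R m1 m2 _ mf f0).
have mbE : measurable_fun setT (EFin \o b) by exact/measurable_EFinP.
have maE : measurable_fun setT (EFin \o a) by exact/measurable_EFinP.
apply: (@le_trans _ _ (\int[m1]_x (B%:E * (a x)%:E))%E).
  apply: ge0_le_integral => //.
  - by move=> x _; apply: integral_ge0 => y _; exact: (f0 (x, y)).
  - by apply: (@measurable_fun_fubini_tonelli_F _ _ _ _ R m2 (fun z => (a z.1 * b z.2)%:E)).
  - by apply: emeasurable_funM.
  - move=> x _; rewrite /fubini_F.
    have -> : (\int[m2]_y (a (x, y).1 * b (x, y).2)%:E = (a x)%:E * \int[m2]_y (b y)%:E)%E.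
      have c0 : (0 <= (a x)%:E)%E by rewrite lee_fin.
      rewrite -(@ge0_integralZl _ _ _ m2 _ measurableT _ mbE _ (fun y _ => _) c0)//.
      by move=> y _; rewrite lee_fin.
    by rewrite muleC; apply: lee_wpmul2r => //; rewrite lee_fin.
have c0 : (0 <= B%:E)%E by rewrite lee_fin.
rewrite (@ge0_integralZl _ _ _ m1 _ measurableT _ maE _ _ c0); last by move=> x _; rewrite lee_fin.
by rewrite mulrC EFinM; apply: lee_wpmul2l.
Qed.
End ProductIntegral.

(** * Amplitudes and their pairings *)

Section Pairing.
Context {R : realType}.
Local Notation pt := (R * R)%type.
Local Notation mR := (measurableTypeR R).
Variables (Th1 Th2 h hd : R -> R[i]) (t0 y T M : R).
Hypotheses (dTh1 : forall t, is_cd Th1 t (h t)) (dTh2 : forall t, is_cd Th2 t (h t ^+ 2))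
  (dh : forall t, is_cd h t (hd t)) (chd : forall t, ccont hd t).
Hypotheses (t0T : t0 <= T) (yM : `|y| <= M).
Variables (K C : R).
Hypotheses (K0 : 0 <= K) (C0 : 0 < C).
Hypothesis pbound : path_bounded Th1 Th2 h t0 y T M K C.
Variables (nu1 nu2 : {finite_measure set mR -> \bar R}) (rho1 rho2 : R -> R[i]) (r1 r2 : R -> R).
Hypotheses (mrho1 : @cmeas R _ mR rho1) (mrho2 : @cmeas R _ mR rho2).
Hypotheses (mr1 : @measurable_fun _ _ mR R setT r1) (mr2 : @measurable_fun _ _ mR R setT r2).
Hypotheses (rr1 : forall x, normc (rho1 x) <= r1 x) (rr2 : forall x, normc (rho2 x) <= r2 x).
Hypothesis exp1 : forall c : R, 0 < c -> (\int[nu1]_x (expR (c * `|x|) * r1 x)%:E < +oo)%E.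
Variable R2 : R.
Hypotheses (int2 : (\int[nu2]_x (r2 x)%:E <= R2%:E)%E) (supp2 : forall x, M < `|x| -> r2 x = 0).
Variables (e : R).
Hypothesis (e0 : 0 < e).

Definition mu1 : {finite_measure set (mR * mR)%type -> \bar R} := fprodm (lebr t0 T) nu1.
Definition mu2 : {finite_measure set (mR * mR)%type -> \bar R} := fprodm (lebr t0 T) nu2.
Definition inT (s : R) := (t0 <= s) && (s <= T).
Definition W1 (w : pt) : R[i] := if inT w.1 then rho1 w.2 else 0.
Definition W2 (w : pt) : R[i] := if inT w.1 then rho2 w.2 else 0.
Definition core (u v : seq pt) (q : pt) : R[i] :=
  \prod_(p <- u) W2 p * \prod_(w <- v) (W1 w * (if w.1 <= q.1 then 1 else 0)) *
  path Th1 Th2 h t0 y u v q.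
Definition PM k m : {finite_measure set (k.-tuple (mR * mR) * m.-tuple (mR * mR))%type -> \bar R} := fprodm (tmeas mu2 k) (tmeas mu1 m).
Definition Amp k m (q : pt) : R[i] := cint (PM k m) setT (fun z => core z.1 z.2 q).

Let r10 x : 0 <= r1 x. Proof. exact: le_trans (normc_ge0 _) (rr1 x). Qed.
Let r20 x : 0 <= r2 x. Proof. exact: le_trans (normc_ge0 _) (rr2 x). Qed.

Definition e1 (c : R) (w : pt) : R := expR (c * `|w.2|) * r1 w.2.

Lemma e1_ge0 c w : 0 <= e1 c w. Proof. by rewrite mulr_ge0 ?expR_ge0. Qed.

Let mexp (c : R) : @measurable_fun _ _ mR R setT (fun x => expR (c * `|x|)).
Proof.
apply: (@measurableT_comp _ _ _ _ _ _ (@expR R) _ (fun x : R => c * `|x|)) => //.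
by apply: measurable_funM => //; exact: (@normr_measurable R).
Qed.

Lemma measurable_e1 c : measurable_fun setT (e1 c).
Proof.
have m : measurable_fun setT (fun x : mR => expR (c * `|x : R|) * r1 x) by exact: measurable_funM.
exact: (measurableT_comp m (@measurable_snd _ _ R R)).
Qed.

Lemma e1_integral c : 0 < c -> exists B : R, (\int[mu1]_w (e1 c w)%:E <= B%:E)%E.
Proof.
move=> c0; have m : measurable_fun setT (fun x : mR => expR (c * `|x : R|) * r1 x) by exact: measurable_funM.
have fin : (\int[nu1]_x (expR (c * `|x|) * r1 x)%:E)%E \is a fin_num.
  rewrite ge0_fin_numE ?exp1// integral_ge0// => x _.
  by rewrite lee_fin mulr_ge0 ?expR_ge0.
exists (fine (lebr t0 T setT) * fine (\int[nu1]_x (expR (c * `|x|) * r1 x)%:E)%E).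
have := @ge0_integral_prod_le R _ _ mR mR (lebr t0 T) nu1 (cst 1) (fun x => expR (c * `|x|) * r1 x)
   (fine (lebr t0 T setT)) (fine (\int[nu1]_x (expR (c * `|x|) * r1 x)%:E)%E).
move=> H; apply: le_trans (H _ _ _ _ _ _) => //.
- rewrite le_eqVlt; apply/orP; left; apply/eqP; apply: eq_integral => w _.
  by rewrite /e1 mul1r.
- by move=> x; rewrite mulr_ge0 ?expR_ge0.
- have -> : (\int[lebr t0 T]_x (cst (1 : R) x)%:E = \int[lebr t0 T]_x (cst 1%:E) x)%E by apply: eq_integral.
  by rewrite integral_cst// mul1e fineK// fin_num_measure.
- by rewrite fineK.
Qed.

Definition majorant k c (u v : seq pt) (q : pt) : R :=
  K ^+ k.+1 * ((chain dk (t0, y) u q * \prod_(p <- u) r2 p.2) * \prod_(w <- v) e1 c w).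

Let W2_ok p : W2 p != 0 -> okpt t0 T M p.
Proof.
rewrite /W2 /okpt /inT; case: ifP => [_|]; last by rewrite eqxx.
rewrite /= leNgt; apply: contraNN => h1; apply/eqP.
by apply: Normc.eq0_normc; apply/eqP; rewrite eq_le normc_ge0 andbT -(supp2 h1) rr2.
Qed.

Lemma core_le u v q : okpt t0 T M q -> normc (core u v q) <= majorant (size u) C u v q.
Proof.
move=> okq.
have G0 : 0 <= majorant (size u) C u v q.
  rewrite mulr_ge0 ?exprn_ge0// mulr_ge0//.
    by rewrite mulr_ge0 ?chain_dk_ge0// prodr_ge0.
  by rewrite prodr_ge0// => w _; exact: e1_ge0.
have [oku|/allPn[p pu np]] := boolP (all (okpt t0 T M) u); last first.
  have -> : core u v q = 0; last by rewrite Normc.normc0.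
  rewrite /core (_ : \prod_(p <- u) W2 p = 0) ?mul0r//.
  by apply/eqP; rewrite prodf_seq_eq0; apply/hasP; exists p => //=; apply: contraNT np; exact: W2_ok.
have [okv|/allPn[w wv nw]] := boolP (all (fun w => inT w.1) v); last first.
  have -> : core u v q = 0; last by rewrite Normc.normc0.
  rewrite /core (_ : \prod_(w <- v) _ = 0) ?mulr0 ?mul0r//.
  apply/eqP; rewrite prodf_seq_eq0; apply/hasP; exists w => //=.
  by rewrite /W1 (negbTE nw) mul0r.
rewrite /core /majorant Normc.normcM Normc.normcM.
have h1 := pbound okq oku okv.
have h2 : normc (\prod_(p <- u) W2 p) <= \prod_(p <- u) r2 p.2.
  rewrite normc_prod; apply: ler_prod => p _; rewrite normc_ge0/= /W2.
  by case: ifP => // _; rewrite Normc.normc0.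
have h3 : normc (\prod_(w <- v) (W1 w * (if w.1 <= q.1 then 1 else 0))) <= \prod_(w <- v) r1 w.2.
  rewrite normc_prod; apply: ler_prod => w _; rewrite normc_ge0/= Normc.normcM -[leRHS]mulr1.
  rewrite ler_pM ?normc_ge0//.
    by rewrite /W1; case: ifP => // _; rewrite Normc.normc0.
  by case: ifP => _; rewrite ?Normc.normc0// Normc.normc1.
have p0 : 0 <= \prod_(p <- u) r2 p.2 by apply: prodr_ge0.
apply: (le_trans (ler_pM _ _ (ler_pM _ _ h2 h3) h1)); rewrite ?mulr_ge0 ?normc_ge0//.
rewrite (_ : \prod_(w <- v) e1 C w = \prod_(w <- v) expR (C * `|w.2|) * \prod_(w <- v) r1 w.2); last first.
  by rewrite -big_split.
rewrite le_eqVlt; apply/orP; left; apply/eqP.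
move: (\prod_(p <- u) r2 p.2) (\prod_(w <- v) r1 w.2) (K ^+ (size u).+1) (chain dk (t0, y) u q)
  (\prod_(w <- v) expR (C * `|w.2|)) => a1 a2 a3 a4 a5; ring.
Qed.

Let mTh1 : cmeas Th1 := ccont_measurable (fun t => is_cd_ccont (dTh1 t)).
Let mTh2 : cmeas Th2 := ccont_measurable (fun t => is_cd_ccont (dTh2 t)).
Let mh : cmeas h := ccont_measurable (fun t => is_cd_ccont (dh t)).

Let minT d (X : measurableType d) (p : X -> pt) : measurable_fun setT p ->
  measurable_fun setT (fun a => inT (p a).1).
Proof.
move=> mp; have m1 : measurable_fun setT (fun a => (p a).1) by apply: (measurableT_comp (f := fst)).
by apply: measurable_and; exact: measurable_fun_ler.
Qed.

Lemma W1_cmeas d (X : measurableType d) (p : X -> pt) : measurable_fun setT p -> cmeas (fun a => W1 (p a)).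
Proof.
move=> mp; apply: cmeas_if; [exact: minT|apply: (cmeas_comp mrho1)|exact: cmeas_cst].
by apply: (measurableT_comp (f := snd)).
Qed.

Lemma W2_cmeas d (X : measurableType d) (p : X -> pt) : measurable_fun setT p -> cmeas (fun a => W2 (p a)).
Proof.
move=> mp; apply: cmeas_if; [exact: minT|apply: (cmeas_comp mrho2)|exact: cmeas_cst].
by apply: (measurableT_comp (f := snd)).
Qed.

Lemma core_cmeas d (X : measurableType d) k m (u : X -> k.-tuple pt) (v : X -> m.-tuple pt) (q : X -> pt) :
  measurable_fun setT u -> measurable_fun setT v -> measurable_fun setT q ->
  cmeas (fun a => core (u a) (v a) (q a)).
Proof.
move=> mu mv mq.
have mt (n : nat) (z : X -> n.-tuple pt) i : measurable_fun setT z -> measurable_fun setT (fun a => tnth (z a) i).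
  by move=> mz; apply: (measurableT_comp (f := fun x : n.-tuple pt => tnth x i)) => //; exact: measurable_tnth.
apply: cmeasM; last exact: path_cmeas.
apply: cmeasM.
  under eq_fun do rewrite big_tuple; apply: cmeas_prod => i.
  by apply: W2_cmeas; exact: mt.
under eq_fun do rewrite big_tuple; apply: cmeas_prod => i.
apply: cmeasM; first by apply: W1_cmeas; exact: mt.
apply: cmeas_if; [|exact: cmeas_cst|exact: cmeas_cst].
apply: measurable_fun_ler; first by apply: (measurableT_comp (f := fst)) => //; exact: mt.
by apply: (measurableT_comp (f := fst)).
Qed.

Lemma measurable_majorant d (X : measurableType d) k m c (u : X -> k.-tuple pt) (v : X -> m.-tuple pt) (q : X -> pt) :
  measurable_fun setT u -> measurable_fun setT v -> measurable_fun setT q ->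
  measurable_fun setT (fun a => majorant k c (u a) (v a) (q a)).
Proof.
move=> mu mv mq; apply: measurable_funM => //; apply: measurable_funM.
  apply: measurable_funM.
    by apply: measurable_chain => //; exact: measurable_dk.
  apply: measurable_prod_tuple => //.
  exact: (measurableT_comp mr2 (@measurable_snd _ _ R R)).
by apply: measurable_prod_tuple => //; exact: measurable_e1.
Qed.

Lemma majorant_ge0 k c u v q : 0 <= majorant k c u v q.
Proof.
rewrite mulr_ge0 ?exprn_ge0// mulr_ge0//.
  by rewrite mulr_ge0 ?chain_dk_ge0// prodr_ge0.
by rewrite prodr_ge0// => w _; exact: e1_ge0.
Qed.

(* The weight parameter e of the Dirichlet estimate is free; it is chosen later
   so small that K * kap <= 1/4. *)
Definition kap := 6 * Num.sqrt e * R2.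

Lemma R2_ge0 : 0 <= R2.
Proof. by rewrite -lee_fin (le_trans _ int2)// integral_ge0// => x _; rewrite lee_fin. Qed.

Lemma majorant_integral k m c (B : R) (q : pt) : (\int[mu1]_w (e1 c w)%:E <= B%:E)%E ->
  (\int[PM k m]_z (majorant k c z.1 z.2 q)%:E <=
   (K ^+ k.+1 * (kap ^+ k * expR (e^-1 * (q.1 - t0)) * (Num.sqrt (q.1 - t0))^-1 * B ^+ m))%:E)%E.
Proof.
move=> hB.
have mu_ : measurable_fun setT (fun u : k.-tuple pt => chain dk (t0, y) u q * \prod_(p <- u) r2 p.2).
  apply: measurable_funM.
    by apply: measurable_chain => //; exact: measurable_dk.
  apply: measurable_prod_tuple => //.
  exact: (measurableT_comp mr2 (@measurable_snd _ _ R R)).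
have mv_ : measurable_fun setT (fun v : m.-tuple pt => \prod_(w <- v) e1 c w).
  by apply: measurable_prod_tuple => //; exact: measurable_e1.
have u0 (u : k.-tuple pt) : 0 <= chain dk (t0, y) u q * \prod_(p <- u) r2 p.2.
  by rewrite mulr_ge0 ?chain_dk_ge0// prodr_ge0.
have v0 (v : m.-tuple pt) : 0 <= \prod_(w <- v) e1 c w by rewrite prodr_ge0// => w _; exact: e1_ge0.
have h1 := @dirichlet_bound R t0 t0 T e e0 nu2 r2 y mr2 r20 R2 int2 k q.
have h2 := @ge0_integral_prod_tmeas R _ (mR * mR)%type mu1 (e1 c) B m (measurable_e1 c) (e1_ge0 c) hB.
have h3 := @ge0_integral_prod_le R _ _ (k.-tuple (mR * mR))%type (m.-tuple (mR * mR))%type (tmeas mu2 k) (tmeas mu1 m) _ _ _ _ mu_ mv_ u0 v0 h1 h2.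
have c0 : (0 <= (K ^+ k.+1)%:E)%E by rewrite lee_fin exprn_ge0.
have mP : measurable_fun setT (fun z : k.-tuple pt * m.-tuple pt =>
    ((chain dk (t0, y) z.1 q * \prod_(p <- z.1) r2 p.2) * \prod_(w <- z.2) e1 c w)%:E).
  apply/measurable_EFinP; apply: measurable_funM.
    exact: (measurableT_comp mu_ (@measurable_fst _ _ _ _)).
  exact: (measurableT_comp mv_ (@measurable_snd _ _ _ _)).
rewrite EFinM; apply: le_trans (lee_wpmul2l c0 h3).
rewrite -(@ge0_integralZl _ _ _ (PM k m) _ measurableT _ mP _ _ c0); last first.
  by move=> z _; rewrite lee_fin mulr_ge0.
by rewrite le_eqVlt; apply/orP; left; apply/eqP; apply: eq_integral => z _; rewrite -EFinM.
Qed.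

Lemma core_cintg k m q : okpt t0 T M q -> cintg (PM k m) setT (fun z => core z.1 z.2 q).
Proof.
move=> okq; have [B hB] := e1_integral C0.
apply: (@cintg_dom R _ (k.-tuple (mR * mR) * m.-tuple (mR * mR))%type (PM k m) _ (fun z => majorant k C z.1 z.2 q)).
- by apply: core_cmeas.
- by apply: measurable_majorant.
- by move=> [u v] /=; have := core_le u v okq; rewrite size_tuple.
- exact: le_lt_trans (majorant_integral k m q hB) (ltry _).
Qed.

Lemma Amp_le k m (B : R) q : okpt t0 T M q -> (\int[mu1]_w (e1 C w)%:E <= B%:E)%E ->
  normc (Amp k m q) <= 2 * (K ^+ k.+1 * (kap ^+ k * expR (e^-1 * (q.1 - t0)) * (Num.sqrt (q.1 - t0))^-1 * B ^+ m)).
Proof.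
move=> okq hB; apply: (@normc_cint_dom R _ (k.-tuple (mR * mR) * m.-tuple (mR * mR))%type (PM k m) _ (fun z => majorant k C z.1 z.2 q)).
- by apply: core_cmeas.
- by apply: measurable_majorant.
- by move=> [u v] /=; have := core_le u v okq; rewrite size_tuple.
- exact: majorant_integral.
Qed.

Lemma Amp_cmeas k m : cmeas (Amp k m).
Proof.
rewrite /Amp; apply: (cmeas_param2 (PM k m) (f := fun qz : pt * _ => core qz.2.1 qz.2.2 qz.1)).
have m2 : measurable_fun setT (fun qz : pt * (k.-tuple pt * m.-tuple pt) => qz.2) by exact: measurable_snd.
apply: core_cmeas; last exact: measurable_fst.
  by apply: (measurableT_comp (f := fst)) => //.
by apply: (measurableT_comp (f := snd)).
Qed.

Section Testing.
Variables (Q1 : {finite_measure set mR -> \bar R}) (psi : pt -> R[i]) (b : R -> R) (Bq : R).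
Hypotheses (mpsi : cmeas psi) (mb : @measurable_fun _ _ mR R setT b) (b0 : forall x, 0 <= b x)
  (psib : forall q, normc (psi q) <= b q.2) (psi0 : forall q, ~~ okpt t0 T M q -> psi q = 0)
  (intb : (\int[Q1]_x (b x)%:E <= Bq%:E)%E).

Definition QM : {finite_measure set (mR * mR)%type -> \bar R} := fprodm (lebr t0 T) Q1.

Let isq : exists B, (\int[lebr t0 T]_t ((Num.sqrt (t - t0))^-1)%:E <= B%:E)%E.
Proof.
have /integrableP[_ ih] := integrable_isqrt_lebr t0 t0T.
have h0 : (0 <= \int[lebr t0 T]_t ((Num.sqrt (t - t0))^-1)%:E)%E.
  by apply: integral_ge0 => t _; rewrite lee_fin invr_ge0 sqrtr_ge0.
exists (fine (\int[lebr t0 T]_t ((Num.sqrt (t - t0))^-1)%:E)%E).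
rewrite fineK// ge0_fin_numE//; apply: le_lt_trans ih; rewrite le_eqVlt; apply/orP; left; apply/eqP.
by apply: eq_integral => t _; rewrite gee0_abs// lee_fin invr_ge0 sqrtr_ge0.
Qed.

Lemma core_psi_cintg k m :
  cintg (PM k m \x QM)%E setT (fun zq => core zq.1.1 zq.1.2 zq.2 * psi zq.2).
Proof.
have [B hB] := e1_integral C0.
pose c := K ^+ k.+1 * (kap ^+ k * expR (e^-1 * (T - t0)) * B ^+ m).
have B0 : 0 <= B by rewrite -lee_fin (le_trans _ hB)// integral_ge0// => w _; rewrite lee_fin e1_ge0.
have kap0 : 0 <= kap by rewrite !mulr_ge0 ?sqrtr_ge0 ?R2_ge0.
have c0 : 0 <= c by rewrite !mulr_ge0 ?exprn_ge0 ?expR_ge0.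
pose g (zq : (k.-tuple pt * m.-tuple pt) * pt) : R :=
  (if zq.2.1 <= T then majorant k C zq.1.1 zq.1.2 zq.2 else 0) * b zq.2.2.
have m1 : measurable_fun setT (fun zq : (k.-tuple pt * m.-tuple pt) * pt => zq.1.1).
  by apply: (measurableT_comp (f := fst)) => //; exact: measurable_fst.
have m2 : measurable_fun setT (fun zq : (k.-tuple pt * m.-tuple pt) * pt => zq.1.2).
  by apply: (measurableT_comp (f := snd)) => //; exact: measurable_fst.
have m3 : measurable_fun setT (fun zq : (k.-tuple pt * m.-tuple pt) * pt => zq.2) by exact: measurable_snd.
have mg : measurable_fun setT g.
  apply: measurable_funM.
    apply: measurable_fun_ifT => //.
      by apply: measurable_fun_ler => //; apply: (measurableT_comp (f := fst)).
    exact: measurable_majorant.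
  by apply: (measurableT_comp mb); apply: (measurableT_comp (f := snd)).
have g0 z : 0 <= g z by rewrite mulr_ge0//; case: ifP => // _; exact: majorant_ge0.
apply: (@cintg_dom R _ ((k.-tuple (mR * mR) * m.-tuple (mR * mR)) * (mR * mR))%type (PM k m \x QM)%E _ g).
- apply: cmeasM; first exact: core_cmeas.
  exact: (cmeas_comp mpsi m3).
- exact: mg.
- move=> [[u v] q] /=; have [okq|nq] := boolP (okpt t0 T M q); last first.
    by rewrite psi0// mulr0 Normc.normc0; exact: (g0 ((u, v), q)).
  have qT : q.1 <= T by case/andP: okq => /andP[].
  rewrite Normc.normcM /g /= qT ler_pM ?normc_ge0//.
  by have := core_le u v okq; rewrite size_tuple.
have [Bs hBs] := isq.
have mgE : measurable_fun setT (EFin \o g) by exact/measurable_EFinP.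
have g0E z : (0 <= (g z)%:E)%E by rewrite lee_fin.
rewrite (@fubini_tonelli2 _ _ _ _ R (PM k m) QM _ mgE g0E).
have ms : @measurable_fun _ _ mR R setT (fun t => c * (Num.sqrt (t - t0))^-1).
  by apply: measurable_funM => //; apply: measurable_isqrt; exact: measurable_funB.
have s0 (t : R) : 0 <= c * (Num.sqrt (t - t0))^-1 by rewrite mulr_ge0// invr_ge0 sqrtr_ge0.
have hs : (\int[lebr t0 T]_t (c * (Num.sqrt (t - t0))^-1)%:E <= (c * Bs)%:E)%E.
  have mi : measurable_fun setT (fun t : mR => ((Num.sqrt (t - t0))^-1)%:E).
    by apply/measurable_EFinP; apply: measurable_isqrt; exact: measurable_funB.
  have c0' : (0 <= c%:E)%E by rewrite lee_fin.
  under eq_integral do rewrite EFinM.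
  rewrite (@ge0_integralZl _ _ _ (lebr t0 T) _ measurableT _ mi _ _ c0'); last first.
    by move=> t _; rewrite lee_fin invr_ge0 sqrtr_ge0.
  by rewrite [(c * Bs)%:E]EFinM; apply: lee_wpmul2l.
have h3 := @ge0_integral_prod_le R _ _ mR mR (lebr t0 T) Q1 _ _ _ _ ms mb s0 b0 hs intb.
apply: le_lt_trans (le_lt_trans h3 (ltry _)); apply: ge0_le_integral => //.
- by move=> q _; apply: integral_ge0 => z _; exact: g0E.
- exact: (@measurable_fun_fubini_tonelli_G _ _ _ _ R (PM k m) _ mgE g0E).
- apply/measurable_EFinP; apply: measurable_funM.
    exact: (measurableT_comp ms (@measurable_fst _ _ R R)).
  exact: (measurableT_comp mb (@measurable_snd _ _ R R)).
- move=> q _; rewrite /fubini_G /g /=; have [qT|/negbTE qT] := boolP (q.1 <= T); last first.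
    apply: (@le_trans _ _ 0%E); last by rewrite lee_fin mulr_ge0.
    rewrite le_eqVlt; apply/orP; left; apply/eqP; apply: integral0_eq => z _.
    by rewrite mul0r.
  under eq_integral do rewrite mulrC EFinM.
  have c1 : (0 <= (b q.2)%:E)%E by rewrite lee_fin.
  have mm : measurable_fun setT (fun z : k.-tuple pt * m.-tuple pt => (majorant k C z.1 z.2 q)%:E).
    by apply/measurable_EFinP; apply: measurable_majorant.
  rewrite (@ge0_integralZl _ _ _ (PM k m) _ measurableT _ mm _ _ c1); last first.
    by move=> z _; rewrite lee_fin majorant_ge0.
  rewrite mulrC EFinM; apply: lee_wpmul2l => //; apply: (le_trans (majorant_integral k m q hB)).
  rewrite lee_fin /c.
  have he : expR (e^-1 * (q.1 - t0)) <= expR (e^-1 * (T - t0)).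
    by rewrite ler_expR ler_wpM2l ?invr_ge0 ?(ltW e0)// lerB.
  rewrite (_ : K ^+ k.+1 * (kap ^+ k * expR (e^-1 * (q.1 - t0)) * (Num.sqrt (q.1 - t0))^-1 * B ^+ m) =
     K ^+ k.+1 * kap ^+ k * (Num.sqrt (q.1 - t0))^-1 * B ^+ m * expR (e^-1 * (q.1 - t0))); last by ring.
  rewrite (_ : K ^+ k.+1 * (kap ^+ k * expR (e^-1 * (T - t0)) * B ^+ m) / Num.sqrt (q.1 - t0) =
     K ^+ k.+1 * kap ^+ k * (Num.sqrt (q.1 - t0))^-1 * B ^+ m * expR (e^-1 * (T - t0))); last by ring.
  by rewrite ler_wpM2l// !mulr_ge0 ?exprn_ge0// invr_ge0 sqrtr_ge0.
Qed.

Definition pairing_ k m : R[i] := cint QM setT (fun q => Amp k m q * psi q).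

Lemma pairing_swap k m :
  pairing_ k m = cint (PM k m) setT (fun z => cint QM setT (fun q => core z.1 z.2 q * psi q)).
Proof.
rewrite (cint_swap (core_psi_cintg k m)); apply: eq_cint => q _ /=.
have [okq|nq] := boolP (okpt t0 T M q); last first.
  rewrite psi0// mulr0 -[LHS](cint0 (PM k m) measurableT); apply: eq_cint => z _; by rewrite mulr0.
rewrite mulrC -(cintZ _ _ (core_cintg k m okq))//; apply: eq_cint => z _; exact: mulrC.
Qed.

Lemma Amp_psi_cintg k m : cintg QM setT (fun q => Amp k m q * psi q).
Proof.
have := cintg_fubini2 (core_psi_cintg k m); congr (cintg _ _ _); apply/funext => q /=.
have [okq|nq] := boolP (okpt t0 T M q); last first.
  rewrite psi0// mulr0 -[RHS](cint0 (PM k m) measurableT); apply: eq_cint => z _; by rewrite mulr0.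
rewrite [RHS]mulrC -(cintZ _ _ (core_cintg k m okq))//; apply: eq_cint => z _; exact: mulrC.
Qed.

End Testing.

Lemma core_perm u v v' q : perm_eq v v' -> core u v q = core u v' q.
Proof. by move=> vv'; rewrite /core (perm_path _ _ _ _ _ _ _ vv') (perm_big _ vv'). Qed.

Definition okuv (u v : seq pt) := all (okpt t0 T M) u && all (fun w => inT w.1) v.

Lemma core_nok u v q : ~~ okuv u v -> core u v q = 0.
Proof.
rewrite negb_and => /orP[/allPn[p pu np]|/allPn[w wv nw]].
  rewrite /core (_ : \prod_(p <- u) W2 p = 0) ?mul0r//.
  by apply/eqP; rewrite prodf_seq_eq0; apply/hasP; exists p => //=; apply: contraNT np; exact: W2_ok.
rewrite /core (_ : \prod_(w <- v) _ = 0) ?mulr0 ?mul0r//.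
apply/eqP; rewrite prodf_seq_eq0; apply/hasP; exists w => //=.
by rewrite /W1 (negbTE nw) mul0r.
Qed.

Lemma coreE u v q : core u v q =
  if all (fun w => w.1 <= q.1) v then \prod_(p <- u) W2 p * \prod_(w <- v) W1 w * path Th1 Th2 h t0 y u v q else 0.
Proof.
rewrite /core; case: ifPn => [/allP qv|/allPn[w wv nw]].
  by congr (_ * _ * _); apply: eq_big_seq => w /qv ->; rewrite mulr1.
rewrite (_ : \prod_(w <- v) _ = 0) ?mulr0 ?mul0r//.
by apply/eqP; rewrite prodf_seq_eq0; apply/hasP; exists w => //=; rewrite (negbTE nw) mulr0.
Qed.

Section TestFunction.
Variables (phi px pxx pt_ : R -> R -> R[i]).
Hypothesis tst : is_test phi px pxx pt_ M T.
Local Notation Lph := (Lphi hd phi pxx pt_).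
Let Q0 := lebr (- M) M.
Let M0 : 0 <= M. Proof. exact: le_trans (normr_ge0 _) yM. Qed.

Definition psiL (q : pt) : R[i] := if okpt t0 T M q then Lph q.2 q.1 else 0.
Definition phib (q : pt) : R[i] := if okpt t0 T M q then phi q.2 q.1 else 0.

Lemma measurable_okpt d (X : measurableType d) (q : X -> pt) : measurable_fun setT q ->
  measurable_fun setT (fun a => okpt t0 T M (q a)).
Proof.
move=> mq; apply: measurable_and; first exact: (minT mq).
apply: measurable_fun_ler => //.
by apply: (measurableT_comp (@normr_measurable R setT)); apply: (measurableT_comp (f := snd)).
Qed.

Lemma jcont_swap_cmeas (f : R -> R -> R[i]) : jcont f -> cmeas (fun q : pt => f q.2 q.1).
Proof.
move=> /jcont_cmeas mf; apply: (cmeas_comp mf (g := fun q : pt => (q.2, q.1))).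
by apply: measurable_fun_pair; [exact: measurable_snd|exact: measurable_fst].
Qed.

Lemma psiL_cmeas : cmeas psiL.
Proof.
apply: cmeas_if; [exact: (measurable_okpt (q := id))|exact: (jcont_swap_cmeas (jcont_Lphi chd tst))|exact: cmeas_cst].
Qed.

Lemma phib_cmeas : cmeas phib.
Proof. by apply: cmeas_if; [exact: (measurable_okpt (q := id))|exact: (jcont_swap_cmeas (tst_c tst))|exact: cmeas_cst]. Qed.

Lemma jcont_okpt_bounded (f : R -> R -> R[i]) : jcont f -> exists B : R, 0 <= B /\
  forall q, normc (if okpt t0 T M q then f q.2 q.1 else 0) <= B.
Proof.
move=> /(jcont_cbnd (- M) M t0 T)[B hB]; exists (Num.max B 0); split; first by rewrite le_max lexx orbT.
move=> q; rewrite le_max; case: ifP => [/andP[/andP[q1 q2] q3]|_]; last by rewrite Normc.normc0 lexx orbT.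
by rewrite (hB (q.2, q.1))//; split => /=; rewrite ?q1//; rewrite -ler_norml.
Qed.

Lemma psiL_bnd : exists B : R, 0 <= B /\ forall q, normc (psiL q) <= B.
Proof. exact: (jcont_okpt_bounded (jcont_Lphi chd tst)). Qed.

Lemma phib_bnd : exists B : R, 0 <= B /\ forall q, normc (phib q) <= B.
Proof. exact: (jcont_okpt_bounded (tst_c tst)). Qed.

Definition inn u v (t : R) : R[i] :=
  lintegral `[- M, M] (fun x => path Th1 Th2 h t0 y u v (t, x) * Lph x t).

Definition Lam u v : R[i] := cint (QM Q0) setT (fun q => core u v q * psiL q).

Let mseq_core u v d (X : measurableType d) (q : X -> pt) : measurable_fun setT q ->
  cmeas (fun a => core u v (q a)).
Proof. by move=> mq; exact: (core_cmeas (u := fun=> in_tuple u) (v := fun=> in_tuple v)). Qed.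

Lemma last_ok u : all (okpt t0 T M) u -> okpt t0 T M (last (t0, y) u).
Proof.
case: (lastP u) => [|u' p']; first by rewrite /okpt/= lexx t0T.
by rewrite last_rcons all_rcons => /andP[].
Qed.

Lemma path_before u v q : q.1 <= (last (t0, y) u).1 -> path Th1 Th2 h t0 y u v q = 0.
Proof. by move=> qp; rewrite /path /chain (seg_forward _ _ qp) !mulr0. Qed.

Lemma LamE u v : okuv u v -> Lam u v = \prod_(p <- u) W2 p * \prod_(w <- v) W1 w *
  cint (lebr t0 T) setT (fun t => if [&& all (fun w => w.1 <= t) v, (last (t0, y) u).1 < t & t <= T] then inn u v t else 0).
Proof.
move=> /andP[oku okv]; set W := \prod_(p <- u) _ * _.
have /andP[/andP[tp pT] pM] := last_ok oku.
have [BL [BL0 hBL]] := psiL_bnd.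
have mcp : cmeas (fun q => core u v q * psiL q) by apply: cmeasM; [exact: mseq_core|exact: psiL_cmeas].
pose c := K ^+ (size u).+1 * (`|pre dk (t0, y) u| * \prod_(p <- u) r2 p.2 * \prod_(w <- v) e1 C w) * BL.
have c0 : 0 <= c.
  rewrite mulr_ge0// mulr_ge0 ?exprn_ge0// mulr_ge0//; first by rewrite mulr_ge0// prodr_ge0.
  by rewrite prodr_ge0// => w _; exact: e1_ge0.
have bcp q : normc (core u v q * psiL q) <= c * (Num.sqrt (q.1 - (last (t0, y) u).1))^-1.
  have [okq|nq] := boolP (okpt t0 T M q); last first.
    by rewrite /psiL (negbTE nq) mulr0 Normc.normc0 mulr_ge0// invr_ge0 sqrtr_ge0.
  rewrite Normc.normcM; apply: (le_trans (ler_pM (normc_ge0 _) (normc_ge0 _) (core_le u v okq) (hBL q))).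
  rewrite /majorant /chain /dk /c.
  have z1 : 0 <= \prod_(p <- u) r2 p.2 by rewrite prodr_ge0.
  have z2 : 0 <= \prod_(w <- v) e1 C w by rewrite prodr_ge0// => w _; exact: e1_ge0.
  have z3 : 0 <= (Num.sqrt (q.1 - (last (t0, y) u).1))^-1 by rewrite invr_ge0 sqrtr_ge0.
  have z4 := exprn_ge0 (size u).+1 K0.
  move: (\prod_(p <- u) r2 p.2) (\prod_(w <- v) e1 C w) (_^-1) (K ^+ (size u).+1) z1 z2 z3 z4 => a1 a2 a3 a4 z1 z2 z3 z4.
  rewrite (_ : a4 * (pre dk (t0, y) u * a3 * a1 * a2) * BL = pre dk (t0, y) u * (a4 * a3 * a1 * a2 * BL)); last by ring.
  rewrite (_ : a4 * (`|pre dk (t0, y) u| * a1 * a2) * BL * a3 = `|pre dk (t0, y) u| * (a4 * a3 * a1 * a2 * BL)); last by ring.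
  by rewrite ler_wpM2r ?ler_norm// !mulr_ge0.
have icp : cintg (QM Q0) setT (fun q => core u v q * psiL q).
  have ms : @measurable_fun _ _ mR R setT (fun t => c * (Num.sqrt (t - (last (t0, y) u).1))^-1).
    by apply: measurable_funM => //; apply: measurable_isqrt; exact: measurable_funB.
  have iq := integrableZl measurableT c (integrable_isqrt_lebr t0 pT).
  have /integrableP[_ fq] := iq.
  have s0 (t : R) : 0 <= c * (Num.sqrt (t - (last (t0, y) u).1))^-1 by rewrite mulr_ge0// invr_ge0 sqrtr_ge0.
  have fq' : (\int[lebr t0 T]_t (c * (Num.sqrt (t - (last (t0, y) u).1))^-1)%:E < +oo)%E.
    apply: le_lt_trans fq; rewrite le_eqVlt; apply/orP; left; apply/eqP.
    by apply: eq_integral => t _; rewrite -EFinM gee0_abs// lee_fin.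
  have e1' : (\int[Q0]_x (cst (1:R) x)%:E <= (fine (Q0 setT))%:E)%E.
    have -> : (\int[Q0]_x (cst (1 : R) x)%:E = \int[Q0]_x (cst 1%:E) x)%E by apply: eq_integral.
    by rewrite integral_cst// mul1e fineK// fin_num_measure.
  have fq2 : (\int[lebr t0 T]_t (c * (Num.sqrt (t - (last (t0, y) u).1))^-1)%:E <=
     (fine (\int[lebr t0 T]_t (c * (Num.sqrt (t - (last (t0, y) u).1))^-1)%:E))%:E)%E.
    by rewrite fineK// ge0_fin_numE// integral_ge0// => t _; rewrite lee_fin.
  have h3 := @ge0_integral_prod_le R _ _ mR mR (lebr t0 T) Q0 _ (cst 1) _ _ ms (measurable_cst _) s0 (fun=> ler01) fq2 e1'.
  apply: (@cintg_dom R _ (mR * mR)%type (QM Q0) _ (fun q => c * (Num.sqrt (q.1 - (last (t0, y) u).1))^-1 * 1)).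
  - exact: mcp.
  - apply: measurable_funM => //; exact: (measurableT_comp ms (@measurable_fst _ _ R R)).
  - by move=> q; rewrite mulr1.
  - exact: le_lt_trans h3 (ltry _).
rewrite /Lam -(cint_fubini1 icp).
have key t : cint Q0 setT (fun x => core u v (t, x) * psiL (t, x)) =
    W * (if [&& all (fun w => w.1 <= t) v, (last (t0, y) u).1 < t & t <= T] then inn u v t else 0).
  have z0 : (forall x, core u v (t, x) * psiL (t, x) = 0) -> cint Q0 setT (fun x => core u v (t, x) * psiL (t, x)) = 0.
    by move=> z; rewrite -[RHS](cint0 Q0 measurableT); apply: eq_cint => x _; exact: z.
  case: ifPn => [/and3P[vt pt' tT]|]; last first.
    rewrite mulr0 !negb_and -leNgt -ltNge => /or3P[nv|tp'|Tt]; apply: z0 => x.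
    - by rewrite coreE (negbTE nv) mul0r.
    - by rewrite coreE path_before// !mulr0 if_same mul0r.
    - by rewrite /psiL /okpt /= [t <= T]leNgt Tt andbF mulr0.
  have t0t : t0 <= t by rewrite (le_trans tp)// ltW.
  have mt : measurable_fun setT (fun x : R => (t, x)) by exact: measurable_fun_pair.
  have m1 : cmeas (fun x => core u v (t, x) * psiL (t, x)).
    exact: (cmeas_comp mcp mt).
  have e1' x : - M <= x <= M -> core u v (t, x) * psiL (t, x) = W * (path Th1 Th2 h t0 y u v (t, x) * Lph x t).
    move=> xM; rewrite coreE vt /psiL /okpt /= t0t tT ler_norml xM/= /W; ring.
  rewrite -(lintegral_lebr (- M) M m1).
  transitivity (lintegral `[- M, M] (fun x => W * (path Th1 Th2 h t0 y u v (t, x) * Lph x t))).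
    by apply: eq_cint => x; rewrite /= in_itv/=; exact: e1'.
  apply: cintZ_scaled => //; apply: cbnd_cintg.
    apply: cmeasM; first exact: cmeas_cst.
    exact: (cmeas_comp (path_Lphi_cmeas t0 y dTh1 dTh2 dh chd tst u v) mt).
  exists (c * (Num.sqrt (t - (last (t0, y) u).1))^-1) => x xM.
  by rewrite -e1'//; exact: (bcp (t, x)).
have iF : cintg (lebr t0 T) setT (fun t : R => W * (if [&& all (fun w => w.1 <= t) v, (last (t0, y) u).1 < t & t <= T] then inn u v t else 0)).
  by have := cintg_fubini1 icp; congr (cintg _ _ _); apply/funext => t; exact: key.
rewrite -(cintZ_scaled _ iF)//.
by apply: eq_cint => t _; exact: key.
Qed.

Lemma Lam_nok u v : ~~ okuv u v -> Lam u v = 0.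
Proof.
move=> nok; rewrite /Lam -[RHS](cint0 (QM Q0) measurableT); apply: eq_cint => q _.
by rewrite core_nok ?mul0r.
Qed.

Lemma Lam_after_point u v : all (fun w => w.1 <= (last (t0, y) u).1) v -> okuv u v ->
  Lam u v = \prod_(p <- u) W2 p * \prod_(w <- v) W1 w *
    (iC * (phi (last (t0, y) u).2 (last (t0, y) u).1 *
      (pre (seg Th1 v) (t0, y) u * cexp (phase Th1 Th2 h t0 y v (last (t0, y) u))))).
Proof.
move=> vp ok; rewrite LamE//; congr (_ * _); have /andP[oku okv] := ok.
rewrite -(path_delta dTh1 dTh2 dh chd t0T yM tst pbound oku okv vp).
apply: eq_cint => t _; congr (if _ then _ else _).
have [pt'|] := ltP (last (t0, y) u).1 t; last by rewrite andbF.
by rewrite (_ : all _ _)//; apply/allP => w /(allP vp) wp; rewrite (le_trans wp)// ltW.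
Qed.

Lemma Lam_after_kick u w v : all (fun w' => w'.1 <= w.1) v -> (last (t0, y) u).1 < w.1 ->
  okuv u (w :: v) ->
  Lam u (w :: v) = iC * cint Q0 setT (fun x => core u v (w.1, x) * (W1 w * (expR (w.2 * x))%:C%C * phib (w.1, x))).
Proof.
move=> vw pw ok; rewrite LamE//; have /andP[oku okv] := ok.
have wT : t0 <= w.1 <= T by case/andP: okv.
have [t0w wT'] := andP wT.
have vw' : all (fun w' => w'.1 <= w.1) (w :: v) by rewrite /= lexx.
have ibp := path_ibp dTh1 dTh2 dh chd t0T yM tst pbound oku okv vw' pw wT'.
have mI : cmeas (inn u (w :: v)) := inner_cmeas t0 y dTh1 dTh2 dh chd tst u (w :: v).
have mS (a : R) : measurable_fun setT (fun t : R => [&& a <= t & t <= T]).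
  by apply: measurable_and; exact: measurable_fun_ler.
transitivity (\prod_(p <- u) W2 p * \prod_(w' <- w :: v) W1 w' * lintegral `[w.1, T] (inn u (w :: v))).
  congr (_ * _).
  have mF : cmeas (fun t : R => if [&& w.1 <= t & t <= T] then inn u (w :: v) t else 0).
    by apply: cmeas_if; [exact: mS|exact: mI|exact: cmeas_cst].
  transitivity (cint (lebr t0 T) setT (fun t : R => if [&& w.1 <= t & t <= T] then inn u (w :: v) t else 0)).
    apply: eq_cint => t _; congr (if _ then _ else _) => /=.
    have [wt'|] := leP w.1 t; last by [].
    rewrite (lt_le_trans pw wt') (_ : all _ _)//; apply/allP => w' /(allP vw) h1.
    exact: le_trans wt'.
  rewrite -(lintegral_lebr t0 T mF) /lintegral [LHS]cint_mkcond [RHS]cint_mkcond.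
  apply: eq_cint => t _; rewrite !mem_setE !in_itv/=.
  have [h1|h1] := leP w.1 t; last by rewrite if_same.
  by rewrite /= (le_trans t0w h1)/=; case: ifP => // ->.
rewrite ibp mulrCA; congr (_ * _).
have mpair : measurable_fun setT (fun x : mR => (w.1, x)) by exact: measurable_fun_pair.
have mX : cmeas (fun x : mR => (expR (w.2 * x))%:C%C).
  by apply: cmeas_real; apply: (measurableT_comp (f := @expR R)) => //; exact: measurable_funM.
have mG : @cmeas R _ mR (fun x => core u v (w.1, x) * (W1 w * (expR (w.2 * x))%:C%C * phib (w.1, x))).
  apply: cmeasM; first exact: (mseq_core u v mpair).
  apply: cmeasM; first by apply: cmeasM; [exact: cmeas_cst|exact: mX].
  exact: (cmeas_comp phib_cmeas mpair).
rewrite -(lintegral_lebr (- M) M mG).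
set W := \prod_(p <- u) _ * _.
have e1' x : - M <= x <= M -> W * (path Th1 Th2 h t0 y u (w :: v) (w.1, x) * phi x w.1) =
   core u v (w.1, x) * (W1 w * (expR (w.2 * x))%:C%C * phib (w.1, x)).
  move=> xM; rewrite path_kick vw coreE vw /phib /okpt /= wT ler_norml xM/= /W big_cons; ring.
transitivity (lintegral `[- M, M] (fun x => W * (path Th1 Th2 h t0 y u (w :: v) (w.1, x) * phi x w.1))).
  symmetry; apply: cintZ_scaled => //; apply: cbnd_cintg.
    apply: cmeasM; first exact: cmeas_cst.
    apply: cmeasM.
      have := @path_cmeas R _ mR Th1 Th2 h t0 y mTh1 mTh2 mh (size u) (size (w :: v))
        (fun=> in_tuple u) (fun=> in_tuple (w :: v)) (fun x => (w.1, x)).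
      by apply.
    by apply: ccont_measurable => x; exact: jcont1 (tst_c tst).
  apply: cbndM; first exact: cbnd_cst.
  apply: cbndM; last first.
    have [B hB] := jcont_cbnd (- M) M w.1 w.1 (tst_c tst).
    by exists B => x xM; apply: (hB (x, w.1)); split => //=; rewrite lexx.
  exists (K ^+ (size u).+1 * chain dk (t0, y) u (w.1, 0) * \prod_(w <- w :: v) expR (C * `|w.2|)) => x xM.
  by apply: (@pbound u (w :: v) (w.1, x)) => //; rewrite /okpt /= wT ler_norml.
by apply: eq_cint => x; rewrite /= in_itv/=; exact: e1'.
Qed.

Lemma mu1_null c : mu1 [set w | w.1 = c] = 0%E.
Proof.
have -> : [set w : mR * mR | w.1 = c] = [set c] `*` setT.
  by apply/seteqP; split => [w /= h1|w [/= h1 _]] //; split.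
have m1 : measurable ([set c] : set mR) by exact: measurable_set1.
have := @product_measure1E _ _ _ _ R (lebr t0 T) nu1 [set c] setT m1 measurableT.
move=> E; apply: (etrans E).
by apply: (etrans (congr1 (fun x => x * nu1 setT)%E (lebr_null t0 T c))); rewrite mul0e.
Qed.

Definition V1c (x : R) : R[i] := cint nu1 setT (fun a => (expR (a * x))%:C%C * rho1 a).
Definition psi1 q := V1c q.2 * phib q.
Definition psi2 q := W2 q * phib q.

Lemma psi1_cmeas : cmeas psi1.
Proof.
apply: cmeasM; last exact: phib_cmeas.
have mV : @cmeas R _ mR V1c.
  rewrite /V1c; apply: (@cmeas_param2 R _ _ mR mR nu1 (fun xa => (expR (xa.2 * xa.1))%:C%C * rho1 xa.2)).
  apply: cmeasM; last exact: (cmeas_comp mrho1 (@measurable_snd _ _ mR mR)).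
  apply: cmeas_real; apply: (measurableT_comp (f := @expR R)) => //; apply: measurable_funM.
    exact: measurable_snd.
  exact: measurable_fst.
exact: (cmeas_comp mV (@measurable_snd _ _ mR mR)).
Qed.

Lemma psi2_cmeas : cmeas psi2.
Proof. by apply: cmeasM; [exact: (W2_cmeas (p := id))|exact: phib_cmeas]. Qed.

Let exp_le (a x : R) : `|x| <= M -> expR (a * x) <= expR ((M + 1) * `|a|).
Proof.
move=> xM; rewrite ler_expR (le_trans (ler_norm _))// normrM mulrC ler_wpM2r//.
by rewrite (le_trans xM)// lerDl.
Qed.

Let M1 : 0 < M + 1. Proof. by rewrite ltr_wpDl. Qed.

Let exp1B : exists B : R, 0 <= B /\ (\int[nu1]_a (expR ((M + 1) * `|a|) * r1 a)%:E <= B%:E)%E.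
Proof.
have h0 : (0 <= \int[nu1]_a (expR ((M + 1) * `|a|) * r1 a)%:E)%E.
  by apply: integral_ge0 => a _; rewrite lee_fin mulr_ge0 ?expR_ge0.
exists (fine (\int[nu1]_a (expR ((M + 1) * `|a|) * r1 a)%:E)); split; first exact: fine_ge0.
by rewrite fineK// ge0_fin_numE// exp1.
Qed.

Let mexpr1 : @measurable_fun _ _ mR R setT (fun a => expR ((M + 1) * `|a|) * r1 a).
Proof. exact: measurable_funM. Qed.

Let mexpx (x : R) : @cmeas R _ mR (fun a => (expR (a * x))%:C%C * rho1 a).
Proof.
apply: cmeasM => //; apply: cmeas_real; apply: (measurableT_comp (f := @expR R)) => //.
exact: measurable_funM.
Qed.

Let normc_expx (a x : R) : `|x| <= M -> normc ((expR (a * x))%:C%C * rho1 a) <= expR ((M + 1) * `|a|) * r1 a.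
Proof.
move=> xM; rewrite Normc.normcM normc_real ger0_norm ?expR_ge0// ler_pM ?expR_ge0 ?normc_ge0//.
exact: exp_le.
Qed.

Lemma psi1_bnd : exists B : R, 0 <= B /\ forall q, normc (psi1 q) <= B.
Proof.
have [Bp [Bp0 hBp]] := phib_bnd; have [B [B0 hB]] := exp1B.
exists (2 * B * Bp); split; first by rewrite !mulr_ge0.
move=> q; rewrite /psi1; have [okq|nq] := boolP (okpt t0 T M q); last first.
  by rewrite /phib (negbTE nq) mulr0 Normc.normc0 !mulr_ge0.
rewrite Normc.normcM ler_pM ?normc_ge0//.
have qM : `|q.2| <= M by case/andP: okq.
by apply: (@normc_cint_dom R _ mR nu1 _ (fun a => expR ((M + 1) * `|a|) * r1 a)) => // a; exact: normc_expx.
Qed.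

Lemma psi1_nok q : ~~ okpt t0 T M q -> psi1 q = 0.
Proof. by move=> nq; rewrite /psi1 /phib (negbTE nq) mulr0. Qed.

Lemma psi2_nok q : ~~ okpt t0 T M q -> psi2 q = 0.
Proof. by move=> nq; rewrite /psi2 /phib (negbTE nq) mulr0. Qed.

Lemma psiL_nok q : ~~ okpt t0 T M q -> psiL q = 0.
Proof. by move=> nq; rewrite /psiL (negbTE nq). Qed.

Lemma psi2_bnd : exists B : R, 0 <= B /\ forall q, normc (psi2 q) <= r2 q.2 * B.
Proof.
have [Bp [Bp0 hBp]] := phib_bnd; exists Bp; split => // q.
rewrite Normc.normcM ler_pM ?normc_ge0// /W2; case: ifP => // _.
by rewrite Normc.normc0.
Qed.

Let int_cst (Q1 : {finite_measure set mR -> \bar R}) (B : R) :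
  (\int[Q1]_x (B)%:E <= (B * fine (Q1 setT))%:E)%E.
Proof. by rewrite integral_cst// EFinM fineK// fin_num_measure. Qed.

Let mall k m : measurable_fun setT (fun z : k.-tuple pt * m.-tuple pt =>
  all (fun w => w.1 <= (last (t0, y) z.1).1) z.2).
Proof.
have ml : measurable_fun setT (fun u : k.-tuple pt => last (t0, y) u).
  case: k => [|k].
    rewrite (_ : (fun u => _) = cst (t0, y)); first exact: measurable_cst.
    by apply/funext => u; rewrite (tuple0 u).
  rewrite (_ : (fun u => _) = fun u : k.+1.-tuple pt => tnth u ord_max); first exact: measurable_tnth.
  by apply/funext => u; rewrite (tnth_nth (t0, y)) -nth_last size_tuple.
have ml1 : measurable_fun setT (fun z : k.-tuple pt * m.-tuple pt => (last (t0, y) z.1).1).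
  apply: (measurableT_comp (f := fst)) => //.
  by apply: (measurableT_comp ml); exact: measurable_fst.
rewrite (_ : (fun z => _) = fun z : k.-tuple pt * m.-tuple pt =>
   0 < \prod_(i < m) (if (tnth z.2 i).1 <= (last (t0, y) z.1).1 then 1 else 0 : R)).
  apply: measurable_fun_ltr => //; apply: measurable_prod => i _; apply: measurable_fun_ifT => //.
  apply: measurable_fun_ler => //; apply: (measurableT_comp (f := fst)) => //.
  apply: (measurableT_comp (f := fun x : m.-tuple pt => tnth x i)) => //; exact: measurable_tnth.
apply/funext => z; rewrite -(big_tuple _ _ z.2 predT (fun w : pt => if w.1 <= (last (t0, y) z.1).1 then 1 else 0)).
elim: (tval z.2) => [|w v IH] /=; first by rewrite big_nil ltr01.
by rewrite big_cons IH; case: ifP => _; rewrite ?mul1r ?mul0r ?ltxx.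
Qed.

Lemma Lam_cintg k m : cintg (PM k m) setT (fun z => Lam z.1 z.2).
Proof.
have [BL [BL0 hBL]] := psiL_bnd.
have := @core_psi_cintg Q0 psiL (cst BL) _ psiL_cmeas (measurable_cst _) (fun=> BL0) hBL psiL_nok (int_cst Q0 BL) k m.
exact: cintg_fubini1.
Qed.

Lemma pairing_Lam k m : pairing_ Q0 psiL k m = cint (PM k m) setT (fun z => Lam z.1 z.2).
Proof.
have [BL [BL0 hBL]] := psiL_bnd.
exact: (@pairing_swap Q0 psiL (cst BL) _ psiL_cmeas (measurable_cst _) (fun=> BL0) hBL psiL_nok (int_cst Q0 BL) k m).
Qed.

Let cintg_if d (X : measurableType d) (mu : {measure set X -> \bar R}) (b : X -> bool) (f g : X -> R[i]) :
  measurable_fun setT b -> cintg mu setT f -> cintg mu setT g -> cintg mu setT (fun x => if b x then f x else g x).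
Proof.
move=> mb cf cg; have mf := cintg_meas cf; have mg := cintg_meas cg.
have n1 := cintg_normc cf; have n2 := cintg_normc cg.
apply: (cintg_le (g := fun x => normc (f x) + normc (g x))).
- exact: cmeas_if.
- by move=> x; case: ifP => _; rewrite ?lerDl ?lerDr normc_ge0.
- by have := integrableD measurableT n1 n2; apply: eq_integrable => // x _; rewrite /= EFinD.
Qed.

Definition LamA k m (z : k.-tuple pt * m.-tuple pt) : R[i] :=
  if all (fun w => w.1 <= (last (t0, y) z.1).1) z.2 then Lam z.1 z.2 else 0.
Definition LamB k m (z : k.-tuple pt * m.-tuple pt) : R[i] :=
  if all (fun w => w.1 <= (last (t0, y) z.1).1) z.2 then 0 else Lam z.1 z.2.

Lemma LamA_cintg k m : cintg (PM k m) setT (@LamA k m).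
Proof. by apply: cintg_if; [exact: mall|exact: Lam_cintg|exact: cintg0]. Qed.

Lemma LamB_cintg k m : cintg (PM k m) setT (@LamB k m).
Proof. by apply: cintg_if; [exact: mall|exact: cintg0|exact: Lam_cintg]. Qed.

Lemma pairing_split k m : pairing_ Q0 psiL k m =
  cint (PM k m) setT (@LamA k m) + cint (PM k m) setT (@LamB k m).
Proof.
rewrite pairing_Lam -(cintD measurableT (LamA_cintg k m) (LamB_cintg k m)); apply: eq_cint => z _.
by rewrite /LamA /LamB; case: ifP => _; rewrite ?addr0 ?add0r.
Qed.

Lemma point_part k m : cint (PM k.+1 m) setT (@LamA k.+1 m) = iC * pairing_ nu2 psi2 k m.
Proof.
have iA := LamA_cintg k.+1 m.
rewrite -(cint_fubini1 iA); have ig := cintg_fubini1 iA; have mg := cintg_meas ig.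
rewrite (cint_tmeas_rcons mu2 mg).
have ig2 := (cintg_tmeas_rcons mu2 mg).1 ig.
rewrite -(cint_fubini2 ig2).
have [Bp [Bp0 hBp]] := psi2_bnd.
have key (u : k.-tuple pt) (p : pt) (v : m.-tuple pt) :
    LamA (trcons (u, p), v) = iC * psi2 p * core u v p.
  rewrite /LamA /= last_rcons coreE; case: ifP => [vp|_]; last by rewrite mulr0.
  have [ok|nok] := boolP (okuv (rcons u p) v).
    rewrite Lam_after_point ?last_rcons// pre_rcons -cats1 big_cat/= big_seq1 /path.
    have /andP[] := ok; rewrite all_rcons => /andP[okp _] _.
    by rewrite /psi2 /phib okp; ring.
  rewrite Lam_nok//; move: nok; rewrite /okuv all_rcons -andbA negb_and => /orP[np|nuv].
    by rewrite psi2_nok// mulr0 mul0r.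
  by have := core_nok p nuv; rewrite coreE vp => ->; rewrite mulr0.
transitivity (cint mu2 setT (fun p => iC * (Amp k m p * psi2 p))).
  apply: eq_cint => p _.
  have [okp|np] := boolP (okpt t0 T M p); last first.
    rewrite psi2_nok// !mulr0 -[RHS](cint0 (tmeas mu2 k) measurableT); apply: eq_cint => u _ /=.
    rewrite -[RHS](cint0 (tmeas mu1 m) measurableT); apply: eq_cint => v _.
    by rewrite key psi2_nok// mulr0 mul0r.
  have ic := cintgZ measurableT (iC * psi2 p) (core_cintg k m okp).
  transitivity (cint (PM k m) setT (fun z => iC * psi2 p * core z.1 z.2 p)).
    rewrite -(cint_fubini1 ic); apply: eq_cint => u _; apply: eq_cint => v _; exact: key.
  rewrite (cintZ measurableT _ (core_cintg k m okp)) -/(Amp k m p); move: (Amp k m p) (psi2 p) => a1 a2; ring.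
apply: cintZ => //.
apply: (@Amp_psi_cintg nu2 psi2 (fun x => r2 x * Bp) (R2 * Bp)) => //.
- exact: psi2_cmeas.
- exact: measurable_funM.
- by move=> x; rewrite mulr_ge0.
- exact: psi2_nok.
- have mr2E : measurable_fun setT (fun x : mR => (r2 x)%:E) by exact/measurable_EFinP.
  have Bp0' : (0 <= Bp%:E)%E by rewrite lee_fin.
  under eq_integral do rewrite mulrC EFinM.
  rewrite (@ge0_integralZl _ _ _ nu2 _ measurableT _ mr2E _ _ Bp0'); last by move=> x _; rewrite lee_fin.
  by rewrite mulrC EFinM; apply: lee_wpmul2l.
Qed.

Lemma Lam_nil : Lam [::] [::] = iC * phi y t0.
Proof.
rewrite Lam_after_point// !big_nil !mul1r; congr (_ * _); rewrite -[RHS]mulr1; congr (_ * _).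
rewrite /pre/= ?mul1r -[RHS]cexp0; congr cexp; rewrite /phase !big_nil/= !subrr !mulr0 ?rmorph0 ?mulr0; ring.
Qed.

Let mLamA k m : cmeas (@LamA k m) := cintg_meas (LamA_cintg k m).

Lemma point_part0 m : cint (PM 0 m) setT (@LamA 0 m) = if m == 0%N then iC * phi y t0 else 0.
Proof.
have iA := LamA_cintg 0 m.
rewrite -(cint_fubini1 iA) cint_tmeas0; last exact: cintg_meas (cintg_fubini1 iA).
have mA (m' : nat) : cmeas (fun v : m'.-tuple pt => LamA ([tuple] : 0.-tuple pt, v)).
  by apply: (cmeas_comp (@mLamA 0 m') (g := fun v => ([tuple], v))); exact: measurable_fun_pair.
case: m iA => [|m] iA.
  by rewrite (cint_tmeas0 mu1 (mA 0%N)) /LamA /= Lam_nil.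
rewrite /=.
have iA2 : cintg (tmeas mu1 m.+1) setT (fun v => LamA ([tuple] : 0.-tuple pt, v)).
  have := cintg_fubini1 iA => ic.
  have [Bm hB] := e1_integral C0.
  have := (cintg_fubini2 iA); congr (cintg _ _ _); apply/funext => v.
  rewrite cint_tmeas0//.
  by apply: (cmeas_comp (@mLamA 0 m.+1) (g := fun u => (u, v))); exact: measurable_fun_pair.
rewrite (cint_tmeasS iA2).
rewrite -[RHS](cint0 mu1 measurableT); apply: ae_eq_cint.
- exact: cintg_meas (cintg_fubini1 ((cintg_tmeasS mu1 (mA m.+1)).1 iA2)).
- exact: cmeas_cst.
exists [set w | w.1 = t0]; split.
- have -> : [set w : mR * mR | w.1 = t0] = [set t0] `*` setT.
    by apply/seteqP; split => [w /= h1|w [/= h1 _]] //; split.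
  by apply: measurableX => //; exact: measurable_set1.
- exact: mu1_null.
move=> w /=; apply: contra_notP => /eqP wt.
rewrite -[RHS](cint0 (tmeas mu1 m) measurableT); apply: eq_cint => v _.
rewrite /LamA /=; case: ifP => // /andP[w1 _]; apply: Lam_nok.
by rewrite /okuv /= /inT leNgt lt_neqAle wt w1.
Qed.

Lemma core_point_perm k m (u : k.-tuple pt) (v v' : m.-tuple pt) : perm_eq v v' -> LamB (u, v) = LamB (u, v').
Proof.
move=> vv'; rewrite /LamB /= (perm_all _ vv'); case: ifP => _; first by [].
by apply: eq_cint => q _; rewrite (core_perm _ _ vv').
Qed.

Let vtx (w : pt) (x : R) : R[i] := W1 w * (expR (w.2 * x))%:C%C * phib (w.1, x).

Lemma LamB_cons k m (u : k.-tuple pt) (w : pt) (v : m.-tuple pt) :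
  (if tmaxb (T := (mR * mR)%type) fst w v then LamB (u, tcons (w, v)) else 0) =
  iC * cint Q0 setT (fun x => core u v (w.1, x) * vtx w x).
Proof.
have z0 : (forall x, core u v (w.1, x) * vtx w x = 0) ->
    0 = iC * cint Q0 setT (fun x => core u v (w.1, x) * vtx w x).
  move=> z; have -> : cint Q0 setT (fun x => core u v (w.1, x) * vtx w x) = 0; last by rewrite mulr0.
  by rewrite -[RHS](cint0 Q0 measurableT); apply: eq_cint => x _; exact: z.
rewrite /tmaxb; case: ifPn => [vw|nv]; last first.
  by apply: z0 => x; rewrite coreE (negbTE nv) mul0r.
rewrite /LamB /=; have [wp|pw] := leP w.1 (last (t0, y) u).1.
  rewrite (_ : all _ v); last by apply/allP => w' /(allP vw) h1; exact: le_trans wp.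
  by apply: z0 => x; rewrite coreE path_before// !mulr0 if_same mul0r.
rewrite /=; have [ok|] := boolP (okuv u (w :: v)); first exact: Lam_after_kick.
move=> nok; rewrite Lam_nok//; apply: z0 => x.
move: nok; rewrite /okuv /= andbCA negb_and => /orP[nw|nuv]; last by rewrite core_nok// mul0r.
by rewrite /vtx /W1 (negbTE nw) !mul0r mulr0.
Qed.

Let vtx_bound (w : pt) (x : R) : exists B : R, 0 <= B /\ forall x, normc (vtx w x) <= B.
Proof.
have [Bp [Bp0 hBp]] := phib_bnd.
exists (expR ((M + 1) * `|w.2|) * r1 w.2 * Bp); split; first by rewrite !mulr_ge0 ?expR_ge0 ?r10.
move=> {}x; rewrite /vtx; have [okq|nq] := boolP (okpt t0 T M (w.1, x)); last first.
  by rewrite /phib (negbTE nq) mulr0 Normc.normc0 !mulr_ge0 ?expR_ge0 ?r10.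
have xM : `|x| <= M by case/andP: okq.
rewrite Normc.normcM ler_pM ?normc_ge0//; apply: le_trans (normc_expx w.2 xM).
rewrite mulrC !Normc.normcM ler_wpM2l ?normc_ge0//.
by rewrite /W1; case: ifP => // _; rewrite Normc.normc0 normc_ge0.
Qed.

Let vtx_cmeas d (X : measurableType d) (w : X -> pt) (x : X -> R) :
  measurable_fun setT w -> measurable_fun setT x -> cmeas (fun a => vtx (w a) (x a)).
Proof.
move=> mw mx; apply: cmeasM; last first.
  apply: (cmeas_comp phib_cmeas (g := fun a => ((w a).1, x a))); apply: measurable_fun_pair => //.
  exact: (measurableT_comp (f := fst)).
apply: cmeasM; first exact: W1_cmeas.
apply: cmeas_real; apply: (measurableT_comp (f := @expR R)) => //; apply: measurable_funM => //.
exact: (measurableT_comp (f := snd)).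
Qed.

Let core_vtx_cintg k m (w : pt) :
  cintg (PM k m \x Q0)%E setT (fun zx => core zx.1.1 zx.1.2 (w.1, zx.2) * vtx w zx.2).
Proof.
have [B [B0 hB]] := vtx_bound w 0; have [Be hBe] := e1_integral C0.
have mm : measurable_fun setT (fun z : k.-tuple pt * m.-tuple pt => majorant k C z.1 z.2 (w.1, 0)).
  by apply: measurable_majorant.
have h3 := @ge0_integral_prod_le R _ _ (k.-tuple (mR * mR) * m.-tuple (mR * mR))%type mR (PM k m) Q0
   (fun z => majorant k C z.1 z.2 (w.1, 0)) (cst B) _ _ mm (measurable_cst _)
   (fun z => majorant_ge0 k C z.1 z.2 (w.1, 0)) (fun=> B0) (majorant_integral k m (w.1, 0) hBe) (int_cst Q0 B).
have m11 : measurable_fun setT (fun zx : (k.-tuple pt * m.-tuple pt) * mR => zx.1.1).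
  by apply: (measurableT_comp (f := fst)) => //; exact: measurable_fst.
have m12 : measurable_fun setT (fun zx : (k.-tuple pt * m.-tuple pt) * mR => zx.1.2).
  by apply: (measurableT_comp (f := snd)) => //; exact: measurable_fst.
have m2 : measurable_fun setT (fun zx : (k.-tuple pt * m.-tuple pt) * mR => zx.2) by exact: measurable_snd.
apply: (@cintg_dom R _ ((k.-tuple (mR * mR) * m.-tuple (mR * mR)) * mR)%type (PM k m \x Q0)%E _
  (fun zx => majorant k C zx.1.1 zx.1.2 (w.1, 0) * B)).
- apply: cmeasM; last by apply: vtx_cmeas => //; exact: measurable_cst.
  by apply: core_cmeas => //; exact: measurable_fun_pair.
- by apply: measurable_funM => //; exact: (measurableT_comp mm (@measurable_fst _ _ _ _)).
- move=> [[u v] x] /=; have [okq|nq] := boolP (okpt t0 T M (w.1, x)); last first.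
    by rewrite /vtx /phib (negbTE nq) !mulr0 Normc.normc0 mulr_ge0// majorant_ge0.
  rewrite Normc.normcM ler_pM ?normc_ge0//.
  by have := core_le u v okq; rewrite size_tuple.
- exact: le_lt_trans h3 (ltry _).
Qed.

Let Amp_vtx k m (w : pt) (x : R) : cint (PM k m) setT (fun z => core z.1 z.2 (w.1, x) * vtx w x) =
  Amp k m (w.1, x) * vtx w x.
Proof.
have [okq|nq] := boolP (okpt t0 T M (w.1, x)); last first.
  have v0 : vtx w x = 0 by rewrite /vtx /phib (negbTE nq) mulr0.
  by rewrite v0 mulr0 -[RHS](cint0 (PM k m) measurableT); apply: eq_cint => z _; rewrite mulr0.
rewrite [RHS]mulrC -(cintZ _ _ (core_cintg k m okq))//; apply: eq_cint => z _; exact: mulrC.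
Qed.

Let Amp_vtx_cintg k m (t : R) : cintg (nu1 \x Q0)%E setT (fun ax => Amp k m (t, ax.2) * vtx (t, ax.1) ax.2).
Proof.
have [Bp [Bp0 hBp]] := phib_bnd; have [Be hBe] := e1_integral C0; have [Bx [Bx0 hBx]] := exp1B.
have kap0 : 0 <= kap by rewrite !mulr_ge0 ?sqrtr_ge0 ?R2_ge0.
have Be0 : 0 <= Be by rewrite -lee_fin (le_trans _ hBe)// integral_ge0// => w _; rewrite lee_fin e1_ge0.
pose c := 2 * (K ^+ k.+1 * (kap ^+ k * expR (e^-1 * (t - t0)) * (Num.sqrt (t - t0))^-1 * Be ^+ m)) * Bp.
have c0 : 0 <= c by rewrite !mulr_ge0 ?exprn_ge0 ?expR_ge0 ?invr_ge0 ?sqrtr_ge0.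
have h3 := @ge0_integral_prod_le R _ _ mR mR nu1 Q0 (fun a => expR ((M + 1) * `|a|) * r1 a) (cst c) _ _ mexpr1 (measurable_cst _)
  (fun a => mulr_ge0 (expR_ge0 _) (r10 a)) (fun=> c0) hBx (int_cst Q0 c).
apply: (@cintg_dom R _ (mR * mR)%type (nu1 \x Q0)%E _ (fun ax => expR ((M + 1) * `|ax.1|) * r1 ax.1 * c)).
- apply: cmeasM.
    by apply: (cmeas_comp (Amp_cmeas k m) (g := fun ax : mR * mR => (t, ax.2))); apply: measurable_fun_pair => //; exact: measurable_snd.
  apply: vtx_cmeas; last exact: measurable_snd.
  by apply: measurable_fun_pair => //; exact: measurable_fst.
- by apply: measurable_funM => //; exact: (measurableT_comp mexpr1 (@measurable_fst _ _ _ _)).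
- move=> [a x] /=; have [okq|nq] := boolP (okpt t0 T M (t, x)); last first.
    rewrite /vtx /phib (negbTE nq) !mulr0 Normc.normc0.
    exact: (mulr_ge0 (mulr_ge0 (expR_ge0 _) (r10 _)) c0).
    have xM : `|x| <= M by case/andP: okq.
  have h1 := Amp_le k m okq hBe.
  have h2 : normc (W1 (t, a) * (expR (a * x))%:C%C) <= expR ((M + 1) * `|a|) * r1 a.
    apply: le_trans (normc_expx a xM).
    rewrite mulrC !Normc.normcM ler_wpM2l ?normc_ge0//.
    by rewrite /W1; case: ifP => // _; rewrite Normc.normc0 normc_ge0.
  rewrite /vtx !Normc.normcM -[X in _ * (X * _)]Normc.normcM /c.
  rewrite [leRHS]mulrCA.
  by rewrite ler_pM ?mulr_ge0 ?normc_ge0// ler_pM ?normc_ge0.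
- exact: le_lt_trans h3 (ltry _).
Qed.

Let vtx_psi1 k m (t x : R) : cint nu1 setT (fun a => Amp k m (t, x) * vtx (t, a) x) = Amp k m (t, x) * psi1 (t, x).
Proof.
have [okq|nq] := boolP (okpt t0 T M (t, x)); last first.
  rewrite psi1_nok// mulr0 -[RHS](cint0 nu1 measurableT); apply: eq_cint => a _.
  by rewrite /vtx /phib (negbTE nq) !mulr0.
have [/andP[tT xM] [Bx [Bx0 hBx]]] := (okq, exp1B).
rewrite /psi1 /V1c /= mulrA [RHS]mulrAC -(cintZ measurableT); last first.
  apply: (@cintg_dom R _ mR nu1 _ (fun a => expR ((M + 1) * `|a|) * r1 a)).
  - exact: mexpx.
  - exact: mexpr1.
  - by move=> a; exact: normc_expx.
  - exact: le_lt_trans hBx (ltry _).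
apply: eq_cint => a _; rewrite /vtx /W1 /= [inT t]tT; move: (Amp _ _ _) (rho1 a) (phib _) (_%:C)%C => a1 a2 a3 a4; ring.
Qed.

Lemma kick_part0 k : cint (PM k 0) setT (@LamB k 0) = 0.
Proof.
rewrite -[RHS](cint0 (PM k 0) measurableT); apply: eq_cint => -[u v] _.
by rewrite /LamB (tuple0 v).
Qed.

Lemma kick_part k m : cint (PM k m.+1) setT (@LamB k m.+1) = m.+1%:R * (iC * pairing_ Q0 psi1 k m).
Proof.
have iB := LamB_cintg k m.+1.
rewrite -(cint_fubini2 iB); have ig := cintg_fubini2 iB.
have sg : tsym (fun v : m.+1.-tuple (mR * mR) => cint (tmeas mu2 k) setT (fun u => LamB (u, v))).
  by move=> v v' vv'; apply: eq_cint => u _; exact: core_point_perm.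
have ms1 : @measurable_fun _ _ (mR * mR)%type R setT fst by exact: measurable_fst.
rewrite (cint_tmax ms1 mu1_null ig sg); congr (_ * _).
have it := cintg_tmax ms1 ig.
rewrite -(cint_fubini1 it).
have key (w : pt) : cint (tmeas mu1 m) setT (fun v => if tmaxb (T := (mR * mR)%type) fst w v then
    cint (tmeas mu2 k) setT (fun u => LamB (u, tcons (w, v))) else 0) =
    iC * cint Q0 setT (fun x => Amp k m (w.1, x) * vtx w x).
  have ic := core_vtx_cintg k m w; have ic1 := cintg_fubini1 ic.
  transitivity (cint (tmeas mu1 m) setT (fun v => cint (tmeas mu2 k) setT (fun u =>
      iC * cint Q0 setT (fun x => core u v (w.1, x) * vtx w x)))).
    apply: eq_cint => v _; rewrite -[RHS](_ : cint (tmeas mu2 k) setT (fun u =>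
      (if tmaxb (T := (mR * mR)%type) fst w v then LamB (u, tcons (w, v)) else 0)) = _); last first.
      by apply: eq_cint => u _; exact: LamB_cons.
    by case: ifP => // _; rewrite cint0.
  have iz := cintgZ measurableT iC ic1.
  have e1' := cint_fubini2 iz; rewrite [LHS]e1' (cintZ measurableT _ ic1); congr (_ * _).
  rewrite (cint_swap ic); apply: eq_cint => x _; exact: Amp_vtx.
have iG : cintg mu1 setT (fun w => iC * cint Q0 setT (fun x => Amp k m (w.1, x) * vtx w x)).
  by have := cintg_fubini1 it; congr (cintg _ _ _); apply/funext => w; exact: key.
transitivity (cint mu1 setT (fun w => iC * cint Q0 setT (fun x => Amp k m (w.1, x) * vtx w x))).
  by apply: eq_cint => w _; exact: key.
rewrite -(cint_fubini1 iG).
have [B1 [B10 hB1]] := psi1_bnd.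
have ip := @Amp_psi_cintg Q0 psi1 (cst B1) _ psi1_cmeas (measurable_cst _) (fun=> B10) hB1 psi1_nok (int_cst Q0 B1) k m.
rewrite /pairing_ -(cint_fubini1 ip) -(cintZ measurableT _ (cintg_fubini1 ip)).
apply: eq_cint => t _.
have it2 := Amp_vtx_cintg k m t.
rewrite (cintZ measurableT _ (cintg_fubini1 it2)); congr (_ * _).
rewrite (cint_swap it2); apply: eq_cint => x _; exact: vtx_psi1.
Qed.

Definition jc k m : R[i] := (- iC) ^+ (k + m) / (m`!)%:R.

Lemma pairing_rec k m : jc k m * pairing_ Q0 psiL k m =
  (if m is m'.+1 then jc k m' * pairing_ Q0 psi1 k m' else 0) +
  (if k is k'.+1 then jc k' m * pairing_ nu2 psi2 k' m else 0) +
  (if (k == 0%N) && (m == 0%N) then iC * phi y t0 else 0).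
Proof.
have i1 : iC * - iC = 1 :> R[i] by rewrite mulrN iC2 opprK.
have f0 n : (n.+1%:R : R[i]) != 0 by rewrite pnatr_eq0.
rewrite pairing_split mulrDr addrC -addrA; congr (_ + _).
  case: m => [|m]; first by rewrite kick_part0 mulr0.
  rewrite kick_part /jc addnS exprSr factS natrM invfM.
  have := f0 m; move: ((- iC) ^+ (k + m)) (pairing_ _ _ _ _) ((m`!)%:R^-1) (m.+1%:R : R[i]) => a b c d d0.
  rewrite (_ : a * - iC * (d^-1 * c) * (d * (iC * b)) = a * c * b * (iC * - iC) * (d^-1 * d)); last by ring.
  by rewrite i1 mulVf// !mulr1.
case: k => [|k].
  rewrite add0r point_part0 /=; case: m => [|m]; last by rewrite mulr0.
  by rewrite /jc addn0 expr0 fact0 divr1 mul1r.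
rewrite point_part /jc addSn exprSr addr0.
move: ((- iC) ^+ (k + m)) (pairing_ _ _ _ _) ((m`!)%:R^-1) => a b c.
rewrite (_ : a * - iC * c * (iC * b) = a * c * b * (iC * - iC)); last by ring.
by rewrite i1 mulr1.
Qed.

End TestFunction.

End Pairing.

(** * Iterated integrals *)

Section IteratedIntegrals.
Context {R : realType}.
Local Notation mR := (measurableTypeR R).

Section Representable.
Variables (J : (R -> R[i]) -> R[i]) (nu : {finite_measure set mR -> \bar R}) (rho : R -> R[i]) (r : R -> R).
Hypothesis rep : represents J nu rho r.
Variables (w : R -> R) (G : R).
Hypotheses (mw : @measurable_fun _ _ mR R setT w) (w0 : forall a, 0 <= w a)
  (wG : (\int[nu]_a (w a * r a)%:E <= G%:E)%E).
(* Uniform domination (dom constantly true) serves for the kicks, domination on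
   bounded sets together with a bounded support for the point interactions. *)
Variables (dom : R -> R -> bool) (L0 : R).
Hypotheses (dom_mono : forall L L' a, L <= L' -> dom L a -> dom L' a) (dom_ex : forall a, exists L, dom L a)
  (dom_r : forall a, ~~ dom L0 a -> r a = 0).

Definition locally_dominated n (F : n.-tuple R -> R[i]) := forall L, L0 <= L -> exists B, 0 <= B /\
  forall v : n.-tuple R, all (dom L) v -> normc (F v) <= B * \prod_(a <- v) w a.

Let mrho : @cmeas R _ mR rho. Proof. by case: rep. Qed.
Let mr : @measurable_fun _ _ mR R setT r. Proof. by case: rep. Qed.
Let rr a : normc (rho a) <= r a. Proof. by case: rep. Qed.
Let r0 a : 0 <= r a. Proof. exact: le_trans (normc_ge0 _) (rr a). Qed.
Let wr0 a : 0 <= w a * r a. Proof. exact: mulr_ge0. Qed.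
Let mwr : @measurable_fun _ _ mR R setT (fun a => w a * r a). Proof. exact: measurable_funM. Qed.

Lemma cmeas_prod_tuple d (X : measurableType d) (f : X -> R[i]) n : cmeas f ->
  cmeas (fun v : n.-tuple X => \prod_(a <- v) f a).
Proof.
move=> mf; under eq_fun do rewrite big_tuple; apply: cmeas_prod => i.
exact: (cmeas_comp mf (@measurable_tnth _ _ n i)).
Qed.

Lemma normc_weight n (F : n.-tuple R -> R[i]) (B : R) (v : n.-tuple R) : 0 <= B ->
  (all (dom L0) v -> normc (F v) <= B * \prod_(a <- v) w a) ->
  normc (F v * \prod_(a <- v) rho a) <= B * \prod_(a <- v) (w a * r a).
Proof.
move=> B0 h; have p0 : 0 <= \prod_(a <- v) (w a * r a) by apply: prodr_ge0.
have [dv|/allPn[a av nd]] := boolP (all (dom L0) v); last first.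
  rewrite (_ : \prod_(a <- v) rho a = 0) ?mulr0 ?Normc.normc0 ?mulr_ge0//.
  apply/eqP; rewrite prodf_seq_eq0; apply/hasP; exists a => //=; apply/eqP/Normc.eq0_normc.
  by apply/eqP; rewrite eq_le normc_ge0 andbT -(dom_r nd).
rewrite Normc.normcM big_split/= mulrA ler_pM ?normc_ge0 ?h// normc_prod.
by apply: ler_prod => a _; rewrite normc_ge0 rr.
Qed.

Lemma weight_integral_le n (B : R) : 0 <= B ->
  (\int[tmeas nu n]_v (B * \prod_(a <- v) (w a * r a))%:E <= (B * G ^+ n)%:E)%E.
Proof.
move=> B0.
have h := @ge0_integral_prod_tmeas R _ mR nu (fun a => w a * r a) G n mwr wr0 wG.
have mP : measurable_fun setT (fun v : n.-tuple mR => (\prod_(a <- v) (w a * r a))%:E).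
  apply/measurable_EFinP; under eq_fun do rewrite big_tuple.
  apply: measurable_prod => i _ /=; exact: (measurableT_comp mwr (@measurable_tnth _ mR n i)).
have B0' : (0 <= B%:E)%E by rewrite lee_fin.
under eq_integral do rewrite EFinM.
rewrite (@ge0_integralZl _ _ _ (tmeas nu n) _ measurableT _ mP _ _ B0'); last first.
  by move=> v _; rewrite lee_fin prodr_ge0.
by rewrite EFinM; apply: lee_wpmul2l.
Qed.

Lemma measurable_weight n (B : R) : measurable_fun setT (fun v : n.-tuple mR => B * \prod_(a <- v) (w a * r a)).
Proof.
apply: measurable_funM => //; under eq_fun do rewrite big_tuple.
apply: measurable_prod => i _ /=; exact: (measurableT_comp mwr (@measurable_tnth _ mR n i)).
Qed.

Lemma locally_dominated_cintg n (F : n.-tuple R -> R[i]) : @cmeas R _ (n.-tuple mR) F -> locally_dominated F ->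
  cintg (tmeas nu n) setT (fun v => F v * \prod_(a <- v) rho a).
Proof.
move=> mF /(_ L0 (lexx _))[B [B0 hB]].
apply: (@cintg_dom R _ (n.-tuple mR) (tmeas nu n) _ (fun v => B * \prod_(a <- v) (w a * r a))).
- by apply: cmeasM => //; exact: (@cmeas_prod_tuple _ mR).
- exact: measurable_weight.
- by move=> v; apply: normc_weight => // /hB.
- exact: le_lt_trans (weight_integral_le n B0) (ltry _).
Qed.

Lemma normc_cint_weight n (F : n.-tuple R -> R[i]) (B : R) : @cmeas R _ (n.-tuple mR) F -> 0 <= B ->
  (forall v : n.-tuple R, all (dom L0) v -> normc (F v) <= B * \prod_(a <- v) w a) ->
  normc (cint (tmeas nu n) setT (fun v => F v * \prod_(a <- v) rho a)) <= 2 * (B * G ^+ n).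
Proof.
move=> mF B0 hB.
apply: (@normc_cint_dom R _ (n.-tuple mR) (tmeas nu n) _ (fun v => B * \prod_(a <- v) (w a * r a))).
- by apply: cmeasM => //; exact: (@cmeas_prod_tuple _ mR).
- exact: measurable_weight.
- by move=> v; apply: normc_weight => // /hB.
- exact: weight_integral_le.
Qed.

Lemma iter_represents n (F : n.-tuple R -> R[i]) : @cmeas R _ (n.-tuple mR) F -> locally_dominated F ->
  iter_integral J F = cint (tmeas nu n) setT (fun v => F v * \prod_(a <- v) rho a).
Proof.
elim: n F => [|n IH] F mF dF.
  rewrite cint_tmeas0/=; last first.
    by apply: cmeasM => //; exact: (@cmeas_prod_tuple _ mR).
  by rewrite [X in _ * X](_ : _ = 1) ?mulr1//; exact: big_nil.
have G0 : 0 <= G by rewrite -lee_fin (le_trans _ wG)// integral_ge0// => a _; rewrite lee_fin.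
have mFa (a : R) : @cmeas R _ (n.-tuple mR) (fun us => F (tcons (a, us))).
  apply: (cmeas_comp (@cmeas_tcons R _ mR n F mF) (g := fun us => (a, us))).
  exact: measurable_fun_pair.
have dFa (a : R) : locally_dominated (fun us : n.-tuple R => F (tcons (a, us))).
  move=> L L0L; have [La ha] := dom_ex a.
  have [|B [B0 hB]] := dF (Num.max L La); first by rewrite le_max L0L.
  exists (B * w a); split; first exact: mulr_ge0.
  move=> us dus; rewrite -mulrA; have := hB (tcons (a, us)); rewrite big_cons; apply => /=.
  rewrite (dom_mono _ ha) ?le_max ?lexx ?orbT//=.
  by apply: sub_all dus => b; apply: dom_mono; rewrite le_max lexx.
have [_ _ _ repJ] := rep.
have iF := locally_dominated_cintg mF dF.
pose f (a : R) := cint (tmeas nu n) setT (fun us => F (tcons (a, us)) * \prod_(b <- us) rho b).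
transitivity (J f).
  by rewrite /=; congr J; apply/funext => a; exact: IH (mFa a) (dFa a).
have mf : @cmeas R _ mR f.
  apply: (@cmeas_param2 R _ _ mR (n.-tuple mR) (tmeas nu n) (fun aus => F (tcons aus) * \prod_(b <- aus.2) rho b)).
  apply: cmeasM; first exact: (@cmeas_tcons R _ mR n F mF).
  exact: (cmeas_comp (@cmeas_prod_tuple _ mR rho n mrho) (@measurable_snd _ _ mR (n.-tuple mR))).
have [B [B0 hB]] := dF L0 (lexx _).
have fb a : normc (f a) * r a <= 2 * (B * G ^+ n) * (w a * r a).
  have [da|nd] := boolP (dom L0 a); last by rewrite dom_r// !mulr0.
  rewrite [leRHS]mulrA ler_wpM2r// (_ : 2 * (B * G ^+ n) * w a = 2 * ((B * w a) * G ^+ n)); last by ring.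
  apply: normc_cint_weight => //; first exact: mulr_ge0.
  by move=> us dus; rewrite -mulrA; have := hB (tcons (a, us)); rewrite big_cons; apply; rewrite /= da.
rewrite repJ//; last first.
  apply/integrableP; split.
    by apply/measurable_EFinP; apply: measurable_funM => //; exact: measurable_normc.
  have h := @ge0_integral_prod_tmeas R _ mR nu (fun a => w a * r a) G 1 mwr wr0 wG.
  have c0 : 0 <= 2 * (B * G ^+ n) by rewrite !mulr_ge0 ?exprn_ge0.
  have c0' : (0 <= (2 * (B * G ^+ n))%:E)%E by rewrite lee_fin.
  apply: (@le_lt_trans _ _ (\int[nu]_a ((2 * (B * G ^+ n))%:E * (w a * r a)%:E))%E).
    apply: ge0_le_integral => //.
    - apply: measurableT_comp => //.
      by apply/measurable_EFinP; apply: measurable_funM => //; exact: measurable_normc.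
    - by apply: emeasurable_funM => //; exact/measurable_EFinP.
    - by move=> a _; rewrite /= -EFinM lee_fin ger0_norm ?fb// mulr_ge0 ?normc_ge0.
  have mE : measurable_fun setT (fun a : mR => (w a * r a)%:E) by exact/measurable_EFinP.
  rewrite (@ge0_integralZl _ _ _ nu _ measurableT _ mE _ _ c0'); last by move=> a _; rewrite lee_fin.
  by apply: le_lt_trans (lee_wpmul2l c0' wG) _; rewrite -EFinM ltry.
rewrite (cint_tmeasS iF); apply: eq_cint => a _.
rewrite mulrC /f -(cintZ measurableT _ (locally_dominated_cintg (mFa a) (dFa a))).
by apply: eq_cint => us _; rewrite big_cons mulrCA.
Qed.

End Representable.

Lemma lintegral_represents (a b t : R) : a <= t -> t <= b ->
  represents (@lintegral R `[a, t]) (lebr a b) (fun s => if (a <= s) && (s <= t) then 1 else 0) (cst 1).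
Proof.
move=> at_ tb; have mI : @measurable_fun _ _ mR _ setT (fun s : R => (a <= s) && (s <= t)).
  by apply: measurable_and; exact: measurable_fun_ler.
split => //.
- by apply: cmeas_if; [exact: mI|exact: cmeas_cst|exact: cmeas_cst].
- by move=> s; case: ifP => _; rewrite ?Normc.normc1 ?Normc.normc0.
move=> f mf _; have mg : @cmeas R _ mR (fun s => f s * (if (a <= s) && (s <= t) then 1 else 0)).
  by apply: cmeasM => //; apply: cmeas_if; [exact: mI|exact: cmeas_cst|exact: cmeas_cst].
rewrite -(lintegral_lebr a b mg) /lintegral [LHS]cint_mkcond [RHS]cint_mkcond.
apply: eq_cint => s _; rewrite !mem_setE !in_itv/=.
have [as_|sa] := leP a s; last by [].
by rewrite /=; have [st|ts] := leP s t; rewrite ?mulr1 ?mulr0 ?if_same// (le_trans st tb).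
Qed.

Lemma eq_iter_lintegral (a b : R) n (F F' : n.-tuple R -> R[i]) :
  (forall v : n.-tuple R, all (fun s => a <= s <= b) v -> F v = F' v) ->
  iter_integral (@lintegral R `[a, b]) F = iter_integral (@lintegral R `[a, b]) F'.
Proof.
elim: n F F' => [|n IH] F F' FF'; first exact: FF'.
apply: eq_cint => s; rewrite /= in_itv/= => sab.
by apply: IH => v vab; apply: FF'; rewrite /= sab.
Qed.

Lemma eq_simplex_integral (a b : R) n (F F' : n.-tuple R -> R[i]) :
  (forall v : n.-tuple R, inc (a, 0) [seq (s, 0) | s <- v] (b, 0) -> F v = F' v) -> a < b ->
  simplex_integral a b F = simplex_integral a b F'.
Proof.
elim: n a F F' => [|n IH] a F F' FF' ab; first by apply: FF'.
apply: eq_cint => s; rewrite /= in_itv/= => /andP[as_ sb].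
by apply: IH => // v vab; apply: FF'; rewrite /= as_.
Qed.

Definition dchain (a : R) (v : seq R) (t : R) : R := chain dk (a, 0) [seq (s, 0) | s <- v] (t, 0).

Lemma chain_dk_fst p u q : chain dk p u q = dchain p.1 [seq p'.1 | p' <- u] (q.1 : R).
Proof.
rewrite /dchain -map_comp; elim: u p => [|p' u IH] p; first by rewrite /chain /= !mul1r.
by rewrite chain_cons IH /= chain_cons.
Qed.

Lemma dchain_ge0 a v t : 0 <= dchain a v t. Proof. exact: chain_dk_ge0. Qed.

Lemma measurable_dchain d (X : measurableType d) k (v : X -> k.-tuple mR) (t : R) a :
  measurable_fun setT v -> measurable_fun setT (fun x => dchain a (v x) t).
Proof.
move=> mv; rewrite /dchain.
have mt : measurable_fun setT (fun x => [tuple of [seq ((s, 0) : R * R) | s <- v x]]).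
  apply/measurable_fun_tnthP => i.
  rewrite (_ : _ \o _ = fun x => (tnth (v x) i, 0)); last by apply/funext => x; rewrite /= tnth_map.
  apply: measurable_fun_pair => //.
  exact: (measurableT_comp (@measurable_tnth _ mR k i) mv).
exact: (measurable_chain (@measurable_dk R) mt (measurable_cst _) (measurable_cst _)).
Qed.

Lemma dchain_integral (s0 T a t : R) k :
  (\int[tmeas (lebr s0 T) k]_v (dchain a v t)%:E < +oo)%E.
Proof.
pose nu : {finite_measure set mR -> \bar R} := (\d_(0 : mR))%R.
have i1 : (\int[nu]_x ((cst 1 : R -> R) x)%:E <= 1%:E)%E.
  have -> : (\int[nu]_x ((cst 1 : R -> R) x)%:E = \int[nu]_x (cst 1%:E) x)%E by apply: eq_integral.
  by rewrite integral_cst// mul1e /nu /= diracT.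
have mf (n : nat) : measurable_fun setT (fun z : n.-tuple mR * n.-tuple mR => (dchain a z.1 t)%:E).
  by apply/measurable_EFinP; apply: measurable_dchain; exact: measurable_fst.
have f0 (n : nat) (z : n.-tuple mR * n.-tuple mR) : (0 <= (dchain a z.1 t)%:E)%E.
  by rewrite lee_fin dchain_ge0.
have h := @dirichlet_bound R s0 a T 1 ltr01 nu (cst 1) 0 (measurable_cst _) (fun=> ler01) 1 i1 k (t, 0).
have mass n : (\int[tmeas nu n]_v (cst 1%:E : n.-tuple mR -> \bar R) v = 1%:E)%E.
  elim: n => [|n IH]; first by rewrite ge0_integral_tmeas0.
  rewrite ge0_integral_tmeasS//; transitivity (\int[nu]_w (cst 1%:E : mR -> \bar R) w)%E.
    by apply: eq_integral => w _.
  by rewrite integral_cst// mul1e /nu /= diracT.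
have e1 := @ge0_integral_tunzip R _ _ mR mR (lebr s0 T) nu k _ (mf k) (f0 k).
have e2 := @fubini_tonelli1 _ _ _ _ R (tmeas (lebr s0 T) k) (tmeas nu k) _ (mf k) (f0 k).
have -> : (\int[tmeas (lebr s0 T) k]_v (dchain a v t)%:E =
    \int[(tmeas (lebr s0 T) k \x tmeas nu k)%E]_z (dchain a z.1 t)%:E)%E.
  rewrite e2; apply: eq_integral => v _; rewrite /fubini_F /=.
  have c0 : (0 <= (dchain a v t)%:E)%E by rewrite lee_fin dchain_ge0.
  have m1 : measurable_fun setT (cst 1%:E : k.-tuple mR -> \bar R) by exact: measurable_cst.
  have E := @ge0_integralZl _ _ R (tmeas nu k) _ measurableT _ m1 _ (fun _ _ => lee01) c0.
  transitivity ((dchain a v t)%:E * \int[tmeas nu k]_w (cst 1%:E : k.-tuple mR -> \bar R) w)%E.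
    by rewrite (mass k) mule1.
  by apply: etrans (esym E) _; apply: eq_integral => w _; rewrite mule1.
rewrite e1; apply: le_lt_trans (le_lt_trans h (ltry _)).
rewrite le_eqVlt; apply/orP; left; apply/eqP; apply: eq_integral => u _.
by rewrite chain_dk_fst /= big1 ?mulr1.
Qed.

Lemma dchain_cintg (s0 T a t B : R) k (F : k.-tuple R -> R[i]) : 0 <= B -> @cmeas R _ (k.-tuple mR) F ->
  (forall v, normc (F v) <= B * dchain a v t) -> cintg (tmeas (lebr s0 T) k) setT F.
Proof.
move=> B0 mF FB.
have md : measurable_fun setT (fun v : k.-tuple mR => dchain a v t) by exact: measurable_dchain.
apply: (@cintg_dom R _ (k.-tuple mR) (tmeas (lebr s0 T) k) _ (fun v => B * dchain a v t)) => //.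
  by apply: measurable_funM.
have mE : measurable_fun setT (fun v : k.-tuple mR => (dchain a v t)%:E) by exact/measurable_EFinP.
have B0' : (0 <= B%:E)%E by rewrite lee_fin.
under eq_integral do rewrite EFinM.
rewrite (@ge0_integralZl _ _ _ (tmeas (lebr s0 T) k) _ measurableT _ mE _ _ B0'); last first.
  by move=> v _; rewrite lee_fin dchain_ge0.
have i0 := dchain_integral s0 T a t k.
rewrite -[X in (_ * X)%E]fineK; first by rewrite -EFinM ltry.
by rewrite ge0_fin_numE// integral_ge0// => v _; rewrite lee_fin dchain_ge0.
Qed.

Lemma simplex_lebr (s0 T t : R) k (a B : R) (F : k.-tuple R -> R[i]) : t <= T -> s0 <= a -> 0 <= B ->
  @cmeas R _ (k.-tuple mR) F -> (forall v, normc (F v) <= B * dchain a v t) ->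
  simplex_integral a t F = cint (tmeas (lebr s0 T) k) setT F.
Proof.
move=> tT; elim: k a B F => [|k IH] a B F sa B0 mF FB; first by rewrite cint_tmeas0.
have mFs (s : R) : @cmeas R _ (k.-tuple mR) (fun us => F (tcons (s, us))).
  apply: (cmeas_comp (@cmeas_tcons R _ mR k F mF) (g := fun us => (s, us))).
  exact: measurable_fun_pair.
have FBs s (us : k.-tuple R) : normc (F (tcons (s, us))) <= B * dk (a, 0) (s, 0) * dchain s us t.
  by have := FB (tcons (s, us)); rewrite /dchain /= chain_cons mulrA.
have iF := dchain_cintg s0 T B0 mF FB.
rewrite (cint_tmeasS iF).
pose f (s : R) := cint (tmeas (lebr s0 T) k) setT (fun us => F (tcons (s, us))).
have mf : @cmeas R _ mR f.
  apply: (@cmeas_param2 R _ _ mR (k.-tuple mR) (tmeas (lebr s0 T) k) (fun sus => F (tcons sus))).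
  exact: (@cmeas_tcons R _ mR k F mF).
transitivity (lintegral `]a, t[ f).
  apply: eq_cint => s; rewrite /= in_itv/= => /andP[as_ _].
  by apply: (IH s _ (fun us => F (tcons (s, us))) _ _ (mFs s) (FBs s)); [rewrite (le_trans sa)// ltW|rewrite mulr_ge0// dk_ge0].
have f0 s : ~~ ((a < s) && (s < t)) -> f s = 0.
  move=> ns; rewrite /f -[RHS](cint0 (tmeas (lebr s0 T) k) measurableT); apply: eq_cint => us _.
  apply: Normc.eq0_normc; apply/eqP; rewrite eq_le normc_ge0 andbT (le_trans (FBs s us))//.
  move: ns; rewrite negb_and -!leNgt => /orP[sa'|ts].
    by rewrite (@dk_forward R (a, 0) (s, 0))//= mulr0 mul0r.
  by rewrite /dchain chain_forward ?mulr0//; exact: dk_forward.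
rewrite -(lintegral_lebr s0 T mf) /lintegral [LHS]cint_mkcond [RHS]cint_mkcond.
apply: eq_cint => s _; rewrite !mem_setE !in_itv/=.
have [/andP[as_ st]|ns] := boolP ((a < s) && (s < t)); last by rewrite f0// if_same.
by rewrite (le_trans sa (ltW as_)) (le_trans (ltW st) tT).
Qed.

Lemma tuple_zip_unzip d1 d2 (T1 : measurableType d1) (T2 : measurableType d2) n (u : n.-tuple (T1 * T2)) : zip (tunzip u).1 (tunzip u).2 = u.
Proof. exact: zip_unzip. Qed.

Lemma measurable_zip d1 d2 d (T1 : measurableType d1) (T2 : measurableType d2) (X : measurableType d) n
  (f : X -> n.-tuple T1) (g : X -> n.-tuple T2) : measurable_fun setT f -> measurable_fun setT g ->
  measurable_fun setT (fun x => [tuple of zip (f x) (g x)]).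
Proof.
move=> mf mg; apply/measurable_fun_tnthP => i.
rewrite (_ : _ \o _ = fun x => (tnth (f x) i, tnth (g x) i)); last first.
  apply/funext => x /=; by rewrite (tnth_nth (tnth (f x) i, tnth (g x) i)) /= nth_zip ?size_tuple// -!tnth_nth.
apply: measurable_fun_pair; first exact: (measurableT_comp (@measurable_tnth _ T1 n i) mf).
exact: (measurableT_comp (@measurable_tnth _ T2 n i) mg).
Qed.

End IteratedIntegrals.

(** * The T-transform along a path *)

Section TransformOfPath.
Context {R : realType}.
Local Notation pt := (R * R)%type.
Variables (Th1 Th2 h : R -> R[i]) (t0 y t : R).
Hypotheses (dTh1 : forall s, is_cd Th1 s (h s)) (dTh2 : forall s, is_cd Th2 s (h s ^+ 2))
  (ch : forall s, ccont h s).

Let ind (w : pt) (s : R) : R[i] := (\1_(`]w.1, t]%classic) s)%:C%C.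

Let indE w s : ind w s = if (w.1 < s) && (s <= t) then 1 else 0.
Proof. by rewrite /ind indicE mem_setE in_itv/=; case: ifP. Qed.

Let ind_cmeas w : @cmeas R _ (measurableTypeR R) (ind w).
Proof.
rewrite (_ : ind w = fun s => if (w.1 < s) && (s <= t) then 1 else 0); last by apply/funext => s; exact: indE.
apply: cmeas_if; [|exact: cmeas_cst|exact: cmeas_cst].
by apply: measurable_and; [exact: measurable_fun_ltr|exact: measurable_fun_ler].
Qed.

Lemma cintg_indicator (f : R -> R[i]) w a b : (forall s, ccont f s) ->
  cintg (@lebesgue_measure R) `[a, b] (fun s => f s * ind w s).
Proof.
move=> cf; apply: cbnd_cintg; first exact: (cmeasM (ccont_measurable cf) (ind_cmeas w)).
apply: cbndM; first exact: (itv_cbnd (fun s _ => cf s)).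
by exists 1 => s _; rewrite indE; case: ifP => _; rewrite ?Normc.normc1 ?Normc.normc0.
Qed.

Lemma lintegral_indicator (f F : R -> R[i]) (w : pt) a b : a <= b -> b <= t ->
  (forall s, is_cd F s (f s)) -> (forall s, ccont f s) ->
  lintegral `[a, b] (fun s => f s * ind w s) = F b - F (Num.min b (Num.max a w.1)).
Proof.
move=> ab bt dF cf; have [bw|wb] := leP b w.1.
  rewrite (_ : Num.min b (Num.max a w.1) = b); last by apply/min_idPl; rewrite le_max bw orbT.
  rewrite subrr -[RHS](cint0 (@lebesgue_measure R) (@measurable_itv R `[a, b])); apply: eq_cint => s.
  by rewrite /= in_itv/= => /andP[_ sb]; rewrite indE ltNge (le_trans sb bw) mulr0.
set c := Num.max a w.1; have cb : c <= b by rewrite ge_max ab ltW.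
rewrite (_ : Num.min b c = c); last exact/min_idPr.
rewrite -(lintegral_FTC cb dF cf) /lintegral [LHS]cint_mkcond [RHS]cint_mkcond.
have mI (p q : R) : @measurable_fun _ _ (measurableTypeR R) _ setT (fun s : R => s \in `[p, q]%classic).
  rewrite (_ : (fun s => _) = fun s => (p <= s) && (s <= q)); last by apply/funext => s; rewrite mem_setE in_itv.
  by apply: measurable_and; exact: measurable_fun_ler.
apply: ae_eq_cint.
- apply: cmeas_if; [exact: mI|exact: (cmeasM (ccont_measurable cf) (ind_cmeas w))|exact: cmeas_cst].
- by apply: cmeas_if; [exact: mI|exact: ccont_measurable|exact: cmeas_cst].
exists [set w.1]; split; [exact: measurable_set1|exact: lebesgue_measure_set1|].
move=> s /=; apply: contra_notP => /eqP sw; rewrite !mem_setE !in_itv/= indE /c ge_max.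
have [as_|_] := leP a s; last by [].
have [sb|_] := leP s b; last by rewrite !andbF.
by rewrite (le_trans sb bt) !andbT lt_neqAle eq_sym sw /=; case: ifP => _; rewrite ?mulr1 ?mulr0.
Qed.

Lemma ov_minmax (s a b : R) : a <= b -> b - Num.min b (Num.max a s) = ov s a b.
Proof.
move=> ab; rewrite /ov /Num.min /Num.max.
by case: (ltP a s) => h1; case: (ltP (b - s) 0) => h2; case: (ltP (a - s) 0) => h3;
   case: ifPn; rewrite -?leNgt => h4; lra.
Qed.

Definition eta v (s : R) : R[i] := h s + iC * (\sum_(w <- v) w.2 * \1_(`]w.1, t]%classic) s)%:C%C.

Lemma etaE v s : eta v s = h s * 1 + \sum_(w <- v) (iC * w.2%:C%C) * (1 * ind w s).
Proof.
rewrite mulr1 /eta rmorph_sum mulr_sumr; congr (_ + _); apply: eq_bigr => w _.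
by rewrite rmorphM mul1r mulrA.
Qed.

Let cone : forall s : R, ccont (cst 1 : R -> R[i]) s. Proof. by move=> s; exact: ccont_cst. Qed.

Let cintg_cont (f : R -> R[i]) a b : (forall s, ccont f s) -> cintg (@lebesgue_measure R) `[a, b] f.
Proof.
move=> cf; apply: cbnd_cintg; first exact: ccont_measurable.
exact: (itv_cbnd (fun s _ => cf s)).
Qed.

Let mitv (a b : R) : measurable (`[a, b]%classic : set (measurableTypeR R)). Proof. exact: measurable_itv. Qed.

Let lint1 (w : pt) a b : a <= b -> b <= t -> lintegral `[a, b] (fun s => 1 * ind w s) = (ov w.1 a b)%:C%C.
Proof.
move=> ab bt; rewrite (@lintegral_indicator (cst 1) (fun s => s%:C%C) w a b ab bt)//; last exact: is_cd_id.
by rewrite -ov_minmax// rmorphB.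
Qed.

Lemma lintegral_eta v a b : a <= b -> b <= t ->
  lintegral `[a, b] (eta v) = Th1 b - Th1 a + iC * (\sum_(w <- v) w.2 * ov w.1 a b)%:C%C.
Proof.
move=> ab bt.
have i1 : cintg (@lebesgue_measure R) `[a, b] (fun s => h s * 1).
  by apply: cintg_cont => s; apply: ccontM => //; exact: ccont_cst.
have i2 (w : pt) : cintg (@lebesgue_measure R) `[a, b] (fun s => (iC * w.2%:C%C) * (1 * ind w s)).
  by apply: cintgZ => //; exact: cintg_indicator.
transitivity (cint (@lebesgue_measure R) `[a, b] (fun s => h s * 1 + \sum_(w <- v) (iC * w.2%:C%C) * (1 * ind w s))).
  by apply: eq_cint => s _; exact: etaE.
rewrite (cintD (mitv a b) i1 (cintg_sum (mitv a b) v i2)) (cint_sum (mitv a b) v i2); congr (_ + _).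
  rewrite -(lintegral_FTC ab dTh1 ch); apply: eq_cint => s _; exact: mulr1.
rewrite rmorph_sum mulr_sumr; apply: eq_bigr => w _.
rewrite (cintZ (mitv a b) _ (cintg_indicator w a b cone)) rmorphM mulrA; congr (_ * _).
exact: lint1.
Qed.

Let ind_mul (w w' : pt) s : ind w s * ind w' s = ind (Num.max w.1 w'.1, 0) s.
Proof.
rewrite !indE /= gt_max; case: (w.1 < s) => /=; rewrite ?mul0r//.
by case: (w'.1 < s) => /=; rewrite ?mulr0//; case: ifP => _; rewrite ?mulr1 ?mulr0.
Qed.

Lemma eta_sqrE v s : eta v s ^+ 2 = h s ^+ 2 * 1 + \sum_(w <- v) (2%:R * iC * w.2%:C%C) * (h s * ind w s) +
  \sum_(w <- v) \sum_(w' <- v) (- (w.2 * w'.2)%:C%C) * (1 * ind (Num.max w.1 w'.1, 0) s).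
Proof.
rewrite etaE; set S := \sum_(w <- v) (iC * w.2%:C%C) * (1 * ind w s).
rewrite !mulr1 sqrrD; congr (_ + _ + _).
  rewrite -mulr_natl mulrA mulr_sumr; apply: eq_bigr => w _; rewrite mul1r; ring.
rewrite expr2 mulr_suml; apply: eq_bigr => w _; rewrite mulr_sumr; apply: eq_bigr => w' _.
have -> : (w.2 * w'.2)%:C%C = w.2%:C%C * w'.2%:C%C :> R[i] by rewrite rmorphM.
rewrite -ind_mul !mul1r; move: (ind w s) (ind w' s) (w.2%:C%C) (w'.2%:C%C) => a1 a2 a3 a4.
transitivity (iC * iC * (a3 * a4 * (a1 * a2))); first by ring.
by rewrite iC2 mulN1r mulNr.
Qed.

Lemma lintegral_eta_sqr v : t0 <= t -> all (fun w => t0 <= w.1 <= t) v ->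
  lintegral `[t0, t] (fun s => eta v s ^+ 2) = Th2 t - Th2 t0 +
   \sum_(w <- v) (2%:R * iC * w.2%:C%C) * (Th1 t - Th1 w.1) +
   \sum_(w <- v) \sum_(w' <- v) (- (w.2 * w'.2)%:C%C) * (t - Num.max w.1 w'.1)%:C%C.
Proof.
move=> t0t vt.
have i1 : cintg (@lebesgue_measure R) `[t0, t] (fun s => h s ^+ 2 * 1).
  by apply: cintg_cont => s; apply: ccontM; [exact: ccontX|exact: ccont_cst].
have i2 (w : pt) : cintg (@lebesgue_measure R) `[t0, t] (fun s => (2%:R * iC * w.2%:C%C) * (h s * ind w s)).
  by apply: cintgZ => //; exact: cintg_indicator.
have i3 (w w' : pt) : cintg (@lebesgue_measure R) `[t0, t]
    (fun s => (- (w.2 * w'.2)%:C%C) * (1 * ind (Num.max w.1 w'.1, 0) s)).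
  by apply: cintgZ => //; exact: cintg_indicator.
have mt := mitv t0 t.
have i3' (w : pt) := cintg_sum mt v (i3 w).
have i4 := cintg_sum mt v i2.
have i5 := cintg_sum mt v i3'.
rewrite (_ : (fun s => eta v s ^+ 2) = fun s => h s ^+ 2 * 1 + \sum_(w <- v) (2%:R * iC * w.2%:C%C) * (h s * ind w s) +
  \sum_(w <- v) \sum_(w' <- v) (- (w.2 * w'.2)%:C%C) * (1 * ind (Num.max w.1 w'.1, 0) s)); last first.
  by apply/funext => s; exact: eta_sqrE.
rewrite [LHS](cintD mt (cintgD mt i1 i4) i5) (cintD mt i1 i4) (cint_sum mt v i2) (cint_sum mt v i3').
congr (_ + _ + _).
- rewrite -(lintegral_FTC t0t dTh2); first by apply: eq_cint => s _; exact: mulr1.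
  by move=> s; exact: ccontX.
- apply: eq_big_seq => w /(allP vt)/andP[w1 w2].
  rewrite (cintZ mt _ (cintg_indicator w t0 t ch)); congr (_ * _).
  rewrite [LHS](@lintegral_indicator h Th1 w t0 t t0t (lexx _) dTh1 ch).
  by rewrite (max_idPr w1) (min_idPr w2).
- apply: eq_big_seq => w /(allP vt)/andP[w1 w2].
  rewrite (cint_sum mt v (i3 w)); apply: eq_big_seq => w' /(allP vt)/andP[w1' w2'].
  rewrite (cintZ mt _ (cintg_indicator _ t0 t cone)); congr (_ * _).
  rewrite [LHS](lint1 _ t0t (lexx _)) -ov_minmax//=.
  rewrite (max_idPr _); last by rewrite le_max w1.
  by rewrite (min_idPr _)// ge_max w2.
Qed.

Hypothesis h2 : cintg (@lebesgue_measure R) setT (fun s => h s ^+ 2).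

Lemma lintegral_eta_sqrT v : t0 <= t -> all (fun w => t0 <= w.1 <= t) v ->
  lintegral setT (fun s => eta v s ^+ 2) =
  lintegral (~` `[t0, t]) (fun s => h s ^+ 2) + lintegral `[t0, t] (fun s => eta v s ^+ 2).
Proof.
move=> t0t vt; have mt := mitv t0 t; have mc := measurableC mt.
have i1 : cintg (@lebesgue_measure R) (~` `[t0, t]) (fun s => h s ^+ 2).
  by case: h2 => a b; split; [apply: (integrableS measurableT mc _ a)|apply: (integrableS measurableT mc _ b)].
have i2 : cintg (@lebesgue_measure R) `[t0, t] (fun s => eta v s ^+ 2).
  rewrite (_ : (fun s => eta v s ^+ 2) = fun s => h s ^+ 2 * 1 + \sum_(w <- v) (2%:R * iC * w.2%:C%C) * (h s * ind w s) +
    \sum_(w <- v) \sum_(w' <- v) (- (w.2 * w'.2)%:C%C) * (1 * ind (Num.max w.1 w'.1, 0) s)); last first.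
    by apply/funext => s; exact: eta_sqrE.
  apply: cintgD => //; first apply: cintgD => //.
  - by apply: cintg_cont => s; apply: ccontM; [exact: ccontX|exact: ccont_cst].
  - by apply: cintg_sum => // w; apply: cintgZ => //; exact: cintg_indicator.
  - apply: (cintg_sum mt) => w; apply: (cintg_sum mt) => w'; apply: (cintgZ mt).
    exact: (cintg_indicator _ t0 t cone).
have e1 : lintegral (~` `[t0, t]) (fun s => h s ^+ 2) = _ := cint_mkcond _ _ _.
have e2 : lintegral `[t0, t] (fun s => eta v s ^+ 2) = _ := cint_mkcond _ _ _.
rewrite e1 e2.
have j1 := (cintg_mkcond _ _ mc).1 i1; have j2 := (cintg_mkcond _ _ mt).1 i2.
rewrite -(cintD measurableT j1 j2); apply: eq_cint => s _.
rewrite in_setC !mem_setE in_itv/=; have [_|/negbTE ns] := boolP ((t0 <= s) && (s <= t)); first by rewrite add0r.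
rewrite addr0; congr (_ ^+ 2); rewrite /eta big1_seq ?rmorph0 ?mulr0 ?addr0// => w /andP[_ /(allP vt)/andP[w1 w2]].
rewrite indicE mem_setE in_itv/=; have [/andP[ws st]|] := boolP ((w.1 < s) && (s <= t)); last by rewrite mulr0.
by move: ns; rewrite st (le_trans w1 (ltW ws)).
Qed.

Lemma inc_pre (g g' : pt -> pt -> R[i]) p u q : inc p u q ->
  (forall a b, p.1 <= a.1 -> a.1 < b.1 -> b.1 <= q.1 -> g a b = g' a b) -> chain g p u q = chain g' p u q.
Proof.
elim: u p => [|p' u IH] p /=.
  by move=> pq gg'; rewrite /chain /= !mul1r gg'.
move=> /andP[pp' i] gg'; have p'q := inc_lt i; rewrite !chain_cons gg' ?(ltW p'q)//; congr (_ * _).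
by apply: IH => // a b pa; apply: gg'; rewrite (le_trans (ltW pp') pa).
Qed.

Lemma prod_chain (g : pt -> pt -> R[i]) p u q :
  \prod_(1 <= j < (size u).+2) g (nth (0, 0) (p :: rcons u q) j.-1) (nth (0, 0) (p :: rcons u q) j) =
  chain g p u q.
Proof.
elim: u p => [|p' u IH] p; first by rewrite big_nat1 /chain /= mul1r.
rewrite big_ltn// big_add1 /= chain_cons -IH big_add1 /=.
by rewrite [in RHS]big_add1.
Qed.

Lemma gaussian_factor (D : R) (A : R[i]) : 0 < D ->
  (sqrtc (iC * (2 * pi * D)%:C%C))^-1 * cexp (iC / (2 * D)%:C%C * A ^+ 2) = gk D A.
Proof.
move=> D0; have p0 : 0 < (pi : R) := pi_gt0 R.
have e1 (c : R) : 0 < c -> sqrtc (iC * c%:C%C) = (Num.sqrt (c / 2))%:C%C * Complex 1 1 :> R[i].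
  move=> c0; have -> : iC * c%:C%C = Complex 0 c :> R[i] by apply: complex_ext; rewrite ReImE/=; ring.
  rewrite /sqrtc (gt_eqF c0) (gtr0_sg c0) mul1r expr0n/= add0r sqrtr_sqr ger0_norm; last exact: ltW.
  by rewrite addr0 subr0; apply: complex_ext; rewrite ReImE/=; ring.
have ed : sqrtc (iC * (2 * pi * D)%:C%C) = sqrtc (iC * (2 * pi)%:C%C) * (Num.sqrt D)%:C%C :> R[i].
  rewrite !e1 ?mulr_gt0// (_ : 2 * pi * D / 2 = (2 * pi / 2) * D); last by ring.
  rewrite sqrtrM; last by rewrite divr_ge0// mulr_ge0// ltW.
  by rewrite rmorphM mulrAC.
rewrite ed invfM /gk cexpD cexp_real [RHS]mulrA.
have := @dkE R (0, 0) (D, 0); rewrite /dk /= subr0 => /(_ D0) ->.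
rewrite fmorphV; congr (_ * _ * cexp _); congr (_ * _); rewrite rmorphM invfM mulrA fmorphV; congr (_ * _ * _).
by rewrite rmorph_nat.
Qed.

Lemma TPhi_path (x : R) k m (taus : k.-tuple R) (ss : m.-tuple R) (xs : k.-tuple R) (alphas : m.-tuple R) :
  t0 < t -> inc (t0, y) (zip taus xs) (t, x) -> all (fun s => t0 <= s <= t) ss ->
  cexp (iC / 2%:R * lintegral (~` `[t0, t]) (fun s => h s ^+ 2) + iC * y%:C%C * h t0 - iC * x%:C%C * h t) *
  TPhi y t0 x t h taus ss xs alphas = path Th1 Th2 h t0 y (zip taus xs) (zip ss alphas) (t, x).
Proof.
move=> t0t tinc sst; set v := zip ss alphas.
have vt : all (fun w : pt => t0 <= w.1 <= t) v.
  apply/allP => w /(map_f fst); rewrite -/unzip1 unzip1_zip ?size_tuple// => /(allP sst); exact.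
have bt (F : pt -> R) : \sum_(l < m) F (tnth ss l, tnth alphas l) = \sum_(w <- v) F w.
  rewrite (big_nth (0, 0)) size_zip !size_tuple minnn big_mkord; apply: eq_bigr => l _.
  by rewrite nth_zip ?size_tuple// -!tnth_nth.
have ee : shifted t h alphas ss = eta v.
  apply/funext => s; rewrite /shifted /eta; congr (_ + _ * (_)%:C%C).
  by rewrite -(bt (fun w => w.2 * \1_(`]w.1, t]%classic) s)).
have e1 : \sum_(l < m) tnth alphas l = \sum_(w <- v) w.2 by rewrite -(bt snd).
rewrite /TPhi; cbv zeta; rewrite ee e1 (lintegral_eta_sqrT (ltW t0t) vt) (lintegral_eta_sqr (ltW t0t) vt) /path.
rewrite [LHS]mulrA [X in X * _ = _]mulrA -!cexpD; congr (cexp _ * _).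
  rewrite /phase /=; set L := lintegral _ _.
  have s1 : \sum_(w <- v) 2%:R * iC * w.2%:C%C * (Th1 t - Th1 w.1) = 2%:R * iC * \sum_(w <- v) w.2%:C%C * (Th1 t - Th1 w.1).
    by rewrite mulr_sumr; apply: eq_bigr => w _; rewrite !mulrA.
  have s2 : \sum_(w <- v) \sum_(w' <- v) - (w.2 * w'.2)%:C%C * (t - Num.max w.1 w'.1)%:C%C =
     - (\sum_(w <- v) \sum_(w' <- v) w.2 * w'.2 * (t - Num.max w.1 w'.1))%:C%C :> R[i].
    rewrite rmorph_sum -sumrN; apply: eq_bigr => w _; rewrite rmorph_sum -sumrN; apply: eq_bigr => w' _.
    by rewrite mulNr -rmorphM.
  rewrite s1 s2; move: (\sum_(w <- v) _ * (Th1 t - _)) ((\sum_(w <- v) \sum_(w' <- v) _)%:C%C) ((x * _)%:C%C) => S1 S2 S3.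
  have i2 : iC / 2%:R * (2%:R * iC * S1) = - S1.
    have n2 : (2%:R : R[i]) != 0 by rewrite pnatr_eq0.
    transitivity (iC * iC * (2%:R^-1 * 2%:R) * S1); first by ring.
    by rewrite iC2 mulVf// mulr1 mulN1r.
  rewrite mulNr !mulrDr i2; ring.
rewrite -(prod_chain (seg Th1 v)) size_zip !size_tuple minnn.
pose g (p q : pt) : R[i] := (sqrtc (iC * (2 * pi * (q.1 - p.1))%:C%C))^-1 *
  cexp (iC / (2 * (q.1 - p.1))%:C%C * (lintegral `[p.1, q.1] (eta v) + (q.2 - p.2)%:C%C) ^+ 2).
have nt j : nth 0 (t0 :: rcons taus t) j = (nth (0, 0) ((t0, y) :: rcons (zip taus xs) (t, x)) j).1.
  have -> : t0 :: rcons taus t = [seq p.1 | p <- (t0, y) :: rcons (zip taus xs) (t, x)].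
    by rewrite /= map_rcons -/unzip1 unzip1_zip ?size_tuple.
  set s := (_ :: _); have [js|sj] := ltnP j (size s); first by rewrite (nth_map (0, 0)).
  by rewrite !nth_default ?size_map.
have nx j : nth 0 (y :: rcons xs x) j = (nth (0, 0) ((t0, y) :: rcons (zip taus xs) (t, x)) j).2.
  have -> : y :: rcons xs x = [seq p.2 | p <- (t0, y) :: rcons (zip taus xs) (t, x)].
    by rewrite /= map_rcons -/unzip2 unzip2_zip ?size_tuple.
  set s := (_ :: _); have [js|sj] := ltnP j (size s); first by rewrite (nth_map (0, 0)).
  by rewrite !nth_default ?size_map.
transitivity (chain g (t0, y) (zip taus xs) (t, x)).
  rewrite -prod_chain size_zip !size_tuple minnn; apply: eq_bigr => j _.
  by rewrite !nt !nx.
rewrite (inc_pre (g' := seg Th1 v) tinc) -?prod_chain ?size_zip ?size_tuple ?minnn// => a b ta ab bt'.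
by rewrite /g /seg ab gaussian_factor ?subr_gt0// (lintegral_eta v (ltW ab) bt') /segA.
Qed.

End TransformOfPath.

Lemma prod_zip {K : comPzRingType} (S1 S2 : Type) (s : seq S1) (t : seq S2) (f : S1 -> K) (g : S2 -> K) :
  size s = size t -> \prod_(w <- zip s t) (f w.1 * g w.2) = \prod_(a <- s) f a * \prod_(b <- t) g b.
Proof.
elim: s t => [|a s IH] [|b t]//= => [_|[st]]; first by rewrite !big_nil mulr1.
by rewrite !big_cons IH// mulrACA.
Qed.

Section Dictionary.
Context {R : realType}.
Local Notation pt := (R * R)%type.
Local Notation mR := (measurableTypeR R).
Variables (Th1 Th2 h hd : R -> R[i]) (t0 y T M : R).
Hypotheses (dTh1 : forall t, is_cd Th1 t (h t)) (dTh2 : forall t, is_cd Th2 t (h t ^+ 2))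
  (dh : forall t, is_cd h t (hd t)).
Hypothesis M0 : 0 <= M.
Hypothesis pboundL : forall L, M <= L -> exists K C, [/\ 0 <= K, 0 < C & path_bounded Th1 Th2 h t0 y T L K C].
Variables (J1 J2 : (R -> R[i]) -> R[i]).
Variables (nu1 nu2 : {finite_measure set mR -> \bar R}) (rho1 rho2 : R -> R[i]) (r1 r2 : R -> R).
Hypotheses (rep1 : represents J1 nu1 rho1 r1) (rep2 : represents J2 nu2 rho2 r2).
Hypothesis exp1 : forall c : R, 0 < c -> (\int[nu1]_x (expR (c * `|x|) * r1 x)%:E < +oo)%E.
Variable R2 : R.
Hypotheses (int2 : (\int[nu2]_x (r2 x)%:E <= R2%:E)%E) (supp2 : forall x, M < `|x| -> r2 x = 0).
Variables (q : pt).
Hypotheses (t0t : t0 < q.1) (tT : q.1 <= T) (xM : `|q.2| <= M).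

Let mrho1 : @cmeas R _ mR rho1. Proof. by case: rep1. Qed.
Let mrho2 : @cmeas R _ mR rho2. Proof. by case: rep2. Qed.
Let mr1 : @measurable_fun _ _ mR R setT r1. Proof. by case: rep1. Qed.
Let mr2 : @measurable_fun _ _ mR R setT r2. Proof. by case: rep2. Qed.
Let rr1 a : normc (rho1 a) <= r1 a. Proof. by case: rep1. Qed.
Let rr2 a : normc (rho2 a) <= r2 a. Proof. by case: rep2. Qed.
Let r10 a : 0 <= r1 a. Proof. exact: le_trans (normc_ge0 _) (rr1 a). Qed.
Let r20 a : 0 <= r2 a. Proof. exact: le_trans (normc_ge0 _) (rr2 a). Qed.
Let mTh1 : cmeas Th1 := ccont_measurable (fun t => is_cd_ccont (dTh1 t)).
Let mTh2 : cmeas Th2 := ccont_measurable (fun t => is_cd_ccont (dTh2 t)).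
Let mh : cmeas h := ccont_measurable (fun t => is_cd_ccont (dh t)).
Local Notation lam := (lebr t0 T).

Variable z : R[i].

Let chiT (a : R) : R[i] := if inT t0 T a then 1 else 0.
Let chit (a : R) : R[i] := if (t0 <= a) && (a <= q.1) then 1 else 0.

Let P (tau s x al : seq R) : R[i] := (\prod_(a <- tau) chiT a * \prod_(a <- s) chit a) *
  (z * path Th1 Th2 h t0 y (zip tau x) (zip s al) q).

Let mchi (a b : R) : @cmeas R _ mR (fun s : R => if (a <= s) && (s <= b) then 1 else 0).
Proof.
apply: cmeas_if; [|exact: cmeas_cst|exact: cmeas_cst].
by apply: measurable_and; exact: measurable_fun_ler.
Qed.

Let P_cmeas d (X : measurableType d) k m (tau x : X -> k.-tuple mR) (s al : X -> m.-tuple mR) :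
  measurable_fun setT tau -> measurable_fun setT s -> measurable_fun setT x -> measurable_fun setT al ->
  cmeas (fun a => P (tau a) (s a) (x a) (al a)).
Proof.
move=> mt ms mx ma; apply: cmeasM.
  apply: cmeasM.
    exact: (cmeas_comp (@cmeas_prod_tuple R _ mR chiT k (mchi t0 T)) mt).
  exact: (cmeas_comp (@cmeas_prod_tuple R _ mR chit m (mchi t0 q.1)) ms).
apply: cmeasM; first exact: cmeas_cst.
have := @path_cmeas R _ X Th1 Th2 h t0 y mTh1 mTh2 mh k m (fun a => [tuple of zip (tau a) (x a)])
  (fun a => [tuple of zip (s a) (al a)]) (fun=> q).
by apply; [exact: measurable_zip|exact: measurable_zip|exact: measurable_cst].
Qed.

Let chi_all (p : pred R) s : \prod_(a <- s) (if p a then 1 else 0 : R[i]) = if all p s then 1 else 0.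
Proof.
elim: s => [|a s IH] /=; first by rewrite big_nil.
by rewrite big_cons IH; case: (p a); rewrite ?mul1r ?mul0r.
Qed.

Let dch k (tau : k.-tuple R) := dchain t0 tau q.1.

Let dch0 k (tau : k.-tuple R) : 0 <= dch tau. Proof. exact: dchain_ge0. Qed.

Let P_le L K C k m (tau x : k.-tuple R) (s al : m.-tuple R) : M <= L -> 0 <= K ->
  path_bounded Th1 Th2 h t0 y T L K C -> all (fun a => `|a| <= L) x ->
  normc (P tau s x al) <= normc z * K ^+ k.+1 * dch tau * \prod_(a <- al) expR (C * `|a|).
Proof.
move=> ML K0 pb xL; rewrite /P !chi_all.
have p0 : 0 <= normc z * K ^+ k.+1 * dch tau * \prod_(a <- al) expR (C * `|a|).
  have e0 : 0 <= \prod_(a <- al) expR (C * `|a|) by apply: prodr_ge0 => a _; exact: expR_ge0.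
  by rewrite mulr_ge0// mulr_ge0 ?dch0// mulr_ge0 ?normc_ge0 ?exprn_ge0.
case: ifPn => [ta|_]; last by rewrite !mul0r Normc.normc0.
case: ifPn => [sa|_]; last by rewrite mulr0 !mul0r Normc.normc0.
rewrite !mul1r Normc.normcM -!mulrA ler_wpM2l ?normc_ge0//.
have okq : okpt t0 T L q by rewrite /okpt (ltW t0t) tT (le_trans xM ML).
have oku : all (okpt t0 T L) (zip tau x).
  apply/allP => p pz; have /andP[p1 p2] : (p.1 \in unzip1 (zip tau x)) && (p.2 \in unzip2 (zip tau x)) by rewrite !map_f.
  rewrite unzip1_zip ?size_tuple// in p1; rewrite unzip2_zip ?size_tuple// in p2.
  by rewrite /okpt (allP xL _ p2) andbT; exact: (allP ta _ p1).
have okv : all (fun w : pt => t0 <= w.1 <= T) (zip s al).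
  apply/allP => p /(map_f fst); rewrite -/unzip1 unzip1_zip ?size_tuple// => /(allP sa)/andP[-> h2] /=.
  exact: le_trans tT.
have := pb _ _ _ okq oku okv; rewrite size_zip !size_tuple minnn chain_dk_fst -/unzip1 unzip1_zip ?size_tuple//.
have := @prod_zip R _ _ s al (fun=> 1) (fun a => expR (C * `|a|)).
rewrite !size_tuple => /(_ erefl) E; rewrite [X in X * _]big1 ?mul1r// in E.
have E' : \prod_(w <- zip s al) expR (C * `|w.2|) = \prod_(a <- al) expR (C * `|a|).
  by rewrite -E; apply: eq_bigr => w _; rewrite mul1r.
by rewrite E' -!mulrA.
Qed.

Let G1 (C : R) := fine (\int[nu1]_a (expR (C * `|a|) * r1 a)%:E).
Let G1P C : 0 < C -> (\int[nu1]_a (expR (C * `|a|) * r1 a)%:E <= (G1 C)%:E)%E /\ 0 <= G1 C.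
Proof.
move=> C0; have i0 : (0 <= \int[nu1]_a (expR (C * `|a|) * r1 a)%:E)%E.
  by apply: integral_ge0 => a _; rewrite lee_fin mulr_ge0 ?expR_ge0.
by rewrite /G1 fine_ge0// fineK// ge0_fin_numE// exp1.
Qed.

Let mexp (c : R) : @measurable_fun _ _ mR R setT (fun x => expR (c * `|x|)).
Proof.
apply: (@measurableT_comp _ _ _ _ _ _ (@expR R) _ (fun x : R => c * `|x|)) => //.
by apply: measurable_funM => //; exact: (@normr_measurable R).
Qed.

Let F1 k m (tau x : k.-tuple R) (s : m.-tuple R) : R[i] :=
  cint (tmeas nu1 m) setT (fun al => P tau s x al * \prod_(a <- al) rho1 a).

Let P_al k m (tau x : k.-tuple R) (s : m.-tuple R) : @cmeas R _ (m.-tuple mR) (fun al => P tau s x al).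
Proof. by apply: P_cmeas => //; exact: measurable_cst. Qed.

Let Lx k (x : k.-tuple R) := M + \sum_(a <- x) `|a|.
Let LxP k (x : k.-tuple R) : M <= Lx x /\ all (fun a => `|a| <= Lx x) x.
Proof.
split; first by rewrite lerDl sumr_ge0.
apply/allP => a ax; have s0 : 0 <= \sum_(b <- rem a x) `|b| by apply: sumr_ge0.
by rewrite /Lx (big_rem a)//= addrCA lerDl addr_ge0.
Qed.

Let alpha_dom k m (tau x : k.-tuple R) (s : m.-tuple R) : exists2 C, 0 < C &
  locally_dominated (fun a => expR (C * `|a|)) (fun _ _ => true) 0 (fun al : m.-tuple R => P tau s x al).
Proof.
have [ML xL] := LxP x; have [K [C [K0 C0 pb]]] := pboundL ML.
exists C => // L _; exists (normc z * K ^+ k.+1 * dch tau); split.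
  by rewrite mulr_ge0 ?dch0// mulr_ge0 ?normc_ge0 ?exprn_ge0.
by move=> al _; exact: (P_le tau s al ML K0 pb xL).
Qed.

Let dtrue_m : forall (L L' a : R), L <= L' -> (fun _ _ : R => true) L a -> (fun _ _ : R => true) L' a. Proof. by []. Qed.
Let dtrue_e : forall a : R, exists L : R, (fun _ _ : R => true) L a. Proof. by move=> a; exists 0. Qed.
Let dtrue_r (r : R -> R) : forall a : R, ~~ (fun _ _ : R => true) (0 : R) a -> r a = 0. Proof. by []. Qed.

Let step_alpha k m (tau x : k.-tuple R) (s : m.-tuple R) :
  iter_integral J1 (fun al : m.-tuple R => P tau s x al) = F1 tau x s.
Proof.
have [C C0 hd1] := alpha_dom tau x s; have [g1 g2] := G1P C0.
by rewrite (iter_represents rep1 (mexp C) (fun=> expR_ge0 _) g1 dtrue_m dtrue_e (dtrue_r r1) (P_al tau x s) hd1).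
Qed.

Let F1_cintg k m (tau x : k.-tuple R) (s : m.-tuple R) :
  cintg (tmeas nu1 m) setT (fun al => P tau s x al * \prod_(a <- al) rho1 a).
Proof.
have [C C0 hd1] := alpha_dom tau x s; have [g1 g2] := G1P C0.
exact: (locally_dominated_cintg rep1 (mexp C) (fun=> expR_ge0 _) g1 (dtrue_r r1) (P_al tau x s) hd1).
Qed.

Let F1_cmeas d (X : measurableType d) k m (tau x : X -> k.-tuple mR) (s : X -> m.-tuple mR) :
  measurable_fun setT tau -> measurable_fun setT s -> measurable_fun setT x -> cmeas (fun a => F1 (tau a) (x a) (s a)).
Proof.
move=> mt ms mx; rewrite /F1.
apply: (@cmeas_param2 R _ _ X (m.-tuple mR) (tmeas nu1 m) (fun p => P (tau p.1) (s p.1) (x p.1) p.2 * \prod_(a <- p.2) rho1 a)).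
apply: cmeasM.
  apply: P_cmeas; last exact: measurable_snd.
  - exact: (measurableT_comp mt (@measurable_fst _ _ _ _)).
  - exact: (measurableT_comp ms (@measurable_fst _ _ _ _)).
  - exact: (measurableT_comp mx (@measurable_fst _ _ _ _)).
exact: (cmeas_comp (@cmeas_prod_tuple R _ mR rho1 m mrho1) (@measurable_snd _ _ X (m.-tuple mR))).
Qed.

Let domM (L a : R) := `|a| <= L.
Let domM_m L L' a : L <= L' -> domM L a -> domM L' a. Proof. by move=> LL' h1; exact: le_trans LL'. Qed.
Let domM_e a : exists L, domM L a. Proof. by exists `|a|; rewrite /domM. Qed.
Let domM_r a : ~~ domM M a -> r2 a = 0. Proof. by rewrite /domM -ltNge; exact: supp2. Qed.
Let int2' : (\int[nu2]_a (cst 1 a * r2 a)%:E <= R2%:E)%E.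
Proof.
apply: le_trans int2; rewrite le_eqVlt; apply/orP; left; apply/eqP; apply: eq_integral => a _.
by rewrite /= mul1r.
Qed.

Let F1_le L m k : M <= L -> exists B, 0 <= B /\ forall (tau x : k.-tuple R) (s : m.-tuple R),
  all (domM L) x -> normc (F1 tau x s) <= B * dch tau.
Proof.
move=> ML; have [K [C [K0 C0 pb]]] := pboundL ML; have [g1 g2] := G1P C0.
exists (2 * (normc z * K ^+ k.+1 * G1 C ^+ m)); split; first by rewrite !mulr_ge0 ?normc_ge0 ?exprn_ge0.
move=> tau x s xL.
have B0 : 0 <= normc z * K ^+ k.+1 * dch tau by rewrite mulr_ge0 ?dch0// mulr_ge0 ?normc_ge0 ?exprn_ge0.
have := normc_cint_weight rep1 (mexp C) (fun=> expR_ge0 _) g1 (dtrue_r r1) (P_al tau x s) B0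
  (fun al _ => P_le tau s al ML K0 pb xL).
by rewrite (_ : 2 * (_ * G1 C ^+ m) = 2 * (normc z * K ^+ k.+1 * G1 C ^+ m) * dch tau)//; ring.
Qed.

Let x_dom k m (tau : k.-tuple R) (s : m.-tuple R) :
  locally_dominated (cst 1) domM M (fun x : k.-tuple R => F1 tau x s).
Proof.
move=> L ML; have [B [B0 hB]] := F1_le m k ML; exists (B * dch tau); split.
  by rewrite mulr_ge0 ?dch0.
by move=> x xL; rewrite big1 ?mulr1 ?hB.
Qed.

Let F1_x k m (tau : k.-tuple R) (s : m.-tuple R) : @cmeas R _ (k.-tuple mR) (fun x => F1 tau x s).
Proof. by apply: F1_cmeas => //; exact: measurable_cst. Qed.

Let F2 k m (tau : k.-tuple R) (s : m.-tuple R) : R[i] :=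
  cint (tmeas nu2 k) setT (fun x => F1 tau x s * \prod_(a <- x) rho2 a).

Let c1 : @measurable_fun _ _ mR R setT (cst 1). Proof. exact: measurable_cst. Qed.
Let c10 (a : R) : 0 <= (cst 1 : R -> R) a. Proof. exact: ler01. Qed.

Let step_x k m (tau : k.-tuple R) (s : m.-tuple R) :
  iter_integral J2 (fun x : k.-tuple R => F1 tau x s) = F2 tau s.
Proof. exact: (iter_represents rep2 c1 c10 int2' domM_m domM_e domM_r (F1_x tau s) (x_dom tau s)). Qed.

Let F2_cintg k m (tau : k.-tuple R) (s : m.-tuple R) :
  cintg (tmeas nu2 k) setT (fun x => F1 tau x s * \prod_(a <- x) rho2 a).
Proof. exact: (locally_dominated_cintg rep2 c1 c10 int2' domM_r (F1_x tau s) (x_dom tau s)). Qed.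

Let F2_cmeas d (X : measurableType d) k m (tau : X -> k.-tuple mR) (s : X -> m.-tuple mR) :
  measurable_fun setT tau -> measurable_fun setT s -> cmeas (fun a => F2 (tau a) (s a)).
Proof.
move=> mt ms; rewrite /F2.
apply: (@cmeas_param2 R _ _ X (k.-tuple mR) (tmeas nu2 k) (fun p => F1 (tau p.1) p.2 (s p.1) * \prod_(a <- p.2) rho2 a)).
apply: cmeasM; last exact: (cmeas_comp (@cmeas_prod_tuple R _ mR rho2 k mrho2) (@measurable_snd _ _ X (k.-tuple mR))).
apply: F1_cmeas; last exact: measurable_snd.
- exact: (measurableT_comp mt (@measurable_fst _ _ _ _)).
- exact: (measurableT_comp ms (@measurable_fst _ _ _ _)).
Qed.

Let F2_le m k : exists B, 0 <= B /\ forall (tau : k.-tuple R) (s : m.-tuple R), normc (F2 tau s) <= B * dch tau.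
Proof.
have [B [B0 hB]] := F1_le m k (lexx M).
have R20 : 0 <= R2 by rewrite -lee_fin (le_trans _ int2)// integral_ge0// => a _; rewrite lee_fin.
exists (2 * (B * R2 ^+ k)); split; first by rewrite !mulr_ge0 ?exprn_ge0.
move=> tau s; have B0' : 0 <= B * dch tau by rewrite mulr_ge0 ?dch0.
have := normc_cint_weight rep2 c1 c10 int2' domM_r (F1_x tau s) B0'.
rewrite (_ : 2 * (B * dch tau * R2 ^+ k) = 2 * (B * R2 ^+ k) * dch tau); last by ring.
by apply => x xL; rewrite big1 ?mulr1 ?hB.
Qed.

Let GL := fine (lam setT).
Let GLP : (\int[lam]_a ((cst 1 : R -> R) a * (cst 1 : R -> R) a)%:E <= GL%:E)%E.
Proof.
have -> : (\int[lam]_a ((cst 1 : R -> R) a * (cst 1 : R -> R) a)%:E = \int[lam]_a (cst 1%:E) a)%E.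
  by apply: eq_integral => a _; rewrite /= mulr1.
by rewrite integral_cst// mul1e /GL fineK// fin_num_measure.
Qed.

Let reps := @lintegral_represents R t0 T q.1 (ltW t0t) tT.

Let F3 k m (tau : k.-tuple R) : R[i] :=
  cint (tmeas lam m) setT (fun s => F2 tau s * \prod_(a <- s) chit a).

Let s_dom k m (tau : k.-tuple R) :
  locally_dominated (cst 1) (fun _ _ => true) 0 (fun s : m.-tuple R => F2 tau s).
Proof.
move=> L _; have [B [B0 hB]] := F2_le m k; exists (B * dch tau); split.
  by rewrite mulr_ge0 ?dch0.
by move=> s _; rewrite big1 ?mulr1 ?hB.
Qed.

Let F2_s k m (tau : k.-tuple R) : @cmeas R _ (m.-tuple mR) (fun s => F2 tau s).
Proof. by apply: F2_cmeas => //; exact: measurable_cst. Qed.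

Let step_s k m (tau : k.-tuple R) :
  iter_integral (@lintegral R `[t0, q.1]) (fun s : m.-tuple R => F2 tau s) = F3 m tau.
Proof. exact: (iter_represents reps c1 c10 GLP dtrue_m dtrue_e (dtrue_r (cst 1)) (@F2_s k m tau) (@s_dom k m tau)). Qed.

Let F3_le m k : exists B, 0 <= B /\ forall (tau : k.-tuple R), normc (F3 m tau) <= B * dch tau.
Proof.
have [B [B0 hB]] := F2_le m k.
have GL0 : 0 <= GL by rewrite /GL fine_ge0.
exists (2 * (B * GL ^+ m)); split; first by rewrite !mulr_ge0 ?exprn_ge0.
move=> tau; have B0' : 0 <= B * dch tau by rewrite mulr_ge0 ?dch0.
have := normc_cint_weight reps c1 c10 GLP (dtrue_r (cst 1)) (@F2_s k m tau) B0'.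
rewrite (_ : 2 * (B * dch tau * GL ^+ m) = 2 * (B * GL ^+ m) * dch tau); last by ring.
by apply => s _; rewrite big1 ?mulr1 ?hB.
Qed.

Let F3_cmeas m k : @cmeas R _ (k.-tuple mR) (fun tau => F3 m tau).
Proof.
apply: (@cmeas_param2 R _ _ (k.-tuple mR) (m.-tuple mR) (tmeas lam m) (fun p => F2 p.1 p.2 * \prod_(a <- p.2) chit a)).
apply: cmeasM; last exact: (cmeas_comp (@cmeas_prod_tuple R _ mR chit m (mchi t0 q.1)) (@measurable_snd _ _ (k.-tuple mR) (m.-tuple mR))).
by apply: F2_cmeas; [exact: measurable_fst|exact: measurable_snd].
Qed.

Let step_tau m k : simplex_integral t0 q.1 (fun tau : k.-tuple R => F3 m tau) =
  cint (tmeas lam k) setT (fun tau => F3 m tau).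
Proof.
have [B [B0 hB]] := F3_le m k.
exact: (@simplex_lebr R t0 T q.1 k t0 B _ tT (lexx _) B0 (F3_cmeas m k) hB).
Qed.

Lemma iterated_cint m k :
  simplex_integral t0 q.1 (fun tau : k.-tuple R =>
    iter_integral (@lintegral R `[t0, q.1]) (fun s : m.-tuple R =>
      iter_integral J2 (fun x : k.-tuple R =>
        iter_integral J1 (fun al : m.-tuple R => P tau s x al)))) =
  cint (tmeas lam k) setT (fun tau => F3 m tau).
Proof.
rewrite -step_tau; congr simplex_integral; apply/funext => tau.
rewrite -step_s; congr iter_integral; apply/funext => s.
rewrite -step_x; congr iter_integral; apply/funext => x.
exact: step_alpha.
Qed.

Variables (K C : R).
Hypotheses (K0 : 0 <= K) (C0 : 0 < C) (pb : path_bounded Th1 Th2 h t0 y T M K C).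
Variable e : R.
Hypothesis e0 : 0 < e.
Local Notation cor := (core Th1 Th2 h t0 y T rho1 rho2).

Let okq : okpt t0 T M q. Proof. by rewrite /okpt (ltW t0t) tT. Qed.

Let coreP k m (tau x : k.-tuple R) (s al : m.-tuple R) :
  P tau s x al * \prod_(a <- al) rho1 a * \prod_(a <- x) rho2 a * \prod_(a <- s) chit a =
  z * cor (zip tau x) (zip s al) q.
Proof.
rewrite /core.
have e1 : \prod_(p <- zip tau x) W2 t0 T rho2 p = \prod_(a <- tau) chiT a * \prod_(a <- x) rho2 a.
  rewrite -(prod_zip chiT rho2) ?size_tuple//; apply: eq_bigr => p _.
  by rewrite /W2 /chiT; case: ifP => _; rewrite ?mul1r ?mul0r.
have e2 : \prod_(w <- zip s al) (W1 t0 T rho1 w * (if w.1 <= q.1 then 1 else 0)) =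
    \prod_(a <- s) chit a * \prod_(a <- al) rho1 a.
  rewrite -(prod_zip chit rho1) ?size_tuple//; apply: eq_bigr => w _.
  rewrite /W1 /chit /inT; case: (t0 <= w.1) => /=; last by rewrite !mul0r.
  have [wq|_] := leP w.1 q.1; last by rewrite mulr0 mul0r.
  by rewrite (le_trans wq tT) mulr1 mul1r.
have e3 : \prod_(a <- s) chit a * \prod_(a <- s) chit a = \prod_(a <- s) chit a.
  by rewrite chi_all; case: ifP => _; rewrite ?mulr1 ?mulr0.
rewrite e1 e2 /P; set p := path _ _ _ _ _ _ _ _; move: e3.
move: (\prod_(a <- tau) chiT a) (\prod_(a <- x) rho2 a) (\prod_(a <- s) chit a) (\prod_(a <- al) rho1 a) => a1 a2 a3 a4 e3.
transitivity (a1 * (a3 * a3) * (z * p) * a4 * a2); first by ring.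
rewrite e3; ring.
Qed.

Let n1 k m (tau x : k.-tuple R) (s : m.-tuple R) : R[i] :=
  cint (tmeas nu1 m) setT (fun al => z * cor (zip tau x) (zip s al) q).

Let n1E k m (tau x : k.-tuple R) (s : m.-tuple R) :
  n1 tau x s = F1 tau x s * \prod_(a <- x) rho2 a * \prod_(a <- s) chit a.
Proof.
rewrite -mulrA mulrC /F1 -(cintZ measurableT _ (F1_cintg tau x s)); apply: eq_cint => al _.
by rewrite -coreP [RHS]mulrC mulrA.
Qed.

Let chit_le (s : seq R) : normc (\prod_(a <- s) chit a) <= 1.
Proof. by rewrite chi_all; case: ifP => _; rewrite ?Normc.normc1 ?Normc.normc0. Qed.

Let mass1 (d : measure_display) (X : measurableType d) (mu : {finite_measure set X -> \bar R}) :
  (\int[mu]_x ((cst 1 : X -> R) x)%:E <= (fine (mu setT))%:E)%E.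
Proof.
have -> : (\int[mu]_x ((cst 1 : X -> R) x)%:E = \int[mu]_x (cst 1%:E) x)%E by apply: eq_integral.
by rewrite integral_cst// mul1e fineK// fin_num_measure.
Qed.

Let n1_cintg k m (tau : k.-tuple R) :
  cintg (tmeas lam m \x tmeas nu2 k)%E setT (fun sx => n1 tau sx.2 sx.1).
Proof.
have [B [B0 hB]] := F1_le m k (lexx M).
have B0' : 0 <= B * dch tau by rewrite mulr_ge0 ?dch0.
have mw := measurable_weight rep2 c1 (n := k) (B * dch tau).
have iw := weight_integral_le rep2 c1 c10 int2' k B0'.
have w0 (x : k.-tuple mR) : 0 <= B * dch tau * \prod_(a <- x) (cst 1 a * r2 a).
  by apply: mulr_ge0 => //; apply: prodr_ge0 => a _; rewrite mulr_ge0 ?r20.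
have h3 := @ge0_integral_prod_le R _ _ (m.-tuple mR) (k.-tuple mR) (tmeas lam m) (tmeas nu2 k)
  (cst 1) _ _ _ (measurable_cst _) mw (fun=> ler01) w0 (mass1 _) iw.
apply: (@cintg_dom R _ (m.-tuple mR * k.-tuple mR)%type (tmeas lam m \x tmeas nu2 k)%E _
  (fun sx => cst 1 sx.1 * (B * dch tau * \prod_(a <- sx.2) (cst 1 a * r2 a)))).
- rewrite (_ : (fun sx => _) = fun sx : m.-tuple mR * k.-tuple mR => F1 tau sx.2 sx.1 * \prod_(a <- sx.2) rho2 a * \prod_(a <- sx.1) chit a); last first.
    by apply/funext => sx; exact: n1E.
  apply: cmeasM.
    apply: cmeasM; first by apply: F1_cmeas; [exact: measurable_cst|exact: measurable_fst|exact: measurable_snd].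
    exact: (cmeas_comp (@cmeas_prod_tuple R _ mR rho2 k mrho2) (@measurable_snd _ _ (m.-tuple mR) (k.-tuple mR))).
  exact: (cmeas_comp (@cmeas_prod_tuple R _ mR chit m (mchi t0 q.1)) (@measurable_fst _ _ (m.-tuple mR) (k.-tuple mR))).
- apply: measurable_funM => //; exact: (measurableT_comp mw (@measurable_snd _ _ (m.-tuple mR) (k.-tuple mR))).
- move=> [s x]; rewrite n1E mul1r Normc.normcM -[leRHS]mulr1 ler_pM ?normc_ge0//.
  apply: (normc_weight (F := fun x : k.-tuple R => F1 tau x s) rep2 c10 domM_r B0') => xM'.
  by rewrite [X in _ * X]big1 ?mulr1 ?hB.
- exact: le_lt_trans h3 (ltry _).
Qed.

Let mcore k m d (X : measurableType d) (tau x : X -> k.-tuple mR) (s al : X -> m.-tuple mR) :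
  measurable_fun setT tau -> measurable_fun setT x -> measurable_fun setT s -> measurable_fun setT al ->
  cmeas (fun a => z * cor (zip (tau a) (x a)) (zip (s a) (al a)) q).
Proof.
move=> mt mx ms ma; apply: cmeasM; first exact: cmeas_cst.
have := @core_cmeas R Th1 Th2 h hd t0 y T dTh1 dTh2 dh rho1 rho2 mrho1 mrho2 _ X k m
  (fun a => [tuple of zip (tau a) (x a)]) (fun a => [tuple of zip (s a) (al a)]) (fun=> q).
by apply; [exact: measurable_zip|exact: measurable_zip|exact: measurable_cst].
Qed.

Let n_cintg k m (tau x : k.-tuple R) : cintg (tmeas lam m \x tmeas nu1 m)%E setT
  (fun p => z * cor (zip tau x) (zip p.1 p.2) q).
Proof.
have [g1 g2] := G1P C0.
pose B := normc z * (K ^+ k.+1 * (chain dk (t0, y) (zip tau x) q * \prod_(p <- zip tau x) r2 p.2)).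
have B0 : 0 <= B.
  have p0 : 0 <= \prod_(p <- zip tau x) r2 p.2 by apply: prodr_ge0 => p _; exact: r20.
  by rewrite /B mulr_ge0 ?normc_ge0// mulr_ge0 ?exprn_ge0// mulr_ge0// chain_dk_ge0.
have mw := measurable_weight rep1 (mexp C) (n := m) B.
have iw := weight_integral_le rep1 (mexp C) (fun=> expR_ge0 _) g1 m B0.
have w0 (al : m.-tuple mR) : 0 <= B * \prod_(a <- al) (expR (C * `|a|) * r1 a).
  by apply: mulr_ge0 => //; apply: prodr_ge0 => a _; rewrite mulr_ge0 ?expR_ge0 ?r10.
have h3 := @ge0_integral_prod_le R _ _ (m.-tuple mR) (m.-tuple mR) (tmeas lam m) (tmeas nu1 m)
  (cst 1) _ _ _ (measurable_cst _) mw (fun=> ler01) w0 (mass1 _) iw.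
apply: (@cintg_dom R _ (m.-tuple mR * m.-tuple mR)%type (tmeas lam m \x tmeas nu1 m)%E _
  (fun p => cst 1 p.1 * (B * \prod_(a <- p.2) (expR (C * `|a|) * r1 a)))).
- by apply: mcore; [exact: measurable_cst|exact: measurable_cst|exact: measurable_fst|exact: measurable_snd].
- apply: measurable_funM => //; exact: (measurableT_comp mw (@measurable_snd _ _ (m.-tuple mR) (m.-tuple mR))).
- move=> [s al] /=; rewrite mul1r Normc.normcM /B -mulrA ler_wpM2l ?normc_ge0//.
  have := core_le K0 pb rr1 rr2 supp2 (zip tau x) (zip s al) okq.
  rewrite /majorant size_zip !size_tuple minnn.
  rewrite (_ : \prod_(w <- zip s al) e1 r1 C w = \prod_(a <- al) (expR (C * `|a|) * r1 a)) -?mulrA//.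
  have := @prod_zip R _ _ s al (fun=> 1) (fun a => expR (C * `|a|) * r1 a).
  rewrite !size_tuple => /(_ erefl) E; rewrite [X in X * _]big1 ?mul1r// in E.
  by rewrite -E; apply: eq_bigr => w _; rewrite mul1r.
- exact: le_lt_trans h3 (ltry _).
Qed.

Let mu1' := fprodm lam nu1.

Let n2 k m (tau x : k.-tuple R) : R[i] := cint (tmeas mu1' m) setT (fun v => z * cor (zip tau x) v q).

Let n2E k m (tau x : k.-tuple R) : cint (tmeas lam m) setT (fun s => n1 tau x s) = n2 m tau x.
Proof.
rewrite /n1 (cint_fubini1 (n_cintg m tau x)).
have mf : cmeas (fun p : m.-tuple mR * m.-tuple mR => z * cor (zip tau x) (zip p.1 p.2) q).
  by apply: mcore; [exact: measurable_cst|exact: measurable_cst|exact: measurable_fst|exact: measurable_snd].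
rewrite (cint_transfer (@ge0_integral_tunzip R _ _ mR mR lam nu1 m) mf); apply: eq_cint => v _.
by rewrite tuple_zip_unzip.
Qed.

Let F3E k m (tau : k.-tuple R) : F3 m tau = cint (tmeas nu2 k) setT (fun x => n2 m tau x).
Proof.
transitivity (cint (tmeas lam m) setT (fun s => cint (tmeas nu2 k) setT (fun x => n1 tau x s))).
  apply: eq_cint => s _; rewrite mulrC /F2 -(cintZ measurableT _ (F2_cintg tau s)); apply: eq_cint => x _.
  by rewrite n1E mulrC.
rewrite (cint_swap (n1_cintg m tau)); apply: eq_cint => x _; exact: n2E.
Qed.

Lemma cint_F3 m k : cint (tmeas lam k) setT (fun tau => F3 m tau) =
  z * Amp Th1 Th2 h t0 y T nu1 nu2 rho1 rho2 k m q.
Proof.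
have ic := @core_cintg R Th1 Th2 h hd t0 y T M dTh1 dTh2 dh K C K0 C0 pb nu1 nu2 rho1 rho2 r1 r2
  mrho1 mrho2 mr1 mr2 rr1 rr2 exp1 R2 int2 supp2 e e0 k m q okq.
have icz := cintgZ measurableT z ic.
have mn2 : cmeas (fun p : k.-tuple mR * k.-tuple mR => n2 m p.1 p.2).
  apply: (@cmeas_param2 R _ _ (k.-tuple mR * k.-tuple mR)%type (m.-tuple (mR * mR)) (tmeas mu1' m)
    (fun p => z * cor (zip p.1.1 p.1.2) p.2 q)).
  apply: cmeasM; first exact: cmeas_cst.
  have := @core_cmeas R Th1 Th2 h hd t0 y T dTh1 dTh2 dh rho1 rho2 mrho1 mrho2 _
    ((k.-tuple mR * k.-tuple mR) * m.-tuple (mR * mR))%type k m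
    (fun a => [tuple of zip a.1.1 a.1.2]) (fun a => a.2) (fun=> q).
  apply; [|exact: measurable_snd|exact: measurable_cst].
  apply: measurable_zip.
    exact: (measurableT_comp (@measurable_fst _ _ (k.-tuple mR) (k.-tuple mR)) (@measurable_fst _ _ _ _)).
  exact: (measurableT_comp (@measurable_snd _ _ (k.-tuple mR) (k.-tuple mR)) (@measurable_fst _ _ _ _)).
have tr := @ge0_integral_tunzip R _ _ mR mR lam nu2 k.
have eqn : (fun u => n2 m (tunzip u).1 (tunzip u).2) =
    (fun u : k.-tuple (mR * mR) => cint (tmeas mu1' m) setT (fun v => z * cor u v q)).
  by apply/funext => u; rewrite /n2 tuple_zip_unzip.
have in2 : cintg (tmeas lam k \x tmeas nu2 k)%E setT (fun p : k.-tuple mR * k.-tuple mR => n2 m p.1 p.2).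
  apply/(cintg_transfer (@measurable_tunzip _ _ mR mR k) tr mn2); rewrite eqn.
  exact: (cintg_fubini1 icz).
transitivity (cint (tmeas lam k) setT (fun tau => cint (tmeas nu2 k) setT (fun x => n2 m tau x))).
  by apply: eq_cint => tau _; exact: F3E.
rewrite (cint_fubini1 in2) (cint_transfer tr mn2) eqn (cint_fubini1 icz).
exact: cintZ.
Qed.

Theorem iterated_Amp m k (F : k.-tuple R -> m.-tuple R -> k.-tuple R -> m.-tuple R -> R[i]) :
  (forall (tau : k.-tuple R) (s : m.-tuple R) (x : k.-tuple R) (al : m.-tuple R), inc (t0, y) (zip tau x) q -> all (fun a => t0 <= a <= q.1) s ->
     F tau s x al = z * path Th1 Th2 h t0 y (zip tau x) (zip s al) q) ->
  simplex_integral t0 q.1 (fun tau : k.-tuple R =>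
    iter_integral (@lintegral R `[t0, q.1]) (fun s : m.-tuple R =>
      iter_integral J2 (fun x : k.-tuple R =>
        iter_integral J1 (fun al : m.-tuple R => F tau s x al)))) =
  z * Amp Th1 Th2 h t0 y T nu1 nu2 rho1 rho2 k m q.
Proof.
move=> FE; rewrite -cint_F3 -iterated_cint; apply: eq_simplex_integral => // tau tinc.
apply: eq_iter_lintegral => s sq; congr iter_integral; apply/funext => x.
congr iter_integral; apply/funext => al.
have incE : forall (u : seq pt) (p p' : pt), p.1 = p'.1 ->
    inc p u q = inc p' [seq (a, 0) | a <- [seq p.1 | p <- u]] (q.1, 0).
  by elim=> [|p1 u IH] p p' /= ->//; rewrite (IH p1 (p1.1, 0)).
have i1 : inc (t0, y) (zip tau x) q.
  by rewrite (incE _ _ (t0, 0))// -/unzip1 unzip1_zip ?size_tuple.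
rewrite FE// /P !chi_all sq.
rewrite (_ : all _ tau) ?mulr1 ?mul1r//.
move: tinc; apply: contraTT => /allPn[a at_ na].
have key : forall (u : seq R) p, t0 <= p.1 -> inc p [seq (a, 0) | a <- u] (q.1, 0) -> all (inT t0 T) u.
  elim=> [//|b u IH] p tp /= /andP[pb' i]; rewrite (IH _ _ i) ?andbT /=.
    by have /= bq := inc_lt i; rewrite /inT (le_trans tp (ltW pb')) (le_trans (ltW bq) tT).
  by rewrite (le_trans tp) ?ltW.
apply/negP => /key => /(_ (lexx _))/allP/(_ _ at_); exact/negP.
Qed.

End Dictionary.

(** * Summation over the orders *)

Lemma expr_fact_bounded {R : realType} (x : R) : 0 <= x -> exists b, 0 <= b /\ forall m, x ^+ m / (m`!)%:R <= b.
Proof.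
move=> x0; pose n0 := (Num.trunc x).+1; have xn : x <= n0%:R by apply: ltW; exact: truncnS_gt.
pose b := \sum_(j < n0.+1) x ^+ j / (j`!)%:R.
have t0 j : 0 <= x ^+ j / (j`!)%:R by rewrite divr_ge0 ?exprn_ge0.
have b0 : 0 <= b by apply: sumr_ge0.
exists b; split => //; elim=> [|m IH].
  by rewrite /b big_ord_recl lerDl sumr_ge0.
have [mn|nm] := leqP m.+1 n0.
  rewrite /b (bigD1 (Ordinal (mn : (m.+1 < n0.+1)%N)))//= lerDl.
  by apply: sumr_ge0 => j _; exact: t0.
apply: le_trans IH; rewrite exprS factS natrM invfM mulrACA ler_piMl// ler_pdivrMr// mul1r.
by apply: (le_trans xn); rewrite ler_nat ltnW.
Qed.

Lemma sum_natr_exp2_le {R : realFieldType} N : \sum_(n < N) n.+1%:R * (4^-1) ^+ n <= 2 :> R.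
Proof.
have key n : \sum_(j < n) (2^-1) ^+ j <= 2 - 2 * 2^-1 ^+ n :> R.
  elim: n => [|n IH]; first by rewrite big_ord0 expr0 mulr1 subrr.
  rewrite big_ord_recr/= exprS; have := IH; move: (\sum_(i < n) _) (2^-1 ^+ n) => a c; lra.
apply: (@le_trans _ _ (\sum_(j < N) (2^-1) ^+ j)).
  apply: ler_sum => j _.
  have -> : (4^-1 : R) ^+ j = 2^-1 ^+ j * 2^-1 ^+ j.
    by rewrite -exprMn; congr (_ ^+ _); rewrite -invfM; congr (_^-1); rewrite -natrM.
  rewrite mulrA ler_piMl ?exprn_ge0// exprVn ler_pdivrMr ?exprn_gt0// mul1r -natrX ler_nat.
  by rewrite ltn_expl.
by apply: le_trans (key N) _; rewrite lerBlDr lerDl mulr_ge0// exprn_ge0.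
Qed.

Lemma norm_lim_le {R : realType} (u : nat -> R) (l B : R) : u @ \oo --> l -> (forall n, `|u n| <= B) -> `|l| <= B.
Proof.
move=> ul uB; have nl : (fun n => `|u n|) @ \oo --> `|l| by exact: cvg_norm.
by apply: (cvgr_to_le nl); apply: nearW => n; exact: uB.
Qed.

Section Limit.
Context {R : realType}.
Local Notation pt := (R * R)%type.
Local Notation mR := (measurableTypeR R).
Variables (Th1 Th2 h hd : R -> R[i]) (t0 y T M : R).
Hypotheses (dTh1 : forall t, is_cd Th1 t (h t)) (dTh2 : forall t, is_cd Th2 t (h t ^+ 2))
  (dh : forall t, is_cd h t (hd t)) (chd : forall t, ccont hd t).
Hypotheses (t0T : t0 <= T) (yM : `|y| <= M).
Variables (K C : R).
Hypotheses (K0 : 0 <= K) (C0 : 0 < C).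
Hypothesis pbound : path_bounded Th1 Th2 h t0 y T M K C.
Variables (nu1 nu2 : {finite_measure set mR -> \bar R}) (rho1 rho2 : R -> R[i]) (r1 r2 : R -> R).
Hypotheses (mrho1 : @cmeas R _ mR rho1) (mrho2 : @cmeas R _ mR rho2).
Hypotheses (mr1 : @measurable_fun _ _ mR R setT r1) (mr2 : @measurable_fun _ _ mR R setT r2).
Hypotheses (rr1 : forall x, normc (rho1 x) <= r1 x) (rr2 : forall x, normc (rho2 x) <= r2 x).
Hypothesis exp1 : forall c : R, 0 < c -> (\int[nu1]_x (expR (c * `|x|) * r1 x)%:E < +oo)%E.
Variable R2 : R.
Hypotheses (int2 : (\int[nu2]_x (r2 x)%:E <= R2%:E)%E) (supp2 : forall x, M < `|x| -> r2 x = 0).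
Variables (e : R).
Hypothesis (e0 : 0 < e).
Hypothesis small : K * kap R2 e <= 4^-1.
Local Notation A := (Amp Th1 Th2 h t0 y T nu1 nu2 rho1 rho2).
Local Notation pr := (pairing_ Th1 Th2 h t0 y T nu1 nu2 rho1 rho2).

Definition Ssum N (q : pt) : R[i] := \sum_(n < N) \sum_(k < n.+1) jc k (n - k) * A k (n - k) q.

Lemma Ssum_cmeas N : cmeas (Ssum N).
Proof.
apply: cmeas_sum => n; apply: cmeas_sum => k; apply: cmeasM; first exact: cmeas_cst.
exact: (Amp_cmeas t0 y T dTh1 dTh2 dh nu1 nu2 mrho1 mrho2).
Qed.

Lemma normc_jc k m : normc (jc k m : R[i]) = (m`!)%:R^-1.
Proof.
have n1 : normc (- iC : R[i]) = 1 by rewrite normcE2 /= oppr0 expr0n sqrrN expr1n add0r sqrtr1.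
rewrite /jc Normc.normcM normcX n1 expr1n mul1r.
by rewrite (_ : (m`!)%:R^-1 = ((m`!)%:R^-1)%:C%C :> R[i]) ?normc_real ?ger0_norm// fmorphV rmorph_nat.
Qed.

Lemma Ssum_le : exists c, 0 <= c /\ forall N q, okpt t0 T M q ->
  normc (Ssum N q) <= c * (Num.sqrt (q.1 - t0))^-1.
Proof.
have [B hB] := e1_integral t0 T mr1 rr1 exp1 C0.
have B0 : 0 <= B.
  rewrite -lee_fin (le_trans _ hB)// integral_ge0// => w _; rewrite lee_fin.
  exact: (e1_ge0 rr1).
have [b [b0 hb]] := @expr_fact_bounded R (4 * B) (mulr_ge0 (ler0n _ _) B0).
pose E := expR (e^-1 * (T - t0)).
have E0 : 0 <= E := expR_ge0 _.
have kap0 : 0 <= kap R2 e by rewrite !mulr_ge0 ?sqrtr_ge0 ?(R2_ge0 rr2 int2).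
exists (2 * K * E * b * 2); split; first by rewrite !mulr_ge0.
move=> N q okq; set s := (Num.sqrt (q.1 - t0))^-1.
have s0 : 0 <= s by rewrite invr_ge0 sqrtr_ge0.
have term k m : normc (jc k m * A k m q) <= 2 * K * E * b * s * 4^-1 ^+ (k + m).
  rewrite Normc.normcM normc_jc.
  have f0 : 0 <= (m`!)%:R^-1 :> R by rewrite invr_ge0.
  have h1 := Amp_le dTh1 dTh2 dh K0 pbound mrho1 mrho2 mr1 mr2 rr1 rr2 int2 supp2 e0 k m okq hB.
  apply: (le_trans (ler_wpM2l f0 h1)).
  have hE : expR (e^-1 * (q.1 - t0)) <= E.
    by rewrite ler_expR ler_wpM2l ?invr_ge0 ?(ltW e0)// lerB//; case/andP: okq => /andP[].
  have hk : (K * kap R2 e) ^+ k <= 4^-1 ^+ k by apply: lerXn2r; rewrite ?nnegrE ?invr_ge0 ?(mulr_ge0 K0 kap0).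
  have hm : B ^+ m / (m`!)%:R <= b * 4^-1 ^+ m.
    by rewrite exprVn ler_pdivlMr ?exprn_gt0// mulrAC -exprMn [B * 4]mulrC.
  rewrite exprD -/s.
  have z1 : 0 <= (K * kap R2 e) ^+ k by rewrite exprn_ge0// mulr_ge0.
  have z2 : 0 <= B ^+ m / (m`!)%:R by rewrite mulr_ge0// exprn_ge0.
  rewrite [leLHS](_ : _ = 2 * K * s * (expR (e^-1 * (q.1 - t0)) * ((K * kap R2 e) ^+ k * (B ^+ m / (m`!)%:R)))); last first.
    move: (kap R2 e) (expR _) (B ^+ m) ((m`!)%:R^-1) => a1 a2 a3 a4.
    by rewrite exprMn exprS; ring.
  rewrite (_ : 2 * K * E * b * s * _ = 2 * K * s * (E * (4^-1 ^+ k * (b * 4^-1 ^+ m)))); last by ring.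
  apply: ler_wpM2l; first by rewrite !mulr_ge0.
  by apply: ler_pM; [exact: expR_ge0|exact: mulr_ge0|exact: hE|exact: ler_pM].
rewrite /Ssum; apply: (le_trans (normc_sum _ _)).
apply: (@le_trans _ _ (\sum_(n < N) 2 * K * E * b * s * (n.+1%:R * 4^-1 ^+ n))).
  apply: ler_sum => n _; apply: (le_trans (normc_sum _ _)).
  apply: (@le_trans _ _ (\sum_(k < n.+1) 2 * K * E * b * s * 4^-1 ^+ n)).
    apply: ler_sum => k _; have := term k (n - k)%N; by rewrite subnKC// -ltnS.
  by rewrite sumr_const card_ord -[leLHS]mulr_natl mulrCA lexx.
rewrite -mulr_sumr (_ : 2 * K * E * b * 2 * s = 2 * K * E * b * s * 2); last by ring.
by rewrite ler_wpM2l ?mulr_ge0// sum_natr_exp2_le.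
Qed.

Variable Kf : pt -> R[i].
Hypothesis Kf_lim : forall q, okpt t0 T M q -> cpart_cvg (fun N => Ssum N q) (Kf q).

Lemma Kf_le : exists c, 0 <= c /\ forall q, okpt t0 T M q -> normc (Kf q) <= c * (Num.sqrt (q.1 - t0))^-1.
Proof.
have [c [c0 hc]] := Ssum_le; exists (c + c); split; first exact: addr_ge0.
move=> q okq; have [l1 l2] := Kf_lim okq; rewrite mulrDl; apply: (le_trans (normc_le _)); apply: lerD.
  by apply: (norm_lim_le l1) => N; apply: (le_trans (Re_le_normc _)); exact: hc.
by apply: (norm_lim_le l2) => N; apply: (le_trans (Im_le_normc _)); exact: hc.
Qed.

Section Testing.
Variables (Q1 : {finite_measure set mR -> \bar R}) (psi : pt -> R[i]) (b : R -> R) (Bq : R).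
Hypotheses (mpsi : cmeas psi) (mb : @measurable_fun _ _ mR R setT b) (b0 : forall x, 0 <= b x)
  (psib : forall q, normc (psi q) <= b q.2) (psi0 : forall q, ~~ okpt t0 T M q -> psi q = 0)
  (intb : (\int[Q1]_x (b x)%:E <= Bq%:E)%E).

Definition psum N : R[i] := \sum_(n < N) \sum_(k < n.+1) jc k (n - k) * pr Q1 psi k (n - k).

Let Spsi_cvg q : cpart_cvg (fun N => Ssum N q * psi q) (Kf q * psi q).
Proof.
have [okq|nq] := boolP (okpt t0 T M q).
  by apply: cpart_cvgM; [exact: Kf_lim|exact: cpart_cvg_cst].
rewrite psi0// mulr0 (_ : (fun N => _) = fun _ => 0); first exact: cpart_cvg_cst.
by apply/funext => N; rewrite mulr0.
Qed.

Lemma Kpsi_cmeas : cmeas (fun q => Kf q * psi q).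
Proof.
have mS N : cmeas (fun q => Ssum N q * psi q) by apply: cmeasM => //; exact: Ssum_cmeas.
split.
  by apply: (measurable_fun_cvg (h := fun N q => Re (Ssum N q * psi q))) => [N|q _]; [exact: (mS N).1|exact: (Spsi_cvg q).1].
by apply: (measurable_fun_cvg (h := fun N q => Im (Ssum N q * psi q))) => [N|q _]; [exact: (mS N).2|exact: (Spsi_cvg q).2].
Qed.

Let dom : exists c, [/\ 0 <= c, (QM t0 T Q1).-integrable setT (fun q => (c * (Num.sqrt (q.1 - t0))^-1 * b q.2)%:E) &
  forall N q, normc (Ssum N q * psi q) <= c * (Num.sqrt (q.1 - t0))^-1 * b q.2].
Proof.
have [c [c0 hc]] := Ssum_le; exists c.
have s0 (t : R) : 0 <= c * (Num.sqrt (t - t0))^-1 by rewrite mulr_ge0// invr_ge0 sqrtr_ge0.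
split => // [|N q].
  have ms : @measurable_fun _ _ mR R setT (fun t => c * (Num.sqrt (t - t0))^-1).
    by apply: measurable_funM => //; apply: measurable_isqrt; exact: measurable_funB.
  have /integrableP[_ fq] := integrableZl measurableT c (integrable_isqrt_lebr t0 t0T).
  have fq' : (\int[lebr t0 T]_t (c * (Num.sqrt (t - t0))^-1)%:E < +oo)%E.
    apply: le_lt_trans fq; rewrite le_eqVlt; apply/orP; left; apply/eqP.
    by apply: eq_integral => t _; rewrite -EFinM gee0_abs// lee_fin.
  have fq2 : (\int[lebr t0 T]_t (c * (Num.sqrt (t - t0))^-1)%:E <=
     (fine (\int[lebr t0 T]_t (c * (Num.sqrt (t - t0))^-1)%:E))%:E)%E.
    by rewrite fineK// ge0_fin_numE// integral_ge0// => t _; rewrite lee_fin.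
  have h3 := @ge0_integral_prod_le R _ _ mR mR (lebr t0 T) Q1 _ _ _ _ ms mb s0 b0 fq2 intb.
  apply/integrableP; split.
    apply/measurable_EFinP; apply: measurable_funM.
      exact: (measurableT_comp ms (@measurable_fst _ _ R R)).
    exact: (measurableT_comp mb (@measurable_snd _ _ R R)).
  apply: le_lt_trans (le_lt_trans h3 (ltry _)); rewrite le_eqVlt; apply/orP; left; apply/eqP.
  by apply: eq_integral => q _; rewrite gee0_abs// lee_fin mulr_ge0.
have [okq|nq] := boolP (okpt t0 T M q); last by rewrite psi0// mulr0 Normc.normc0 mulr_ge0.
by rewrite Normc.normcM ler_pM ?normc_ge0 ?hc.
Qed.

Lemma Kpsi_cintg : cintg (QM t0 T Q1) setT (fun q => Kf q * psi q).
Proof.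
have [c [c0 ic hc]] := dom.
have ic2 := integrableD (@measurableT _ (mR * mR)%type) ic ic.
apply: (@cintg_le R _ (mR * mR)%type (QM t0 T Q1) _ (fun q => c * (Num.sqrt (q.1 - t0))^-1 * b q.2 + c * (Num.sqrt (q.1 - t0))^-1 * b q.2)) => //.
  exact: Kpsi_cmeas.
move=> q; apply: (le_trans (normc_le _)); have [l1 l2] := Spsi_cvg q; apply: lerD.
  by apply: (norm_lim_le l1) => N; apply: (le_trans (Re_le_normc _)); exact: hc.
by apply: (norm_lim_le l2) => N; apply: (le_trans (Im_le_normc _)); exact: hc.
Qed.

Lemma psum_cvg : cpart_cvg psum (cint (QM t0 T Q1) setT (fun q => Kf q * psi q)).
Proof.
have [c [c0 ic hc]] := dom.
have ia k m := Amp_psi_cintg dTh1 dTh2 dh t0T K0 C0 pbound mrho1 mrho2 mr1 mr2 rr1 rr2 exp1 int2 supp2 e0 mpsi mb b0 psib psi0 intb k m.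
have mq := @measurableT _ (mR * mR)%type.
rewrite (_ : psum = fun N => cint (QM t0 T Q1) setT (fun q => Ssum N q * psi q)); last first.
  apply/funext => N.
  have iz k m := cintgZ mq (jc k m) (ia k m).
  have is_ n := cintg_sum mq (index_enum 'I_n.+1) (fun k : 'I_n.+1 => iz k (n - k)%N).
  transitivity (cint (QM t0 T Q1) setT (fun q => \sum_(n < N) \sum_(k < n.+1) jc k (n - k) * (A k (n - k) q * psi q))).
    rewrite (cint_sum mq _ (fun n : 'I_N => is_ n)); apply: eq_bigr => n _.
    rewrite (cint_sum mq _ (fun k : 'I_n.+1 => iz k (n - k)%N)); apply: eq_bigr => k _.
    by rewrite (cintZ mq _ (ia k (n - k)%N)).
  apply: eq_cint => q _; rewrite /Ssum mulr_suml; apply: eq_bigr => n _; rewrite mulr_suml.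
  by apply: eq_bigr => k _; rewrite mulrA.
apply: (@cint_dominated R _ (mR * mR)%type (QM t0 T Q1) (fun N q => Ssum N q * psi q) _ (fun q => c * (Num.sqrt (q.1 - t0))^-1 * b q.2)) => //.
- by move=> N; apply: cmeasM => //; exact: Ssum_cmeas.
- exact: Kpsi_cmeas.
Qed.

End Testing.

Section Identity.
Variables (phi px pxx pt_ : R -> R -> R[i]).
Hypothesis tst : is_test phi px pxx pt_ M T.
Let Q0 := lebr (- M) M.
Local Notation pL := (psiL hd t0 T M phi pxx pt_).
Local Notation p1 := (psi1 t0 T M nu1 rho1 phi).
Local Notation p2 := (psi2 t0 T M rho2 phi).

Lemma psum_rec N : psum Q0 pL N.+1 = psum Q0 p1 N + psum nu2 p2 N + iC * phi y t0.
Proof.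
pose a k m := jc k m * pr Q0 p1 k m; pose c k m := jc k m * pr nu2 p2 k m.
have rec k m : jc k m * pr Q0 pL k m = (if m is m'.+1 then a k m' else 0) + (if k is k'.+1 then c k' m else 0) +
    (if (k == 0%N) && (m == 0%N) then iC * phi y t0 else 0).
  exact: (pairing_rec dTh1 dTh2 dh chd t0T yM K0 C0 pbound mrho1 mrho2 mr1 mr2 rr1 rr2 exp1 int2 supp2 e0 tst k m).
rewrite /psum big_ord_recl big_ord1 rec /= !add0r addrC -big_split; congr (_ + _).
apply: eq_bigr => n _; rewrite /= /bump /= add1n.
under eq_bigr do rewrite rec.
rewrite !big_split/= [X in _ + X]big1 ?addr0; last first.
  by move=> [[|k] kn] _ //=; rewrite subn0.
congr (_ + _).
  rewrite big_ord_recr/= subnn addr0; apply: eq_bigr => k _.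
  by rewrite subSn// -ltnS.
by rewrite big_ord_recl/= add0r; apply: eq_bigr => k _; rewrite /= /bump /= add1n subSS.
Qed.

Lemma limit_identity :
  [/\ cintg (QM t0 T Q0) setT (fun q => Kf q * pL q),
      cintg (QM t0 T Q0) setT (fun q => Kf q * p1 q),
      cintg (QM t0 T nu2) setT (fun q => Kf q * p2 q) &
  cint (QM t0 T Q0) setT (fun q => Kf q * pL q) =
  cint (QM t0 T Q0) setT (fun q => Kf q * p1 q) + cint (QM t0 T nu2) setT (fun q => Kf q * p2 q) + iC * phi y t0].
Proof.
have int_cst (B : R) : (\int[Q0]_x (cst B x)%:E <= (B * fine (Q0 setT))%:E)%E.
  have -> : (\int[Q0]_x (cst B x)%:E = \int[Q0]_x (cst B%:E) x)%E by apply: eq_integral.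
  by rewrite integral_cst// EFinM fineK// fin_num_measure.
have [BL [BL0 hBL]] := psiL_bnd t0 chd tst.
have [B1 [B10 hB1]] := psi1_bnd t0 yM mrho1 mr1 rr1 exp1 tst.
have [B2 [B20 hB2]] := psi2_bnd t0 rr2 tst.
have r20 x : 0 <= r2 x by exact: le_trans (normc_ge0 _) (rr2 x).
have mcst (B : R) : @measurable_fun _ _ mR R setT (cst B) by exact: measurable_cst.
have mL := psiL_cmeas t0 chd tst; have m1 := psi1_cmeas t0 nu1 mrho1 tst; have m2 := psi2_cmeas t0 mrho2 tst.
have nL := psiL_nok hd phi pxx pt_ (t0 := t0) (T := T) (M := M).
have n1 := psi1_nok nu1 rho1 phi (t0 := t0) (T := T) (M := M).
have n2 := psi2_nok rho2 phi (t0 := t0) (T := T) (M := M).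
have mb2 : @measurable_fun _ _ mR R setT (fun x => r2 x * B2) by exact: measurable_funM.
have b20 x : 0 <= r2 x * B2 by rewrite mulr_ge0.
have i2 : (\int[nu2]_x (r2 x * B2)%:E <= (R2 * B2)%:E)%E.
  have mr2E : measurable_fun setT (fun x : mR => (r2 x)%:E) by exact/measurable_EFinP.
  have B20' : (0 <= B2%:E)%E by rewrite lee_fin.
  under eq_integral do rewrite mulrC EFinM.
  rewrite (@ge0_integralZl _ _ _ nu2 _ measurableT _ mr2E _ _ B20'); last by move=> x _; rewrite lee_fin.
  by rewrite mulrC EFinM; apply: lee_wpmul2l.
have iL := Kpsi_cintg mL (mcst BL) (fun=> BL0) hBL nL (int_cst BL).
have i1 := Kpsi_cintg m1 (mcst B1) (fun=> B10) hB1 n1 (int_cst B1).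
have ii2 := Kpsi_cintg m2 mb2 b20 hB2 n2 i2.
have cL := psum_cvg mL (mcst BL) (fun=> BL0) hBL nL (int_cst BL).
have c1 := psum_cvg m1 (mcst B1) (fun=> B10) hB1 n1 (int_cst B1).
have c2 := psum_cvg m2 mb2 b20 hB2 n2 i2.
split => //.
have cL' : cpart_cvg (fun N => psum Q0 pL N.+1) (cint (QM t0 T Q0) setT (fun q => Kf q * pL q)).
  case: cL => a b; split.
    by rewrite (cvg_shiftS (fun N => Re (psum Q0 pL N))).
  by rewrite (cvg_shiftS (fun N => Im (psum Q0 pL N))).
apply: (cpart_cvg_unique cL'); under eq_fun do rewrite psum_rec.
by apply: cpart_cvgD; [exact: cpart_cvgD|exact: cpart_cvg_cst].
Qed.

End Identity.
End Limit.

(** * Schwartz functions and test functions *)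

Section SchwartzFacts.
Context {R : realType}.
Local Notation mR := (measurableTypeR R).
Implicit Types (theta : R -> R[i]).

Lemma schwartzC_is_cd theta t : schwartzC theta -> is_cd theta t (cderive theta t).
Proof. by move=> [[d1 _] [d2 _]]; apply: cderivable_is_cd; split; [exact: (d1 0%N)|exact: (d2 0%N)]. Qed.

Lemma schwartzC_ccont_derive theta t : schwartzC theta -> ccont (cderive theta) t.
Proof.
move=> [[d1 _] [d2 _]]; apply: (is_cd_ccont (a := cderive (cderive theta) t)).
by apply: cderivable_is_cd; split; [exact: (d1 1%N)|exact: (d2 1%N)].
Qed.

Lemma schwartzC_sqr_integrable theta : schwartzC theta ->
  cintg (@lebesgue_measure R) setT (fun s => theta s ^+ 2).
Proof.
move=> sth; have mth : cmeas theta := ccont_measurable (fun t => is_cd_ccont (schwartzC_is_cd t sth)).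
have [[_ b1] [_ b2]] := sth.
have [M0 h0] := b1 0%N 0%N; have [M1 h1] := b1 1%N 0%N.
have [N0 g0] := b2 0%N 0%N; have [N1 g1] := b2 1%N 0%N.
pose B := (M0 ^+ 2 + M1 ^+ 2) + (N0 ^+ 2 + N1 ^+ 2).
have key (f : R -> R) (m0 m1 : R) : (forall x, `|x ^+ 0 * f x| <= m0) -> (forall x, `|x ^+ 1 * f x| <= m1) ->
    forall x, (1 + x ^+ 2) * f x ^+ 2 <= m0 ^+ 2 + m1 ^+ 2.
  move=> f0 f1 x; have := f0 x; have := f1 x; rewrite expr0 mul1r expr1 => l1 l0.
  have sqle (a m : R) : `|a| <= m -> a ^+ 2 <= m ^+ 2.
    by move=> am; rewrite -[a ^+ 2]real_normK ?num_real// lerXn2r ?nnegrE// (le_trans _ am).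
  by rewrite mulrDl mul1r -exprMn; apply: lerD; exact: sqle.
have sq x : normc (theta x ^+ 2) <= B * (oneDsqr x)^-1.
  have d0 : 0 < oneDsqr x by rewrite (lt_le_trans ltr01)// oneDsqr_ge1.
  rewrite normcX normcE2 sqr_sqrtr ?addr_ge0 ?sqr_ge0// ler_pdivlMr// mulrC mulrDr.
  apply: lerD; [exact: (key (fun s => Re (theta s)))|exact: (key (fun s => Im (theta s)))].
have mi : (@lebesgue_measure R).-integrable setT (EFin \o (fun x : R => B * (oneDsqr x)^-1)).
  have mf : measurable_fun setT (fun x : R => (oneDsqr x)^-1).
    by apply: continuous_measurable_fun; exact: continuous_oneDsqrV.
  have i1 : (@lebesgue_measure R).-integrable setT (EFin \o (fun x : R => (oneDsqr x)^-1)).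
    apply/integrableP; split; first exact/measurable_EFinP.
    have f0 (x : R) : 0 <= (oneDsqr x)^-1 by rewrite invr_ge0 (le_trans ler01)// oneDsqr_ge1.
    rewrite [X in (X < _)%E](_ : _ = (\int[@lebesgue_measure R]_x ((oneDsqr x)^-1)%:E)%E); last first.
      by apply: eq_integral => x _; rewrite gee0_abs// lee_fin.
    rewrite ge0_symfun_integralT//; last 2 first.
    - exact: continuous_oneDsqrV.
    - by move=> x; rewrite /= /oneDsqr sqrrN.
    by rewrite -set_itvcy integral0y_oneDsqr -EFinM ltry.
  exact: (integrableZl measurableT B i1).
by apply: (@cintg_le R _ mR (@lebesgue_measure R) _ (fun x => B * (oneDsqr x)^-1)) => //; exact: cmeasX.
Qed.

Lemma schwartzC0 : schwartzC (fun _ : R => 0 : R[i]).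
Proof.
have d0 n : derive1n n (fun _ : R => 0 : R) = fun _ => 0.
  elim: n => [//|n IH]; rewrite derive1nS; apply/funext => x.
  by rewrite IH derive1_cst.
have s0 : schwartz (fun _ : R => 0 : R).
  split => [n x|k n]; first by rewrite d0; exact: derivable_cst.
  by exists 0 => x; rewrite d0 mulr0 normr0.
by split; exact: s0.
Qed.

Lemma schwartzC_nbhs0_0 (U : set (R -> R[i])) : schwartzC_nbhs0 U -> U (fun=> 0).
Proof.
move=> [_ [N [e [e0 hU]]]]; apply: hU; first exact: schwartzC0.
have d0 n : derive1n n (fun _ : R => 0 : R) = fun _ => 0.
  elim: n => [//|n IH]; rewrite derive1nS; apply/funext => x.
  by rewrite IH derive1_cst.
by move=> k n x _ _ /=; rewrite !d0 mulr0 normr0.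
Qed.

End SchwartzFacts.

Section TestFunctions.
Context {R : realType}.
Implicit Types (phi : R -> R -> R[i]).

Lemma cderive_near0 (g : R -> R[i]) (x d : R) : 0 < d -> (forall s, `|s - x| < d -> g s = 0) -> cderive g x = 0.
Proof.
move=> d0 g0; have key (f : R[i] -> R) : f 0 = 0 -> derive1 (fun s => f (g s)) x = 0.
  move=> f0; rewrite derive1E; transitivity ('D_1 (cst (0 : R)) x); last by rewrite derive_cst.
  apply: near_eq_derive; apply/nbhs_normP; exists d => //= s /=.
  by rewrite distrC => sx; rewrite g0 ?f0.
by apply: complex_ext => /=; rewrite key.
Qed.

Lemma smooth2_jcont w phi : smooth2 phi -> jcont (iter_partial w phi).
Proof. by move=> /(_ w)[]. Qed.

Lemma smooth2_dx w phi : smooth2 phi -> forall x t,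
  is_cd (fun x' => iter_partial w phi x' t) x (iter_partial (true :: w) phi x t).
Proof. by move=> /(_ w)[_ _ h _] x t; apply: cderivable_is_cd. Qed.

Lemma smooth2_dt w phi : smooth2 phi -> forall x t,
  is_cd (iter_partial w phi x) t (iter_partial (false :: w) phi x t).
Proof. by move=> /(_ w)[_ _ _ h] x t; apply: cderivable_is_cd. Qed.

Lemma ccont_right0 (f : R -> R[i]) (T : R) : ccont f T -> (forall t, T < t -> f t = 0) -> f T = 0.
Proof.
move=> cf f0; have h1 : (fun n => T + (n.+1%:R)^-1 : R) @ \oo --> T.
  rewrite -[X in _ --> X]addr0; apply: cvgD; first exact: cvg_cst.
  exact: cvg_harmonic.
apply: (cpart_cvg_unique (ccont_cvg cf h1)); rewrite (_ : (fun n => _) = fun _ => 0); first exact: cpart_cvg_cst.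
by apply/funext => n; rewrite f0// ltrDl invr_gt0.
Qed.

Lemma test_function_is_test (T0 T : R) phi : test_function T0 T phi -> exists M1, forall M, M1 <= M ->
  is_test phi (partial_x phi) (partial_x (partial_x phi)) (partial_t phi) M T.
Proof.
move=> [sm [M1 supp]]; exists (M1 + 1) => M MM.
have z0 x t : M1 < `|x| -> phi x t = 0.
  by move=> xM; apply/eqP; apply: contraLR xM => /supp[]; rewrite -leNgt.
have zx (g : R -> R -> R[i]) : (forall x t, M1 < `|x| -> g x t = 0) -> forall x t, M1 < `|x| -> partial_x g x t = 0.
  move=> g0 x t xM; apply: (@cderive_near0 _ x (`|x| - M1)); first by rewrite subr_gt0.
  move=> s sx; apply: g0; rewrite distrC in sx.
  have := ler_distD s x 0; rewrite !subr0; move: sx; lra.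
have lt x : M <= `|x| -> M1 < `|x| by move=> h; rewrite (lt_le_trans _ h)// (lt_le_trans _ MM)// ltrDl.
split.
- exact: (smooth2_dx [::] sm).
- exact: (smooth2_dx [:: true] sm).
- exact: (smooth2_dt [::] sm).
- exact: (smooth2_jcont [::] sm).
- exact: (smooth2_jcont [:: true] sm).
- exact: (smooth2_jcont [:: true; true] sm).
- exact: (smooth2_jcont [:: false] sm).
- by move=> x t /lt; exact: z0.
- by move=> x t /lt; apply: (zx).
- by move=> x t /lt; apply: (zx); apply: (zx).
- move=> x t /lt xM; rewrite /partial_t (_ : phi x = fun _ => 0); last by apply/funext => s; exact: z0.
  by apply: (@cderive_near0 _ _ 1).
move=> x; apply: ccont_right0; first exact: jcont2 (smooth2_jcont [::] sm).
move=> t Tt; apply/eqP; apply: contraLR Tt => /supp[_ /andP[_]]; by rewrite -leNgt.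
Qed.

Lemma test_function_before (T0 T : R) phi : test_function T0 T phi -> forall x t, t < T0 ->
  [/\ phi x t = 0, partial_t phi x t = 0 & partial_x (partial_x phi) x t = 0].
Proof.
move=> [sm [M1 supp]] x t tT.
have z0 x' t' : t' < T0 -> phi x' t' = 0.
  by move=> h; apply/eqP; apply: contraLR h => /supp[_ /andP[]]; rewrite -leNgt.
have zx (g : R -> R -> R[i]) : (forall x t, t < T0 -> g x t = 0) -> forall x t, t < T0 -> partial_x g x t = 0.
  by move=> g0 x' t' h; apply: (@cderive_near0 _ _ 1) => // s _; exact: g0.
split; [exact: z0| |by apply: (zx) => //; exact: (zx)].
apply: (@cderive_near0 _ t (T0 - t)); first by rewrite subr_gt0.
by move=> s; rewrite ltr_norml => /andP[_ h]; apply: z0; move: h; lra.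
Qed.

Lemma test_function_widen (T0 T1 T : R) phi : T1 <= T0 -> test_function T0 T phi -> test_function T1 T phi.
Proof.
move=> TT [sm [M supp]]; split => //; exists M => x t /supp[xM /andP[h1 h2]]; split => //.
by rewrite h2 (le_trans TT h1).
Qed.

End TestFunctions.

Section PathBounds.
Context {R : realType}.

Lemma path_bounded_exists (Th1 Th2 h : R -> R[i]) (t0 y T M : R) : (forall t, is_cd Th1 t (h t)) ->
  (forall t, is_cd Th2 t (h t ^+ 2)) -> (forall t, ccont h t) -> t0 <= T -> `|y| <= M ->
  exists K C, [/\ 0 <= K, 0 < C & path_bounded Th1 Th2 h t0 y T M K C].
Proof.
move=> dTh1 dTh2 ch t0T yM.
have [B0 hB0] := itv_cbnd (a := t0) (b := T) (fun t _ => ch t).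
have [B1 hB1] := itv_cbnd (a := t0) (b := T) (fun t _ => is_cd_ccont (dTh1 t)).
have [B2 hB2] := itv_cbnd (a := t0) (b := T) (fun t _ => is_cd_ccont (dTh2 t)).
pose N := Num.max 1 (Num.max B0 (Num.max B1 B2)).
have N1 : 1 <= N by rewrite le_max lexx.
have M0 : 0 <= M := le_trans (normr_ge0 _) yM.
have pb := path_bound dTh1 ch t0T yM (N := N).
eexists; eexists; split; last first.
- move=> u v q okq oku okv; apply: pb => // t tT.
  + by rewrite !le_max hB0 ?orbT.
  + by rewrite !le_max hB1 ?orbT.
  + by rewrite !le_max hB2 ?orbT.
- by move: N1 M0; lra.
- by rewrite mulr_ge0 ?expR_ge0// mulr_ge0 ?expR_ge0 ?normc_ge0.
Qed.

End PathBounds.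

(** * The Green function *)

Section Green.
Context {R : realType}.
Local Notation pt := (R * R)%type.
Local Notation mR := (measurableTypeR R).
Variables (m1 : complex_measure R) (m2 : signed_measure R) (y t0 : R) (theta : R -> R[i]).
Hypothesis sth : schwartzC theta.
Hypotheses (hm1 : all_exp_moments m1) (hm2 : bounded_support m2).
Variable (TI : R -> R -> R[i]).
Hypothesis TI_series : forall x t, t0 < t -> feynman_series_to m1 m2 y t0 x t theta (TI x t).

Let gauge (x t : R) : R[i] := iC / 2%:R * lintegral (~` `[t0, t]) (fun s => theta s ^+ 2)
          + iC * y%:C%C * theta t0 - iC * x%:C%C * theta t.
Let Kt (x t : R) : R[i] := (heaviside (t - t0))%:C%C * TI x t * cexp (gauge x t).

Variables (T0 T : R) (phi : R -> R -> R[i]).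
Hypotheses (T0t : T0 <= t0 <= T) (tphi : test_function T0 T phi).

Let px := partial_x phi.
Let pxx := partial_x px.
Let pt_ := partial_t phi.
Let hd := cderive theta.

Theorem green_identity :
  - iC * dist_of_fun T0 T Kt pt_ + 2%:R^-1 * dist_of_fun T0 T Kt pxx
  - dist_of_fun T0 T (fun x t => hd t * x%:C%C * Kt x t) phi
  - dist_V m1 m2 T0 T Kt phi = iC * phi y t0.
Proof.
have [T0t0 t0T] := andP T0t.
have [nu1 [rho1 [r1 [rep1 exp1]]]] := cmeasure_representation hm1.
have [nu2 [rho2 [r2 [M2 [rep2 ir2 supp2']]]]] := charge_bounded_representation hm2.
have [Mp tst'] := test_function_is_test tphi.
pose M := Num.max `|y| (Num.max M2 Mp).
have yM : `|y| <= M by rewrite le_max lexx.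
have M0 : 0 <= M := le_trans (normr_ge0 _) yM.
have M2M : M2 <= M by rewrite !le_max lexx orbT.
have tst : is_test phi px pxx pt_ M T by apply: tst'; rewrite !le_max lexx !orbT.
have supp2 x : M < `|x| -> r2 x = 0 by move=> h; apply: supp2'; exact: le_lt_trans h.
have [mrho1 mr1 rr1 J1E] := rep1; have [mrho2 mr2 rr2 J2E] := rep2.
have r10 x : 0 <= r1 x by exact: le_trans (normc_ge0 _) (rr1 x).
have r20 x : 0 <= r2 x by exact: le_trans (normc_ge0 _) (rr2 x).
pose R2 := fine (\int[nu2]_x (r2 x)%:E)%E.
have int2 : (\int[nu2]_x (r2 x)%:E <= R2%:E)%E.
  by rewrite /R2 fineK//; exact: (integrable_fin_num measurableT ir2).
have dth t : is_cd theta t (hd t) := schwartzC_is_cd t sth.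
have cth t : ccont theta t := is_cd_ccont (dth t).
have chd t : ccont hd t := schwartzC_ccont_derive t sth.
have [Th1 [_ dTh1]] := cprimitive_exists cth.
have [Th2 [_ dTh2]] := @cprimitive_exists R (fun t => theta t ^+ 2) (fun t => ccontX 2 (cth t)).
have pboundL L : M <= L -> exists K C, [/\ 0 <= K, 0 < C & path_bounded Th1 Th2 theta t0 y T L K C].
  by move=> ML; apply: path_bounded_exists => //; exact: le_trans ML.
have [K [C [K0 C0 pb]]] := pboundL M (lexx _).
have [e [e0 small]] : exists e, 0 < e /\ K * kap R2 e <= 4^-1.
  have R20 : 0 <= R2 by exact: (R2_ge0 rr2 int2).
  pose a := (4 * (K * 6 * R2) + 1)^-1.
  have a0 : 0 < a by rewrite invr_gt0; apply: ltr_wpDl; rewrite ?mulr_ge0.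
  exists (a ^+ 2); split; first exact: exprn_gt0.
  rewrite /kap sqrtr_sqr ger0_norm ?(ltW a0)// /a.
  have X0 : 0 <= K * 6 * R2 by rewrite !mulr_ge0.
  rewrite (_ : K * (6 * _ * R2) = (K * 6 * R2) / (4 * (K * 6 * R2) + 1)); last by ring.
  move: (K * 6 * R2) X0 => X X0; rewrite ler_pdivrMr; last by lra.
  by lra.
pose Kf (q : pt) := Kt q.2 q.1.
have Kf_lim q : okpt t0 T M q -> cpart_cvg (fun N => Ssum Th1 Th2 theta t0 y T nu1 nu2 rho1 rho2 N q) (Kf q).
  move=> /andP[/andP[t0q qT] qM]; have [tt|qt0] := ltP t0 q.1; last first.
    have A0 k m : Amp Th1 Th2 theta t0 y T nu1 nu2 rho1 rho2 k m q = 0.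
      rewrite /Amp -[RHS](cint0 (PM t0 T nu1 nu2 k m) measurableT); apply: eq_cint => z _.
      rewrite /core /path chain_forward ?mulr0//; exact: seg_forward.
    rewrite (_ : (fun N => _) = fun _ => 0); last first.
      by apply/funext => N; rewrite /Ssum big1// => n _; rewrite big1// => k _; rewrite A0 mulr0.
    rewrite (_ : Kf q = 0); first exact: cpart_cvg_cst.
    by rewrite /Kf /Kt /heaviside subr_gt0 ltNge qt0 /= !mul0r.
  have eN N : Ssum Th1 Th2 theta t0 y T nu1 nu2 rho1 rho2 N q =
      cexp (gauge q.2 q.1) * \sum_(n < N) feynman_term m1 m2 y t0 q.2 q.1 theta n.
    rewrite mulr_sumr; apply: eq_bigr => n _; rewrite /feynman_term mulrCA mulr_sumr mulr_sumr.
    apply: eq_bigr => k _; have kn : (k <= n)%N by rewrite -ltnS.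
    have E := @iterated_Amp R Th1 Th2 theta hd t0 y T M dTh1 dTh2 dth M0 pboundL
      (cmeasure_integral m1) (charge_integral m2) nu1 nu2 rho1 rho2 r1 r2 rep1 rep2 exp1 R2 int2 supp2 q tt qT qM
      (cexp (- gauge q.2 q.1)) K C K0 C0 pb e e0 (n - k)%N k
      (fun tau s x al => TPhi y t0 q.2 q.1 theta tau s x al).
    rewrite E; last first.
      move=> tau s x al tinc sq.
      have tinc' : inc (t0, y) (zip tau x) (q.1, q.2) by case: (q) tinc.
      have F := TPhi_path dTh1 dTh2 cth (schwartzC_sqr_integrable sth) (x := q.2) (t := q.1) al tt tinc' sq.
      rewrite (_ : path _ _ _ _ _ _ _ q = cexp (gauge q.2 q.1) * TPhi y t0 q.2 q.1 theta tau s x al).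
        by rewrite mulrA -cexpD addNr cexp0 mul1r.
      by rewrite F; case: (q).
    set A := Amp _ _ _ _ _ _ _ _ _ _ _ _ _.
    rewrite (_ : cexp _ * (_ * (cexp _ * A)) = ('C(n, k) * k`!)%:R * (cexp (gauge q.2 q.1) * cexp (- gauge q.2 q.1)) * A); last by ring.
    rewrite -cexpD subrr cexp0 mulr1 mulrA; congr (_ * A).
    rewrite /jc subnKC//; have := bin_fact kn => bf.
    have f0 j : ((j`!)%:R : R[i]) != 0 by rewrite pnatr_eq0 -lt0n fact_gt0.
    have f1 := f0 n; have f2 := f0 (n - k)%N.
    rewrite -mulrA; congr (_ * _); apply: (mulfI f1); rewrite [RHS]mulrA mulfV// mul1r.
    by apply: (mulIf f2); rewrite divfK// -natrM -mulnA bf.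
  rewrite (_ : (fun N => _) = fun N => cexp (gauge q.2 q.1) * \sum_(n < N) feynman_term m1 m2 y t0 q.2 q.1 theta n); last first.
    by apply/funext => N; exact: eN.
  rewrite (_ : Kf q = cexp (gauge q.2 q.1) * TI q.2 q.1); last first.
    by rewrite /Kf /Kt /heaviside subr_gt0 tt mul1r mulrC.
  apply: cpart_cvgM; first exact: cpart_cvg_cst.
  exact: TI_series.
have [iL i1 i2 main] := limit_identity dTh1 dTh2 dth chd t0T yM K0 C0 pb mrho1 mrho2 mr1 mr2 rr1 rr2 exp1 int2 supp2 e0 small Kf_lim tst.
pose Q0 := lebr (- M) M.
have MM : - M <= M by move: M0; lra.
pose ok := okpt t0 T M.
have lint_t (g f : R -> R -> R[i]) (psi : pt -> R[i]) x : (`|x| <= M) -> cmeas (fun t : mR => Kf (t, x) * psi (t, x)) ->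
    (forall t, psi (t, x) = if ok (t, x) then g x t * f x t else 0) ->
    lintegral `[T0, T] (fun t => g x t * Kt x t * f x t) = cint (lebr t0 T) setT (fun t => Kf (t, x) * psi (t, x)).
  move=> xM mf psiE; rewrite -(lintegral_lebr t0 T mf) /lintegral [LHS]cint_mkcond [RHS]cint_mkcond.
  apply: eq_cint => t _; rewrite !mem_setE !in_itv/= psiE /ok /okpt /= xM andbT.
  have [t0t|tt0] := leP t0 t.
    rewrite (le_trans T0t0 t0t) /=; case: ifP => // tT.
    by rewrite [g x t * _]mulrC -mulrA.
  have K0' : Kt x t = 0 by rewrite /Kt /heaviside subr_gt0 ltNge (ltW tt0) /= !mul0r.
  by rewrite K0' mulr0 mul0r if_same.
have dist (g f : R -> R -> R[i]) (psi : pt -> R[i]) :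
    cintg (QM t0 T Q0) setT (fun q => Kf q * psi q) ->
    (forall q, psi q = if ok q then g q.2 q.1 * f q.2 q.1 else 0) -> (forall x t, M <= `|x| -> f x t = 0) ->
    dist_of_fun T0 T (fun x t => g x t * Kt x t) f = cint (QM t0 T Q0) setT (fun q => Kf q * psi q).
  move=> ic psiE f0.
  have mc x : cmeas (fun t : mR => Kf (t, x) * psi (t, x)).
    by apply: (cmeas_comp (cintg_meas ic) (g := fun t : mR => (t, x))); exact: measurable_fun_pair.
  have mx : @cmeas R _ mR (fun x => cint (lebr t0 T) setT (fun t => Kf (t, x) * psi (t, x))).
    exact: (cintg_meas (cintg_fubini2 ic)).
  rewrite -(cint_fubini2 ic) -(lintegral_lebr (- M) M mx) /dist_of_fun /lintegral [RHS]cint_mkcond.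
  apply: eq_cint => x _; rewrite mem_setE in_itv/= -ler_norml; case: ifPn => [xM|].
    exact: (lint_t g f psi x xM (mc x) (fun t => psiE (t, x))).
  rewrite -ltNge => Mx; rewrite -[RHS](cint0 (@lebesgue_measure R) (@measurable_itv R `[T0, T])).
  by apply: eq_cint => t _; rewrite f0 ?mulr0// ltW.
have jc1 : jcont pt_ by exact: tst_ct tst.
have jc2 : jcont pxx by exact: tst_cxx tst.
have jc0 : jcont phi by exact: tst_c tst.
have jc3 : jcont (fun x t => hd t * x%:C%C * phi x t).
  have c3 p : ccont (fun p : R * R => hd p.2 * p.1%:C%C * phi p.1 p.2) p.
    apply: ccontM; last by split; [exact: jc0.1|exact: jc0.2].
    apply: ccontM.
      have [a b] := chd p.2; split.
        exact: (@continuous_comp _ _ _ snd (fun t => Re (hd t)) p (@cvg_snd _ _ _ _ _) a).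
      exact: (@continuous_comp _ _ _ snd (fun t => Im (hd t)) p (@cvg_snd _ _ _ _ _) b).
    by apply: ccont_real; exact: cvg_fst.
  by split=> p; case: (c3 p).
pose ps (f : R -> R -> R[i]) (q : pt) : R[i] := if ok q then f q.2 q.1 else 0.
have mcst (B : R) : @measurable_fun _ _ mR R setT (cst B) by exact: measurable_cst.
have mps f : jcont f -> cmeas (ps f).
  move=> jf; apply: cmeas_if; [exact: (measurable_okpt t0 T M (q := id))|exact: jcont_swap_cmeas|exact: cmeas_cst].
have nps f q : ~~ ok q -> ps f q = 0 by move=> nq; rewrite /ps (negbTE nq).
have ips f : jcont f -> cintg (QM t0 T Q0) setT (fun q => Kf q * ps f q).
  move=> jf; have [B [B0 hB]] := jcont_okpt_bounded t0 T M jf.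
  have int_cst : (\int[Q0]_x (cst B x)%:E <= (B * fine (Q0 setT))%:E)%E.
    have -> : (\int[Q0]_x (cst B x)%:E = \int[Q0]_x (cst B%:E) x)%E by apply: eq_integral.
    by rewrite integral_cst// EFinM fineK// fin_num_measure.
  exact: (Kpsi_cintg dTh1 dTh2 dth t0T K0 C0 pb mrho1 mrho2 mr1 mr2 rr1 rr2 exp1 int2 supp2 e0 small Kf_lim (mps f jf) (mcst B) (fun=> B0) hB (nps f) int_cst).
have dist1 f : jcont f -> (forall x t, M <= `|x| -> f x t = 0) ->
    dist_of_fun T0 T Kt f = cint (QM t0 T Q0) setT (fun q => Kf q * ps f q).
  move=> jf f0.
  have e1 : (fun x t => 1 * Kt x t) = Kt by apply/funext => x; apply/funext => t; exact: mul1r.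
  have ep q : ps f q = if ok q then 1 * f q.2 q.1 else 0 by rewrite [1 * _]mul1r.
  have E := dist (fun _ _ => 1) f (ps f) (ips f jf) ep f0.
  by rewrite -E e1.
rewrite (dist1 pt_ jc1 (tst_t0 tst)) (dist1 pxx jc2 (tst_xx0 tst)).
rewrite (dist (fun x t => hd t * x%:C%C) phi (ps (fun x t => hd t * x%:C%C * phi x t)) (ips _ jc3) (fun q => erefl) (tst_0 tst)).
rewrite /dist_V.
rewrite (dist (fun x _ => potential1 m1 x) phi (psi1 t0 T M nu1 rho1 phi) i1 _ (tst_0 tst)); last first.
  move=> q; rewrite /psi1 /phib -/(ok q); case: ifP => _; last by rewrite mulr0.
  congr (_ * _); rewrite /V1c /potential1 J1E//.
    apply: cmeas_real; apply: (measurableT_comp (f := @expR R)) => //; exact: measurable_funM.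
  have c0 : 0 < `|q.2| + 1 by rewrite ltr_wpDl.
  have mE : @measurable_fun _ _ mR _ setT (fun a : R => expR (a * q.2)).
    by apply: (measurableT_comp (f := @expR R)) => //; exact: measurable_funM.
  apply/integrableP; split.
    apply/measurable_EFinP; apply: measurable_funM => //.
    by apply: (@measurable_normc R _ mR); exact: cmeas_real.
  refine (le_lt_trans _ (exp1 _ c0)); apply: ge0_le_integral => //.
  - apply: measurableT_comp => //; apply/measurable_EFinP; apply: measurable_funM => //.
    by apply: (@measurable_normc R _ mR); exact: cmeas_real.
  - apply/measurable_EFinP; apply: measurable_funM => //.
    apply: (@measurableT_comp _ _ _ _ _ _ (@expR R) _ (fun x : R => (`|q.2| + 1) * `|x|)) => //.
    by apply: measurable_funM => //; exact: (@normr_measurable R).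
  - move=> a _; rewrite gee0_abs lee_fin ?mulr_ge0 ?normc_ge0//.
    rewrite normc_real (ger0_norm (expR_ge0 _)) ler_wpM2r// ler_expR (le_trans (ler_norm _))//.
    by rewrite normrM mulrC ler_wpM2r// lerDl.
have dV2 : dist_V2 m2 T0 T Kt phi = cint (QM t0 T nu2) setT (fun q => Kf q * psi2 t0 T M rho2 phi q).
  have [Bp [Bp0 hBp]] := phib_bnd t0 tst.
  have [c [c0 hc]] := Kf_le dTh1 dTh2 dth K0 C0 pb mrho1 mrho2 mr1 mr2 rr1 rr2 exp1 int2 supp2 e0 small Kf_lim.
  pose G (x : R) := cint (lebr t0 T) setT (fun t : mR => Kf (t, x) * ps phi (t, x)).
  have mKp : cmeas (fun q => Kf q * ps phi q) := cintg_meas (ips phi jc0).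
  have mx x : cmeas (fun t : mR => Kf (t, x) * ps phi (t, x)).
    by apply: (cmeas_comp mKp (g := fun t : mR => (t, x))); exact: measurable_fun_pair.
  have s0 (t : R) : 0 <= c * (Num.sqrt (t - t0))^-1 * Bp by rewrite !mulr_ge0// invr_ge0 sqrtr_ge0.
  have le1 x t : normc (Kf (t, x) * ps phi (t, x)) <= c * (Num.sqrt (t - t0))^-1 * Bp.
    have [okq|nq] := boolP (ok (t, x)); last by rewrite nps// mulr0 Normc.normc0.
    by rewrite Normc.normcM ler_pM ?normc_ge0 ?hBp// (hc (t, x)).
  have is_ : (lebr t0 T).-integrable setT (EFin \o (fun t : R => c * (Num.sqrt (t - t0))^-1 * Bp)).
    have := integrableZl measurableT (c * Bp) (integrable_isqrt_lebr t0 t0T).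
    by apply: eq_integrable => // t _; rewrite /= -EFinM mulrAC.
  have ix x : cintg (lebr t0 T) setT (fun t : mR => Kf (t, x) * ps phi (t, x)).
    exact: (cintg_le (mx x) (le1 x) is_).
  have mG : @cmeas R _ mR G := cintg_meas (cintg_fubini2 (ips phi jc0)).
  pose BG := 2 * fine (\int[lebr t0 T]_t (c * (Num.sqrt (t - t0))^-1 * Bp)%:E)%E.
  have Gle x : normc (G x) <= BG.
    apply: (normc_cint_dom (mx x) _ (le1 x)); first by case/integrableP: is_ => /measurable_EFinP.
    by rewrite fineK//; exact: (integrable_fin_num measurableT is_).
  have BG0 : 0 <= BG := le_trans (normc_ge0 _) (Gle 0).
  rewrite /dist_V2 (_ : (fun x => _) = G); last first.
    apply/funext => x; have [xM|Mx] := leP `|x| M.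
      rewrite /G -(lint_t (fun _ _ => 1) phi (ps phi) x xM (mx x)); last by move=> t; rewrite mul1r.
      by apply: eq_cint => t _; rewrite mul1r.
    transitivity (0 : R[i]).
      rewrite -[RHS](cint0 (@lebesgue_measure R) (@measurable_itv R `[T0, T])).
      by apply: eq_cint => t _; rewrite (tst_0 tst) ?mulr0// ltW.
    rewrite /G -[LHS](cint0 (lebr t0 T) measurableT); apply: eq_cint => t _.
    by rewrite nps ?mulr0// /ok /okpt /= [`|x| <= M]leNgt Mx !andbF.
  rewrite J2E//; last first.
    apply: (@le_integrable _ mR _ nu2 setT _ _ (fun x => (BG * r2 x)%:E)) => //.
    - by apply/measurable_EFinP; apply: measurable_funM => //; exact: measurable_normc.
    - move=> x _; rewrite !gee0_abs lee_fin; [|exact: mulr_ge0|by rewrite mulr_ge0 ?normc_ge0].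
      by apply: ler_wpM2r.
    - have := integrableZl measurableT BG ir2.
      by apply: eq_integrable => // x _; rewrite /= EFinM.
  rewrite -(cint_fubini2 i2); apply: eq_cint => x _.
  rewrite mulrC /G -(cintZ measurableT _ (ix x)); apply: eq_cint => t _.
  rewrite /psi2 /phib /W2 /ps -/(ok (t, x)) /=; case: ifP => okq; last by rewrite !mulr0.
  by move: okq; rewrite /ok /okpt /inT /= => /andP[-> _]; rewrite mulrCA.
rewrite dV2.
have mq := @measurableT _ (mR * mR)%type.
have lin : cint (QM t0 T Q0) setT (fun q => Kf q * psiL hd t0 T M phi pxx pt_ q) =
    - iC * cint (QM t0 T Q0) setT (fun q => Kf q * ps pt_ q) + 2%:R^-1 * cint (QM t0 T Q0) setT (fun q => Kf q * ps pxx q)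
    - cint (QM t0 T Q0) setT (fun q => Kf q * ps (fun x t => hd t * x%:C%C * phi x t) q).
  have a1 := cintgZ mq (- iC) (ips _ jc1); have a2 := cintgZ mq (2%:R^-1) (ips _ jc2).
  rewrite -(cintZ mq (- iC) (ips _ jc1)) -(cintZ mq (2%:R^-1) (ips _ jc2)).
  rewrite -(cintD mq a1 a2) -(cintB mq (cintgD mq a1 a2) (ips _ jc3)).
  apply: eq_cint => q _; rewrite /psiL /ps -/(ok q); case: ifP => _; last by rewrite !mulr0 !addr0 subr0.
  rewrite /Lphi; move: (Kf q) (pt_ _ _) (pxx _ _) (hd _) (phi _ _) (2%:R^-1) => b1 b2 b3 b4 b5 b6; ring.
have main' := etrans (esym lin) main; rewrite main'.
move: (cint _ _ _) (cint _ _ _) => b1 b2; ring.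
Qed.

End Green.

Theorem theorem8 (R : realType) (y t0 : R)
  (m1 : complex_measure R) (hm1 : all_exp_moments m1)
  (m2 : signed_measure R) (hm2 : bounded_support m2)
  (I : R -> R -> kondratiev R) (U : set (R -> R[i]))
  (hI : feynman_integrand m1 m2 y t0 I U) :
  (forall theta : R -> R[i], U theta ->
   forall T0 T : R, T0 <= t0 <= T ->
   forall phi : R -> R -> R[i], test_function T0 T phi ->
     let K := green_kernel y t0 I theta in
     let uK := dist_of_fun T0 T K in
     iC * dist_dt uK phi + 2%:R^-1 * dist_dx (dist_dx uK) phi
     - dist_of_fun T0 T (fun x t => cderive theta t * x%:C%C * K x t) phi
     - dist_V m1 m2 T0 T K phi
     = iC * dist_delta t0 y phi)
  /\
  (forall T0 T : R, t0 < T0 <= T ->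
   forall phi : R -> R -> R[i], test_function T0 T phi ->
     let K := fun x t => Ttransform (I x t) (fun=> 0) in
     let uK := dist_of_fun T0 T K in
     iC * dist_dt uK phi
     = - (2%:R^-1) * dist_dx (dist_dx uK) phi + dist_V m1 m2 T0 T K phi).
Proof.
have [[sU _] series] := hI.
have green theta : U theta -> forall T0 T : R, T0 <= t0 <= T -> forall phi : R -> R -> R[i], test_function T0 T phi ->
    - iC * dist_of_fun T0 T (green_kernel y t0 I theta) (partial_t phi)
    + 2%:R^-1 * dist_of_fun T0 T (green_kernel y t0 I theta) (partial_x (partial_x phi))
    - dist_of_fun T0 T (fun x t => cderive theta t * x%:C%C * green_kernel y t0 I theta x t) phi
    - dist_V m1 m2 T0 T (green_kernel y t0 I theta) phi = iC * phi y t0.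
  move=> Ut T0 T hT phi tphi.
  exact: (@green_identity R m1 m2 y t0 theta (sU _ Ut) hm1 hm2 (fun x t => Ttransform (I x t) theta)
    (fun x t => series theta Ut x t) T0 T phi hT tphi).
split=> [theta Ut T0 T hT phi tphi K uK|T0 T /andP[t0T0 T0T] phi tphi K uK].
  by rewrite /dist_dt /dist_dx opprK mulrN -mulNr /dist_delta; exact: green.
have tphi' : test_function t0 T phi := test_function_widen (ltW t0T0) tphi.
have U0 := schwartzC_nbhs0_0 hI.1.
have hT : t0 <= t0 <= T by rewrite lexx (le_trans (ltW t0T0) T0T).
have before := test_function_before tphi.
pose K' := green_kernel y t0 I (fun=> 0).
have KK' x t : t0 < t -> K' x t = K x t.
  move=> t0t; rewrite /K' /green_kernel /heaviside subr_gt0 t0t mul1r.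
  rewrite (_ : lintegral _ _ = 0) ?mulr0 ?subrr ?addr0 ?subr0 ?cexp0 ?mulr1//.
  rewrite /lintegral -[RHS](cint0 (@lebesgue_measure R) (measurableC (@measurable_itv R `[t0, t]))).
  by apply: eq_cint => s _; rewrite expr0n.
have lint (f g : R -> R[i]) : (forall t, T0 <= t -> f t = g t) -> (forall t, t < T0 -> f t = 0) ->
    lintegral `[t0, T] f = lintegral `[T0, T] g.
  move=> fg f0; rewrite /lintegral [LHS]cint_mkcond [RHS]cint_mkcond; apply: eq_cint => t _.
  rewrite !mem_setE !in_itv/=; have [T0t|tT0] := leP T0 t; last by rewrite f0// if_same.
  by rewrite (le_trans (ltW t0T0) T0t) fg.
have slice (g f : R -> R -> R[i]) x : (forall x t, t < T0 -> f x t = 0) ->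
    lintegral `[t0, T] (fun t => g x t * K' x t * f x t) = lintegral `[T0, T] (fun t => g x t * K x t * f x t).
  by move=> f0; apply: lint => t h; [rewrite KK'// (lt_le_trans t0T0)|rewrite f0 ?mulr0].
have dist (g f : R -> R -> R[i]) : (forall x t, t < T0 -> f x t = 0) ->
    dist_of_fun t0 T (fun x t => g x t * K' x t) f = dist_of_fun T0 T (fun x t => g x t * K x t) f.
  by move=> f0; apply: eq_cint => x _; exact: slice.
have one (k : R -> R -> R[i]) : (fun x t => 1 * k x t) = k.
  by apply/funext => x; apply/funext => t; exact: mul1r.
have dist1 f : (forall x t, t < T0 -> f x t = 0) -> dist_of_fun t0 T K' f = dist_of_fun T0 T K f.
  by move=> f0; have := dist (fun _ _ => 1) f f0; rewrite !one.
have phi0 x t : t < T0 -> phi x t = 0 by move=> /(before x)[].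
have := green _ U0 t0 T hT phi tphi'; rewrite -/K' phi0// mulr0.
rewrite dist1; last by move=> x t /(before x)[].
rewrite (dist1 (partial_x (partial_x phi))); last by move=> x t /(before x)[].
rewrite (_ : dist_of_fun t0 T (fun x t => cderive _ t * x%:C%C * K' x t) phi = 0); last first.
  rewrite /dist_of_fun -[RHS](cint0 (@lebesgue_measure R) measurableT); apply: eq_cint => x _.
  rewrite -[RHS](cint0 (@lebesgue_measure R) (@measurable_itv R `[t0, T])); apply: eq_cint => t _.
  by rewrite (@cderive_near0 _ _ _ 1)// !mul0r.
have -> : dist_V m1 m2 t0 T K' phi = dist_V m1 m2 T0 T K phi.
  rewrite /dist_V (dist (fun x _ => potential1 m1 x) phi phi0); apply: (congr1 (+%R _)).
  apply: (congr1 (charge_integral m2)); apply/funext => x.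
  have E : lintegral `[t0, T] (fun t => 1 * K' x t * phi x t) = lintegral `[T0, T] (fun t => 1 * K x t * phi x t).
    exact: (slice (fun _ _ => 1) phi x phi0).
  have e (k : R -> R -> R[i]) : (fun t => 1 * k x t * phi x t) = (fun t => k x t * phi x t).
    by apply/funext => t; rewrite mul1r.
  by rewrite !e in E.
rewrite subr0 => /eqP; rewrite subr_eq0 => /eqP <-; rewrite /dist_dt /dist_dx /uK opprK.
move: (dist_of_fun _ _ _ _) (dist_of_fun _ _ _ _) => a b; ring.
Qed.
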